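(* Let $N\ge 4$. The map $\Psi^{\mathsf{HP}}:\mathsf{HPPolyh}_N\to\mathcal{A}$ that sends a marked non-degenerate convex ideal polyhedron $P$ in $\mathrm{HP}^3$ with $1$-skeleton $\Gamma\in\mathsf{Graph}(\Sigma_{0,N},\gamma)$ to its function of (infinitesimal) dihedral angles $\Psi^{\mathsf{HP}}_\Gamma(P)\in\mathcal{A}_\Gamma\subset\mathcal{A}$ is a homeomorphism.
   Context: Half-pipe space. $\mathrm{HP}^3=\{[x_1:x_2:x_3:x_4]\in\mathbb{RP}^3: x_1^2+x_2^2-x_4^2<0\}$ (the solid cylinder in the chart $x_4=1$), with ideal boundary $\partial_\infty\mathrm{HP}^3$ the cylinder $x_1^2+x_2^2=1$ in that chart. The projection $\varpi:[x_1:x_2:x_3:x_4]\mapsto[x_1:x_2:x_4]$ maps $\mathrm{HP}^3$ to the projective model of $\mathbb{H}^2$ and $\partial_\infty\mathrm{HP}^3$ to $\partial_\infty\mathbb{H}^2$; its fibers carry the length coordinate $L=x_3/\sqrt{x_4^2-x_1^2-x_2^2}$ (with $x_4>0$), and are oriented by increasing $L$. Let $\langle u,u'\rangle=u_1u_1'+u_2u_2'-u_4u_4'$ on $u=(x_1,x_2,x_4)\in\mathbb{R}^{2,1}$. The group of orientation preserving and fiber-orientation preserving transformations in the structure group is $G_0=\{(u,x_3)\mapsto(Au,x_3+\ell(u)): A\in \mathrm{SO}_0(2,1),\ \ell\in(\mathbb{R}^{2,1})^*\}$. Ideal polyhedra. A convex ideal polyhedron $P$ in $\mathrm{HP}^3$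 is a convex polyhedron whose vertices lie in $\partial_\infty\mathrm{HP}^3$ and all of whose other points lie in $\mathrm{HP}^3$; it is non-degenerate if it has non-empty interior. Its faces are transverse to the fibers of $\varpi$. A face is positive (top) or negative (bottom) according to whether the outward pointing fiber direction is positive or negative. The edges separating positive from negative faces form a Hamiltonian cycle, the equator. A marking is a labelling $z_1,\dots,z_N$ of the vertices consecutively along the equator such that $\varpi(z_1),\dots,\varpi(z_N)$ are in positive cyclic order on $\partial_\infty\mathbb{H}^2$ (orientation fixed). $\mathsf{HPPolyh}_N$ is the space of marked non-degenerate convex ideal polyhedra in $\mathrm{HP}^3$ with $N$ vertices up to $G_0$. Graphs. $\Sigma_{0,N}$ is the oriented $N$-punctured sphere, with a fixed oriented simple loop $\gamma$ visiting each puncture once; punctures are labelled $1,\dots,N$ along $\gamma$. The polygon on the positive side of $\gamma$ is the top, the other the bottom. $\mathsf{Graph}(\Sigma_{0,N},\gamma)$ is the set of three-connected graphs embedded in $\Sigma_{0,N}$ with vertices the punctures, up to isotopy, each of whose edges connects two distinct punctures and whose edge set contains the edges of $\gamma$. A marked polyhedron's boundary is identified with $\Sigma_{0,N}$, taking $z_i$ to puncture $i$, the equator to $\gamma$, positive faces to the top and negative faces to the bottom; its $1$-skeleton thereby becomes an element $\Gamma\in\mathsf{Graph}(\Sigma_{0,N},\gamma)$. Dihedral angles. A plane transverse to the fibers has the form $x_3=f(u)$ with $f$ a linear functional. If two faces meeting along an edge $e$ lie in the planes $x_3=f(u)$ and $x_3=f'(u)$, then $f'-f=\langle v,\cdot\rangle$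 with $v$ spacelike, and the (infinitesimal) dihedral angle $\theta(e)$ is the signed infinitesimal rotation angle about $e$ taking one plane to the other: $|\theta(e)|=\sqrt{\langle v,v\rangle}$, with $\theta(e)<0$ if $e$ is an edge of the equator and $\theta(e)>0$ otherwise. $\Psi^{\mathsf{HP}}_\Gamma(P)$ is the function $\theta\in\mathbb{R}^{E(\Gamma)}$ so obtained, viewed also on dual edges by $\theta(e^* )=\theta(e)$. Angle complex. For $\Gamma\in\mathsf{Graph}(\Sigma_{0,N},\gamma)$ let $\Gamma^*$ be its planar dual graph, $e^*$ the edge dual to $e$. $\mathcal{A}_\Gamma$ is the set of $\theta\in\mathbb{R}^{E(\Gamma)}$ such that: (i) $\theta(e^* )<0$ if $e$ is an edge of $\gamma$, and $\theta(e^* )>0$ otherwise; (ii) if $e_1^*,\dots,e_k^*$ bound a face of $\Gamma^*$, then $\theta(e_1^* )+\cdots+\theta(e_k^* )=0$; (iii) if $e_1^*,\dots,e_k^*$ form a simple circuit which does not bound a face of $\Gamma^*$, and exactly two of these edges are dual to edges of $\gamma$, then $\theta(e_1^* )+\cdots+\theta(e_k^* )>0$. $\mathcal{A}$ is the disjoint union of all $\mathcal{A}_\Gamma$, $\Gamma\in\mathsf{Graph}(\Sigma_{0,N},\gamma)$, glued together along faces corresponding to common subgraphs: for $\Gamma'\subset\Gamma$ in $\mathsf{Graph}(\Sigma_{0,N},\gamma)$, $\mathcal{A}_{\Gamma'}$ is regarded inside $\mathbb{R}^{E(\Gamma)}$ by extending weights by $0$; $\overline{\mathcal{A}}_\Gamma=\bigcup_{\Gamma'\subset\Gamma}\mathcal{A}_{\Gamma'}\subset\mathbb{R}^{E(\Gamma)}$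 has the subspace topology, and $\mathcal{A}$ has the quotient topology from $\bigsqcup_\Gamma\overline{\mathcal{A}}_\Gamma$. *)

(* Defs.v *)
From HB Require Import structures.
From mathcomp Require Import all_boot all_order all_algebra.
From mathcomp Require Import all_classical all_reals all_analysis.

Set Implicit Arguments.
Unset Strict Implicit.
Unset Printing Implicit Defensive.

Import Order.TTheory GRing.Theory Num.Theory.
Import numFieldNormedType.Exports.

Local Open Scope classical_set_scope.
Local Open Scope ring_scope.
Local Open Scope quotient_scope.

Definition homeomorphism (T U : topologicalType) (f : T -> U) : Prop :=
  continuous f /\
  exists g : U -> T, [/\ cancel f g, cancel g f & continuous g].

(** ** Half-pipe space

   Both HP^3 and its ideal boundary lie in the affine chart x_4 = 1 of RP^3,
   and so does every convex ideal polyhedron.  A point [x_1 : x_2 : x_3 : 1] is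
   therefore represented by the row vector (x_1, x_2, x_3).  Vectors
   u = (x_1, x_2, x_4) of R^{2,1} are columns, with x_4 at index 2;
   linear functionals on R^{2,1} are rows. *)

Definition lform (R : realType) (u v : 'cV[R]_3) : R :=
  u 0 0 * v 0 0 + u 1 0 * v 1 0 - u 2 0 * v 2 0.

Definition ev (R : realType) (f : 'rV[R]_3) (u : 'cV[R]_3) : R := (f *m u) 0 0.

(* The chosen lift (x_1, x_2, 1) of the projection of x to the projective model
   of H^2. *)
Definition upart (R : realType) (x : 'rV[R]_3) : 'cV[R]_3 :=
  \col_(k < 3) (if k == 2 then 1 else x 0 k).

Definition height (R : realType) (x : 'rV[R]_3) : R := x 0 2.

Definition HP3 (R : realType) : set 'rV[R]_3 :=
  [set x | lform (upart x) (upart x) < 0].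

Definition bdHP3 (R : realType) : set 'rV[R]_3 :=
  [set x | lform (upart x) (upart x) = 0].

(** ** The group G_0 *)

Definition SO21 (R : realType) : set 'M[R]_3 :=
  [set A | (forall u v, lform (A *m u) (A *m v) = lform u v) /\ \det A = 1].

Definition SO0_21 (R : realType) : set 'M[R]_3 :=
  connected_component (@SO21 R) 1%:M.

(* The action of (u, x_3) |-> (A u, x_3 + l(u)), read in the chart x_4 = 1. *)
Definition hp_act (R : realType) (A : 'M[R]_3) (l : 'rV[R]_3) (x : 'rV[R]_3) :
    'rV[R]_3 :=
  let u := A *m upart x in
  \row_(k < 3) ((if k == 2 then height x + ev l (upart x) else u k 0) / u 2 0).

(** ** Marked ideal polyhedra

   A marked polyhedron is given by the matrix z whose i-th row is its i-th
   vertex; the polyhedron itself is [hull z]. *)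

Definition hull (R : realType) (N : nat) (z : 'M[R]_(N, 3)) : set 'rV[R]_3 :=
  [set x | exists w : 'I_N -> R,
     [/\ forall i, 0 <= w i, \sum_i w i = 1 & x = \sum_i w i *: row i z]].

Definition extreme_points (R : realType) (P : set 'rV[R]_3) : set 'rV[R]_3 :=
  [set x | P x /\ forall (y y' : 'rV[R]_3) (t : R), P y -> P y' ->
     0 < t < 1 -> x = t *: y + (1 - t) *: y' -> y = y'].

Definition convex_ideal (R : realType) (N : nat) (z : 'M[R]_(N, 3)) : Prop :=
  [/\ injective (fun i => row i z),
      extreme_points (hull z) = range (fun i => row i z),
      extreme_points (hull z) `<=` @bdHP3 R
    & hull z `\` extreme_points (hull z) `<=` @HP3 R].

Definition nondegenerate (R : realType) (N : nat) (z : 'M[R]_(N, 3)) : Prop :=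
  interior (hull z) !=set0.

Definition uvec3 (R : realType) (N : nat) (z : 'M[R]_(N, 3)) (i j k : 'I_N) :
    'M[R]_3 :=
  \matrix_(a < 3, b < 3) upart (row (nth i [:: i; j; k] a) z) b 0.

(* The vertices lying on the plane x_3 = f(u). *)
Definition contact (R : realType) (N : nat) (z : 'M[R]_(N, 3)) (f : 'rV[R]_3) :
    {set 'I_N} :=
  [set i | height (row i z) == ev f (upart (row i z))]%SET.

(* The plane x_3 = f(u) supports the polyhedron along a two-dimensional face,
   positive (top) if b and negative (bottom) otherwise: the outward fiber
   direction is positive exactly when the polyhedron lies below the plane. *)
Definition is_face (R : realType) (N : nat) (z : 'M[R]_(N, 3)) (b : bool)
    (f : 'rV[R]_3) : Prop :=
  (forall x, hull z x ->
     if b then height x <= ev f (upart x) else ev f (upart x) <= height x) /\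
  exists i j k : 'I_N,
    [/\ i \in contact z f, j \in contact z f, k \in contact z f
      & \det (uvec3 z i j k) != 0].

(* Two distinct faces whose intersection is the segment joining the two
   vertices in S. *)
Definition meet_along (R : realType) (N : nat) (z : 'M[R]_(N, 3))
    (b : bool) (f : 'rV[R]_3) (b' : bool) (f' : 'rV[R]_3) (S : {set 'I_N}) :
    Prop :=
  [/\ is_face z b f, is_face z b' f', f <> f',
      (contact z f :&: contact z f')%SET = S & #|S| = 2%N].

Definition equatorial_edge (R : realType) (N : nat) (z : 'M[R]_(N, 3))
    (S : {set 'I_N}) : Prop :=
  exists f f', meet_along z true f false f' S.

(* On the unit circle, three points are in positive (counterclockwise) cyclic
   order iff the determinant of their lifts (x_1, x_2, 1) is positive.
   [ordS] is the cyclic successor i |-> i + 1 mod N. *)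
Definition marking (R : realType) (N : nat) (z : 'M[R]_(N, 3)) : Prop :=
  (forall S : {set 'I_N}, equatorial_edge z S <->
     exists i : 'I_N, S = [set i; ordS i]%SET) /\
  (forall i j k : 'I_N, (i < j)%N -> (j < k)%N -> 0 < \det (uvec3 z i j k)).

Definition marked_poly (R : realType) (N : nat) : set 'M[R]_(N, 3) :=
  [set z | [/\ convex_ideal z, nondegenerate z & marking z]].
Arguments marked_poly : clear implicits.

(** ** Embedded graphs containing gamma

   The loop gamma cuts the punctured sphere into two N-gons, and up to isotopy
   an arc in one of them is determined by its two endpoints.  So the edges of
   gamma and the other arcs disjoint from gamma are encoded as follows:
   - [inl i] is the edge of gamma from i to i + 1;
   - [inr (true, S)] (resp. [inr (false, S)]) is the diagonal of the top (resp.
     bottom) polygon with set of endpoints S.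
   An embedded graph containing gamma is then a set of arcs, in which the
   diagonals of the same polygon do not cross. *)

Definition arc (N : nat) : finType := ('I_N + bool * {set 'I_N})%type.

Definition in_gamma (N : nat) (e : arc N) : bool :=
  if e is inl _ then true else false.

Definition ends (N : nat) (e : arc N) : {set 'I_N} :=
  match e with inl i => [set i; ordS i]%SET | inr (_, D) => D end.

(* The arc e lies in the closed polygon on the side b. *)
Definition on_side (N : nat) (b : bool) (e : arc N) : bool :=
  if e is inr (c, _) then c == b else true.

Definition is_diagonal (N : nat) (S : {set 'I_N}) : bool :=
  [exists i : 'I_N, exists j : 'I_N,
     [&& i != j, j != ordS i, i != ordS j & S == [set i; j]%SET]].

Definition crossing (N : nat) (S T : {set 'I_N}) : bool :=
  [exists i : 'I_N, exists j : 'I_N, exists k : 'I_N, exists l : 'I_N,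
     [&& (i < j)%N, (j < k)%N, (k < l)%N
       & ((S == [set i; k]%SET) && (T == [set j; l]%SET))
      || ((T == [set i; k]%SET) && (S == [set j; l]%SET))]].

Definition adjacent (N : nat) (E : {set arc N}) : rel 'I_N :=
  fun i j => [exists e in E, ends e == [set i; j]%SET].

Definition three_connected (N : nat) (E : {set arc N}) : bool :=
  (3 < N)%N &&
  [forall X : {set 'I_N}, (#|X| < 3)%N ==>
     [forall x, forall y, (x \notin X) && (y \notin X) ==>
        connect (fun i j => [&& i \notin X, j \notin X & adjacent E i j]) x y]].

Definition is_graph (N : nat) (E : {set arc N}) : bool :=
  [&& [forall i : 'I_N, (inl i : arc N) \in E],
      [forall b : bool, forall S : {set 'I_N},
         ((inr (b, S) : arc N) \in E) ==> is_diagonal S],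
      [forall b : bool, forall S : {set 'I_N}, forall T : {set 'I_N},
         ((inr (b, S) : arc N) \in E) && ((inr (b, T) : arc N) \in E) ==>
           ~~ crossing S T]
    & three_connected E].

Definition graph_gamma (N : nat) : finType := {E : {set arc N} | is_graph E}.

(** ** The dual graph

   The faces of a graph are the regions into which its diagonals cut the top and
   bottom polygons.  A region is encoded by its side b and its set F of corners,
   which is a maximal set of vertices no two of which are separated by a
   diagonal. *)

Definition unseparated (N : nat) (E : {set arc N}) (b : bool)
    (F : {set 'I_N}) : bool :=
  [forall x in F, forall y in F, forall S : {set 'I_N},
     ((inr (b, S) : arc N) \in E) ==> ~~ crossing S [set x; y]%SET].

Definition gface (N : nat) : finType := (bool * {set 'I_N})%type.

Definition is_gface (N : nat) (E : {set arc N}) (F : gface N) : bool :=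
  maxset (unseparated E F.1) F.2.

Definition incident (N : nat) (E : {set arc N}) (e : arc N) (F : gface N) :
    bool :=
  [&& e \in E, is_gface E F, on_side F.1 e & ends e \subset F.2].

Definition dual_joins (N : nat) (E : {set arc N}) (e : arc N) (F F' : gface N) :
    bool :=
  [&& F != F', incident E e F & incident E e F'].

(* A simple circuit of the dual graph is a cyclic sequence
   F_1, e_1^*, F_2, e_2^*, ... without repetition in which e_i^* joins F_i to
   F_{i+1}; it is given by the list of the pairs (F_i, e_i). *)
Definition dual_circuit (N : nat) (E : {set arc N})
    (c : seq (gface N * arc N)) : bool :=
  [&& uniq (unzip1 c), uniq (unzip2 c)
    & cycle (fun p q => dual_joins E p.2 p.1 q.1) c].

(* The faces of the dual graph correspond to the vertices of the graph; the face
   corresponding to i is bounded by the duals of the edges in [star E i]. *)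
Definition star (N : nat) (E : {set arc N}) (i : 'I_N) : {set arc N} :=
  [set e in E | i \in ends e]%SET.

Definition bounds_dual_face (N : nat) (E : {set arc N})
    (c : seq (gface N * arc N)) : bool :=
  [exists i : 'I_N, [set e in unzip2 c]%SET == star E i].

(** ** The angle complex

   R^{E(Gamma)} is identified with the space of weights vanishing off E(Gamma),
   so that extension by 0 is an inclusion. *)

Definition weights (R : realType) (N : nat) : topologicalType :=
  prod_topology (fun _ : arc N => R : topologicalType).

Definition angle_cell (R : realType) (N : nat) (E : {set arc N}) :
    set (weights R N) :=
  [set theta | [/\ forall e, e \notin E -> theta e = 0,
     forall e, e \in E -> if in_gamma e then theta e < 0 else 0 < theta e,
     forall i : 'I_N, \sum_(e in star E i) theta e = 0
   & forall c, dual_circuit E c -> ~~ bounds_dual_face E c ->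
       count (@in_gamma N) (unzip2 c) = 2%N ->
       0 < \sum_(e <- unzip2 c) theta e]].
Arguments angle_cell R {N} E.

Definition angle_cell_closure (R : realType) (N : nat) (G : graph_gamma N) :
    set (weights R N) :=
  [set theta | exists2 G' : graph_gamma N,
     val G' \subset val G & angle_cell R (val G') theta].
Arguments angle_cell_closure R {N} G.

Definition cell_space (R : realType) (N : nat) (G : graph_gamma N) :
    topologicalType :=
  set_type (angle_cell_closure R G).
Arguments cell_space R {N} G.

Definition cells (R : realType) (N : nat) : topologicalType :=
  {G : graph_gamma N & cell_space R G}.

(* A weight in two closed cells lies in a unique A_Gamma', with Gamma' contained
   in both graphs, and its two copies are glued. *)
Definition glue (R : realType) (N : nat) : rel (cells R N) :=
  fun a b => `[< val (projT2 a) = val (projT2 b) >].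

Lemma glue_equiv (R : realType) (N : nat) : equiv_class_of (@glue R N).
Proof.
split=> [a|a b|b a c]; first exact/asboolP.
- by apply/idP/idP => /asboolP h; apply/asboolP; rewrite h.
- by move=> /asboolP h1 /asboolP h2; apply/asboolP; rewrite h1.
Qed.

Canonical glue_equiv_rel (R : realType) (N : nat) :=
  EquivRelPack (glue_equiv R N).

Definition angle_complex (R : realType) (N : nat) : topologicalType :=
  quotient_topology {eq_quot (glue_equiv_rel R N)}.

Definition angle_class (R : realType) (N : nat) (G : graph_gamma N)
    (theta : cell_space R G) : angle_complex R N :=
  \pi_(quotient_topology {eq_quot (glue_equiv_rel R N)})
    (existT _ G theta : cells R N).

(** ** Polyhedra up to G_0 *)

Lemma continuous_mulmxl (R : realType) (m n p : nat) (A : 'M[R]_(m, n)) :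
  continuous (fun B : 'M[R]_(n, p) => A *m B).
Proof.
move=> B U [P BP sPU] /=.
have cont_ij i j : (fun C : 'M[R]_(n, p) => (A *m C) i j) @ B --> (A *m B) i j.
  rewrite mxE; under eq_fun do rewrite mxE.
  apply: (@cvg_big R^o _ _ _ _ _ _ (nbhs B) _ _ _ (nbhs_filter B)) => [|k _].
    exact: add_continuous.
  apply: cvgM; first exact: cvg_cst.
  exact: coord_continuous.
have nbhsP : \forall C \near B, forall i j, P i j ((A *m C) i j).
  apply: (@filter_forall _ _ _ _ (nbhs_filter B)) => i.
  apply: (@filter_forall _ _ _ _ (nbhs_filter B)) => j.
  exact: cont_ij (BP i j).
by apply: (@filterS _ _ (nbhs_filter B) _ _ _ nbhsP) => C PC; exact: sPU.
Qed.

Lemma SO21_1 (R : realType) : SO21 (1%:M : 'M[R]_3).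
Proof. by split=> [u v|]; rewrite ?mul1mx ?det1. Qed.

Lemma SO21_mul (R : realType) (A B : 'M[R]_3) :
  SO21 A -> SO21 B -> SO21 (A *m B).
Proof.
move=> [fA dA] [fB dB]; split=> [u v|]; first by rewrite -!mulmxA fA fB.
by rewrite det_mulmx dA dB mulr1.
Qed.

Lemma SO21_unit (R : realType) (A : 'M[R]_3) : SO21 A -> A \in unitmx.
Proof. by case=> _ dA; rewrite unitmxE dA unitr1. Qed.

Lemma SO21_inv (R : realType) (A : 'M[R]_3) : SO21 A -> SO21 (invmx A).
Proof.
move=> hA; have uA := SO21_unit hA; case: hA => fA dA.
split=> [u v|]; last by rewrite det_inv dA invr1.
by rewrite -fA !mulKVmx.
Qed.

Lemma SO21_component_mull (R : realType) (A B C : 'M[R]_3) : SO21 A ->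
  connected_component (@SO21 R) B C ->
  connected_component (@SO21 R) (A *m B) (A *m C).
Proof.
move=> hA [D [DB sD cD] DC].
exists [set A *m X | X in D]; last by exists C.
split; first by exists B.
  by move=> _ [X DX <-]; apply: SO21_mul => //; exact: sD.
apply: connected_continuous_connected => //.
exact/continuous_subspaceT/continuous_mulmxl.
Qed.

Lemma SO0_21_sub (R : realType) (A : 'M[R]_3) : SO0_21 A -> SO21 A.
Proof. exact: connected_component_sub. Qed.

Lemma SO0_21_1 (R : realType) : SO0_21 (1%:M : 'M[R]_3).
Proof. exact/connected_component_refl/SO21_1. Qed.

Lemma SO0_21_mul (R : realType) (A B : 'M[R]_3) :
  SO0_21 A -> SO0_21 B -> SO0_21 (A *m B).
Proof.
move=> hA hB; apply: connected_component_trans (hA) _.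
have := SO21_component_mull (SO0_21_sub hA) hB.
by rewrite mulmx1.
Qed.

Lemma SO0_21_inv (R : realType) (A : 'M[R]_3) : SO0_21 A -> SO0_21 (invmx A).
Proof.
move=> hA; have hA' := SO0_21_sub hA; apply: connected_component_sym.
have := SO21_component_mull (SO21_inv hA') hA.
by rewrite mulmx1 mulVmx ?SO21_unit.
Qed.

Lemma SO21_bd_neq0 (R : realType) (A : 'M[R]_3) (x : 'rV[R]_3) :
  SO21 A -> bdHP3 x -> (A *m upart x) 2 0 != 0.
Proof.
move=> hA bx; apply/eqP => w2.
have : lform (A *m upart x) (A *m upart x) = 0 by rewrite hA.1.
rewrite /lform w2 mulr0 subr0 -!expr2 => /eqP.
rewrite paddr_eq0 ?sqr_ge0 // !sqrf_eq0 => /andP[/eqP w0 /eqP w1].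
have w : A *m upart x = 0.
  apply/matrixP => i j; rewrite ord1 [RHS]mxE.
  by case: i => [[|[|[|]]]] // p;
    [rewrite -[RHS]w0|rewrite -[RHS]w1|rewrite -[RHS]w2];
    congr (fun_of_matrix _ _ _); apply: val_inj.
have /matrixP/(_ 2 0) := mulKmx (SO21_unit hA) (upart x).
by rewrite w mulmx0 !mxE /= => /eqP; rewrite eq_sym oner_eq0.
Qed.

Lemma upart_hp_act (R : realType) (A : 'M[R]_3) (l x : 'rV[R]_3) :
  (A *m upart x) 2 0 != 0 ->
  upart (hp_act A l x) = ((A *m upart x) 2 0)^-1 *: (A *m upart x).
Proof.
move=> w2; apply/matrixP => i j; rewrite ord1 /hp_act.
move: (ev _ _) (A *m upart x) w2 => t w w2.
rewrite [LHS]mxE [RHS]mxE; case: ifP => [/eqP ->|i2]; first by rewrite mulVf.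
by rewrite mxE i2 mulrC.
Qed.

Lemma height_hp_act (R : realType) (A : 'M[R]_3) (l x : 'rV[R]_3) :
  height (hp_act A l x) = (height x + ev l (upart x)) / (A *m upart x) 2 0.
Proof. by rewrite /height mxE. Qed.

Lemma chart_eq (R : realType) (x y : 'rV[R]_3) :
  upart x = upart y -> height x = height y -> x = y.
Proof.
move=> e h; apply/matrixP => i j; rewrite ord1.
have [->|j2] := eqVneq j 2; first exact: h.
by move/matrixP/(_ j 0): e; rewrite !mxE (negbTE j2).
Qed.

Lemma hp_act1 (R : realType) (x : 'rV[R]_3) : hp_act 1%:M 0 x = x.
Proof.
have w2 : (1%:M *m upart x) 2 0 = 1 by rewrite mul1mx mxE.
apply: chart_eq; first by rewrite upart_hp_act ?w2 ?oner_eq0// invr1 scale1r mul1mx.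
by rewrite height_hp_act w2 /ev mul0mx mxE addr0 divr1.
Qed.

Lemma hp_actM (R : realType) (A B : 'M[R]_3) (l m x : 'rV[R]_3) :
  (B *m upart x) 2 0 != 0 -> ((A *m B) *m upart x) 2 0 != 0 ->
  hp_act A l (hp_act B m x) = hp_act (A *m B) (m + l *m B) x.
Proof.
move=> b2 ab2; have uB := upart_hp_act m b2.
have w2 : (A *m upart (hp_act B m x)) 2 0 =
    ((A *m B) *m upart x) 2 0 / (B *m upart x) 2 0.
  by rewrite uB -scalemxAr mxE mulmxA mulrC.
apply: chart_eq.
  rewrite [LHS]upart_hp_act w2 ?mulf_neq0 ?invr_eq0 // [RHS]upart_hp_act //.
  by rewrite uB -scalemxAr mulmxA scalerA invfM invrK mulfK.
have evZ c u : ev l (c *: u) = c * ev l u by rewrite /ev -scalemxAr mxE.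
have evD : ev (m + l *m B) (upart x) = ev m (upart x) + ev l (B *m upart x).
  by rewrite /ev mulmxDl mxE mulmxA.
rewrite !height_hp_act w2 uB evZ evD.
move: (ev l _) (ev m _) b2 ab2 => s t b2 ab2.
move: ((B *m _) 2 0) ((A *m B *m _) 2 0) b2 ab2 => b a b2 ab2.
by rewrite [b^-1 * s]mulrC -mulrDl invfM invrK mulrCA !mulrA mulfVK // mulrC addrA.
Qed.

Definition G0_rel (R : realType) (N : nat) : rel (marked_poly R N) :=
  fun z z' => `[< exists (A : 'M[R]_3) (l : 'rV[R]_3), SO0_21 A /\
     forall i, row i (val z') = hp_act A l (row i (val z)) >].

Lemma marked_poly_bd (R : realType) (N : nat) (z : marked_poly R N) (i : 'I_N) :
  bdHP3 (row i (val z)).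
Proof.
have [[_ hE hb _] _ _] := set_mem (valP z).
by apply: hb; rewrite hE; exists i.
Qed.

Lemma G0_equiv (R : realType) (N : nat) : equiv_class_of (@G0_rel R N).
Proof.
have sym (z z' : marked_poly R N) : G0_rel z z' -> G0_rel z' z.
  move=> /asboolP[A [l [hA h]]]; apply/asboolP.
  have hA' := SO0_21_sub hA; have uA := SO21_unit hA'.
  exists (invmx A), (- (l *m invmx A)); split=> [|i]; first exact: SO0_21_inv.
  have bz := marked_poly_bd z i.
  rewrite h hp_actM ?SO21_bd_neq0 //; last exact/SO21_mul/hA'/SO21_inv.
  by rewrite mulVmx // mulNmx mulmxKV // subrr hp_act1.
split=> [z|z z'|z' z z''].
- apply/asboolP; exists 1%:M, 0; split; first exact: SO0_21_1.
  by move=> i; rewrite hp_act1.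
- by apply/idP/idP; exact: sym.
- move=> /asboolP[A [l [hA h]]] /asboolP[B [m [hB h']]]; apply/asboolP.
  exists (B *m A), (l + m *m A); split; first exact: SO0_21_mul.
  move=> i; have bz := marked_poly_bd z i.
  have [hA' hB'] := (SO0_21_sub hA, SO0_21_sub hB).
  by rewrite h' h hp_actM ?SO21_bd_neq0 //; exact: SO21_mul.
Qed.

Canonical G0_equiv_rel (R : realType) (N : nat) :=
  EquivRelPack (G0_equiv R N).

Definition HPPolyh (R : realType) (N : nat) : topologicalType :=
  quotient_topology {eq_quot (G0_equiv_rel R N)}.

Definition poly_class (R : realType) (N : nat) (P : marked_poly R N) :
    HPPolyh R N :=
  \pi_(quotient_topology {eq_quot (G0_equiv_rel R N)}) P.

(** ** The map Psi *)

(* f and f' are the planes of the two faces of the polyhedron meeting along the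
   edge that is identified with the arc e. *)
Definition edge_planes (R : realType) (N : nat) (z : 'M[R]_(N, 3)) (e : arc N)
    (f f' : 'rV[R]_3) : Prop :=
  match e with
  | inl _ => meet_along z true f false f' (ends e)
  | inr (b, _) => meet_along z b f b f' (ends e)
  end.

Definition skeleton (R : realType) (N : nat) (z : 'M[R]_(N, 3)) :
    {set arc N} :=
  [set e | `[< exists f f', edge_planes z e f f' >]]%SET.

Definition dihedral_angles (R : realType) (N : nat) (z : 'M[R]_(N, 3))
    (theta : weights R N) : Prop :=
  (forall e, e \notin skeleton z -> theta e = 0) /\
  (forall e, e \in skeleton z -> exists (f f' : 'rV[R]_3) (v : 'cV[R]_3),
     [/\ edge_planes z e f f',
         forall u, ev f' u - ev f u = lform v u,
         0 < lform v v
       & theta e = (if in_gamma e then - 1 else 1) * Num.sqrt (lform v v)]).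

(* Main.v *)
From mathcomp Require Import all_boot all_order all_algebra.
From mathcomp Require Import all_classical all_reals all_analysis.
From mathcomp Require Import ring lra zify.
Require Import Defs.

(** A marked polyhedron is a cyclically ordered configuration of points on the
    circle together with heights.  Its faces are the affine pieces of the least
    concave and the greatest convex function fitting the heights, and its dihedral
    angles are given by minima and maxima of slopes of planes through vertices;
    this makes them continuous and invariant under G_0.  Comparing the planes of
    consecutive faces around a vertex shows that the angles, viewed as
    infinitesimal rotations, are balanced at every vertex.  Balance implies the
    equations (ii) and the inequalities (iii), because a dual circuit crossing the
    equator twice consists of the edges leaving an arc of vertices.

    Conversely, the angles determine the heights up to a linear function, by
    adding one crease per diagonal, as soon as the positions of the points make
    them balanced.  With the last point at infinity and consecutive distances
    e^(s_k) between the other points x_i, balance says that s is a critical point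
    of the sum of theta_ij ln (x_j - x_i).  Only terms that are linear in s have
    negative coefficients, so this function is convex; the conditions (ii) and
    (iii) make it coercive, and strictly convex up to the addition of a constant.
    Hence the positions exist, are unique up to affine maps of the line, and
    depend continuously on the angles. *)

Set Implicit Arguments.
Unset Strict Implicit.
Unset Printing Implicit Defensive.

Import Order.TTheory GRing.Theory Num.Theory.
Import numFieldNormedType.Exports.

Local Open Scope classical_set_scope.
Local Open Scope ring_scope.

(** * Concave envelopes on the line *)

(** Planes through a fixed vertex are affine functions of one variable in the pencil at that vertex,
    so the faces around it are the pieces of the concave envelope of finitely many points on a line.
    The bottom of a polyhedron is treated as the top of the configuration with negated heights. Two
    systems of side angles are never compared directly: balanced systems that agree on the diagonals
    at a vertex also agree on the sides there. For cuts, balance and energy, the weights of all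
    edges with the same two ends are added, so the graph enters only through signs. The polyhedron
    attached to a weight is therefore defined without choosing a graph: its positions minimize an
    energy and its heights are a sum over all pairs of vertices. Hence the inverse map respects the
    gluing of the cells, and its continuity can be checked on each closed cell. The angle complex
    has the finest topology that the cells allow, so continuity of the map itself needs more: there
    are finitely many graphs, and the support of a weight is the edge set of the graph whose cell
    contains it. *)

Section Envelope.
Variables (R : realType) (m : nat) (x y : nat -> R).
Hypothesis x_incr : forall i j, (i < j)%N -> (j <= m)%N -> x i < x j.

Definition slope (i j : nat) : R := (y j - y i) / (x j - x i).

(** Among the chords spanning the gap between [x k] and [x k.+1], one that is highest over the
    midpoint of the gap works: a point above its line could replace the endpoint on its own side of
    the gap and raise the chord. *)
Lemma support_line (k : nat) : (k < m)%N ->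
  exists al be : R,
    [/\ forall j, (j <= m)%N -> y j <= al * x j + be,
        exists2 l, (l <= k)%N & y l = al * x l + be
      & exists2 r, (k < r <= m)%N & y r = al * x r + be].
Proof.
move=> km; pose xi := (x k + x k.+1) / 2.
have xk := x_incr (ltnSn k) km.
have xl l : (l <= k)%N -> x l < xi.
  rewrite leq_eqVlt => /orP[/eqP->|lk]; first by rewrite /xi; lra.
  have := @x_incr l k lk (ltnW km); rewrite /xi; lra.
have xr r : (k < r)%N -> (r <= m)%N -> xi < x r.
  rewrite leq_eqVlt => /orP[/eqP<- _|kr rm]; first by rewrite /xi; lra.
  have := @x_incr k.+1 r kr rm; rewrite /xi; lra.
pose v (p : 'I_m.+1 * 'I_m.+1) :=
  (y p.1 * (x p.2 - xi) + y p.2 * (xi - x p.1)) / (x p.2 - x p.1).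
pose P (p : 'I_m.+1 * 'I_m.+1) := (p.1 <= k < p.2)%N.
have P0 : P (inord k, inord k.+1).
  by rewrite /P /= !inordK ?leqnn ?ltnSn// ?ltnS // ltnW.
case: (@arg_maxP _ R _ _ P v P0) => -[l r] /andP[/= lk kr] vmax.
have rm : (r <= m)%N by rewrite -ltnS.
have xlr : x l < x r by apply: x_incr => //; exact: leq_ltn_trans lk kr.
pose al := slope l r; pose be := y l - al * x l.
have hr : y r = al * x r + be by rewrite /be /al /slope; field; lra.
exists al, be; split; first last.
- by exists r => //; rewrite kr.
- by exists l => //; rewrite /be; ring.
move=> j jm; rewrite leNgt; apply/negP => hj.
have jm1 : (j < m.+1)%N by rewrite ltnS.
have [jk|kj] := leqP j k.
  have /vmax : P (Ordinal jm1, r) by rewrite /P /= jk.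
  apply/negP; rewrite -ltNge /v /=.
  have h1 := xl _ jk; have h2 := xr _ kr rm.
  have -> : (y l * (x r - xi) + y r * (xi - x l)) / (x r - x l) = al * xi + be.
    by rewrite hr /be; field; lra.
  have -> : (y j * (x r - xi) + y r * (xi - x j)) / (x r - x j) =
     (al * xi + be) + (y j - (al * x j + be)) * ((x r - xi) / (x r - x j)).
    by rewrite hr; field; lra.
  by rewrite ltrDl mulr_gt0 ?divr_gt0 //; lra.
have /vmax : P (l, Ordinal jm1) by rewrite /P /= lk.
apply/negP; rewrite -ltNge /v /=.
have h1 := xl _ lk; have h2 := xr _ kj jm.
have hl : y l = al * x l + be by rewrite /be; ring.
have -> : (y l * (x r - xi) + y r * (xi - x l)) / (x r - x l) = al * xi + be.
  by rewrite hr hl; field; lra.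
have -> : (y l * (x j - xi) + y j * (xi - x l)) / (x j - x l) =
   (al * xi + be) + (y j - (al * x j + be)) * ((xi - x l) / (x j - x l)).
  by rewrite hl; field; lra.
by rewrite ltrDl mulr_gt0 ?divr_gt0 //; lra.
Qed.

(** The drop of slope at [k] of the least concave function above the points, in the form in which
    [top_angleP] delivers it. When [t] is 0, some chord passes on or above the point [k], so the
    envelope has no corner there. *)
Definition is_jump (k : nat) (t : R) : Prop :=
  (forall l r, (l < k)%N -> (k < r <= m)%N -> 0 < t ->
     t <= slope l k - slope k r) /\
  (0 <= t /\ exists l r, [/\ (l < k)%N, (k < r <= m)%N
     & if 0 < t then t = slope l k - slope k r else slope l k <= slope k r]).

Lemma slope_le_touch (al be : R) (l k : nat) : (l < k <= m)%N ->
  y l = al * x l + be -> y k <= al * x k + be -> slope l k <= al.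
Proof.
move=> /andP[lk km] hl hk; have h := x_incr lk km.
rewrite /slope ler_pdivrMr; [nra|lra].
Qed.

Lemma slope_ge_touch (al be : R) (k r : nat) : (k < r <= m)%N ->
  y r = al * x r + be -> y k <= al * x k + be -> al <= slope k r.
Proof.
move=> /andP[kr rm] hl hk; have h := x_incr kr rm.
rewrite /slope ler_pdivlMr; [nra|lra].
Qed.

(** The difference of the two lines is nonnegative where the first one touches and nonpositive where
    the second one touches. Unless both touch at [k], these signs make the lines equal; the common
    line then touches on both sides of [k], and the jump is 0. *)
Lemma support_line_jump (k : nat) (t al be al' be' : R) :
  (0 < k < m)%N -> is_jump k t ->
  (forall j, (j <= m)%N -> y j <= al * x j + be) ->
  (exists2 l, (l < k)%N & y l = al * x l + be) ->
  (exists2 r, (k <= r <= m)%N & y r = al * x r + be) ->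
  (forall j, (j <= m)%N -> y j <= al' * x j + be') ->
  (exists2 l, (l <= k)%N & y l = al' * x l + be') ->
  (exists2 r, (k < r <= m)%N & y r = al' * x r + be') ->
  al' - al = - t /\ be' - be = t * x k.
Proof.
move=> /andP[k0 km] [ht1 [ht0 ht2]] hf [l lk hl] [r /andP[kr rm] hr].
move=> hf' [l' lk' hl'] [r' /andP[kr' rm'] hr'].
have km' := ltnW km.
have d1 : 0 <= (al' - al) * x l + (be' - be).
  have := hf' l (leq_trans (ltnW lk) km'); lra.
have d2 : 0 <= (al' - al) * x r + (be' - be) by have := hf' r rm; lra.
have d3 : (al' - al) * x l' + (be' - be) <= 0.
  have := hf l' (leq_trans lk' km'); lra.
have d4 : (al' - al) * x r' + (be' - be) <= 0 by have := hf r' rm'; lra.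
move: d1 d2 d3 d4; set d := al' - al; set e := be' - be => d1 d2 d3 d4.
have xlk := x_incr lk km'; have xkr' := x_incr kr' rm'.
have zero_case : d = 0 -> e = 0 -> (exists2 r0, (k < r0 <= m)%N &
    y r0 = al * x r0 + be) -> d = - t /\ e = t * x k.
  move=> dz ez [r0 kr0 hr0].
  have s1 : slope l k <= al.
    by apply: slope_le_touch hl (hf _ km'); rewrite lk km'.
  have s2 : al <= slope k r0 by apply: slope_ge_touch hr0 (hf _ km').
  suff -> : t = 0 by rewrite dz ez; split; ring.
  apply/eqP; rewrite eq_le ht0 andbT leNgt; apply/negP => tp.
  have := ht1 l r0 lk kr0 tp; lra.
have [kr1|rk1] := ltnP k r.
  have xkr := x_incr kr1 rm.
  have dk : 0 <= d * x k + e.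
    have h : (d * x k + e) * (x r - x l) =
      (d * x l + e) * (x r - x k) + (d * x r + e) * (x k - x l) by ring.
    have : 0 <= (d * x k + e) * (x r - x l).
      by rewrite h addr_ge0 // mulr_ge0 //; lra.
    by rewrite pmulr_lge0 //; lra.
  have dk' : d * x k + e <= 0.
    move: lk'; rewrite leq_eqVlt => /orP[/eqP<-//|lk'].
    have xl'k := x_incr lk' km'.
    have h : (d * x k + e) * (x r' - x l') =
      (d * x l' + e) * (x r' - x k) + (d * x r' + e) * (x k - x l') by ring.
    have : (d * x k + e) * (x r' - x l') <= 0 by rewrite h; nra.
    by rewrite pmulr_lle0 //; lra.
  have dk0 : d * x k + e = 0 by lra.
  have d0 : d = 0 by nra.
  have e0 : e = 0 by move: dk0; rewrite d0; lra.
  by apply: (zero_case d0 e0); exists r => //; rewrite kr1.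
have rk : r = k by apply/eqP; rewrite eqn_leq rk1.
rewrite {r rm rk1 kr}rk in hr d2 *.
move: lk'; rewrite leq_eqVlt => /orP[/eqP lk'|lk'].
  rewrite {l'}lk' in hl' d3 *.
  have ek : e = - d * x k by lra.
  have al_s : al = slope l k by rewrite /slope hl hr; field; lra.
  have al_s' : al' = slope k r' by rewrite /slope hl' hr'; field; lra.
  have dle : d <= 0 by nra.
  have tau l1 r1 : (l1 < k)%N -> (k < r1 <= m)%N ->
      - d <= slope l1 k - slope k r1.
    move=> lk1 kr1.
    have : al <= slope l1 k.
      apply: slope_ge_touch hr (hf _ _); first by rewrite lk1 km'.
      exact: leq_trans (ltnW lk1) km'.
    have : slope k r1 <= al'.
      by apply: slope_le_touch hl' (hf' _ _) => //; case/andP: kr1.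
    rewrite /d; lra.
  suff -> : t = - d by split; [ring|rewrite ek].
  have [l1 [r1 [lk1 kr1]]] := ht2; case: ifPn => [tp tE|].
    have := tau _ _ lk1 kr1.
    have := ht1 l r' lk; rewrite kr' rm' => /(_ isT tp).
    rewrite -al_s -al_s' /d; lra.
  rewrite -leNgt => tn ss; have := tau _ _ lk1 kr1; lra.
have xl'k := x_incr lk' km'.
have dk : 0 <= d * x k + e by [].
have dk' : d * x k + e <= 0.
  have h : (d * x k + e) * (x r' - x l') =
    (d * x l' + e) * (x r' - x k) + (d * x r' + e) * (x k - x l') by ring.
  have : (d * x k + e) * (x r' - x l') <= 0 by rewrite h; nra.
  by rewrite pmulr_lle0 //; lra.
have dk0 : d * x k + e = 0 by lra.
have d0 : d = 0 by nra.
have e0 : e = 0 by move: dk0; rewrite d0; lra.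
apply: (zero_case d0 e0); exists r'; first by rewrite kr'.
by rewrite hr'; move: d0 e0; rewrite /d /e => h1 h2; congr (_ * _ + _); lra.
Qed.

(** Telescoping over the support lines of consecutive gaps: at [k] the slope decreases by [t k] and
    the intercept increases by [t k * x k]. The first and the last line pass through the end points
    with slopes [s0] and [sm]. *)
Lemma sum_jumps (t : nat -> R) (s0 sm : R) : (0 < m)%N ->
  (forall k, (0 < k < m)%N -> is_jump k (t k)) ->
  (forall r, (0 < r <= m)%N -> slope 0 r <= s0) ->
  (exists2 r, (0 < r <= m)%N & slope 0 r = s0) ->
  (forall l, (l < m)%N -> sm <= slope l m) ->
  (exists2 l, (l < m)%N & slope l m = sm) ->
  \sum_(1 <= k < m) t k = s0 - sm /\
  \sum_(1 <= k < m) t k * x k = (y m - sm * x m) - (y 0%N - s0 * x 0%N).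
Proof.
move=> m0 ht h0 [r0 /andP[r00 r0m] hr0] hm [l0 l0m hl0].
have x0r0 := x_incr r00 r0m; have xl0m := x_incr l0m (leqnn m).
pose Q k (p : R * R) := [/\ forall j, (j <= m)%N -> y j <= p.1 * x j + p.2,
        exists2 l, (l <= k)%N & y l = p.1 * x l + p.2
      & exists2 r, (k < r <= m)%N & y r = p.1 * x r + p.2].
pose F k := xget (0, 0) (Q k).
have FP k : (k < m)%N -> Q k (F k).
  move=> /support_line[al [be h]]; apply: (xgetPex (0, 0)).
  by exists (al, be).
have step k : (0 < k < m)%N ->
    (F k).1 - (F k.-1).1 = - t k /\ (F k).2 - (F k.-1).2 = t k * x k.
  move=> /andP[k0 km]; have k1m : (k.-1 < m)%N by lia.
  have [f1 [l f2 f3] [r f4 f5]] := FP _ k1m; have [g1 g2 g3] := FP _ km.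
  apply: support_line_jump => //; first by rewrite k0.
  - by apply: ht; rewrite k0.
  - by exists l => //; lia.
  - by exists r => //; lia.
have tele n : (n < m)%N -> \sum_(1 <= k < n.+1) t k = (F 0%N).1 - (F n).1 /\
   \sum_(1 <= k < n.+1) t k * x k = (F n).2 - (F 0%N).2.
  elim: n => [_|n IH nm]; first by rewrite !big_geq // !subrr.
  have [i1 i2] := IH (ltnW nm).
  have := step n.+1; rewrite /= nm => /(_ isT)[h1 h2].
  rewrite big_nat_recr //= [X in _ /\ X = _]big_nat_recr //= i1 i2.
  by split; lra.
have m1m : (m.-1 < m)%N by lia.
have := tele m.-1 m1m; rewrite prednK // => -[-> ->].
have [f1 [l f2 f3] [r /andP[f4 f4'] f5]] := FP _ m0.
have l00 : l = 0%N by lia.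
rewrite {l f2}l00 in f3.
have F01 : (F 0%N).1 = s0.
  have xr := x_incr f4 f4'.
  have e1 : (F 0%N).1 = slope 0 r by rewrite /slope f5 f3; field; lra.
  have e2 : (F 0%N).1 <= s0 by rewrite e1 h0 ?f4.
  have : slope 0 r0 <= (F 0%N).1.
    by apply: slope_le_touch f3 (f1 _ r0m); rewrite r00.
  lra.
have [g1 [l /= g2 g3] [r' /andP[g4 g4'] g5]] := FP _ m1m.
have rm : r' = m by lia.
rewrite {r' g4 g4'}rm in g5.
have lm : (l < m)%N by lia.
have Fm1 : (F m.-1).1 = sm.
  have xr := x_incr lm (leqnn m).
  have e1 : (F m.-1).1 = slope l m by rewrite /slope g5 g3; field; lra.
  have e2 : sm <= (F m.-1).1 by rewrite e1 hm.
  have : (F m.-1).1 <= slope l0 m.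
    by apply: slope_ge_touch g5 (g1 _ (ltnW l0m)); rewrite l0m leqnn.
  lra.
have := f3; have := g5; rewrite F01 Fm1 => h1 h2; split; lra.
Qed.

End Envelope.

(** * Points on the circle and planes over them *)

Ltac iflia := repeat match goal with
  | |- context [if ?b then _ else _] =>
      lazymatch b with context [if _ then _ else _] => fail | _ => case: (boolP b) => ? end
  | H : context [if _ then _ else _] |- _ => move: H
  end; lia.

Definition cyc (i j k : nat) : bool :=
  [|| i < j < k, j < k < i | k < i < j]%N.

Lemma ordSE (N : nat) (i : 'I_N) :
  (ordS i : nat) = (if i.+1 == N then 0 else i.+1)%N.
Proof.
rewrite /ordS /=; case: eqP => [->|/eqP h]; first by rewrite modnn.
by rewrite modn_small // ltn_neqAle h ltn_ord.
Qed.

Lemma cyc_total (N : nat) (i j k : 'I_N) : i != j -> j != k -> i != k ->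
  cyc i j k || cyc i k j.
Proof. rewrite -!(inj_eq val_inj) /cyc /= => h1 h2 h3; lia. Qed.

Lemma det_mx22 (R : comNzRingType) (A : 'M[R]_2) :
  \det A = A 0 0 * A 1 1 - A 0 1 * A 1 0.
Proof.
rewrite (expand_det_row _ 0) !big_ord_recl big_ord0 /cofactor !det_mx11 !mxE.
rewrite (_ : lift 0 0 = 1 :> 'I_2); last exact: val_inj.
rewrite (_ : lift 1 0 = 0 :> 'I_2); last exact: val_inj.
by rewrite /= expr0 expr1; ring.
Qed.

Lemma sum3 (R : nmodType) (F : 'I_3 -> R) : \sum_(i < 3) F i = F 0 + F 1 + F 2.
Proof.
rewrite !big_ord_recl big_ord0 addr0 addrA.
by congr (F _ + F _ + F _); apply: val_inj.
Qed.

Lemma det_mx33 (R : comNzRingType) (A : 'M[R]_3) : \det A =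
  A 0 0 * (A 1 1 * A 2 2 - A 1 2 * A 2 1) -
  A 0 1 * (A 1 0 * A 2 2 - A 1 2 * A 2 0) +
  A 0 2 * (A 1 0 * A 2 1 - A 1 1 * A 2 0).
Proof.
rewrite (expand_det_row _ 0) sum3 /cofactor !det_mx22 !mxE.
rewrite (_ : lift 0 0 = 1 :> 'I_3); last exact: val_inj.
rewrite (_ : lift 0 1 = 2 :> 'I_3); last exact: val_inj.
rewrite (_ : lift 1 0 = 0 :> 'I_3); last exact: val_inj.
rewrite (_ : lift 1 1 = 2 :> 'I_3); last exact: val_inj.
rewrite (_ : lift 2 0 = 0 :> 'I_3); last exact: val_inj.
rewrite (_ : lift 2 1 = 1 :> 'I_3); last exact: val_inj.
by rewrite /= expr0 expr1 expr2; ring.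
Qed.

Lemma ord3_cases (k : 'I_3) : k = 0 \/ k = 1 \/ k = 2.
Proof.
case: k => [[|[|[|]]]] // p; [left|right; left|right; right]; exact: val_inj.
Qed.

Section Configurations.
Variables (R : realType) (N : nat).
Implicit Types (z : 'M[R]_(N, 3)) (h : 'I_N -> R) (f g : 'rV[R]_3).

(* For the lifts u_i = (z i 0, z i 1, 1) of points on the unit circle,
   br z i j k = det (u_i, u_j, u_k) and ch z i j = - <u_i, u_j>. *)
Definition br z (i j k : 'I_N) : R :=
  (z j 0 - z i 0) * (z k 1 - z i 1) - (z k 0 - z i 0) * (z j 1 - z i 1).

Definition ch z (i j : 'I_N) : R := 1 - z i 0 * z j 0 - z i 1 * z j 1.

Definition fv z f (i : 'I_N) : R := f 0 0 * z i 0 + f 0 1 * z i 1 + f 0 2.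

Lemma upart_rowE z (i : 'I_N) (k : 'I_3) :
  upart (row i z) k 0 = if k == 2 then 1 else z i k.
Proof. by rewrite !mxE. Qed.

Lemma ev_vertex z f (i : 'I_N) : ev f (upart (row i z)) = fv z f i.
Proof. by rewrite /ev mxE sum3 !upart_rowE /= mulr1. Qed.

Lemma height_vertex z (i : 'I_N) : height (row i z) = z i 2.
Proof. by rewrite /height mxE. Qed.

Lemma det_uvec3 z (i j k : 'I_N) : \det (uvec3 z i j k) = br z i j k.
Proof.
by rewrite det_mx33 !mxE /= /br; ring.
Qed.

Lemma bd_vertex z (i : 'I_N) :
  bdHP3 (row i z) <-> z i 0 ^+ 2 + z i 1 ^+ 2 = 1.
Proof. rewrite /bdHP3 /= /lform !upart_rowE /=; split=> h; nra. Qed.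

Definition is_config z : Prop := (forall i, z i 0 ^+ 2 + z i 1 ^+ 2 = 1) /\
  (forall i j k : 'I_N, (i < j)%N -> (j < k)%N -> 0 < br z i j k).

Lemma br_rot z i j k : br z j k i = br z i j k.
Proof. by rewrite /br; ring. Qed.

Lemma br_swap z i j k : br z i k j = - br z i j k.
Proof. by rewrite /br; ring. Qed.

Lemma br_iij z i j : br z i i j = 0. Proof. by rewrite /br; ring. Qed.
Lemma br_iji z i j : br z i j i = 0. Proof. by rewrite /br; ring. Qed.
Lemma br_ijj z i j : br z i j j = 0. Proof. by rewrite /br; ring. Qed.

Lemma ch_sym z i j : ch z i j = ch z j i.
Proof. by rewrite /ch; ring. Qed.

Section Config.
Variable z : 'M[R]_(N, 3).
Hypothesis cz : is_config z.

Lemma br_gt0 (i j k : 'I_N) : cyc i j k -> 0 < br z i j k.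
Proof.
case/or3P => /andP[h1 h2]; first exact: cz.2.
- by rewrite -br_rot cz.2.
- by rewrite -2!br_rot cz.2.
Qed.

Lemma br_lt0 (i j k : 'I_N) : cyc i k j -> br z i j k < 0.
Proof. by move=> h; rewrite br_swap oppr_lt0 br_gt0. Qed.

Lemma br_neq0 (i j k : 'I_N) : i != j -> j != k -> i != k -> br z i j k != 0.
Proof.
move=> h1 h2 h3; case/orP: (cyc_total h1 h2 h3) => h.
  by rewrite gt_eqF // br_gt0.
by rewrite lt_eqF // br_lt0.
Qed.

Lemma br_neq0P (i j k : 'I_N) : br z i j k != 0 ->
  [/\ i != j, j != k & i != k].
Proof.
by move=> h; split; apply: contra h => /eqP->; rewrite ?br_iij ?br_ijj ?br_iji.
Qed.

Lemma br_gt0P (i j k : 'I_N) : (0 < br z i j k) = cyc i j k.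
Proof.
apply/idP/idP => [h|/br_gt0//].
have [h1 h2 h3] := br_neq0P (lt0r_neq0 h).
case/orP: (cyc_total h1 h2 h3) => // /br_lt0 h'.
by have := lt_trans h h'; rewrite ltxx.
Qed.

Lemma ch_ii (i : 'I_N) : ch z i i = 0.
Proof. by rewrite /ch; have := cz.1 i; lra. Qed.

Lemma chE (i j : 'I_N) :
  ch z i j = ((z i 0 - z j 0) ^+ 2 + (z i 1 - z j 1) ^+ 2) / 2.
Proof. by rewrite /ch; have := cz.1 i; have := cz.1 j; lra. Qed.

Hypothesis N3 : (2 < N)%N.

Lemma third_index (i j : 'I_N) : exists k : 'I_N, k != i /\ k != j.
Proof.
have [k hk] : exists k : 'I_N, k \notin [set i; j]%SET.
  apply/existsP; rewrite -negb_forall; apply/negP => /forallP hk.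
  have : [set i; j]%SET = [set: 'I_N]%SET by apply/setP => k; rewrite hk inE.
  by move/(congr1 (fun A : {set 'I_N} => #|A|)); rewrite cardsT card_ord cards2; lia.
by exists k; move: hk; rewrite !inE negb_or => /andP.
Qed.

(** By [chE] this is half a squared distance, so a zero would identify the two points and flatten
    every triangle that contains both. *)
Lemma ch_gt0 (i j : 'I_N) : i != j -> 0 < ch z i j.
Proof.
move=> ij; have [k [ki kj]] := third_index i j.
have := br_neq0 ij; rewrite eq_sym in kj; rewrite eq_sym in ki.
move=> /(_ k kj ki) hb.
rewrite lt_def chE divr_ge0 ?addr_ge0 ?sqr_ge0 // andbT.
apply: contra hb; rewrite mulf_eq0 invr_eq0 pnatr_eq0 orbF.
rewrite paddr_eq0 ?sqr_ge0 // !sqrf_eq0 !subr_eq0 => /andP[/eqP h1 /eqP h2].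
by rewrite /br h1 h2; apply/eqP; ring.
Qed.

Definition cross (i j : 'I_N) : 'rV[R]_3 := \row_(k < 3)
  (if k == 0 then z i 1 - z j 1 else
   if k == 1 then z j 0 - z i 0 else z i 0 * z j 1 - z i 1 * z j 0).

Lemma fv_cross i j k : fv z (cross i j) k = br z i j k.
Proof. by rewrite /fv !mxE /br /=; ring. Qed.

Lemma fvD f g i : fv z (f + g) i = fv z f i + fv z g i.
Proof. by rewrite /fv !mxE; ring. Qed.
Lemma fvZ c g i : fv z (c *: g) i = c * fv z g i.
Proof. by rewrite /fv !mxE; ring. Qed.
Lemma fvN g i : fv z (- g) i = - fv z g i.
Proof. by rewrite /fv !mxE; ring. Qed.
Lemma fvB f g i : fv z (f - g) i = fv z f i - fv z g i.
Proof. by rewrite fvD fvN. Qed.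

Lemma row3P f g : f 0 0 = g 0 0 -> f 0 1 = g 0 1 -> f 0 2 = g 0 2 -> f = g.
Proof.
move=> h0 h1 h2; apply/matrixP => i k; rewrite ord1.
by have [->|[->|->]] := ord3_cases k.
Qed.

Lemma fv_inj0 f (i j k : 'I_N) : br z i j k != 0 ->
  fv z f i = 0 -> fv z f j = 0 -> fv z f k = 0 -> f = 0.
Proof.
rewrite /fv => hb hi hj hk.
have h0 : f 0 0 * br z i j k = 0.
  transitivity ((f 0 0 * z j 0 + f 0 1 * z j 1 + f 0 2 - (f 0 0 * z i 0 + f 0 1 * z i 1 + f 0 2)) * (z k 1 - z i 1) - (f 0 0 * z k 0 + f 0 1 * z k 1 + f 0 2 - (f 0 0 * z i 0 + f 0 1 * z i 1 + f 0 2)) * (z j 1 - z i 1)).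
    by rewrite /br; ring.
  by rewrite hi hj hk; ring.
have h1 : f 0 1 * br z i j k = 0.
  transitivity ((f 0 0 * z k 0 + f 0 1 * z k 1 + f 0 2 - (f 0 0 * z i 0 + f 0 1 * z i 1 + f 0 2)) * (z j 0 - z i 0) - (f 0 0 * z j 0 + f 0 1 * z j 1 + f 0 2 - (f 0 0 * z i 0 + f 0 1 * z i 1 + f 0 2)) * (z k 0 - z i 0)).
    by rewrite /br; ring.
  by rewrite hi hj hk; ring.
move/eqP: h0; rewrite mulf_eq0 (negbTE hb) orbF => /eqP h0.
move/eqP: h1; rewrite mulf_eq0 (negbTE hb) orbF => /eqP h1.
by apply: row3P; rewrite ?h0 ?h1 ?mxE //; rewrite h0 h1 in hi; lra.
Qed.

Lemma fv_inj f g (i j k : 'I_N) : br z i j k != 0 ->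
  fv z f i = fv z g i -> fv z f j = fv z g j -> fv z f k = fv z g k -> f = g.
Proof.
move=> hb hi hj hk; apply/eqP; rewrite -subr_eq0; apply/eqP.
by apply: (fv_inj0 hb); rewrite fvB ?hi ?hj ?hk subrr.
Qed.

End Config.

(* The plane through the vertices i and j, at heights h i and h j, that has slope
   s in the affine chart of the pencil of planes through i. *)
Definition plane z h (i j : 'I_N) (s : R) : 'rV[R]_3 :=
  (ch z i j)^-1 *: (\row_(k < 3) (if k == 0 then - (h j - h i) * z i 0 else
     if k == 1 then - (h j - h i) * z i 1 else h j - h i + h i * ch z i j) +
   s *: cross z i j).

(** The parameter [s] for which [plane z h i j s] also passes through the vertex [k]. *)
Definition plane_slope z h (i j k : 'I_N) : R :=
  ((h k - h i) * ch z i j - (h j - h i) * ch z i k) / br z i j k.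

Lemma plane_slope_sym z h i j k : plane_slope z h i k j = plane_slope z h i j k.
Proof. by rewrite /plane_slope br_swap invrN; ring. Qed.

Section Planes.
Variable z : 'M[R]_(N, 3).
Hypothesis cz : is_config z.
Hypothesis N3 : (2 < N)%N.
Variable h : 'I_N -> R.

Lemma fv_plane i j s k : i != j -> fv z (plane z h i j s) k =
  h i + ((h j - h i) * ch z i k + s * br z i j k) / ch z i j.
Proof.
move=> ij; have := ch_gt0 cz N3 ij => c0.
rewrite /plane fvZ fvD fvZ fv_cross /fv !mxE /=.
rewrite [ch z i k]/ch; field; exact: lt0r_neq0.
Qed.

Lemma plane_slopeP i j s k : i != j -> j != k -> i != k ->
  h k - fv z (plane z h i j s) k =
  (plane_slope z h i j k - s) * (br z i j k / ch z i j).
Proof.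
move=> ij jk ik; rewrite fv_plane // /plane_slope.
have := br_neq0 cz ij jk ik; have := lt0r_neq0 (ch_gt0 cz N3 ij).
by move=> h1 h2; field; rewrite h1 h2.
Qed.

Lemma fv_plane_l i j s : i != j -> fv z (plane z h i j s) i = h i.
Proof. by move=> ij; rewrite fv_plane // br_iji ch_ii //; ring. Qed.

Lemma fv_plane_r i j s : i != j -> fv z (plane z h i j s) j = h j.
Proof.
move=> ij; rewrite fv_plane // br_ijj mulr0 addr0 mulfK; first by ring.
exact: lt0r_neq0 (ch_gt0 _ _ _).
Qed.

Lemma plane_through f i j : i != j -> fv z f i = h i -> fv z f j = h j ->
  exists s, f = plane z h i j s.
Proof.
move=> ij hi hj; have [k [ki kj]] := third_index N3 i j.
rewrite eq_sym in ki; rewrite eq_sym in kj.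
have hb := br_neq0 cz ij kj ki; have hc := lt0r_neq0 (ch_gt0 cz N3 ij).
exists (((fv z f k - h i) * ch z i j - (h j - h i) * ch z i k) / br z i j k).
apply: (fv_inj hb); rewrite ?fv_plane_l ?fv_plane_r //.
by rewrite fv_plane //; field; rewrite hb hc.
Qed.

Lemma planeB i j s s' : plane z h i j s' - plane z h i j s =
  ((s' - s) / ch z i j) *: cross z i j.
Proof.
rewrite /plane; set A := (\row_(k < 3) _); rewrite -scalerBr opprD addrACA subrr add0r -scalerBl scalerA.
by rewrite mulrC.
Qed.

End Planes.
End Configurations.

(** * Bending of an envelope along its edges *)

Lemma val_iter_ordS (N : nat) (i : 'I_N) (t : nat) : (t < N)%N ->
  (iter t (@ordS _) i : nat) = (if i + t < N then i + t else i + t - N)%N.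
Proof.
have := ltn_ord i; elim: t => [|t IH] iN tN; first by rewrite addn0 iN.
by rewrite iterS ordSE (IH iN (ltnW tN)); clear IH; iflia.
Qed.

Lemma iter_ordS_inj (N : nat) (i : 'I_N) :
  injective (fun t : 'I_N => iter t (@ordS _) i).
Proof.
move=> s t /(congr1 val); rewrite /= !val_iter_ordS // => e.
by apply: val_inj => /=; have := ltn_ord i; have := ltn_ord s; have := ltn_ord t; iflia.
Qed.

Lemma iter_ordS_onto (N : nat) (i j : 'I_N) : i != j ->
  exists2 t, (t < N.-1)%N & j = iter t.+1 (@ordS _) i.
Proof.
rewrite -(inj_eq (@ord_inj _)) => ij; have iN := ltn_ord i; have jN := ltn_ord j.
exists (if i < j then j - i - 1 else N + j - i - 1)%N; first by iflia.
by apply: ord_inj; rewrite val_iter_ordS; iflia.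
Qed.

Lemma cyc_iter (N : nat) (i : 'I_N) (s t : nat) : (s < N.-1)%N -> (t < N.-1)%N ->
  cyc i (iter s.+1 (@ordS _) i) (iter t.+1 (@ordS _) i) = (s < t)%N.
Proof.
move=> sN tN; have iN := ltn_ord i.
rewrite !val_iter_ordS; [|iflia|iflia]; rewrite /cyc; iflia.
Qed.

Lemma sum_iter_ordS (N : nat) (V : zmodType) (i : 'I_N) (F : 'I_N -> V) :
  \sum_j F j = F i + \sum_(0 <= t < N.-1) F (iter t.+1 (@ordS _) i).
Proof.
have N0 : (0 < N)%N by apply: leq_trans (ltn_ord i).
rewrite (reindex_inj (@iter_ordS_inj N i)) /= -(big_mkord xpredT (fun t => F (iter t (@ordS _) i))).
rewrite big_ltn //; congr (_ + _).
by rewrite big_add1.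
Qed.

Lemma cycP (N : nat) (i j k : 'I_N) : cyc i j k -> [/\ i != j, j != k & i != k].
Proof. by move=> c; split; move: c; rewrite -(inj_eq (@ord_inj _)) /cyc; lia. Qed.

Definition adjacent_ord (N : nat) (i j : 'I_N) : bool :=
  (j == ordS i) || (i == ordS j).

Section BigMinMax.
Variables (R : realType) (I : finType) (P : pred I) (F : I -> R) (i0 : I).
Hypothesis P0 : P i0.

Lemma bigminP : (forall i, P i -> \big[Num.min/F i0]_(i | P i) F i <= F i) /\
  exists2 i, P i & \big[Num.min/F i0]_(i | P i) F i = F i.
Proof.
split; first by move=> i Pi; exact: bigmin_le_cond.
apply: (big_ind (fun v => exists2 i, P i & v = F i)).
- by exists i0.
- by move=> u v hu hv; case: (leP u v).
- by move=> i Pi; exists i.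
Qed.

Lemma bigmaxP : (forall i, P i -> F i <= \big[Num.max/F i0]_(i | P i) F i) /\
  exists2 i, P i & \big[Num.max/F i0]_(i | P i) F i = F i.
Proof.
split; first by move=> i Pi; exact: le_bigmax_cond.
apply: (big_ind (fun v => exists2 i, P i & v = F i)).
- by exists i0.
- by move=> u v hu hv; case: (leP u v).
- by move=> i Pi; exists i.
Qed.
End BigMinMax.

Section Angles.
Variables (R : realType) (N : nat).
Implicit Types (z : 'M[R]_(N, 3)) (h : 'I_N -> R) (f g : 'rV[R]_3).

Definition slope_drop z h (i j l r : 'I_N) : R :=
  plane_slope z h i l j - plane_slope z h i j r.

(* The bending of the upper envelope of h along the segment from i to j; it is
   positive exactly when this segment is an edge of the envelope. *)
Definition top_angle z h (i j : 'I_N) : R :=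
  if (i == j) || adjacent_ord i j then 0 else
  Num.max 0 (\big[Num.min/slope_drop z h i j (ordS i) (ordS j)]_(p : 'I_N * 'I_N |
      cyc i p.1 j && cyc i j p.2) slope_drop z h i j p.1 p.2).

(** All other vertices lie on the positive side of the segment from [i] to its successor, so the
    largest slope of a plane through this segment and a further vertex is the supporting one. The
    initial value of the maximum is one of its terms. *)
Definition side_slope z h (i : 'I_N) : R :=
  \big[Num.max/plane_slope z h i (ordS i) (ordS (ordS i))]_(k : 'I_N |
      cyc i (ordS i) k) plane_slope z h i (ordS i) k.

(** The second slope belongs to the negated heights, so the sum is the upper slope minus the lower
    one; the outer sign makes equatorial angles negative. *)
Definition side_angle z h (i : 'I_N) : R :=
  - (side_slope z h i + side_slope z (fun k => - h k) i).

Definition angle z h (i j : 'I_N) : R :=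
  if j == ordS i then side_angle z h i else
  if i == ordS j then side_angle z h j else
  top_angle z h i j + top_angle z (fun k => - h k) i j.

(* cross z i j / ch z i j is the unit conormal of the geodesic from u_i to u_j, so
   this says that the infinitesimal rotations of angle W i j about the geodesics
   from u_i to the other points compose to the identity. *)
Definition balanced z (W : 'I_N -> 'I_N -> R) : Prop :=
  forall i, \sum_j (W i j / ch z i j) *: cross z i j = 0.

Definition top_support z h f : Prop := forall i, h i <= fv z f i.

Definition side_plane z h (i : 'I_N) : 'rV[R]_3 :=
  plane z h i (ordS i) (side_slope z h i).

(** * The faces around a vertex *)

Section Envelope.
Variable z : 'M[R]_(N, 3).
Hypothesis cz : is_config z.
Hypothesis N4 : (3 < N)%N.
Let N3 : (2 < N)%N := ltnW N4.
Variable h : 'I_N -> R.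

Lemma ordS_neq (i : 'I_N) : i != ordS i.
Proof. by rewrite -(inj_eq (@ord_inj _)) ordSE; have := ltn_ord i; iflia. Qed.

Lemma cyc_side (i k : 'I_N) : k != i -> k != ordS i -> cyc i (ordS i) k.
Proof.
rewrite -!(inj_eq (@ord_inj _)) /cyc ordSE; have := ltn_ord i; have := ltn_ord k; iflia.
Qed.

Lemma cyc_diagonal (i j : 'I_N) : i != j -> ~~ adjacent_ord i j ->
  cyc i (ordS i) j && cyc i j (ordS j).
Proof.
rewrite /adjacent_ord -!(inj_eq (@ord_inj _)) !ordSE /cyc.
have := ltn_ord i; have := ltn_ord j; iflia.
Qed.

Lemma side_slopeP (i : 'I_N) :
  (forall k, k != i -> k != ordS i ->
     plane_slope z h i (ordS i) k <= side_slope z h i) /\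
  exists k, [/\ k != i, k != ordS i &
     side_slope z h i = plane_slope z h i (ordS i) k].
Proof.
have P0 : cyc i (ordS i) (ordS (ordS i)).
  by rewrite /cyc !ordSE; have := ltn_ord i; iflia.
have [h1 [k hk e]] := @bigmaxP R 'I_N (fun k => cyc i (ordS i) k)
  (plane_slope z h i (ordS i)) _ P0.
split; first by move=> k1 n1 n2; apply/h1/cyc_side.
by exists k; have [c1 c2 c3] := cycP hk; rewrite ![k == _]eq_sym.
Qed.

Lemma top_angleP (i j : 'I_N) : i != j -> ~~ adjacent_ord i j ->
  [/\ 0 <= top_angle z h i j,
      forall l r : 'I_N, cyc i l j -> cyc i j r -> 0 < top_angle z h i j ->
        top_angle z h i j <= slope_drop z h i j l r
    & exists l r : 'I_N, [/\ cyc i l j, cyc i j r & if 0 < top_angle z h i j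
        then top_angle z h i j = slope_drop z h i j l r
        else slope_drop z h i j l r <= 0]].
Proof.
move=> ij aij; rewrite /top_angle (negbTE ij) (negbTE aij) /=.
have [h1 [[l r] /= /andP[h2 h3] e]] := @bigminP R ('I_N * 'I_N)%type
  (fun p => cyc i p.1 j && cyc i j p.2)
  (fun p => slope_drop z h i j p.1 p.2) (ordS i, ordS j) (cyc_diagonal ij aij).
move: h1 e; rewrite /=; set m := \big[_/_]_(_ | _) _ => h1 e.
rewrite lt_max ltxx /=; split; first by rewrite le_max lexx.
- by move=> l' r' hl hr m0; rewrite ge_max (ltW (lt_le_trans m0 _)) ?(h1 (l', r')) //= hl.
- by exists l, r; split => //; case: ltP => m0; rewrite -e.
Qed.

Lemma top_angle_ge0 (i j : 'I_N) : 0 <= top_angle z h i j.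
Proof. by rewrite /top_angle; case: ifP => // _; rewrite le_max lexx. Qed.

Lemma top_support_side (i : 'I_N) : top_support z h (side_plane z h i).
Proof.
move=> k; have iS := ordS_neq i; rewrite -subr_le0.
have [->|ki] := eqVneq k i; first by rewrite fv_plane_l // subrr.
have [->|kS] := eqVneq k (ordS i); first by rewrite fv_plane_r // subrr.
have [h1 _] := side_slopeP i.
rewrite plane_slopeP // 1?eq_sym // mulr_le0_ge0 ?subr_le0 ?h1 //.
by rewrite divr_ge0 ?ltW ?ch_gt0 // br_gt0 // cyc_side.
Qed.

Lemma fv_side_l (i : 'I_N) : fv z (side_plane z h i) i = h i.
Proof. by rewrite fv_plane_l ?ordS_neq. Qed.

Lemma fv_side_r (i : 'I_N) : fv z (side_plane z h i) (ordS i) = h (ordS i).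
Proof. by rewrite fv_plane_r ?ordS_neq. Qed.

Lemma side_contact (i : 'I_N) : exists k, [/\ k != i, k != ordS i &
  fv z (side_plane z h i) k = h k].
Proof.
have [_ [k [ki kS e]]] := side_slopeP i; exists k; split=> //.
apply/eqP; rewrite eq_sym -subr_eq0 plane_slopeP ?ordS_neq // 1?eq_sym //.
by rewrite e subrr mul0r.
Qed.

(* The coordinates in which the planes through the vertex i are affine functions
   of one variable. *)
Definition pencil_x (i k : 'I_N) : R := - (z i 0 * z k 1 - z i 1 * z k 0) / ch z i k.
Definition pencil_y (i k : 'I_N) : R := (h k - h i) / ch z i k.

(** The underlying polynomial identity holds modulo the equation of the circle at [i]. It shows that
    [pencil_x] increases along the vertices that follow [i]. *)
Lemma pencil_xB (i j k : 'I_N) : i != j -> i != k ->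
  pencil_x i k - pencil_x i j = br z i j k / (ch z i j * ch z i k).
Proof.
move=> ij ik; have hj := ch_gt0 cz N3 ij; have hk := ch_gt0 cz N3 ik.
have -> : br z i j k = ch z i j * (- (z i 0 * z k 1 - z i 1 * z k 0)) -
    ch z i k * (- (z i 0 * z j 1 - z i 1 * z j 0)) -
    (z i 0 ^+ 2 + z i 1 ^+ 2 - 1) * (z j 0 * z k 1 - z j 1 * z k 0).
  by rewrite /br /ch; ring.
rewrite cz.1 /pencil_x; move: (ch z i j) (ch z i k) hj hk => c d hc hd.
by field; rewrite !lt0r_neq0.
Qed.

Lemma pencil_slope (i j k : 'I_N) : i != j -> j != k -> i != k ->
  (pencil_y i k - pencil_y i j) / (pencil_x i k - pencil_x i j) =
  plane_slope z h i j k.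
Proof.
move=> ij jk ik; have hj := ch_gt0 cz N3 ij; have hk := ch_gt0 cz N3 ik.
have hb := br_neq0 cz ij jk ik.
rewrite pencil_xB // /pencil_y /plane_slope.
move: (ch z i j) (ch z i k) (br z i j k) hj hk hb => c d e hc hd he.
by field; rewrite he !lt0r_neq0.
Qed.

(** Turning around [i] from the preceding side to the following one, the faces met are the pieces of
    a concave envelope in the pencil at [i]. Each diagonal at [i] contributes one jump, and
    [sum_jumps] adds them up. *)
Lemma side_plane_step (p i : 'I_N) : i = ordS p ->
  side_plane z h i - side_plane z h p =
  \sum_j (top_angle z h i j / ch z i j) *: cross z i j.
Proof.
move=> iE; pose m := N.-2; have m2 : (1 < m)%N by rewrite /m; iflia.
have NE : N.-1 = m.+1 by rewrite /m; iflia.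
(* The other vertices in order: [v 0] is the successor of [i] and [v m] its predecessor [p], so the
   diagonals at [i] have indices strictly between 0 and [m]. *)
pose v t : 'I_N := iter t.+1 (@ordS _) i.
have vi t : (t < N.-1)%N -> i != v t.
  move=> tN; rewrite -(inj_eq (@ord_inj _)) val_iter_ordS; have := ltn_ord i; iflia.
have vv s t : (s < t)%N -> (t < N.-1)%N -> v s != v t.
  move=> st tN; rewrite -(inj_eq (@ord_inj _)) !val_iter_ordS; have := ltn_ord i; iflia.
have v0 : v 0%N = ordS i by [].
have vm : v m = p.
  apply: ord_inj; rewrite /v val_iter_ordS; last by rewrite /m; lia.
  rewrite iE ordSE /m; have := ltn_ord p; iflia.
have ip : i != p by rewrite -vm vi // /m; iflia.
pose x t := pencil_x i (v t); pose y t := pencil_y i (v t).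
have cv s t : (s < t)%N -> (t < N.-1)%N -> cyc i (v s) (v t).
  by move=> st tN; rewrite cyc_iter // (ltn_trans st).
have x_incr s t : (s < t)%N -> (t <= m)%N -> x s < x t.
  move=> st tm; have tN : (t < N.-1)%N by rewrite NE.
  have sN := ltn_trans st tN.
  rewrite -subr_gt0 /x pencil_xB ?vi // divr_gt0 ?mulr_gt0 ?ch_gt0 ?vi //.
  by rewrite br_gt0 // cv.
have slopeE s t : (s < t)%N -> (t <= m)%N ->
    slope x y s t = plane_slope z h i (v s) (v t).
  move=> st tm; have tN : (t < N.-1)%N by rewrite NE.
  have sN := ltn_trans st tN.
  by rewrite /slope pencil_slope // ?vi // vv.
have onto k : k != i -> exists2 t, (t <= m)%N & k = v t.
  rewrite eq_sym => /iter_ordS_onto[t tN ->].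
  by exists t => //; rewrite -ltnS -NE.
have pS : ordS p = i by rewrite iE.
have [sm hsm] : exists s, side_plane z h p = plane z h i p s.
  apply: plane_through => //.
    by rewrite -pS fv_side_r.
  exact: fv_side_l.
have hsup := @top_support_side p.
have [k0 [k0p k0i hk0]] := side_contact p; rewrite pS in k0i.
(* Seen from [i], the face at the preceding side is the last piece of the envelope: its slope [sm]
   is the smallest slope of a chord that ends at [p]. *)
have slope_last k : k != i -> k != p -> sm <= plane_slope z h i k p /\    (fv z (side_plane z h p) k = h k -> plane_slope z h i k p = sm).
  move=> ki kp; rewrite plane_slope_sym.
  have := hsup k; rewrite -subr_le0 hsm plane_slopeP // 1?eq_sym //.
  have b0 : br z i p k < 0.
    have [t tm kt] := onto k ki; have tm' : (t < m)%N.
      by rewrite ltn_neqAle tm andbT; apply: contra kp => /eqP e; rewrite kt e vm.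
    by rewrite br_lt0 // kt -vm cv // NE.
  have bc : br z i p k / ch z i p < 0 by rewrite pmulr_llt0 // invr_gt0 ch_gt0.
  split; first by rewrite -subr_ge0 -(nmulr_lle0 _ bc).
  move/eqP; rewrite eq_sym -subr_eq0 plane_slopeP // 1?eq_sym //.
  by rewrite eq_sym mulf_eq0 (lt_eqF bc) orbF subr_eq0 => /eqP.
have [ss1 [k1 [k1i k1S ss2]]] := side_slopeP i.
have m0 : (0 < m)%N by exact: ltnW.
have jumps t : (0 < t < m)%N -> is_jump m x y t (top_angle z h i (v t)).
  move=> /andP[t0 tm]; have tN : (t < N.-1)%N by rewrite NE ltnS ltnW.
  have adj : ~~ adjacent_ord i (v t).
    rewrite /adjacent_ord negb_or -v0 eq_sym vv //=.
    apply: contraTN tm => /eqP e; rewrite -leqNgt.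
    have : p = v t.
      by apply: ordS_inj; rewrite -iE -e.
    rewrite -vm leqNgt => vE; apply/negP => tm.
    by have := vv _ _ tm; rewrite vE eqxx NE ltnSn => /(_ isT).
  have [a0 a1 [l [r [hl hr a2]]]] := top_angleP (vi _ tN) adj.
  have toN (l' : 'I_N) : cyc i l' (v t) -> exists2 s, (s < t)%N & l' = v s.
    move=> hl'; have [li _ _] := cycP hl'; rewrite eq_sym in li.
    have [s sm' ls] := onto l' li; exists s => //.
    by move: hl'; rewrite ls cyc_iter // NE.
  have toN' (r' : 'I_N) : cyc i (v t) r' -> exists2 s, (t < s <= m)%N & r' = v s.
    move=> hr'; have [_ _ ri] := cycP hr'; rewrite eq_sym in ri.
    have [s sm' rs] := onto r' ri; exists s => //.
    by move: hr'; rewrite rs cyc_iter ?sm' ?andbT // NE.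
  have sd l' r' : (l' < t)%N -> (t < r' <= m)%N -> slope x y l' t - slope x y t r' =
      slope_drop z h i (v t) (v l') (v r').
    by move=> lt /andP[tr rm]; rewrite !slopeE // ltnW.
  split.
    move=> l' r' lt' tr' ap; rewrite sd //; case/andP: tr' => tr' rm'.
    by apply: a1; rewrite ?cv // NE ltnS.
  split=> //; have [s st ls] := toN _ hl; have [s' ts' rs'] := toN' _ hr.
  exists s, s'; split=> //; move: a2; rewrite ls rs' -sd //.
  by case: ifP => // _; rewrite subr_le0.
have sum_ends (V : zmodType) (F : 'I_N -> V) : F i = 0 -> F (ordS i) = 0 -> F p = 0 ->
    \sum_j F j = \sum_(1 <= t < m) F (v t).
  move=> Fi F0 Fp; rewrite (sum_iter_ordS i) Fi add0r NE big_nat_recr //=.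
  have -> : F (ordS (iter m (@ordS _) i)) = 0 by rewrite -Fp -vm.
  by rewrite big_ltn //= F0 add0r addr0.
have [||||] := sum_jumps x_incr m0 jumps (s0 := side_slope z h i) (sm := sm).
- move=> r /andP[r0 rm]; rewrite slopeE // v0; apply: ss1.
    by rewrite eq_sym vi // NE.
  by rewrite -v0 eq_sym vv // NE.
- have [t tm kt] := onto k1 k1i; exists t.
    rewrite tm andbT lt0n; apply: contra k1S => /eqP t0.
    by rewrite kt t0.
  rewrite slopeE // ?v0 -?kt //.
  rewrite lt0n; apply: contra k1S => /eqP t0; by rewrite kt t0.
- move=> l lm; rewrite slopeE // vm; apply: (slope_last _ _ _).1.
    by rewrite eq_sym vi // NE ltnW.
  by rewrite -vm vv // NE.
- have [t tm kt] := onto k0 k0i; have tm' : (t < m)%N.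
    by rewrite ltn_neqAle tm andbT; apply: contra k0p => /eqP e; rewrite kt e vm.
  by exists t => //; rewrite slopeE // vm -kt (slope_last _ _ _).2.
move=> sum1 sum2.
have [q [qi qp]] := third_index N3 i p.
have main k : fv z (side_plane z h i - side_plane z h p) k =
   fv z (\sum_j (top_angle z h i j / ch z i j) *: cross z i j) k.
  have fv_sum (F : 'I_N -> 'rV[R]_3) : fv z (\sum_j F j) k = \sum_j fv z (F j) k.
    rewrite /fv !summxE !mulr_suml -!big_split /=.
    by apply: eq_bigr => j _.
  rewrite fv_sum (sum_ends _ (fun j => fv z (_ *: cross z i j) k)); first last.
  - rewrite /top_angle /adjacent_ord pS eqxx !orbT mul0r scale0r /fv !mxE; ring.
  - rewrite /top_angle /adjacent_ord eqxx !orbT mul0r scale0r /fv !mxE; ring.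
  - rewrite /top_angle eqxx mul0r scale0r /fv !mxE; ring.
  rewrite fvB hsm /side_plane !fv_plane ?ordS_neq //.
  have [->|ki] := eqVneq k i.
    rewrite ch_ii // !br_iji big1; first by ring.
    by move=> t _; rewrite fvZ fv_cross br_iji mulr0.
  have ik : i != k by rewrite eq_sym.
  have E j : i != j -> br z i j k / ch z i j = (pencil_x i k - pencil_x i j) * ch z i k.
    move=> ij; rewrite pencil_xB //.
    have := ch_gt0 cz N3 ij; have := ch_gt0 cz N3 ik => c1 c2.
    by field; rewrite !lt0r_neq0.
  transitivity (\sum_(1 <= t < m) (top_angle z h i (v t) * pencil_x i k - top_angle z h i (v t) * x t) * ch z i k); last first.
    apply: eq_big_nat => t /andP[_ tm].
    have vit : i != v t by apply: vi; rewrite NE ltnS ltnW.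
    by rewrite fvZ fv_cross -mulrA [_^-1 * _]mulrC E // /x; ring.
  rewrite -mulr_suml sumrB -mulr_suml sum1 sum2.
  rewrite -[y 0%N]/(pencil_y i (ordS i)) -[x 0%N]/(pencil_x i (ordS i)).
  rewrite /y /x vm.
  have -> : ((h (ordS i) - h i) * ch z i k + side_slope z h i * br z i (ordS i) k) / ch z i (ordS i) =
     (pencil_y i (ordS i) + side_slope z h i * (pencil_x i k - pencil_x i (ordS i))) * ch z i k.
    rewrite mulrDl -!mulrA E ?ordS_neq // /pencil_y; ring.
  have -> : ((h p - h i) * ch z i k + sm * br z i p k) / ch z i p =
     (pencil_y i p + sm * (pencil_x i k - pencil_x i p)) * ch z i k.
    rewrite mulrDl -!mulrA E // /pencil_y; ring.
  ring.
by apply: (fv_inj (br_neq0 cz _ _ _) (main i) (main p) (main q)); rewrite // eq_sym.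
Qed.

End Envelope.

Section Balance.
Variable z : 'M[R]_(N, 3).
Hypothesis cz : is_config z.
Hypothesis N4 : (3 < N)%N.
Let N3 : (2 < N)%N := ltnW N4.
Variable h : 'I_N -> R.

Lemma planeD_opp (i j : 'I_N) (s s' : R) :
  plane z h i j s + plane z (fun k => - h k) i j s' =
  ((s + s') / ch z i j) *: cross z i j.
Proof. by apply: row3P; rewrite !mxE /=; ring. Qed.

(** Add the steps around [i] for the heights and for the negated heights. The planes of the two
    faces at a side add up to the crease along that side, so the two sides at [i] supply the missing
    terms of the balance. *)
Lemma balanced_angle : balanced z (angle z h).
Proof.
move=> i; pose p := ord_pred i; have pS : ordS p = i by exact: ord_predK.
have ip : i != ordS i := ordS_neq N4 i.
have s1 := side_plane_step cz N4 h (esym pS).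
have s2 := side_plane_step cz N4 (fun k => - h k) (esym pS).
have e1 : side_plane z h i + side_plane z (fun k => - h k) i =
    (- side_angle z h i / ch z i (ordS i)) *: cross z i (ordS i).
  by rewrite /side_plane planeD_opp /side_angle opprK.
have e2 : side_plane z h p + side_plane z (fun k => - h k) p =
    (side_angle z h p / ch z i p) *: cross z i p.
  rewrite /side_plane planeD_opp pS /side_angle ch_sym mulNr scaleNr.
  rewrite (_ : cross z p i = - cross z i p) ?scalerN //.
  by apply: row3P; rewrite !mxE /=; ring.
pose T j := (top_angle z h i j / ch z i j) *: cross z i j.
pose T' j := (top_angle z (fun k => - h k) i j / ch z i j) *: cross z i j.
pose C1 j := if j == ordS i then (side_angle z h i / ch z i j) *: cross z i j else 0.
pose C2 j := if j == p then (side_angle z h p / ch z i j) *: cross z i j else 0.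
have -> : \sum_j (angle z h i j / ch z i j) *: cross z i j =
    \sum_j (T j + T' j + C1 j + C2 j).
  apply: eq_bigr => j _; rewrite /angle /T /T' /C1 /C2.
  have [->|jS] := eqVneq j (ordS i).
    rewrite /top_angle /adjacent_ord eqxx orbT !mul0r !scale0r !add0r.
    case: eqVneq => [pE|_]; last by rewrite addr0.
    have := congr1 val pE; have := congr1 val pS; have := ltn_ord i.
    rewrite /= -!/(nat_of_ord _) => iN h1 h2.
    have : (ordS p : nat) = i by rewrite pS.
    have : (p : nat) = ordS i by rewrite pE.
    rewrite !ordSE; iflia.
  have [iS|iS] := eqVneq i (ordS j).
    have -> : j = p by apply: (@ordS_inj N); rewrite pS.
    rewrite eqxx /top_angle /adjacent_ord pS eqxx !orbT.
    by rewrite !mul0r !scale0r !add0r.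
  have -> : (j == p) = false.
    by apply/eqP => jp; rewrite jp pS eqxx in iS.
  by rewrite !addr0 -scalerDl -mulrDl.
rewrite !big_split /= -/(T _) -s1 -s2 -!big_mkcond /= !big_pred1_eq.
rewrite addrACA -opprD e1 e2 mulNr scaleNr.
by rewrite -addrA -opprD addNr.
Qed.

(** By [side_plane_step] the difference of the side planes of [h] and [h'] is the same linear
    function at every side, and each vertex lies on side planes of both. *)
Lemma top_angles_inj (h' : 'I_N -> R) :
  (forall i j, top_angle z h i j = top_angle z h' i j) ->
  exists f, forall k, h k - h' k = fv z f k.
Proof.
move=> hh; pose d i := side_plane z h i - side_plane z h' i.
have dS p : d (ordS p) = d p.
  have : side_plane z h (ordS p) - side_plane z h p =
      side_plane z h' (ordS p) - side_plane z h' p.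
    by rewrite !(side_plane_step cz N4 _ (erefl _)); apply: eq_bigr => j _; rewrite hh.
  rewrite /d => /eqP; rewrite subr_eq => /eqP->.
  by rewrite addrAC [_ - _ - _]addrAC subrr add0r addrC.
have N0 : (0 < N)%N by apply: leq_trans N4.
pose i0 := Ordinal N0; exists (d i0) => k.
have -> : d i0 = d k.
  have [->//|] := eqVneq k i0; rewrite eq_sym => /iter_ordS_onto[t _ ->].
  by elim: t.+1 => [|s IH] //; rewrite iterS dS.
by rewrite /d fvB !fv_side_l.
Qed.

End Balance.
End Angles.

(** * Edges and faces of the upper envelope *)

Section Edges.
Variables (R : realType) (N : nat).
Hypothesis N4 : (3 < N)%N.
Let N3 : (2 < N)%N := ltnW N4.
Implicit Types (h : 'I_N -> R) (f g : 'rV[R]_3).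
Variable z : 'M[R]_(N, 3).
Hypothesis cz : is_config z.

(** A signed volume of the tetrahedron over the four vertices. For [i], [l], [j], [r] in cyclic
    order it is positive when the segment from [i] to [j] passes above the one from [l] to [r]. *)
Definition quad h (i l j r : 'I_N) : R :=
  br z l j r * h i + br z i l r * h j - br z i j r * h l - br z i l j * h r.

(** Divided by the product of the three [ch] at [i], this is the additivity of the differences of
    [pencil_x z i]. *)
Lemma ch_plucker (i l j r : 'I_N) :
  ch z i l * br z i j r + ch z i r * br z i l j = ch z i j * br z i l r.
Proof.
have -> : ch z i l * br z i j r + ch z i r * br z i l j = ch z i j * br z i l r +
  (1 - (z i 0 ^+ 2 + z i 1 ^+ 2)) * ((z l 0 * z j 1 - z l 1 * z j 0) +
  (z j 0 * z r 1 - z j 1 * z r 0) + (z r 0 * z l 1 - z r 1 * z l 0)).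
  by rewrite /ch /br; ring.
by rewrite cz.1; ring.
Qed.

(** The left-hand side singles out the end [i]; the right-hand side is symmetric in the two ends of
    the segment, and its sign is that of [quad]. *)
Lemma slope_dropE h (i j l r : 'I_N) : cyc i l j -> cyc i j r ->
  slope_drop z h i j l r = ch z i j * quad h i l j r / (br z i l j * br z i j r).
Proof.
move=> hl hr; have b1 := br_gt0 cz hl; have b2 := br_gt0 cz hr.
rewrite /slope_drop /plane_slope.
have -> : ch z i j * quad h i l j r = (h j - h i) * (ch z i j * br z i l r) -
   (h l - h i) * ch z i j * br z i j r - (h r - h i) * ch z i j * br z i l j.
  by rewrite /quad /br; ring.
rewrite -ch_plucker; move: (br z i l j) (br z i j r) (ch z i l) (ch z i r) (ch z i j) b1 b2.
by move=> c1 c2 a1 a2 a3 b1 b2; field; rewrite !lt0r_neq0.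
Qed.

Lemma slope_drop_sgr h (i j l r : 'I_N) : cyc i l j -> cyc i j r ->
  (0 < slope_drop z h i j l r) = (0 < quad h i l j r).
Proof.
move=> hl hr; have [ij _ _] := cycP hr; rewrite slope_dropE // pmulr_lgt0.
  by rewrite pmulr_rgt0 // ch_gt0.
by rewrite invr_gt0 mulr_gt0 // br_gt0.
Qed.

Lemma slope_drop_sym h (i j l r : 'I_N) : cyc i l j -> cyc i j r ->
  slope_drop z h j i r l = slope_drop z h i j l r.
Proof.
move=> hl hr; have hr' : cyc j r i by move: hr; rewrite /cyc; lia.
have hl' : cyc j i l by move: hl; rewrite /cyc; lia.
rewrite !slope_dropE // ch_sym; congr (_ * _ / _).
  by rewrite /quad /br; ring.
by rewrite /br; ring.
Qed.

Lemma adjacent_ord_sym (i j : 'I_N) : adjacent_ord i j = adjacent_ord j i.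
Proof. by rewrite /adjacent_ord orbC. Qed.

Lemma top_angle_sym h (i j : 'I_N) : top_angle z h i j = top_angle z h j i.
Proof.
suff le a b : top_angle z h a b <= top_angle z h b a.
  by apply/eqP; rewrite eq_le !le.
have [->//|ab] := eqVneq a b.
case: (boolP (adjacent_ord a b)) => [aab|aab].
  by rewrite {1}/top_angle aab orbT top_angle_ge0.
have [p0 p1 _] := top_angleP z N4 h ab aab.
rewrite eq_sym in ab; rewrite adjacent_ord_sym in aab.
have [q0 _ [l [r [hl hr q2]]]] := top_angleP z N4 h ab aab.
rewrite leNgt; apply/negP => lt; have := le_lt_trans q0 lt => ap.
have hl' : cyc a b l by move: hl; rewrite /cyc; lia.
have hr' : cyc a r b by move: hr; rewrite /cyc; lia.
have := p1 r l hr' hl' ap; rewrite -slope_drop_sym // => le.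
move: q2; case: ifP => _ q2; last by have := le_lt_trans (le_trans le q2) ap; rewrite ltxx.
by have := le_lt_trans le (_ : _ < top_angle z h a b); rewrite -q2 lt ltxx => /(_ isT).
Qed.

(** Each of the two segments would have to pass above the other at their crossing: [quad] changes
    sign when the two pairs are exchanged. *)
Lemma top_angle_cross h (i j k l : 'I_N) : cyc i k j -> cyc i j l ->
  0 < top_angle z h i j -> 0 < top_angle z h k l -> False.
Proof.
have pos (a b c d : 'I_N) : cyc a c b -> cyc a b d -> 0 < top_angle z h a b -> 0 < quad h a c b d.
  move=> hc hd p; have [ab _ _] := cycP hd.
  have [ad|ad] := boolP (adjacent_ord a b).
    by move: p; rewrite /top_angle ad orbT ltxx.
  have [_ h1 _] := top_angleP z N4 h ab ad.
  by rewrite -slope_drop_sgr // (lt_le_trans p) // h1.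
move=> hk hl /pos => /(_ _ _ hk hl) h1 /pos h2.
have hk' : cyc k j l by move: hk hl; rewrite /cyc; lia.
have hl' : cyc k l i by move: hk hl; rewrite /cyc; lia.
have := h2 _ _ hk' hl'.
have -> : quad h k j l i = - quad h i k j l by rewrite /quad /br; ring.
by rewrite oppr_gt0 => h3; have := lt_trans h1 h3; rewrite ltxx.
Qed.

Definition top_face h g : Prop := top_support z h g /\
  exists i j k : 'I_N, [/\ br z i j k != 0, fv z g i = h i, fv z g j = h j
    & fv z g k = h k].

Lemma top_face_third h g (i j : 'I_N) : top_face h g ->
  exists k, [/\ k != i, k != j & fv z g k = h k].
Proof.
move=> [_ [a [b [c [/br_neq0P[ab bc ac] ha hb hc]]]]].
have [aij|] := boolP ((a != i) && (a != j)).
  by exists a; split => //; case/andP: aij.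
rewrite negb_and !negbK => a1.
have [bij|] := boolP ((b != i) && (b != j)).
  by exists b; split => //; case/andP: bij.
rewrite negb_and !negbK => b1.
exists c; split=> //; apply/eqP => cE; subst c; case/orP: a1 => /eqP e1; case/orP: b1 => /eqP e2;
  by move: ab bc ac; rewrite e1 e2 !eqxx.
Qed.

Lemma plane_contact h (i j k : 'I_N) (s : R) : i != j -> k != i -> k != j ->
  (fv z (plane z h i j s) k = h k) <-> s = plane_slope z h i j k.
Proof.
move=> ij ki kj; rewrite eq_sym in ki; rewrite eq_sym in kj.
have e := plane_slopeP cz N3 h s ij kj ki.
have b0 : br z i j k / ch z i j != 0.
  by rewrite mulf_neq0 ?br_neq0 // invr_eq0 lt0r_neq0 // ch_gt0.
split=> [hk|hk]; last first.
  by apply/eqP; rewrite eq_sym -subr_eq0 e hk subrr mul0r.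
move/eqP: e; rewrite hk subrr eq_sym mulf_eq0 (negbTE b0) orbF subr_eq0.
by move=> /eqP->.
Qed.

Lemma plane_above_r h (i j k : 'I_N) (s : R) : i != j -> cyc i j k ->
  (h k <= fv z (plane z h i j s) k) = (plane_slope z h i j k <= s).
Proof.
move=> ij hk; have [_ jk ik] := cycP hk.
rewrite -subr_le0 plane_slopeP // pmulr_lle0 ?subr_le0 //.
by rewrite divr_gt0 ?br_gt0 ?ch_gt0.
Qed.

Lemma plane_above_l h (i j k : 'I_N) (s : R) : i != j -> cyc i k j ->
  (h k <= fv z (plane z h i j s) k) = (s <= plane_slope z h i j k).
Proof.
move=> ij hk; have [ik kj _] := cycP hk; rewrite eq_sym in kj.
rewrite -subr_le0 plane_slopeP // nmulr_lle0 ?subr_ge0 //.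
by rewrite pmulr_llt0 ?br_lt0 ?invr_gt0 ?ch_gt0.
Qed.

(** The planes through [i] and [j] above all vertices are those whose slope lies between the largest
    slope of a vertex on the right and the smallest slope of one on the left. The two extreme planes
    touch a further vertex, and this interval has length [top_angle]. *)
Lemma top_edge_planes h (i j : 'I_N) : 0 < top_angle z h i j -> exists s : R,
  [/\ top_face h (plane z h i j s),
      top_face h (plane z h i j (s + top_angle z h i j))
    & forall k, k != i -> k != j -> fv z (plane z h i j s) k = h k ->
        fv z (plane z h i j (s + top_angle z h i j)) k = h k -> False].
Proof.
move=> p; have [ij|ij] := eqVneq i j.
  by move: p; rewrite /top_angle ij eqxx ltxx.
have [ad|ad] := boolP (adjacent_ord i j).
  by move: p; rewrite /top_angle ad orbT ltxx.
have [_ h1 [l [r [hl hr]]]] := top_angleP z N4 h ij ad.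
rewrite p => h2; set t := top_angle z h i j in p h1 h2 *.
have sE : plane_slope z h i j r + t = plane_slope z h i j l.
  by rewrite h2 /slope_drop (plane_slope_sym z h i j l); ring.
have hlow (k : 'I_N) : cyc i j k -> plane_slope z h i j k <= plane_slope z h i j r.
  move=> hk; have := h1 l k hl hk p; rewrite /slope_drop (plane_slope_sym z h i j l) -sE; lra.
have hup (k : 'I_N) : cyc i k j -> plane_slope z h i j l <= plane_slope z h i j k.
  move=> hk; have := h1 k r hk hr p; rewrite /slope_drop (plane_slope_sym z h i j k) -sE; lra.
have [il lj _] := cycP hl; have [_ jr ir] := cycP hr.
exists (plane_slope z h i j r); rewrite sE; split.
- split; last first.
    exists i, j, r; rewrite fv_plane_l ?fv_plane_r ?br_neq0 //; split=> //.
    by apply/plane_contact; rewrite // eq_sym.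
  move=> k; have [->|ki] := eqVneq k i; first by rewrite fv_plane_l.
  have [->|kj] := eqVneq k j; first by rewrite fv_plane_r.
  rewrite eq_sym in ki; rewrite eq_sym in kj.
  case/orP: (cyc_total ij kj ki) => hk; first by rewrite plane_above_r ?hlow.
  by rewrite plane_above_l // (le_trans _ (hup _ hk)) // -sE lerDl ltW.
- split; last first.
    exists i, l, j; rewrite fv_plane_l ?fv_plane_r ?br_neq0 //; split=> //.
    by apply/plane_contact; rewrite // eq_sym.
  move=> k; have [->|ki] := eqVneq k i; first by rewrite fv_plane_l.
  have [->|kj] := eqVneq k j; first by rewrite fv_plane_r.
  rewrite eq_sym in ki; rewrite eq_sym in kj.
  case/orP: (cyc_total ij kj ki) => hk; last by rewrite plane_above_l ?hup.
  by rewrite plane_above_r // (le_trans (hlow _ hk)) // -sE lerDl ltW.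
- move=> k ki kj /plane_contact e1 /plane_contact e2; move: p.
  suff -> : t = 0 by rewrite ltxx.
  have := e1 ij ki kj; have := e2 ij ki kj; lra.
Qed.

Lemma side_face h (i : 'I_N) : top_face h (side_plane z h i).
Proof.
split; first exact: top_support_side.
have [k [ki kS e]] := side_contact cz N4 h i.
exists i, (ordS i), k; rewrite fv_side_l ?fv_side_r //; split=> //.
by rewrite br_neq0 ?ordS_neq // eq_sym.
Qed.

Lemma side_face_unique h g (i : 'I_N) : top_face h g ->
  fv z g i = h i -> fv z g (ordS i) = h (ordS i) -> g = side_plane z h i.
Proof.
move=> fg gi gS; have iS := ordS_neq N4 i.
have [s gE] := plane_through cz N3 iS gi gS.
have [k [ki kS]] := top_face_third i (ordS i) fg; rewrite gE => /plane_contact sE.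
have := sE iS ki kS => {}sE.
have [h1 [k' [k'i k'S h2]]] := side_slopeP z N4 h i.
rewrite /side_plane; congr plane; apply/eqP; rewrite eq_le {1}sE h1 //= h2.
by rewrite -plane_above_r ?cyc_side // -gE; exact: fg.1.
Qed.

(** Converse of [top_edge_planes]: of two faces through [i] and [j], the one of smaller slope
    touches a vertex on the right and the other one a vertex on the left, so they bound the interval
    of supporting slopes. Over a side there is only one face. *)
Lemma top_edge_faces h g g' (i j : 'I_N) : i != j ->
  top_face h g -> top_face h g' -> g <> g' ->
  fv z g i = h i -> fv z g j = h j -> fv z g' i = h i -> fv z g' j = h j ->
  [/\ ~~ adjacent_ord i j, 0 < top_angle z h i j &
      g' - g = (top_angle z h i j / ch z i j) *: cross z i j \/
      g' - g = (- top_angle z h i j / ch z i j) *: cross z i j].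
Proof.
move=> ij fg fg' gg' gi gj gi' gj'.
have ad : ~~ adjacent_ord i j.
  apply/negP => /orP[]/eqP e; apply: gg'.
    by subst j; rewrite (side_face_unique fg gi gj) (side_face_unique fg' gi' gj').
  by subst i; rewrite (side_face_unique fg gj gi) (side_face_unique fg' gj' gi').
suff main a b s s' : a = plane z h i j s -> b = plane z h i j s' ->
    top_face h a -> top_face h b -> s < s' -> 0 < top_angle z h i j /\
    s' - s = top_angle z h i j.
  have [s gE] := plane_through cz N3 ij gi gj.
  have [s' gE'] := plane_through cz N3 ij gi' gj'.
  case: (ltgtP s s') => ss; last by case: gg'; rewrite gE gE' ss.
  - have [p e] := main _ _ _ _ gE gE' fg fg' ss; split=> //; left.
    by rewrite gE gE' planeB e.
  - have [p e] := main _ _ _ _ gE' gE fg' fg ss; split=> //; right.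
    by rewrite gE gE' planeB // -e opprB.
move=> aE bE fa fb ss.
have [k [ki kj]] := top_face_third i j fa; rewrite aE => /plane_contact sE.
have {}sE := sE ij ki kj.
have [l [li lj]] := top_face_third i j fb; rewrite bE => /plane_contact sE'.
have {}sE' := sE' ij li lj.
rewrite eq_sym in ki; rewrite eq_sym in kj.
rewrite eq_sym in li; rewrite eq_sym in lj.
have hk : cyc i j k.
  case/orP: (cyc_total ij kj ki) => // hk.
  have := fb.1 k; rewrite bE plane_above_l // -sE leNgt ss //.
have hl : cyc i l j.
  case/orP: (cyc_total ij lj li) => // hl.
  have := fa.1 l; rewrite aE plane_above_r // -sE' leNgt ss //.
have drop (l' r' : 'I_N) : cyc i l' j -> cyc i j r' -> s' - s <= slope_drop z h i j l' r'.
  move=> hl' hr'; rewrite /slope_drop (plane_slope_sym z h i j l').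
  have := fb.1 l'; rewrite bE plane_above_l //.
  have := fa.1 r'; rewrite aE plane_above_r //; lra.
have [h0 h1 [l0 [r0 [hl0 hr0 h2]]]] := top_angleP z N4 h ij ad.
have d0 := drop _ _ hl0 hr0.
have tp : 0 < top_angle z h i j.
  rewrite lt_neqAle h0 andbT eq_sym; apply/eqP => t0.
  by move: h2; rewrite t0 ltxx; lra.
split=> //; have := h1 l k hl hk tp; rewrite /slope_drop (plane_slope_sym z h i j l) -sE -sE'.
move: h2; rewrite tp => h2; lra.
Qed.

Definition coplanar h : Prop := exists f, forall k, h k = fv z f k.

Lemma plane_slopeN h (i j k : 'I_N) :
  plane_slope z (fun k => - h k) i j k = - plane_slope z h i j k.
Proof. by rewrite /plane_slope; ring. Qed.

(** Otherwise the upper slope does not exceed the lower one, and the slopes of all planes through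
    the side and a further vertex are pinched to one value. *)
Lemma side_angle_lt0 h (i : 'I_N) : ~ coplanar h -> side_angle z h i < 0.
Proof.
move=> nc; rewrite oppr_lt0 ltNge; apply/negP => le; apply: nc.
exists (side_plane z h i) => k.
have [->|ki] := eqVneq k i; first by rewrite fv_side_l.
have [->|kS] := eqVneq k (ordS i); first by rewrite fv_side_r.
have [h1 _] := side_slopeP z N4 h i.
have [h2 _] := side_slopeP z N4 (fun k => - h k) i.
have := h1 k ki kS; have := h2 k ki kS.
rewrite plane_slopeN.
move=> e1 e2; symmetry; apply/plane_contact; rewrite ?ordS_neq //; lra.
Qed.

Lemma side_planes_coplanar h (i k : 'I_N) : k != i -> k != ordS i ->
  fv z (side_plane z h i) k = h k ->
  fv z (side_plane z (fun k => - h k) i) k = - h k ->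
  0 <= side_angle z h i.
Proof.
move=> ki kS /plane_contact e1 /plane_contact e2.
have iS := ordS_neq N4 i; have {}e1 := e1 iS ki kS; have {}e2 := e2 iS ki kS.
by rewrite /side_angle e1 e2 plane_slopeN subrr oppr0.
Qed.

End Edges.

(** * Marked polyhedra as circle configurations with heights *)

Section Hull.
Variables (R : realType) (N : nat) (z : 'M[R]_(N, 3)).

Lemma hull_comb (I : finType) (p : I -> 'I_N) (w : I -> R) :
  (forall s, 0 <= w s) -> \sum_s w s = 1 -> hull z (\sum_s w s *: row (p s) z).
Proof.
move=> w0 w1; exists (fun i => \sum_(s | p s == i) w s); split.
- by move=> i; apply: sumr_ge0.
- by rewrite -w1 [RHS](partition_big p xpredT).
- rewrite [LHS](partition_big p xpredT) //=; apply: eq_bigr => i _.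
  by rewrite scaler_suml; apply: eq_bigr => s /eqP->.
Qed.

Lemma hull_vertex (i : 'I_N) : hull z (row i z).
Proof.
have -> : row i z = \sum_(s : 'I_1) 1 *: row i z by rewrite big_ord1 scale1r.
by apply: (@hull_comb 'I_1 (fun=> i) (fun=> 1)); rewrite ?big_ord1.
Qed.

Lemma ev_upart (f x : 'rV[R]_3) :
  ev f (upart x) = f 0 0 * x 0 0 + f 0 1 * x 0 1 + f 0 2.
Proof. by rewrite /ev mxE sum3 !mxE /= mulr1. Qed.

Lemma comb_coord (w : 'I_N -> R) (k : 'I_3) :
  (\sum_i w i *: row i z) 0 k = \sum_i w i * z i k.
Proof. by rewrite summxE; apply: eq_bigr => i _; rewrite !mxE. Qed.

Lemma ev_comb (f : 'rV[R]_3) (w : 'I_N -> R) : \sum_i w i = 1 ->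
  ev f (upart (\sum_i w i *: row i z)) = \sum_i w i * fv z f i.
Proof.
move=> w1; rewrite ev_upart !comb_coord -[X in _ + X]mulr1 -w1 !mulr_sumr.
by rewrite -!big_split /=; apply: eq_bigr => i _; rewrite /fv; ring.
Qed.

(** Negated for the bottom, so that bottom faces become faces of an upper envelope. *)
Definition vertex_height (b : bool) (i : 'I_N) : R := if b then z i 2 else - z i 2.

Definition upward (b : bool) (f : 'rV[R]_3) : 'rV[R]_3 := if b then f else - f.

Lemma is_faceP (b : bool) (f : 'rV[R]_3) :
  is_face z b f <-> top_face z (vertex_height b) (upward b f).
Proof.
have contactE i : (i \in contact z f) =
    (fv z (upward b f) i == vertex_height b i).
  rewrite inE height_vertex ev_vertex eq_sym /upward /vertex_height.
  by case: b => //; rewrite fvN eqr_opp.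
split=> -[h1 [i [j [k]]]].
  rewrite !contactE => -[/eqP hi /eqP hj /eqP hk hb]; split; last first.
    by exists i, j, k; rewrite -det_uvec3.
  move=> l; have := h1 _ (hull_vertex l); rewrite height_vertex ev_vertex.
  by rewrite /upward /vertex_height; case: (b) => //; rewrite fvN lerN2.
move=> [hb hi hj hk]; split; last first.
  by exists i, j, k; rewrite !contactE hi hj hk !eqxx det_uvec3.
move=> _ [w [w0 w1 ->]]; rewrite ev_comb // /height comb_coord.
have h2 i' := h1 i'; move: h2; rewrite /upward /vertex_height; case: (b) => h2.
  by apply: ler_sum => l _; rewrite ler_wpM2l.
by apply: ler_sum => l _; rewrite ler_wpM2l // -lerN2 -fvN.
Qed.

Lemma contactP (b : bool) (f : 'rV[R]_3) (i : 'I_N) :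
  (i \in contact z f) = (fv z (upward b f) i == vertex_height b i).
Proof.
rewrite inE height_vertex ev_vertex eq_sym /upward /vertex_height.
by case: b => //; rewrite fvN eqr_opp.
Qed.

End Hull.

Section MarkedPolyhedra.
Variables (R : realType) (N : nat).
Hypothesis N4 : (3 < N)%N.
Let N3 : (2 < N)%N := ltnW N4.
Variable z : 'M[R]_(N, 3).

(** The hull of coplanar vertices lies in a plane transverse to the fibers, so moving an interior
    point vertically would leave it. *)
Lemma marked_poly_config : marked_poly R N z ->
  is_config z /\ ~ coplanar z (vertex_height z true).
Proof.
move=> [[_ hE hb _] [x hx] [_ hpos]]; split.
  split=> [i|i j k ij jk]; last by rewrite -det_uvec3 hpos.
  by apply/bd_vertex/hb; rewrite hE; exists i.
move=> [f hf]; have flat y : hull z y -> height y = ev f (upart y).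
  move=> [w [w0 w1 ->]]; rewrite ev_comb // /height comb_coord.
  by apply: eq_bigr => i _; rewrite -hf.
pose e : 'rV[R]_3 := \row_(k < 3) (if k == 2 then 1 else 0).
have cvg_e : (x + t *: e) @[t --> (0 : R)] --> x.
  rewrite -[X in _ --> X]addr0 -[X in _ + X](scale0r e).
  by apply: cvgD; [exact: cvg_cst|apply: cvgZr_tmp; exact: cvg_id].
have [d /= d0 hd] : nbhs (0 : R) [set t | hull z (x + t *: e)] by apply: cvg_e.
have hx0 := flat _ (interior_subset hx).
have : hull z (x + (d / 2) *: e).
  apply: hd; rewrite /= sub0r normrN gtr0_norm; lra.
move=> /flat; rewrite /height ev_upart in hx0 *; rewrite ev_upart !mxE /=.
rewrite /height in hx0; rewrite hx0; lra.
Qed.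

Section FromConfig.
Hypothesis cz : is_config z.
Hypothesis nc : ~ coplanar z (vertex_height z true).

Lemma ch_ge0 (i j : 'I_N) : 0 <= ch z i j.
Proof. by rewrite chE // divr_ge0 // addr_ge0 ?sqr_ge0. Qed.

(** The tangent line of the circle at [u_i] meets the hull of the projected vertices only at [u_i]:
    the numbers [ch z i k] are nonnegative and vanish only for [k = i]. *)
Lemma hull_polar (i : 'I_N) (w : 'I_N -> R) : (forall k, 0 <= w k) ->
  \sum_k w k = 1 -> \sum_k w k * ch z i k = 0 ->
  \sum_k w k *: row k z = row i z.
Proof.
move=> w0 w1 wc; have wk k : k != i -> w k = 0.
  rewrite eq_sym => ik.
  have pos j : true -> 0 <= w j * ch z i j by move=> _; rewrite mulr_ge0 ?ch_ge0.
  have /eqP := psumr_eq0P pos wc (i := k) isT.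
  by rewrite mulf_eq0 (gt_eqF (ch_gt0 cz N3 ik)) orbF => /eqP.
rewrite (bigD1 i) //= big1 ?addr0; last by move=> k ki; rewrite wk ?scale0r.
suff -> : w i = 1 by rewrite scale1r.
by rewrite -w1 (bigD1 i) //= big1 ?addr0 // => k ki; rewrite wk.
Qed.

(** The tangent functional [g] at [u_i] is nonnegative on the hull and 0 at the vertex, hence 0 at
    [y] and at [y'], and [hull_polar] identifies both with the vertex. *)
Lemma vertex_extreme (i : 'I_N) : extreme_points (hull z) (row i z).
Proof.
split; first exact: hull_vertex.
pose g : 'rV[R]_3 := \row_(k < 3) (if k == 2 then 1 else - z i k).
have gE k : fv z g k = ch z i k by rewrite /fv !mxE /ch /=; ring.
have ge0 w : (forall k, 0 <= w k) -> 0 <= \sum_k w k * fv z g k.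
  by move=> w0; apply: sumr_ge0 => k _; rewrite gE mulr_ge0 ?ch_ge0.
move=> y y' t [w [w0 w1 yE]] [w' [w'0 w'1 yE']] /andP[t0 t1] e.
have : ev g (upart (row i z)) = t * ev g (upart y) + (1 - t) * ev g (upart y').
  by rewrite e !ev_upart !mxE; ring.
rewrite ev_vertex gE ch_ii // yE yE' !ev_comb // => e0.
have := ge0 _ w0; have := ge0 _ w'0 => a0 b0.
have za : \sum_k w k * fv z g k = 0 by nra.
have zb : \sum_k w' k * fv z g k = 0 by nra.
have eq0 (v : 'I_N -> R) : \sum_k v k * fv z g k = 0 -> \sum_k v k * ch z i k = 0.
  by under eq_bigr do rewrite gE.
by rewrite !(@hull_polar i) //; apply: eq0.
Qed.

Lemma row_inj_config : injective (fun i => row i z).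
Proof.
move=> i j e; apply/eqP/negPn/negP => ij.
have /matrixP e' := e; have e0 := e' 0 0; have e1 := e' 0 1; rewrite !mxE in e0 e1.
have := ch_gt0 cz N3 ij; rewrite chE // e0 e1 !subrr expr0n /= addr0 mul0r ltxx //.
Qed.

(** A combination whose weight at [i] is strictly between 0 and 1 is a proper combination of the
    vertex [i] and of the rescaled rest, so extremality forces it to be that vertex. *)
Lemma extreme_vertex : extreme_points (hull z) = range (fun i => row i z).
Proof.
apply/seteqP; split=> [x [[w [w0 w1 xE]] hx]|x [i _ <-]]; last exact: vertex_extreme.
have [i wi] : exists i, w i != 0.
  apply/existsP; rewrite -negb_forall; apply/negP => /forallP h.
  have : \sum_i w i = 0 by apply: big1 => i _; apply/eqP/negPn; rewrite h.
  by rewrite w1; apply/eqP; rewrite oner_eq0.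
exists i => //.
have wS : w i + \sum_(k | k != i) w k = 1 by rewrite -w1 [RHS](bigD1 i).
have xS : x = w i *: row i z + \sum_(k | k != i) w k *: row k z by rewrite xE (bigD1 i).
have rest0 : 0 <= \sum_(k | k != i) w k by apply: sumr_ge0.
have wi0 : 0 < w i by rewrite lt_def wi w0.
have [wi1|wi1] := eqVneq (w i) 1.
  rewrite xS wi1 scale1r big1 ?addr0 // => k ki.
  suff -> : w k = 0 by rewrite scale0r.
  have e0 : \sum_(k | k != i) w k = 0 by lra.
  exact: (psumr_eq0P (fun k _ => w0 k) e0).
have wi1' : w i < 1 by rewrite lt_neqAle wi1 /=; lra.
pose v k := if k == i then 0 else w k / (1 - w i).
have hy' : hull z (\sum_k v k *: row k z).
  exists v; split=> // [k|].
    by rewrite /v; case: eqP => // _; rewrite divr_ge0 // subr_ge0 ltW.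
  rewrite (bigD1 i) //= /v eqxx add0r.
  under eq_bigr => k ki do rewrite (negbTE ki).
  by rewrite -mulr_suml (_ : \sum_(k | k != i) w k = 1 - w i) ?mulfV //; lra.
have e : x = w i *: row i z + (1 - w i) *: \sum_k v k *: row k z.
  rewrite xS; congr (_ + _); rewrite scaler_sumr [RHS](bigD1 i) //=.
  rewrite {1}/v eqxx scale0r scaler0 add0r; apply: eq_bigr => k ki.
  by rewrite /v (negbTE ki) scalerA mulrCA mulfV ?mulr1 //; lra.
have := hx _ _ (w i) (hull_vertex z i) hy' (introT andP (conj wi0 wi1')) e.
by move=> rE; rewrite e -rE -scalerDl addrC subrK scale1r.
Qed.

Lemma hull_disk (w : 'I_N -> R) : \sum_i w i = 1 ->
  lform (upart (\sum_i w i *: row i z)) (upart (\sum_i w i *: row i z)) =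
  - \sum_i \sum_j w i * w j * ch z i j.
Proof.
move=> w1; rewrite /lform !mxE /= !comb_coord mulr1 -[X in _ - X]mulr1.
rewrite -[X in _ - X * _]w1 -[X in _ - _ * X]w1 !big_distrlr /=.
rewrite -!sumrN -!big_split /=; apply: eq_bigr => i _.
rewrite -!sumrN -!big_split /=; apply: eq_bigr => j _.
by rewrite /ch; ring.
Qed.

(** By [hull_disk] the form is minus a sum of nonnegative terms. If it vanishes, the terms of an
    index [i] of nonzero weight show by [hull_polar] that the point is the vertex [i]. *)
Lemma convex_ideal_config : convex_ideal z.
Proof.
split; first exact: row_inj_config.
- exact: extreme_vertex.
- by rewrite extreme_vertex => _ [i _ <-]; apply/bd_vertex; exact: cz.1.
move=> x [[w [w0 w1 xE]] nx]; rewrite /HP3 /= xE hull_disk // oppr_lt0.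
have t0 i j : 0 <= w i * w j * ch z i j.
  by rewrite !mulr_ge0 ?ch_ge0.
have s0 i : 0 <= \sum_j w i * w j * ch z i j by apply: sumr_ge0.
rewrite lt_def sumr_ge0 // andbT; apply/negP => /eqP e0; apply: nx.
rewrite extreme_vertex xE.
have [i wi] : exists i, w i != 0.
  apply/existsP; rewrite -negb_forall; apply/negP => /forallP h.
  have : \sum_i w i = 0 by apply: big1 => i _; apply/eqP/negPn; rewrite h.
  by rewrite w1; apply/eqP; rewrite oner_eq0.
exists i => //; rewrite (@hull_polar i) //.
have e1 := psumr_eq0P (fun i _ => s0 i) e0 (i := i) isT.
apply/eqP; move/eqP: e1; under eq_bigr do rewrite -mulrA.
by rewrite -mulr_sumr mulf_eq0 (negbTE wi).
Qed.

(** Some vertex lies off the plane through the first three. With respect to these four affinely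
    independent vertices the barycentric coordinates are continuous, hence positive near the
    barycentre, and a neighbourhood of it lies in the hull. *)
Lemma nondegenerate_config : nondegenerate z.
Proof.
have N0 : (0 < N)%N := ltnW (ltnW N3).
have N1 : (1 < N)%N := ltnW N3.
pose i0 := Ordinal N0; pose i1 := Ordinal N1; pose i2 := Ordinal N3.
have b0 : br z i0 i1 i2 != 0 by rewrite gt_eqF // cz.2.
pose s0 := plane_slope z (vertex_height z true) i0 i1 i2.
pose f0 := plane z (vertex_height z true) i0 i1 s0.
have ne01 : i0 != i1 by []; have ne12 : i1 != i2 by []; have ne02 : i0 != i2 by [].
have f0E : [/\ fv z f0 i0 = z i0 2, fv z f0 i1 = z i1 2 & fv z f0 i2 = z i2 2].
  by split; [exact: fv_plane_l|exact: fv_plane_r|apply/plane_contact].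
have [l hl] : exists l, z l 2 != fv z f0 l.
  apply/existsP; rewrite -negb_forall; apply/negP => /forallP h.
  by apply: nc; exists f0 => k; exact/eqP/h.
pose p (s : 'I_4) := nth l [:: i0; i1; i2; l] s.
pose A : 'M[R]_4 := \matrix_(k, s) (if unlift ord_max k is Some k' then z (p s) k' else 1).
have sum4 (V : zmodType) (F : 'I_4 -> V) : \sum_(s < 4) F s = F 0 + F 1 + F 2 + F 3.
  rewrite !big_ord_recl big_ord0 addr0 !addrA.
  by congr (F _ + F _ + F _ + F _); apply: val_inj.
have AE (s : 'I_4) : [/\ A 0 s = z (p s) 0, A 1 s = z (p s) 1, A 2 s = z (p s) 2 & A 3 s = 1].
  have u k k' : k = lift ord_max k' -> A k s = z (p s) k'.
    by move=> ->; rewrite mxE liftK.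
  split; [apply: u|apply: u|apply: u|]; try exact: val_inj.
  by rewrite (_ : 3 = ord_max) ?mxE ?unlift_none //; exact: val_inj.
have uA : A \in unitmx.
  rewrite unitmxE unitfE; apply/negP => /det0P[v v0 vA].
  have rel s : v 0 0 * z (p s) 0 + v 0 1 * z (p s) 1 + v 0 2 * z (p s) 2 + v 0 3 = 0.
    have /matrixP/(_ 0 s) := vA; rewrite !mxE sum4.
    by have [-> -> -> ->] := AE s; rewrite mulr1.
  have r0 := rel 0; have r1 := rel 1; have r2 := rel 2; have r3 := rel 3.
  rewrite /p /= in r0 r1 r2 r3; have [e0 e1 e2] := f0E.
  pose g : 'rV[R]_3 := (\row_(k < 3) (if k == 0 then v 0 0 else if k == 1 then v 0 1 else v 0 3))
     + v 0 2 *: f0.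
  have gE k : fv z g k = v 0 0 * z k 0 + v 0 1 * z k 1 + v 0 3 + v 0 2 * fv z f0 k.
    by rewrite /g fvD fvZ /fv !mxE /=.
  have g0 : g = 0 by apply: (fv_inj0 b0); rewrite gE ?e0 ?e1 ?e2; lra.
  have := gE l; rewrite g0 {1}/fv !mxE !mul0r !addr0 => gl.
  have /eqP : v 0 2 * (z l 2 - fv z f0 l) = 0 by lra.
  rewrite mulf_eq0 subr_eq0 (negbTE hl) orbF => /eqP v2.
  move: g0 => /matrixP g0; have := g0 0 0; have := g0 0 1; have := g0 0 2.
  rewrite !mxE /= v2 !mul0r !addr0 => w3 w1 w0.
  move/eqP: v0; apply; apply/matrixP => a b; rewrite ord1 mxE.
  have [->|[->|[->|->]]] // : b = 0 \/ b = 1 \/ b = 2 \/ b = 3.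
  case: b => [[|[|[|[|]]]]] // q; [left|right; left|right; right; left|
    right; right; right]; exact: val_inj.
pose lam (x : 'rV[R]_3) (s : 'I_4) : R :=
  invmx A s 0 * x 0 0 + invmx A s 1 * x 0 1 + invmx A s 2 * x 0 2 + invmx A s 3.
have lamE x k : \sum_s A k s * lam x s = if unlift ord_max k is Some k' then x 0 k' else 1.
  pose y : 'cV[R]_4 := \col_k (if unlift ord_max k is Some k' then x 0 k' else 1).
  have := mulKVmx uA y => /matrixP/(_ k 0); rewrite !mxE => <-.
  apply: eq_bigr => s _; congr (_ * _); rewrite mxE sum4 !mxE /lam.
  have u (j : 'I_4) (j' : 'I_3) : val j = val j' -> unlift ord_max j = Some j'.
    move=> e; rewrite (_ : j = lift ord_max j') ?liftK //; apply: val_inj.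
    by rewrite /= /bump leqNgt ltn_ord.
  rewrite (u 0 0) ?(u 1 1) ?(u 2 2) //.
  by rewrite (_ : 3 = ord_max) ?unlift_none ?mulr1 //; exact: val_inj.
have lam1 x : \sum_s lam x s = 1.
  have := lamE x ord_max; rewrite unlift_none => <-; apply: eq_bigr => s _.
  by rewrite mxE unlift_none mul1r.
have lamx x : x = \sum_s lam x s *: row (p s) z.
  apply/matrixP => a k; rewrite ord1 summxE.
  have := lamE x (lift ord_max k); rewrite liftK => <-; apply: eq_bigr => s _.
  by rewrite !mxE liftK mulrC.
pose x0 : 'rV[R]_3 := \sum_s (4^-1 : R) *: row (p s) z.
have lam_x0 s : lam x0 s = 4^-1.
  pose d : 'cV[R]_4 := \col_s (lam x0 s - 4^-1).
  suff : d = 0 by move/matrixP/(_ s 0); rewrite !mxE => /eqP; rewrite subr_eq0 => /eqP.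
  rewrite -(mulKmx uA d) (_ : A *m d = 0) ?mulmx0 //; apply/matrixP => k j.
  rewrite ord1 [RHS]mxE.
  transitivity (\sum_s A k s * lam x0 s - \sum_s A k s * 4^-1).
    by rewrite mxE -sumrB; apply: eq_bigr => s' _; rewrite [d s' 0]mxE mulrBr.
  rewrite lamE; case: unliftP => [k' ->|->].
    rewrite /x0 summxE; apply/eqP; rewrite subr_eq0; apply/eqP.
    by apply: eq_bigr => s' _; rewrite !mxE liftK mulrC.
  under eq_bigr do rewrite mxE unlift_none mul1r.
  by rewrite sumr_const card_ord -mulr_natr; lra.
have lam_cvg s : (fun x : 'rV[R]_3 => lam x s) @ x0 --> lam x0 s.
  have c k : (fun x : 'rV[R]_3 => x 0 k) @ x0 --> x0 0 k by exact: coord_continuous.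
  exact: (cvgD (cvgD (cvgD (cvgM (cvg_cst _) (c 0)) (cvgM (cvg_cst _) (c 1)))
    (cvgM (cvg_cst _) (c 2))) (cvg_cst _)).
exists x0; rewrite /interior /=.
have : \forall x \near x0, forall s, 0 < lam x s.
  apply: (@filter_forall _ _ _ _ (nbhs_filter x0)) => s.
  apply: (cvgr_gt (lam x0 s) (lam_cvg s)).
  by rewrite lam_x0 invr_gt0.
apply: filterS => x hx; rewrite [x]lamx; apply: hull_comb => // s.
exact: ltW.
Qed.

(** The difference of a top and a bottom plane through [i] and [j] is a multiple of [br z i j] and
    nonnegative at all vertices, so one of the two arcs between [i] and [j] contains no vertex.
    Conversely, a third vertex on both side planes of a side would make its angle nonnegative. *)
Lemma marking_config : marking z.
Proof.
split; last by move=> i j k ij jk; rewrite det_uvec3 cz.2.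
have up b f : is_face z b f -> top_face z (vertex_height z b) (upward b f).
  by move/is_faceP.
move=> S; split.
  move=> [f [f' [/is_faceP hf /is_faceP hf' ff' hS cS]]].
  have /cards2P[i [j [ij SE]]] : #|S| == 2%N by rewrite cS.
  have con k : (k \in S) = (fv z f k == z k 2) && (fv z f' k == z k 2).
    by rewrite -hS finset.in_setI !(contactP _ true).
  have : i \in S by rewrite SE !inE eqxx.
  have : j \in S by rewrite SE !inE eqxx orbT.
  rewrite !con => /andP[/eqP fj /eqP f'j] /andP[/eqP fi /eqP f'i].
  have [s fE] := plane_through cz N3 (h := vertex_height z true) ij fi fj.
  have [s' fE'] := plane_through cz N3 (h := vertex_height z true) ij f'i f'j.
  have ss' : s - s' != 0.
    by rewrite subr_eq0; apply/eqP => e; apply: ff'; rewrite fE fE' e.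
  have dE k : fv z f k - fv z f' k = (s - s') / ch z i j * br z i j k.
    by rewrite -fvB fE fE' planeB // fvZ fv_cross.
  have d0 k : 0 <= fv z f k - fv z f' k.
    have h1 := hf.1 k; have h2 := hf'.1 k; rewrite /upward /vertex_height fvN lerN2 in h1 h2.
    by rewrite subr_ge0 (le_trans h2 h1).
  have c0 := ch_gt0 cz N3 ij.
  have [sp|sn] := ltP 0 (s - s').
    have adj (k : 'I_N) : cyc i k j -> False.
      move=> hk; have := d0 k; rewrite dE leNgt => /negP; apply.
      by rewrite pmulr_rlt0 ?divr_gt0 // br_lt0.
    exists i; rewrite SE; congr [set _; _]%SET; apply: ord_inj; rewrite ordSE.
    apply/eqP/negPn/negP => ji; apply: (adj (ordS i)); move: ij ji.
    rewrite -!(inj_eq (@ord_inj _)) /cyc ordSE; have := ltn_ord i; have := ltn_ord j; iflia.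
  have {}sn : s - s' < 0 by rewrite lt_neqAle ss'.
  have adj (k : 'I_N) : cyc i j k -> False.
    move=> hk; have := d0 k; rewrite dE leNgt => /negP; apply.
    by rewrite pmulr_llt0 ?br_gt0 // pmulr_llt0 ?invr_gt0.
  exists j; rewrite SE finset.setUC; congr [set _; _]%SET; apply: ord_inj; rewrite ordSE.
  apply/eqP/negPn/negP => ji; apply: (adj (ordS j)); move: ij ji.
  rewrite -!(inj_eq (@ord_inj _)) /cyc ordSE; have := ltn_ord i; have := ltn_ord j; iflia.
move=> [i ->]; have iS := ordS_neq N4 i.
pose f := side_plane z (vertex_height z true) i.
pose f' := side_plane z (vertex_height z false) i.
have ht := side_face N4 cz (vertex_height z true) i.
have hb := side_face N4 cz (vertex_height z false) i.
have neg := side_angle_lt0 N4 cz i nc.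
have con : (contact z f :&: contact z (- f') = [set i; ordS i])%SET.
  apply/setP => k; rewrite !inE -[_ == ev f _]/(_ == ev f _).
  have := contactP z true f k; rewrite inE => ->.
  have := contactP z false (- f') k; rewrite inE => ->; rewrite /upward opprK.
  have [->|ki] := eqVneq k i; first by rewrite /= !fv_side_l // !eqxx.
  have [->|kS] := eqVneq k (ordS i); first by rewrite /= !fv_side_r // !eqxx.
  apply/negP => /andP[/eqP e1 /eqP e2].
  by have := side_planes_coplanar N4 cz ki kS e1 e2; rewrite leNgt neg.
exists f, (- f'); split=> //; last by rewrite cards2 iS.
- exact/is_faceP.
- by apply/is_faceP; rewrite /upward opprK.
- move=> ff'; have [k [ki kS hk]] := side_contact cz N4 (vertex_height z true) i.
  have : k \in (contact z f :&: contact z (- f'))%SET.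
    by rewrite -ff' finset.setIid (contactP _ true) hk.
  by rewrite con !inE (negbTE ki) (negbTE kS).
Qed.

Lemma config_marked_poly : marked_poly R N z.
Proof.
by split; [exact: convex_ideal_config|exact: nondegenerate_config|exact: marking_config].
Qed.

End FromConfig.
End MarkedPolyhedra.

(** * Dihedral angles and the skeleton *)

Section DihedralAngles.
Variables (R : realType) (N : nat).
Implicit Type z : 'M[R]_(N, 3).

(** A diagonal is given as the set of its ends, so its angle is written as a sum over ordered pairs
    with these ends. The sum has at most one term, and is 0 for a set that is not a pair. *)
Definition dihedral z : weights R N := fun e : arc N =>
  match e with
  | inl i => side_angle z (vertex_height z true) i
  | inr (b, D) => \sum_(p : 'I_N * 'I_N | (p.1 < p.2)%N && (D == [set p.1; p.2]%SET))
      top_angle z (vertex_height z b) p.1 p.2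
  end.

Lemma set2_inj (i j k l : 'I_N) : [set i; j]%SET = [set k; l]%SET ->
  (i == k) && (j == l) || (i == l) && (j == k).
Proof.
move=> e; have ei : i \in [set k; l]%SET by rewrite -e !inE eqxx.
have ej : j \in [set k; l]%SET by rewrite -e !inE eqxx orbT.
have ek : k \in [set i; j]%SET by rewrite e !inE eqxx.
have el : l \in [set i; j]%SET by rewrite e !inE eqxx orbT.
by move: ei ej ek el; rewrite !inE -!(inj_eq (@ord_inj _)); lia.
Qed.

Lemma sum_pairs_set2 (V : zmodType) (F : 'I_N -> 'I_N -> V) (i j : 'I_N) :
  i != j -> F i j = F j i ->
  \sum_(p : 'I_N * 'I_N | (p.1 < p.2)%N && ([set i; j]%SET == [set p.1; p.2]%SET))
    F p.1 p.2 = F i j.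
Proof.
rewrite -(inj_eq (@ord_inj _)) => ij sF.
pose q := if (i < j)%N then (i, j) else (j, i).
have qE (p : 'I_N * 'I_N) : (p.1 < p.2)%N && ([set i; j]%SET == [set p.1; p.2]%SET) = (p == q).
  rewrite /q; case: p => k l /=; apply/idP/idP.
    move=> /andP[kl /eqP/set2_inj]; case: ifP => ltij; rewrite xpair_eqE -!(inj_eq (@ord_inj _)); lia.
  case: ifP => ltij; rewrite xpair_eqE => /andP[/eqP-> /eqP->]; first by rewrite ltij eqxx.
  by rewrite finset.setUC eqxx andbT; lia.
rewrite (eq_bigl _ _ qE) big_pred1_eq /q; case: ifP => // _; exact: esym.
Qed.

Hypothesis N4 : (3 < N)%N.
Let N3 : (2 < N)%N := ltnW N4.

Section Config.
Variable z : 'M[R]_(N, 3).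
Hypothesis cz : is_config z.

Lemma dihedral_pair (b : bool) (i j : 'I_N) : i != j ->
  dihedral z (inr (b, [set i; j]%SET)) = top_angle z (vertex_height z b) i j.
Proof. by move=> ij; rewrite /dihedral sum_pairs_set2 // top_angle_sym. Qed.

Lemma dihedral_diagonal_ge0 (b : bool) (S : {set 'I_N}) :
  0 <= dihedral z (inr (b, S)).
Proof. by apply: sumr_ge0 => p _; exact: top_angle_ge0. Qed.

Lemma dihedral_diagonalP (b : bool) (S : {set 'I_N}) :
  dihedral z (inr (b, S)) != 0 -> exists i j : 'I_N,
  [/\ S = [set i; j]%SET, i != j & 0 < top_angle z (vertex_height z b) i j].
Proof.
move=> h; have [[i j] /= /andP[ij /eqP SE] p] : exists2 p : 'I_N * 'I_N,
    (p.1 < p.2)%N && (S == [set p.1; p.2]%SET) & 0 < top_angle z (vertex_height z b) p.1 p.2.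
  apply/exists_inP; apply: contraNT h; rewrite negb_exists_in => /forall_inP h.
  apply/eqP; rewrite /dihedral big1 // => p hp; apply/eqP.
  by rewrite eq_le top_angle_ge0 leNgt h.
by exists i, j; split=> //; rewrite -(inj_eq (@ord_inj _)); lia.
Qed.

Lemma top_angle_gt0P h (i j : 'I_N) : 0 < top_angle z h i j ->
  i != j /\ ~~ adjacent_ord i j.
Proof.
rewrite /top_angle; case: eqP => [_|ij]; first by rewrite ltxx.
by rewrite orFb; case: (adjacent_ord i j) => //; rewrite ltxx.
Qed.

Lemma crossingP (i j k l : 'I_N) : i != j -> k != l ->
  crossing [set i; j]%SET [set k; l]%SET =
  (cyc i k j && cyc i j l) || (cyc i l j && cyc i j k).
Proof.
move=> ij kl; apply/idP/idP.
  move=> /existsP[a /existsP[b /existsP[c /existsP[d /and4P[ab bc cd]]]]].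
  move=> /orP[]/andP[/eqP/set2_inj e1 /eqP/set2_inj e2]; move: e1 e2;
  rewrite -!(inj_eq (@ord_inj _)) /cyc; lia.
move=> h; have p (a b c d : 'I_N) : (a < b)%N -> (b < c)%N -> (c < d)%N ->
    crossing [set a; c]%SET [set b; d]%SET /\ crossing [set b; d]%SET [set a; c]%SET.
  move=> ab bc cd; split; apply/existsP; exists a; apply/existsP; exists b;
  by apply/existsP; exists c; apply/existsP; exists d; rewrite ab bc cd !eqxx ?orbT.
rewrite /cyc in h; rewrite -(inj_eq (@ord_inj _)) in ij; rewrite -(inj_eq (@ord_inj _)) in kl.
have [ltij|ltji] := ltnP i j; have [ltkl|ltlk] := ltnP k l.
- have [h1|h1] : ((i < k) && (k < j) && (j < l) \/ (k < i) && (i < l) && (l < j))%N by lia.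
    by case/andP: h1 => /andP[h1 h2] h3; exact: (p _ _ _ _ h1 h2 h3).1.
  by case/andP: h1 => /andP[h1 h2] h3; exact: (p _ _ _ _ h1 h2 h3).2.
- rewrite [[set k; l]%SET]finset.setUC.
  have [h1|h1] : ((i < l) && (l < j) && (j < k) \/ (l < i) && (i < k) && (k < j))%N by lia.
    by case/andP: h1 => /andP[h1 h2] h3; exact: (p _ _ _ _ h1 h2 h3).1.
  by case/andP: h1 => /andP[h1 h2] h3; exact: (p _ _ _ _ h1 h2 h3).2.
- rewrite [[set i; j]%SET]finset.setUC.
  have [h1|h1] : ((j < k) && (k < i) && (i < l) \/ (k < j) && (j < l) && (l < i))%N by lia.
    by case/andP: h1 => /andP[h1 h2] h3; exact: (p _ _ _ _ h1 h2 h3).1.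
  by case/andP: h1 => /andP[h1 h2] h3; exact: (p _ _ _ _ h1 h2 h3).2.
- rewrite [[set k; l]%SET]finset.setUC [[set i; j]%SET]finset.setUC.
  have [h1|h1] : ((j < l) && (l < i) && (i < k) \/ (l < j) && (j < k) && (k < i))%N by lia.
    by case/andP: h1 => /andP[h1 h2] h3; exact: (p _ _ _ _ h1 h2 h3).1.
  by case/andP: h1 => /andP[h1 h2] h3; exact: (p _ _ _ _ h1 h2 h3).2.
Qed.

Lemma dihedral_noncrossing (b : bool) (S T : {set 'I_N}) :
  dihedral z (inr (b, S)) != 0 -> dihedral z (inr (b, T)) != 0 -> ~~ crossing S T.
Proof.
move=> /dihedral_diagonalP[i [j [-> ij p]]] /dihedral_diagonalP[k [l [-> kl q]]].
rewrite crossingP //; apply/negP => /orP[]/andP[h1 h2].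
  exact: (top_angle_cross N4 cz h1 h2 p q).
by apply: (top_angle_cross N4 cz h1 h2 p); rewrite top_angle_sym.
Qed.

Lemma diagonalP (i j : 'I_N) : i != j -> ~~ adjacent_ord i j ->
  is_diagonal [set i; j]%SET.
Proof.
move=> ij; rewrite /adjacent_ord negb_or => /andP[h1 h2].
by apply/existsP; exists i; apply/existsP; exists j; rewrite ij h1 h2 eqxx.
Qed.

Hypothesis nc : ~ coplanar z (vertex_height z true).

Definition normal (i j : 'I_N) (t : R) : 'cV[R]_3 :=
  \col_k (t / ch z i j * (if k == 2 then - cross z i j 0 k else cross z i j 0 k)).

Lemma normalE (i j : 'I_N) (t : R) u :
  lform (normal i j t) u = ev ((t / ch z i j) *: cross z i j) u.
Proof. by rewrite /lform /ev [RHS]mxE sum3 !mxE /=; ring. Qed.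

(** For null vectors the Lorentzian square of the cross product is the square of their product, here
    of [ch], so [cross] divided by [ch] is a unit vector. *)
Lemma normal_norm (i j : 'I_N) (t : R) : i != j -> lform (normal i j t) (normal i j t) = t ^+ 2.
Proof.
move=> ij; have c0 := ch_gt0 cz N3 ij.
have -> : lform (normal i j t) (normal i j t) = t ^+ 2 / ch z i j ^+ 2 *
   (cross z i j 0 0 ^+ 2 + cross z i j 0 1 ^+ 2 - cross z i j 0 2 ^+ 2).
  by rewrite /lform !mxE /=; field; rewrite lt0r_neq0.
have -> : cross z i j 0 0 ^+ 2 + cross z i j 0 1 ^+ 2 - cross z i j 0 2 ^+ 2 =
    ch z i j ^+ 2 + (z i 0 ^+ 2 + z i 1 ^+ 2 - 1) * (1 - (z j 0 ^+ 2 + z j 1 ^+ 2)) .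
  by rewrite !mxE /= /ch; have := cz.1 i; have := cz.1 j; nra.
by rewrite cz.1 subrr mul0r addr0 divfK // expf_neq0 // lt0r_neq0.
Qed.

Lemma ev_lin (f g : 'rV[R]_3) u : ev f u - ev g u = ev (f - g) u.
Proof. by rewrite /ev mulmxBl !mxE. Qed.

Lemma edge_diagonal (b : bool) (i j : 'I_N) :
  0 < top_angle z (vertex_height z b) i j -> exists f f' v,
  [/\ edge_planes z (inr (b, [set i; j]%SET)) f f',
      forall u, ev f' u - ev f u = lform v u &
      lform v v = top_angle z (vertex_height z b) i j ^+ 2].
Proof.
move=> p; have [ij _] := top_angle_gt0P p.
have [s [ft ft' con]] := top_edge_planes N4 cz p.
set t := top_angle _ _ i j in p ft' con *.
pose f := upward b (plane z (vertex_height z b) i j s).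
pose f' := upward b (plane z (vertex_height z b) i j (s + t)).
have upK g : upward b (upward b g) = g by rewrite /upward; case: (b); rewrite ?opprK.
exists f, f', (normal i j (if b then t else - t)); split; first last.
- by rewrite normal_norm //; case: (b); rewrite ?sqrrN.
- move=> u; rewrite ev_lin normalE; congr (ev _ u).
  rewrite /f /f' /upward; case: (b); last rewrite opprK addrC -opprB.
    by rewrite planeB addrAC subrr add0r.
  by rewrite planeB addrAC subrr add0r mulNr scaleNr.
have conE k : (k \in contact z f) && (k \in contact z f') = (k \in [set i; j]%SET).
  rewrite !(contactP _ b) /f /f' !upK !inE.
  have [->|ki] := eqVneq k i; first by rewrite !fv_plane_l // !eqxx.
  have [->|kj] := eqVneq k j; first by rewrite !fv_plane_r // !eqxx.
  by apply/negP => /andP[/eqP e1 /eqP e2]; exact: con ki kj e1 e2.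
split.
- by apply/is_faceP; rewrite upK.
- by apply/is_faceP; rewrite upK.
- move=> ff'; have /eqP := congr1 (upward b) ff'; rewrite !upK.
  rewrite -subr_eq0 -opprB planeB oppr_eq0 scaler_eq0 => /orP[].
    rewrite addrAC subrr add0r mulf_eq0 invr_eq0 !gt_eqF ?ch_gt0 //.
  move=> /eqP c0; have [k [ki kj]] := third_index N3 i j.
  have : br z i j k != 0 by rewrite br_neq0 // eq_sym.
  by rewrite -fv_cross c0 /fv !mxE !mul0r !addr0 eqxx.
- by apply/setP => k; rewrite finset.in_setI conE.
- by rewrite cards2 ij.
Qed.

Lemma edge_diagonal_conv (b : bool) (S : {set 'I_N}) f f' :
  edge_planes z (inr (b, S)) f f' ->
  exists i j, [/\ S = [set i; j]%SET, i != j, ~~ adjacent_ord i j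
    & 0 < top_angle z (vertex_height z b) i j].
Proof.
move=> [/is_faceP hf /is_faceP hf' ff' hS cS]; rewrite /ends in hS cS.
have /cards2P[i [j [ij SE]]] : #|S| == 2%N by rewrite cS.
have con k : k \in S -> (fv z (upward b f) k = vertex_height z b k) /\
    (fv z (upward b f') k = vertex_height z b k).
  by rewrite -hS finset.in_setI !(contactP _ b) => /andP[/eqP-> /eqP->].
have [fi f'i] := con i ltac:(by rewrite SE !inE eqxx).
have [fj f'j] := con j ltac:(by rewrite SE !inE eqxx orbT).
have ff1 : upward b f <> upward b f'.
  by rewrite /upward; case: (b) => // /oppr_inj.
have [ad p _] := top_edge_faces N4 cz ij hf hf' ff1 fi fj f'i f'j.
by exists i, j.
Qed.

Lemma edge_side (i : 'I_N) : exists f f' v,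
  [/\ edge_planes z (inl i) f f', forall u, ev f' u - ev f u = lform v u &
      lform v v = side_angle z (vertex_height z true) i ^+ 2].
Proof.
have iS := ordS_neq N4 i.
pose f := side_plane z (vertex_height z true) i.
pose f' := side_plane z (vertex_height z false) i.
have [_ _ [eq_edge _]] := config_marked_poly N4 cz nc.
have /eq_edge [g [g' gg']] : exists k, [set i; ordS i]%SET = [set k; ordS k]%SET by exists i.
have [hg hg' _ hS _] := gg'.
have [gi g'i] : i \in contact z g /\ i \in contact z g'.
  by apply/andP; rewrite -finset.in_setI hS !inE eqxx.
have [gS g'S] : ordS i \in contact z g /\ ordS i \in contact z g'.
  by apply/andP; rewrite -finset.in_setI hS !inE eqxx orbT.
rewrite (contactP _ true) in gi; rewrite (contactP _ true) in gS.
rewrite (contactP _ false) in g'i; rewrite (contactP _ false) in g'S.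
move/is_faceP: hg => hg; move/is_faceP: hg' => hg'.
have gE : g = f := side_face_unique N4 cz hg (eqP gi) (eqP gS).
have gE' : - g' = f' := side_face_unique N4 cz hg' (eqP g'i) (eqP g'S).
exists g, g', (normal i (ordS i) (side_angle z (vertex_height z true) i)).
split=> //; last by rewrite normal_norm.
move=> u; rewrite ev_lin normalE; congr (ev _ u).
have -> : g' = - f' by rewrite -gE' opprK.
rewrite gE -opprD addrC /f /f' /side_plane planeD_opp /side_angle.
by rewrite mulNr scaleNr.
Qed.

Lemma in_skeleton (e : arc N) : (e \in skeleton z) = (dihedral z e != 0).
Proof.
rewrite inE; apply/asboolP/idP => [[f [f']]|].
  case: e => [i _|[b S] /edge_diagonal_conv[i [j [-> ij _ p]]]].
    by rewrite lt_eqF // side_angle_lt0.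
  by rewrite dihedral_pair // gt_eqF.
case: e => [i _|[b S] /dihedral_diagonalP[i [j [-> ij p]]]].
  by have [f [f' [v [h _ _]]]] := edge_side i; exists f, f'.
by have [f [f' [v [h _ _]]]] := edge_diagonal p; exists f, f'.
Qed.

Lemma dihedral_sign (e : arc N) : e \in skeleton z ->
  if in_gamma e then dihedral z e < 0 else 0 < dihedral z e.
Proof.
rewrite in_skeleton; case: e => [i|[b S]] /= h; first exact: side_angle_lt0.
by rewrite lt_def h dihedral_diagonal_ge0.
Qed.

Lemma dihedral_anglesP : dihedral_angles z (dihedral z).
Proof.
split=> e; first by rewrite in_skeleton negbK => /eqP.
rewrite in_skeleton; case: e => [i _|[b S] /dihedral_diagonalP[i [j [-> ij p]]]].
  have [f [f' [v [h1 h2 h3]]]] := edge_side i; exists f, f', v.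
  have neg := side_angle_lt0 N4 cz i nc.
  split=> //; first by rewrite h3 exprn_even_gt0 //= lt_eqF.
  by rewrite h3 sqrtr_sqr ltr0_norm //= mulN1r opprK.
have [f [f' [v [h1 h2 h3]]]] := edge_diagonal p; exists f, f', v.
split=> //; first by rewrite h3 exprn_even_gt0 //= gt_eqF.
by rewrite dihedral_pair // h3 sqrtr_sqr gtr0_norm // mul1r.
Qed.

Lemma skeleton_diagonal (b : bool) (S : {set 'I_N}) :
  (inr (b, S) : arc N) \in skeleton z -> is_diagonal S.
Proof.
rewrite in_skeleton => /dihedral_diagonalP[i [j [-> ij /top_angle_gt0P[_ ad]]]].
exact: diagonalP.
Qed.

Lemma skeleton_side (i : 'I_N) : (inl i : arc N) \in skeleton z.
Proof. by rewrite in_skeleton lt_eqF // side_angle_lt0. Qed.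

End Config.
End DihedralAngles.

(** * Cuts *)

Lemma adjacent_ordE (N : nat) (i j : 'I_N) : adjacent_ord i j =
  [|| i.+1 == j, j.+1 == i, (j == 0 :> nat) && (i.+1 == N)
    | (i == 0 :> nat) && (j.+1 == N)].
Proof.
have := ltn_ord i; have := ltn_ord j.
rewrite /adjacent_ord -!(inj_eq (@ord_inj _)) !ordSE.
by case: (i.+1 =P N); case: (j.+1 =P N); lia.
Qed.

Section ArcIndices.
Variables (N p q c d i j : nat).
Hypotheses (pq : (p < q)%N) (pqN : (q - p < N - 2)%N) (qN : (q < N)%N).
Hypothesis cv : c.+1 = p \/ (p = 0%N /\ c.+1 = N).
Hypothesis dv : d = q.+1 \/ (d = 0%N /\ q.+1 = N).

(** Cyclically, [c] precedes the arc from [p] to [q] and [d] follows it. Stated over natural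
    numbers, all relative positions are left to linear arithmetic. *)
Lemma arc_ends : [/\ c != p, c != q, c != d, cyc c p q & cyc c q d].
Proof.
by rewrite /cyc; case: cv => [e|[e e']]; case: dv => [f|[f f']]; split; lia.
Qed.

Lemma arc_in : (p <= i <= q)%N ->
  [/\ c != i, p = i \/ cyc c p i & i = q \/ cyc c i q].
Proof.
rewrite /cyc => h; split.
- by case: cv => [e|[e1 e2]]; lia.
- have [->|ne] := eqVneq p i; [by left|right].
  by case: cv => [e|[e1 e2]]; lia.
- have [->|ne] := eqVneq i q; [by left|right].
  by case: cv => [e|[e1 e2]]; lia.
Qed.

Lemma arc_out : (j < N)%N -> ~~ (p <= j <= q)%N -> c != j -> d = j \/ cyc c d j.
Proof.
rewrite /cyc => jN h cj; have [->|ne] := eqVneq d j; [by left|right].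
by case: cv => [e|[e1 e2]]; case: dv => [e3|[e3 e4]]; lia.
Qed.

End ArcIndices.

Lemma sum_antisym (R : realType) (I : finType) (F : I -> I -> R) :
  (forall i j, F i j = - F j i) -> \sum_i \sum_j F i j = 0.
Proof.
move=> h; have e : \sum_i \sum_j F i j = - \sum_i \sum_j F i j.
  rewrite [LHS]exchange_big /= -sumrN; apply: eq_bigr => i _.
  by rewrite -sumrN; apply: eq_bigr => j _.
lra.
Qed.

(** * Stereographic coordinates from a vertex *)

Section Chart.
Variables (R : realType) (N : nat) (z : 'M[R]_(N, 3)).
Hypothesis N4 : (3 < N)%N.
Let N3 : (2 < N)%N := ltnW N4.
Hypothesis cz : is_config z.

(** [pencil_x z c] is the stereographic coordinate from [u_c], and this is the rational
    parametrization of the circle in the frame of [u_c]. *)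
Lemma chart_coord (c k : 'I_N) : c != k ->
  [/\ ch z c k = 2 / (1 + pencil_x z c k ^+ 2),
      z k 0 = z c 0 * (1 - ch z c k) + z c 1 * (ch z c k * pencil_x z c k)
    & z k 1 = z c 1 * (1 - ch z c k) - z c 0 * (ch z c k * pencil_x z c k)].
Proof.
move=> ck; have l0 := ch_gt0 cz N3 ck.
have e : ch z c k * pencil_x z c k = - (z c 0 * z k 1 - z c 1 * z k 0).
  by rewrite /pencil_x mulrC divfK // lt0r_neq0.
split.
- have e2 : ch z c k * (1 + pencil_x z c k ^+ 2) = 2.
    apply: (mulfI (lt0r_neq0 l0)).
    have -> : ch z c k * (ch z c k * (1 + pencil_x z c k ^+ 2)) =
      ch z c k ^+ 2 + (ch z c k * pencil_x z c k) ^+ 2 by ring.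
    rewrite e; have -> : ch z c k ^+ 2 + (- (z c 0 * z k 1 - z c 1 * z k 0)) ^+ 2 =
      ch z c k * 2 - 1 + (z c 0 ^+ 2 + z c 1 ^+ 2) * (z k 0 ^+ 2 + z k 1 ^+ 2).
      by rewrite /ch; ring.
    by rewrite !cz.1; ring.
  have x0 : 1 + pencil_x z c k ^+ 2 != 0 by rewrite gt_eqF // ltr_pwDl ?sqr_ge0.
  by rewrite -e2 mulfK.
- rewrite e /ch; have -> : z c 0 * (1 - (1 - z c 0 * z k 0 - z c 1 * z k 1)) +
    z c 1 * (- (z c 0 * z k 1 - z c 1 * z k 0)) = (z c 0 ^+ 2 + z c 1 ^+ 2) * z k 0 by ring.
  by rewrite cz.1 mul1r.
- rewrite e /ch; have -> : z c 1 * (1 - (1 - z c 0 * z k 0 - z c 1 * z k 1)) -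
    z c 0 * (- (z c 0 * z k 1 - z c 1 * z k 0)) = (z c 0 ^+ 2 + z c 1 ^+ 2) * z k 1 by ring.
  by rewrite cz.1 mul1r.
Qed.

(** A Vandermonde product: in a frame at [c] the lift of a point with coordinate [x] is a multiple
    of [(1, x, x^2)]. *)
Lemma br_chart (c i j k : 'I_N) : c != i -> c != j -> c != k ->
  br z i j k = ch z c i * ch z c j * ch z c k / 2 *
  ((pencil_x z c j - pencil_x z c i) * (pencil_x z c k - pencil_x z c j) *
   (pencil_x z c k - pencil_x z c i)).
Proof.
move=> ci cj ck; have [li ai bi] := chart_coord ci.
have [lj aj bj] := chart_coord cj; have [lk ak bk] := chart_coord ck.
have -> : br z i j k = (z c 0 ^+ 2 + z c 1 ^+ 2) *
  - ((ch z c i - ch z c j) * (ch z c k * pencil_x z c k - ch z c i * pencil_x z c i) -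
   (ch z c i - ch z c k) * (ch z c j * pencil_x z c j - ch z c i * pencil_x z c i)).
  by rewrite /br ai bi aj bj ak bk; ring.
rewrite cz.1 li lj lk.
have p x : 1 + x ^+ 2 != 0 :> R by rewrite gt_eqF // ltr_pwDl ?sqr_ge0.
by field; rewrite !p.
Qed.

Lemma ch_chart (c i j : 'I_N) : c != i -> c != j ->
  ch z i j = ch z c i * ch z c j / 2 * (pencil_x z c j - pencil_x z c i) ^+ 2.
Proof.
move=> ci cj; have [li ai bi] := chart_coord ci; have [lj aj bj] := chart_coord cj.
have -> : ch z i j = 1 - (z c 0 ^+ 2 + z c 1 ^+ 2) * ((1 - ch z c i) * (1 - ch z c j) +
   ch z c i * pencil_x z c i * (ch z c j * pencil_x z c j)).
  by rewrite [LHS]/ch ai bi aj bj; ring.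
rewrite cz.1 li lj.
have p x : 1 + x ^+ 2 != 0 :> R by rewrite gt_eqF // ltr_pwDl ?sqr_ge0.
by field; rewrite !p.
Qed.

Lemma br_chart_pole (c i j : 'I_N) : c != i -> c != j ->
  br z c i j = ch z c i * ch z c j * (pencil_x z c j - pencil_x z c i).
Proof.
move=> ci cj; rewrite pencil_xB //.
have := ch_gt0 cz N3 ci; have := ch_gt0 cz N3 cj => h1 h2.
by field; rewrite !lt0r_neq0.
Qed.

Lemma pencil_x_lt (c i j : 'I_N) : cyc c i j -> pencil_x z c i < pencil_x z c j.
Proof.
move=> h; have [ci ij cj] := cycP h.
by rewrite -subr_gt0 pencil_xB // divr_gt0 ?mulr_gt0 ?ch_gt0 // br_gt0.
Qed.

End Chart.

Section Cuts.
Variables (R : realType) (N : nat) (z : 'M[R]_(N, 3)).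
Hypothesis N4 : (3 < N)%N.
Let N3 : (2 < N)%N := ltnW N4.
Hypothesis cz : is_config z.
Variable W : 'I_N -> 'I_N -> R.
Hypothesis W_sym : forall i j, W i j = W j i.
Hypothesis W_bal : balanced z W.
Hypothesis W_pos : forall i j, i != j -> ~~ adjacent_ord i j -> 0 <= W i j.
Hypothesis W_neg : forall i, W i (ordS i) < 0.

Definition cut (P : pred 'I_N) : R := \sum_(i | P i) \sum_(j | ~~ P j) W i j.

(** [W] is symmetric and [br] antisymmetric, so pairs inside [P] cancel in the sum of the balance
    equations over [P]. *)
Lemma balanced_cut (P : pred 'I_N) (k : 'I_N) :
  \sum_(i | P i) \sum_(j | ~~ P j) W i j * br z i j k / ch z i j = 0.
Proof.
have bal i : \sum_j W i j * br z i j k / ch z i j = 0.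
  have : fv z (\sum_j (W i j / ch z i j) *: cross z i j) k = 0.
    by rewrite W_bal /fv !mxE; ring.
  rewrite /fv !summxE !mulr_suml -!big_split /= => h; rewrite -[RHS]h.
  apply: eq_bigr => j _; rewrite -[LHS]/(_) -fv_cross /fv !mxE /=; ring.
have all0 : \sum_(i | P i) \sum_j W i j * br z i j k / ch z i j = 0 by apply: big1.
have ins0 : \sum_(i | P i) \sum_(j | P j) W i j * br z i j k / ch z i j = 0.
  rewrite big_mkcond /=; under eq_bigr do rewrite big_mkcond /=.
  rewrite -[RHS](@sum_antisym R 'I_N (fun i j => if P i then if P j then
    W i j * br z i j k / ch z i j else 0 else 0)).
    by apply: eq_bigr => i _; case: (P i) => //; rewrite big1.
  move=> i j; case: (P i); case: (P j); rewrite ?oppr0 //.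
  by rewrite W_sym ch_sym (_ : br z i j k = - br z j i k) ?mulrN ?mulNr // /br; ring.
rewrite -[RHS]all0; under [RHS]eq_bigr do rewrite (bigID P) /=.
by rewrite big_split /= ins0 add0r.
Qed.

(** With [c] at infinity, the difference is a positive factor times [(xi - xp) (xj - xd) + (xd - xp)
    (xq - xi)], or times [(xi - xp) (xq - xp)] if [j = c]. These expressions vanish only for the two
    sides leaving the arc. *)
Lemma normal_lt (p q d c i j : 'I_N) : c = ord_pred p -> d = ordS q ->
  (p < q)%N -> (q - p < N - 2)%N -> (p <= i <= q)%N -> ~~ (p <= j <= q)%N ->
  ~~ adjacent_ord i j ->
  (br z p q c / ch z p c * br z i j p - br z p q d / ch z q d * br z i j q) / ch z i j <
  br z p q c / ch z p c * (br z p q d / ch z q d).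
Proof.
move=> cE dE pq pqN iI jJ ad.
have cp : ordS c = p by rewrite cE ord_predK.
have [ip jp] := (ltn_ord i, ltn_ord j); have [pp qp] := (ltn_ord p, ltn_ord q).
have cd := ltn_ord c.
have cv : c.+1 = p \/ (p = 0 :> nat /\ c.+1 = N).
  by move: cp => /(congr1 (@nat_of_ord _)); rewrite ordSE; case: eqP; lia.
have dv : d = q.+1 :> nat \/ (d = 0 :> nat /\ q.+1 = N).
  by rewrite dE ordSE; case: eqP; lia.
have [] := arc_ends pq pqN qp cv dv; rewrite !(inj_eq (@ord_inj _)).
move=> c_p c_q c_d c1 c2; have [c_i c3 c4] := arc_in pq pqN qp cv dv iI.
rewrite (inj_eq (@ord_inj _)) in c_i.
have adc : j = c -> i != p by move=> jc; apply: contraNneq ad => ->; rewrite jc -cp /adjacent_ord eqxx orbT.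
have add : i = q -> j != d by move=> iq; apply: contraNneq ad => ->; rewrite iq dE /adjacent_ord eqxx.
have lt_x (k l : 'I_N) : cyc c k l -> pencil_x z c k < pencil_x z c l by exact: pencil_x_lt.
have le_x (k l : 'I_N) : k = l :> nat \/ cyc c k l -> pencil_x z c k <= pencil_x z c l.
  by case=> [/ord_inj->//|/lt_x/ltW].
have xpq := lt_x _ _ c1; have xqd := lt_x _ _ c2.
have xpi := le_x _ _ c3; have xiq := le_x _ _ c4.
have lp := ch_gt0 cz N3 c_p; have lq := ch_gt0 cz N3 c_q.
have ld := ch_gt0 cz N3 c_d; have li := ch_gt0 cz N3 c_i.
have -> : br z p q c = ch z c p * ch z c q * (pencil_x z c q - pencil_x z c p).
  by rewrite -br_chart_pole // -br_rot -br_rot.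
rewrite (br_chart N4 cz c_p c_q c_d) (ch_chart N4 cz c_q c_d) (ch_sym z p c).
have [jc|jc] := eqVneq j c.
  rewrite {j jJ jp add}jc in ad adc *.
  have ip' : pencil_x z c p < pencil_x z c i.
    by case: c3 => [/ord_inj pi|/lt_x//]; move: (adc erefl); rewrite pi eqxx.
  have -> : br z i c p = ch z c p * ch z c i * (pencil_x z c i - pencil_x z c p).
    by rewrite -br_chart_pole // -br_rot.
  have -> : br z i c q = ch z c q * ch z c i * (pencil_x z c i - pencil_x z c q).
    by rewrite -br_chart_pole // -br_rot.
  rewrite (ch_sym z i c).
  move: (ch z c p) (ch z c q) (ch z c d) (ch z c i) lp lq ld li => P Q D I lp lq ld li.
  move: (pencil_x z c p) (pencil_x z c q) (pencil_x z c d) (pencil_x z c i) xpq xqd xpi xiq ip'.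
  move=> xp xq xd xi xpq xqd xpi xiq ip'.
  rewrite -subr_gt0.
  have -> : P * Q * (xq - xp) / P * (P * Q * D / 2 * ((xq - xp) * (xd - xq) * (xd - xp)) / (Q * D / 2 * (xd - xq) ^+ 2)) -
    (P * Q * (xq - xp) / P * (P * I * (xi - xp)) - P * Q * D / 2 * ((xq - xp) * (xd - xq) * (xd - xp)) / (Q * D / 2 * (xd - xq) ^+ 2) * (Q * I * (xi - xq))) / I
    = P * Q * (xq - xp) / (xd - xq) * ((xi - xp) * (xq - xp)).
    by field; rewrite !lt0r_neq0 ?subr_gt0.
  by rewrite !mulr_gt0 ?invr_gt0 ?subr_gt0.
rewrite eq_sym in jc; have lj := ch_gt0 cz N3 jc.
have c5 : d = j :> nat \/ cyc c d j by apply: (arc_out pq pqN qp cv dv jp jJ); rewrite (inj_eq (@ord_inj _)).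
have xdj := le_x _ _ c5.
have strict : pencil_x z c i < pencil_x z c q \/ pencil_x z c d < pencil_x z c j.
  case: c4 => [/ord_inj iq|/lt_x]; [right|by left].
  by case: c5 => [/ord_inj dj|/lt_x//]; move: (add iq); rewrite dj eqxx.
rewrite (br_chart N4 cz c_i jc c_p) (br_chart N4 cz c_i jc c_q) (ch_chart N4 cz c_i jc).
move: (ch z c p) (ch z c q) (ch z c d) (ch z c i) (ch z c j) lp lq ld li lj => P Q D I J lp lq ld li lj.
move: (pencil_x z c p) (pencil_x z c q) (pencil_x z c d) (pencil_x z c i) (pencil_x z c j) xpq xqd xpi xiq xdj strict.
move=> xp xq xd xi xj xpq xqd xpi xiq xdj strict.
rewrite -subr_gt0.
have -> : P * Q * (xq - xp) / P * (P * Q * D / 2 * ((xq - xp) * (xd - xq) * (xd - xp)) / (Q * D / 2 * (xd - xq) ^+ 2)) -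
  (P * Q * (xq - xp) / P * (I * J * P / 2 * ((xj - xi) * (xp - xj) * (xp - xi))) -
   P * Q * D / 2 * ((xq - xp) * (xd - xq) * (xd - xp)) / (Q * D / 2 * (xd - xq) ^+ 2) * (I * J * Q / 2 * ((xj - xi) * (xq - xj) * (xq - xi))))
   / (I * J / 2 * (xj - xi) ^+ 2) =
  P * Q * (xq - xp) ^+ 2 / ((xd - xq) * (xj - xi)) * ((xi - xp) * (xj - xd) + (xd - xp) * (xq - xi)).
  by field; rewrite !lt0r_neq0 ?subr_gt0 //; lra.
rewrite mulr_gt0 //; last first.
  have [lt|ge] := ltP xi xq.
    by rewrite ltr_wpDl ?mulr_ge0 ?mulr_gt0 //; lra.
  have {}strict : xd < xj by case: strict => //; rewrite ltNge ge.
  by rewrite ltr_pwDl ?mulr_ge0 ?mulr_gt0 //; lra.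
by rewrite divr_gt0 ?mulr_gt0 ?exprn_gt0 ?subr_gt0 //; lra.
Qed.

(* Evaluate the sum of the balance equations over the arc from p to q at
   mu u_p - nu u_q.  The two sides leaving the arc get the same coefficient, and
   every other segment leaving the arc gets a smaller one. *)
Lemma cut_gt0 (p q : 'I_N) : (p < q)%N -> (q - p < N - 2)%N ->
  0 < cut (fun k => p <= k <= q)%N.
Proof.
move=> pq pqN; pose P (k : 'I_N) := (p <= k <= q)%N.
pose c := ord_pred p; pose d := ordS q.
pose mu := br z p q c / ch z p c; pose nu := br z p q d / ch z q d.
pose n i j := (mu * br z i j p - nu * br z i j q) / ch z i j.
have cp : ordS c = p by rewrite ord_predK.
have [pp qp] := (ltn_ord p, ltn_ord q); have cd := ltn_ord c.
have cv : c.+1 = p \/ (p = 0 :> nat /\ c.+1 = N).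
  by move: cp => /(congr1 (@nat_of_ord _)); rewrite ordSE; case: eqP; lia.
have dv : d = q.+1 :> nat \/ (d = 0 :> nat /\ q.+1 = N).
  by rewrite ordSE; case: eqP; lia.
have [] := arc_ends pq pqN qp cv dv; rewrite !(inj_eq (@ord_inj _)).
move=> c_p c_q c_d c1 c2; rewrite eq_sym in c_p.
have p_q : p != q by rewrite -(inj_eq (@ord_inj _)) ltn_eqF.
have q_d : q != d by have [_ ? _] := cycP c2.
have mu0 : 0 < mu by rewrite divr_gt0 ?ch_gt0 // -br_rot -br_rot br_gt0.
have nu0 : 0 < nu.
  rewrite divr_gt0 ?ch_gt0 // br_gt0 //.
  by move: c1 c2; rewrite /cyc; clear; lia.
have n_sum : \sum_(i | P i) \sum_(j | ~~ P j) W i j * n i j = 0.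
  transitivity (mu * (\sum_(i | P i) \sum_(j | ~~ P j) W i j * br z i j p / ch z i j) -
     nu * (\sum_(i | P i) \sum_(j | ~~ P j) W i j * br z i j q / ch z i j)).
    rewrite !mulr_sumr -sumrB; apply: eq_bigr => i _.
    by rewrite !mulr_sumr -sumrB; apply: eq_bigr => j _; rewrite /n; ring.
  by rewrite !balanced_cut !mulr0 subrr.
have adjP i j : P i -> ~~ P j -> adjacent_ord i j -> i = q /\ j = d \/ i = p /\ j = c.
  rewrite /P => Pi Pj; have [ip jp] := (ltn_ord i, ltn_ord j).
  rewrite adjacent_ordE => h.
  have [h1|h1] : (i = q :> nat /\ j = d :> nat) \/ (i = p :> nat /\ j = c :> nat).
    have dd := ltn_ord d; clear -Pi Pj h ip jp cv dv dd qp pq pqN; case: cv => [e|[e1 e2]]; case: dv => [e3|[e3 e4]]; lia.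
    by left; split; apply: ord_inj; case: h1.
  by right; split; apply: ord_inj; case: h1.
have n_adj i j : P i -> ~~ P j -> adjacent_ord i j -> n i j = mu * nu.
  move=> Pi Pj /(adjP _ _ Pi Pj)[[-> ->]|[-> ->]]; rewrite /n.
    rewrite br_iji mulr0 subr0 -[br z q d p]br_rot -[br z d p q]br_rot.
    by rewrite -mulrA.
  by rewrite br_iji mulr0 sub0r br_swap mulrN opprK -mulrA mulrC.
have S0 i j : P i -> ~~ P j -> 0 <= W i j * (mu * nu - n i j).
  move=> Pi Pj; have [ad|ad] := boolP (adjacent_ord i j).
    by rewrite n_adj // subrr mulr0.
  have ij : i != j by apply: contraNneq Pj => <-.
  by rewrite mulr_ge0 ?W_pos // subr_ge0 ltW // normal_lt.
have Ssum : \sum_(i | P i) \sum_(j | ~~ P j) W i j * (mu * nu - n i j) = mu * nu * cut P.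
  rewrite /cut mulr_sumr -[LHS]addr0 -[X in _ + X]n_sum -big_split /=.
  apply: eq_bigr => i _; rewrite mulr_sumr -big_split /=.
  by apply: eq_bigr => j _; ring.
(* If the cut were not positive, all diagonals leaving the arc would have weight 0. Then the cut
   would be the sum of two negative side weights, whereas [Ssum] makes it 0. *)
rewrite ltNge; apply/negP => cut_le0.
have S_eq0 : \sum_(i | P i) \sum_(j | ~~ P j) W i j * (mu * nu - n i j) = 0.
  apply/eqP; rewrite eq_le sumr_ge0; last by move=> i Pi; apply: sumr_ge0 => j Pj; exact: S0.
  by rewrite andbT Ssum pmulr_rle0 // mulr_gt0.
have W0 i j : P i -> ~~ P j -> ~~ adjacent_ord i j -> W i j = 0.
  move=> Pi Pj ad.
  have h1 := psumr_eq0P (fun i Pi => sumr_ge0 _ (fun j Pj => S0 i j Pi Pj)) S_eq0 (i := i) Pi.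
  have /eqP := psumr_eq0P (fun j Pj => S0 i j Pi Pj) h1 (i := j) Pj.
  have nlt : 0 < mu * nu - n i j by rewrite subr_gt0; exact: normal_lt.
  by rewrite mulf_eq0 (gt_eqF nlt) orbF => /eqP.
have : cut P < 0.
  have Pq : P q by rewrite /P leqnn andbT ltnW.
  have nPd : ~~ P d by rewrite /P; clear -pq pqN qp dv; lia.
  rewrite /cut (bigD1 q) //= (bigD1 d) //= -addrA addrC; apply: le_lt_trans (W_neg q).
  rewrite gerDr -oppr_ge0 opprD addr_ge0 // oppr_ge0.
    apply: sumr_le0 => j /andP[Pj jd]; have [ad|ad] := boolP (adjacent_ord q j); last by rewrite W0.
    have [[_ jE]|[qE _]] := adjP _ _ Pq Pj ad; first by rewrite jE eqxx in jd.
    by rewrite qE eqxx in p_q.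
  apply: sumr_le0 => i /andP[Pi iq]; apply: sumr_le0 => j Pj.
  have [ad|ad] := boolP (adjacent_ord i j); last by rewrite W0.
  have [[iE _]|[-> ->]] := adjP _ _ Pi Pj ad; first by rewrite iE eqxx in iq.
  by rewrite -cp W_sym ltW.
have munu : 0 < mu * nu by rewrite mulr_gt0.
move: Ssum; rewrite S_eq0 => /esym/eqP; rewrite mulf_eq0 (gt_eqF munu) => /eqP->.
by rewrite ltxx.
Qed.

End Cuts.

Section Crossing.
Variables (R : realType) (N : nat).
Variable W : 'I_N -> 'I_N -> R.
Hypothesis W_sym : forall i j, W i j = W j i.
Hypothesis W_star : forall i, \sum_(j | j != i) W i j = 0.
Hypothesis W_cut : forall p q : 'I_N, (p < q)%N -> (q - p < N - 2)%N ->
  0 < cut W (fun k => p <= k <= q)%N.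

(* The cuts around [i, j-1] and [i+1, j] sum to the stars of i and j plus twice the
   weight of the diagonals that cross the segment from i to j. *)
Lemma crossing_diagonal (i j : 'I_N) : (i < j)%N -> ~~ adjacent_ord i j ->
  exists k l : 'I_N, [/\ (i < k < j)%N, (l < i)%N || (j < l)%N & 0 < W k l].
Proof.
move=> ij; have [iN jN] := (ltn_ord i, ltn_ord j).
rewrite adjacent_ordE => ad.
have j1N : (j.-1 < N)%N by lia.
have i1N : (i.+1 < N)%N by lia.
have cA := @W_cut i (Ordinal j1N) ltac:(rewrite /=; lia) ltac:(rewrite /=; lia).
have cB := @W_cut (Ordinal i1N) j ltac:(rewrite /=; lia) ltac:(rewrite /=; lia).
pose A (k : 'I_N) := (i <= k <= j.-1)%N; pose B (k : 'I_N) := (i.+1 <= k <= j)%N.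
pose In (k : 'I_N) := (i < k < j)%N; pose Out (k : 'I_N) := (k < i)%N || (j < k)%N.
pose X := \sum_(k | In k) \sum_(l | Out l) W k l.
have E (P Q : pred 'I_N) : \sum_(k | P k) \sum_(l | Q l) W k l =
    \sum_k \sum_l (P k && Q l)%:R * W k l.
  rewrite big_mkcond; apply: eq_bigr => k _; case: (P k) => /=.
    by rewrite big_mkcond; apply: eq_bigr => l _; case: (Q l); rewrite ?mul1r ?mul0r.
  by rewrite big1 // => l _; rewrite mul0r.
have S k0 : \sum_k \sum_l ((k == k0) && (l != k0))%:R * W k l = 0.
  by rewrite -(E (pred1 k0) (fun l => l != k0)) big_pred1_eq W_star.
have key : \sum_k \sum_l (A k && ~~ A l)%:R * W k l +
    \sum_k \sum_l (B k && ~~ B l)%:R * W k l -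
    \sum_k \sum_l ((k == i) && (l != i))%:R * W k l -
    \sum_k \sum_l ((k == j) && (l != j))%:R * W k l -
    2 * \sum_k \sum_l (In k && Out l)%:R * W k l = 0.
  transitivity (\sum_k \sum_l ((A k && ~~ A l)%:R + (B k && ~~ B l)%:R -
    ((k == i) && (l != i))%:R - ((k == j) && (l != j))%:R -
    2 * (In k && Out l)%:R) * W k l).
    rewrite mulr_sumr -!sumrN -!big_split /=; apply: eq_bigr => k _.
    rewrite mulr_sumr -!sumrN -!big_split /=; apply: eq_bigr => l _; ring.
  apply: sum_antisym.
  move=> k l; rewrite [W l k]W_sym -[RHS]mulNr; congr (_ * _).
  (* Four kinds of vertices: outside, [i], strictly between, [j]. The total coefficient is
     antisymmetric for each pair of kinds. *)
  have cls m : let t := (A m, B m, m == i, m == j, In m, Out m) in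
      t = (false, false, false, false, false, true) \/
      t = (true, false, true, false, false, false) \/
      t = (true, true, false, false, true, false) \/
      t = (false, true, false, true, false, false).
    rewrite /A /B /In /Out -!(inj_eq (@ord_inj _)) /=.
    have [h|[h|[h|h]]] : (m < i)%N || (j < m)%N \/ m = i :> nat \/ (i < m < j)%N \/ m = j :> nat by lia.
    - by left; congr (_, _, _, _, _, _); lia.
    - by right; left; congr (_, _, _, _, _, _); lia.
    - by right; right; left; congr (_, _, _, _, _, _); lia.
    - by right; right; right; congr (_, _, _, _, _, _); lia.
  by case: (cls k) => [|[|[|]]] [-> -> -> -> -> ->];
    case: (cls l) => [|[|[|]]] [-> -> -> -> -> ->] /=; ring.
have XE : cut W A + cut W B = 2 * X.
  by have := S i; have := S j; rewrite /cut /X !E; lra.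
have : 0 < X by rewrite /A /B in XE; have := cA; have := cB; rewrite /=; lra.
move=> X0; have [k kIn X1] : exists2 k, In k & 0 < \sum_(l | Out l) W k l.
  apply/exists_inP; apply: contraTT X0; rewrite negb_exists_in => /forall_inP h.
  by rewrite -leNgt; apply: sumr_le0 => k Ik; rewrite leNgt; exact: h.
have [l lOut Wp] : exists2 l, Out l & 0 < W k l.
  apply/exists_inP; apply: contraTT X1; rewrite negb_exists_in => /forall_inP h.
  by rewrite -leNgt; apply: sumr_le0 => l Ol; rewrite leNgt; exact: h.
by exists k, l.
Qed.
End Crossing.

(** * Faces of a graph and dual circuits *)

Lemma is_diagonalP (N : nat) (S : {set 'I_N}) :
  reflect (exists i j : 'I_N, [/\ S = [set i; j]%SET, i != j & ~~ adjacent_ord i j])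
    (is_diagonal S).
Proof.
apply: (iffP idP) => [/existsP[i /existsP[j /and4P[ij h1 h2 /eqP->]]]|[i [j [-> ij ad]]]].
  by exists i, j; rewrite ij /adjacent_ord negb_or h1 h2.
exact: diagonalP.
Qed.

Lemma crossing_refl (N : nat) (S : {set 'I_N}) (x : 'I_N) : crossing S [set x; x]%SET = false.
Proof.
apply/negbTE/negP => /existsP[a /existsP[b /existsP[c /existsP[d /and4P[ab bc cd]]]]].
by move=> /orP[]/andP[/eqP e1 /eqP e2]; [move: e2|move: e1] => /set2_inj;
  rewrite -!(inj_eq (@ord_inj _)); lia.
Qed.

Definition arc_length (N i k : nat) : nat := if (i <= k)%N then (k - i)%N else (k + N - i)%N.

Lemma arc_length_lt (N i k x : nat) : (i < N)%N -> (k < N)%N -> (x < N)%N ->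
  cyc i k x -> (arc_length N i k < arc_length N i x)%N.
Proof. by rewrite /arc_length /cyc => iN kN xN h; case: (leqP i k); case: (leqP i x); lia. Qed.

Lemma arc_length_lt_l (N i k x : nat) : (i < N)%N -> (k < N)%N -> (x < N)%N ->
  cyc i k x -> (arc_length N k x < arc_length N i x)%N.
Proof. by rewrite /arc_length /cyc => iN kN xN h; case: (leqP k x); case: (leqP i x); lia. Qed.

Section Faces.
Variables (N : nat) (E : {set arc N}) (b : bool).
Hypothesis N4 : (3 < N)%N.
Let N3 : (2 < N)%N := ltnW N4.
Hypothesis E_diagonal : forall S, (inr (b, S) : arc N) \in E -> is_diagonal S.
Hypothesis E_noncrossing : forall S T, (inr (b, S) : arc N) \in E ->
  (inr (b, T) : arc N) \in E -> ~~ crossing S T.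

Definition uncrossed (x y : 'I_N) : Prop :=
  forall S, (inr (b, S) : arc N) \in E -> ~~ crossing S [set x; y]%SET.

Lemma unseparatedP (F : {set 'I_N}) :
  reflect (forall x y, x \in F -> y \in F -> uncrossed x y) (unseparated E b F).
Proof.
apply: (iffP idP) => [/forall_inP h x y xF yF S SE|h].
  by have /forall_inP/(_ _ yF)/forallP/(_ S)/implyP := h _ xF; exact.
apply/forall_inP => x xF; apply/forall_inP => y yF; apply/forallP => S.
by apply/implyP => SE; exact: h.
Qed.

Lemma uncrossed_sym (x y : 'I_N) : uncrossed x y -> uncrossed y x.
Proof. by move=> h S SE; rewrite finset.setUC h. Qed.

Lemma uncrossed_refl (x : 'I_N) : uncrossed x x.
Proof. by move=> S SE; rewrite crossing_refl. Qed.

Lemma crossing_cases (S : {set 'I_N}) (x y : 'I_N) : (inr (b, S) : arc N) \in E ->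
  crossing S [set x; y]%SET -> exists u v : 'I_N,
  [/\ S = [set u; v]%SET, u != v, cyc u x v & cyc u v y].
Proof.
move=> /E_diagonal/is_diagonalP[u [v [-> uv _]]].
have [->|xy] := eqVneq x y; first by rewrite crossing_refl.
rewrite (crossingP N4) // => /orP[]/andP[h1 h2]; first by exists u, v.
exists v, u; rewrite finset.setUC eq_sym uv; split=> //.
  by move: h1 h2; rewrite /cyc; clear; lia.
by move: h1 h2; rewrite /cyc; clear; lia.
Qed.

Lemma uncrossed_cyc (u v x y : 'I_N) : (inr (b, [set u; v]%SET) : arc N) \in E ->
  uncrossed x y -> cyc u x v -> cyc u v y -> False.
Proof.
move=> uvE xy h1 h2; have [uv _ _] := cycP h2.
have := xy _ uvE; rewrite (crossingP N4) ?h1 ?h2 //.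
by rewrite -(inj_eq (@ord_inj _)); move: h1 h2; rewrite /cyc; clear; lia.
Qed.

Lemma uncrossed_side (i : 'I_N) : uncrossed i (ordS i).
Proof.
move=> S SE; apply/negP => /(crossing_cases SE)[u [v [_ _ h1 h2]]].
have := ltn_ord i; have := ltn_ord u; have := ltn_ord v; move: h1 h2.
have [iS|[iN i0]] : (ordS i = i.+1 :> nat) \/ (i.+1 = N /\ ordS i = 0 :> nat).
- by rewrite ordSE; case: eqP; [right|left].
- by rewrite /cyc iS; clear; lia.
- by rewrite /cyc i0; clear -iN; lia.
Qed.

(** This is the third vertex of a triangle on the segment: among the successor of [i] and the
    vertices joined to [i] by a diagonal, take the one in the arc that is farthest from [i]. A
    diagonal crossing the segment from [k] to [j] would cross the one to [j] or to [k] from [i], or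
    would join [i] to a vertex beyond [k]. *)
Lemma uncrossed_third (i j : 'I_N) : uncrossed i j ->
  cyc i (ordS i) j ->
  exists k : 'I_N, [/\ cyc i k j, uncrossed i k & uncrossed k j].
Proof.
move=> ij hS.
pose P (k : 'I_N) := cyc i k j && ((k == ordS i) || ((inr (b, [set i; k]%SET) : arc N) \in E)).
have P0 : P (ordS i) by rewrite /P hS eqxx.
case: (arg_maxnP (fun k : 'I_N => arc_length N i k) P0) => k /andP[ikj kE] kmax.
exists k; split; first exact: ikj.
  case/orP: kE => [/eqP->|kE]; first exact: uncrossed_side.
  by move=> S SE; exact: E_noncrossing.
have far (x : 'I_N) : cyc i x j -> cyc i k x -> (inr (b, [set i; x]%SET) : arc N) \in E -> False.
  move=> ixj ikx xE; have := kmax x; rewrite /P ixj xE orbT => /(_ isT) /= le.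
  have lt := arc_length_lt (ltn_ord i) (ltn_ord k) (ltn_ord x) ikx.
  by have := leq_ltn_trans le lt; rewrite ltnn.
have main x y : (inr (b, [set x; y]%SET) : arc N) \in E -> cyc k x j -> cyc k j y -> False.
  move=> xyE h1 h2.
  have [yi|yi] := eqVneq y i.
    rewrite yi finset.setUC in xyE; apply: far xyE;
      by move: ikj h1 h2; rewrite /cyc; clear; lia.
  have yi' : (y : nat) != i by rewrite (inj_eq (@ord_inj _)).
  have [h3|h3] : cyc i j y \/ cyc i y k by move: ikj h2 yi'; rewrite /cyc; clear; lia.
    have h4 : cyc x j y by move: h1 h2 h3 ikj; rewrite /cyc; clear; lia.
    have h5 : cyc x y i by move: h1 h2 h3 ikj; rewrite /cyc; clear; lia.
    exact: (uncrossed_cyc xyE (uncrossed_sym ij) h4 h5).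
  case/orP: kE => [/eqP kS|kE].
    have := ltn_ord y; have := ltn_ord i; move: h3; rewrite /cyc kS ordSE; clear.
    by case: eqP; lia.
  have h4 : cyc i y k by [].
  have h5 : cyc i k x by move: h1 h2 ikj; rewrite /cyc; clear; lia.
  have := E_noncrossing kE xyE; rewrite (crossingP N4); first by rewrite h4 h5 orbT.
    by have [] := cycP ikj.
  by rewrite -(inj_eq (@ord_inj _)); move: h1 h2; rewrite /cyc; clear; lia.
move=> S SE; apply/negP => cr.
have [u [v [Suv uv h1 h2]]] := crossing_cases SE cr; rewrite {}Suv in SE.
apply: (main v u); first by rewrite finset.setUC.
  by move: h1 h2; rewrite /cyc; clear; lia.
by move: h1 h2; rewrite /cyc; clear; lia.
Qed.

(** A common vertex of the two sets cannot lie strictly on either side of a diagonal that separates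
    them, so the two common vertices are its ends. *)
Lemma separating_unique (F F' S : {set 'I_N}) (i j x y : 'I_N) :
  unseparated E b F -> unseparated E b F' -> i != j ->
  i \in F -> j \in F -> i \in F' -> j \in F' -> x \in F -> y \in F' ->
  (inr (b, S) : arc N) \in E -> crossing S [set x; y]%SET -> S = [set i; j]%SET.
Proof.
move=> /unseparatedP uF /unseparatedP uF' ij iF jF iF' jF' xF yF' SE cr.
have [u [v [Suv uv h1 h2]]] := crossing_cases SE cr; rewrite Suv in SE *.
have pt k : k \in F -> k \in F' -> (k == u) || (k == v).
  move=> kF kF'; have c1 := uncrossed_cyc SE (uF _ _ xF kF) h1.
  have [//|] := boolP ((k == u) || (k == v)).
  rewrite negb_or -!(inj_eq (@ord_inj _)) => /andP[ku kv].
  have SE' := SE; rewrite finset.setUC in SE'.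
  have h3 : cyc v y u by move: h2; rewrite /cyc; clear; lia.
  have c2 := uncrossed_cyc SE' (uF' _ _ yF' kF') h3.
  have uv' : (u : nat) != v by rewrite (inj_eq (@ord_inj _)).
  have [/c1//|h4] : cyc u v k \/ cyc v u k by move: ku kv uv'; rewrite /cyc; clear; lia.
  by case: c2.
have := pt _ iF iF'; have := pt _ jF jF'.
move=> /orP[]/eqP e1 /orP[]/eqP e2; move: ij; rewrite e1 e2 ?eqxx // => _.
by rewrite finset.setUC.
Qed.

(** If no diagonal separates the two sets, their union is unseparated, and maximality makes both
    equal to it. *)
Lemma face_unique (F F' : {set 'I_N}) (i j : 'I_N) :
  maxset (unseparated E b) F -> maxset (unseparated E b) F' -> i != j ->
  i \in F -> j \in F -> i \in F' -> j \in F' ->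
  ((inr (b, [set i; j]%SET) : arc N) \in E -> forall x y, x \in F -> y \in F' ->
     ~~ crossing [set i; j]%SET [set x; y]%SET) -> F = F'.
Proof.
move=> /maxsetP[uF mF] /maxsetP[uF' mF'] ij iF jF iF' jF' same.
have uU : unseparated E b (F :|: F')%SET.
  have cr x y S : x \in F -> y \in F' -> (inr (b, S) : arc N) \in E ->
      ~~ crossing S [set x; y]%SET.
    move=> xF yF' SE; apply/negP => c.
    have SE' := separating_unique uF uF' ij iF jF iF' jF' xF yF' SE c.
    by rewrite SE' in SE c; have := same SE _ _ xF yF'; rewrite c.
  apply/unseparatedP => x y; rewrite !finset.in_setU => /orP[]xF /orP[]yF S SE.
  - by move/unseparatedP: uF; apply.
  - exact: cr.
  - by rewrite finset.setUC; apply: cr.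
  - by move/unseparatedP: uF'; apply.
rewrite -(mF _ uU (finset.subsetUl _ _)); apply: mF' => //.
exact: finset.subsetUr.
Qed.

End Faces.

(** * Dual circuits that cross the equator twice *)

Section DualCircuits.
Variables (N : nat) (E : {set arc N}).
Hypothesis N4 : (3 < N)%N.
Let N3 : (2 < N)%N := ltnW N4.
Hypothesis E_gamma : forall i, (inl i : arc N) \in E.
Hypothesis E_diagonal : forall b S, (inr (b, S) : arc N) \in E -> is_diagonal S.
Hypothesis E_noncrossing : forall b S T, (inr (b, S) : arc N) \in E ->
  (inr (b, T) : arc N) \in E -> ~~ crossing S T.

(* A face lies below the diagonal {i, j}, i < j, of the polygon on the side b if it
   is contained in the part of this polygon cut off by the diagonal on the side of
   the vertices between i and j. *)
Definition below (b : bool) (i j : 'I_N) (F : gface N) : bool :=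
  (F.1 == b) && [exists x in F.2, (i < x < j)%N].

(** The region below the diagonal is entered or left through the diagonal itself or through the part
    of [gamma] between [i] and [j]. *)
Definition flips (b : bool) (i j : 'I_N) (e : arc N) : bool :=
  match e with
  | inl k => (i <= k < j)%N
  | inr (c, D) => (c == b) && (D == [set i; j]%SET)
  end.

Lemma face_one_side (b : bool) (F : {set 'I_N}) (i j x y : 'I_N) :
  unseparated E b F -> (inr (b, [set i; j]%SET) : arc N) \in E ->
  x \in F -> y \in F -> (i < x < j)%N -> (i <= y <= j)%N.
Proof.
move=> /unseparatedP uF ijE xF yF xij; rewrite leqNgt [(y <= j)%N]leqNgt -negb_or.
apply/negP => yij; have h1 : cyc i x j by rewrite /cyc xij.
have h2 : cyc i j y by move: xij yij; rewrite /cyc; clear; lia.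
exact: (uncrossed_cyc N4 ijE (uF _ _ xF yF) h1 h2).
Qed.

Lemma diagonal_wide (b : bool) (i j : 'I_N) : (i < j)%N ->
  (inr (b, [set i; j]%SET) : arc N) \in E -> (i.+1 < j)%N /\ ((0 < i)%N || (j.+1 < N)%N).
Proof.
move=> ij /E_diagonal/is_diagonalP[u [v [/set2_inj e uv]]].
rewrite adjacent_ordE; have := ltn_ord j; have := ltn_ord i.
by move: e; rewrite -!(inj_eq (@ord_inj _)); lia.
Qed.

Lemma crossing_sides (i j x y : 'I_N) : (i < j)%N ->
  crossing [set i; j]%SET [set x; y]%SET ->
  (i < x < j)%N && ((y < i) || (j < y))%N || (i < y < j)%N && ((x < i) || (j < x))%N.
Proof.
move=> ij; have [->|xy] := eqVneq x y; first by rewrite crossing_refl.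
have ij' : i != j by rewrite -(inj_eq (@ord_inj _)) ltn_eqF.
by rewrite (crossingP N4) // /cyc; clear -ij; lia.
Qed.

(** Across a side of [gamma] the polygon changes, and only the face on the side [b] counts. Across
    another diagonal, a common end that is neither [i] nor [j] decides for both faces. Across
    [{i, j}] itself, two faces on the same side of it would coincide by [face_unique]. *)
Lemma dual_joins_below (b : bool) (i j : 'I_N) (e : arc N) (F F' : gface N) :
  (i < j)%N -> (inr (b, [set i; j]%SET) : arc N) \in E -> dual_joins E e F F' ->
  below b i j F (+) below b i j F' = flips b i j e.
Proof.
move=> ij ijE /and3P[FF' /and4P[eE mF sF eF] /and4P[_ mF' sF' eF']].
have [ij1 ijN] := diagonal_wide ij ijE.
case: F F' FF' mF sF eF mF' sF' eF' => [c F] [c' F'] /= FF' mF sF eF mF' sF' eF'.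
have [uF _] := maxsetP mF; have [uF' _] := maxsetP mF'.
case: e eE sF eF sF' eF' => [k _ _|[a T] TE /eqP ac].
  rewrite /ends !finset.subUset !finset.sub1set => /andP[kF kSF] _ /andP[kF' kSF'].
  have kS := ordS_neq N4 k.
  have cc : c' = ~~ c.
    apply/eqP; rewrite -addbT; have [cc|] := eqVneq c' c; last by case: (c) (c') => -[].
    exfalso; subst c'; case/eqP: FF'; congr (_, _).
    apply: (face_unique N4 (@E_diagonal c) mF mF' kS kF kSF kF' kSF').
    by move=> /E_diagonal/is_diagonalP[u [v [/set2_inj e uv]]];
      rewrite /adjacent_ord; move: e => /orP[]/andP[/eqP<- /eqP<-]; rewrite eqxx ?orbT.
  have key G : unseparated E b G -> k \in G -> ordS k \in G ->
      [exists x in G, (i < x < j)%N] = (i <= k < j)%N.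
    move=> uG kG kSG; have kv := ordSE k; have kN := ltn_ord k.
    apply/exists_inP/idP => [[x xG xij]|kij].
      have := face_one_side uG ijE xG kG xij; have := face_one_side uG ijE xG kSG xij.
      by rewrite kv; case: eqP; clear -ij1 ijN kN; lia.
    have [ki|ki] := eqVneq (k : nat) i.
      by exists (ordS k); rewrite // kv; case: eqP; move: kij ij1 ki (ltn_ord j); clear; lia.
    by exists k; rewrite // ltn_neqAle eq_sym ki.
  rewrite /below cc /=.
  have [cb|cb] := eqVneq c b.
    rewrite cb (_ : (~~ b == b) = false) /= ?addbF; last by case: (b).
    by apply: key; rewrite -?cb.
  have cb' : ~~ c = b by case: (c) (b) cb => -[].
  by rewrite cb' eqxx /=; apply: key; rewrite // -cb' -cc.
rewrite /ends => TF /eqP ac' TF'; rewrite -{c}ac in FF' mF uF *; rewrite -{c'}ac' in FF' mF' uF' *.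
rewrite /below /flips /=; have [ab|//] := eqVneq a b.
rewrite {a}ab in TE FF' mF uF mF' uF' *.
rewrite /=; have FF : F != F' by apply: contraNneq FF' => ->.
have [Tij|Tij] := eqVneq T [set i; j]%SET.
  rewrite {T TE}Tij in TF TF'; rewrite !finset.subUset !finset.sub1set in TF TF'.
  have [iF jF] := andP TF; have [iF' jF'] := andP TF'.
  have ij' : i != j by rewrite -(inj_eq (@ord_inj _)) ltn_eqF.
  have uniq : (exists x y, [/\ x \in F, y \in F' & crossing [set i; j]%SET [set x; y]%SET]).
    apply: contrapT => h; case/eqP: FF.
    apply: (face_unique N4 (@E_diagonal b) mF mF' ij' iF jF iF' jF') => _ x y xF yF'.
    by apply/negP => c; apply: h; exists x, y.
  have [x [y [xF yF' /(crossing_sides ij)]]] := uniq.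
  move=> /orP[]/andP[h1 h2].
    have -> : [exists x in F, (i < x < j)%N] by apply/exists_inP; exists x.
    rewrite addTb; apply/negP => /exists_inP[w wF' wij].
    have := face_one_side uF' ijE wF' yF' wij; move: h2; clear; lia.
  have -> : [exists x in F', (i < x < j)%N] by apply/exists_inP; exists y.
  rewrite addbT; apply/negP => /exists_inP[w wF wij].
  have := face_one_side uF ijE wF xF wij; move: h2; clear; lia.
have [u [v [Tuv uv _]]] := is_diagonalP _ (E_diagonal TE).
rewrite {T}Tuv in TE TF TF' Tij; rewrite !finset.subUset !finset.sub1set in TF TF'.
have [uFm vF] := andP TF; have [uFm' vF'] := andP TF'.
have [w [wF wF' wi wj]] : exists w, [/\ w \in F, w \in F', w != i :> nat & w != j :> nat].
  have [ui|ui] := boolP ((u != i) && (u != j)).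
    by exists u; split=> //; case/andP: ui.
  have [vi|vi] := boolP ((v != i) && (v != j)).
    by exists v; split=> //; case/andP: vi.
  case/negP: Tij; move: ui vi; rewrite !negb_and !negbK => /orP[]/eqP e1 /orP[]/eqP e2;
    move: uv; rewrite e1 e2 ?eqxx // => _.
  by rewrite finset.setUC.
have key G : unseparated E b G -> w \in G -> [exists x in G, (i < x < j)%N] = (i < w < j)%N.
  move=> uG wG; apply/exists_inP/idP => [[x xG xij]|wij]; last by exists w.
  by have := face_one_side uG ijE xG wG xij; rewrite !ltn_neqAle eq_sym wi wj.
by rewrite (key F) // (key F') // addbb.
Qed.

Lemma cycle_parity (A : eqType) (r : rel A) (f g : A -> bool) (c : seq A) :
  (forall x y, r x y -> f x (+) f y = g x) -> cycle r c -> ~~ odd (count g c).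
Proof.
move=> h; case: c => [//|x s] /=.
have path_parity y t : path r y t ->
    odd (count g (belast y t)) = f y (+) f (last y t).
  elim: t y => [|z t IH] y /=; first by rewrite addbb.
  move=> /andP[/h yz /IH e]; rewrite oddD e -yz; case: (g y) yz; case: (f y); case: (f z); by case: (f _).
move=> /path_parity; rewrite belast_rcons last_rcons addbb /= => ->.
by [].
Qed.

(** Removing the sides [a] and [a'] cuts [gamma] into the arc from [a + 1] to [a'] and the rest; the
    edge must have an end in each. *)
Definition joins (a a' : 'I_N) (e : arc N) : bool :=
  [exists x in ends e, (a < x <= a')%N] && [exists y in ends e, ~~ (a < y <= a')%N].

Lemma joins_set2 (a a' x y : 'I_N) (e : arc N) : ends e = [set x; y]%SET ->
  joins a a' e = (a < x <= a')%N (+) (a < y <= a')%N.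
Proof.
rewrite /joins => ->; apply/andP/idP => [[/exists_inP[u uxy u1] /exists_inP[v vxy v1]]|].
  by move: uxy vxy u1 v1; rewrite !inE => /orP[]/eqP-> /orP[]/eqP->;
    case: (_ <= a')%N; case: (a < _)%N => //=; case: (_ && _).
have inx : x \in [set x; y]%SET by rewrite !inE eqxx.
have iny : y \in [set x; y]%SET by rewrite !inE eqxx orbT.
case: (boolP (a < x <= a')%N) => h1; case: (boolP (a < y <= a')%N) => h2 //= _.
  by split; apply/exists_inP; [exists x|exists y].
by split; apply/exists_inP; [exists y|exists x].
Qed.

(** By [cycle_parity], a diagonal [{i, j}] belongs to the circuit exactly when one but not both of
    the sides [a] and [a'] lie between [i] and [j], that is, when it joins the two arcs. *)
Lemma circuit_edges (c : seq (gface N * arc N)) : dual_circuit E c ->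
  count (@in_gamma N) (unzip2 c) = 2%N ->
  exists a a' : 'I_N, [/\ (a < a')%N, (inl a : arc N) \in unzip2 c,
    (inl a' : arc N) \in unzip2 c &
    forall e, (e \in unzip2 c) = (e \in E) && joins a a' e].
Proof.
move=> /and3P[_ uc cc] c2.
have subE e : e \in unzip2 c -> e \in E.
  move=> /mapP[p pc ->]; have := next_cycle cc pc.
  by move=> /and3P[_ /and4P[]].
have [a [a' [aa' aP]]] : exists a a' : 'I_N, (a < a')%N /\
    forall k, ((inl k : arc N) \in unzip2 c) = (k == a) || (k == a').
  pose s := [seq e <- unzip2 c | in_gamma e].
  have us : uniq s by rewrite filter_uniq.
  have s2 : size s = 2%N by rewrite size_filter.
  have sP k : ((inl k : arc N) \in unzip2 c) = ((inl k : arc N) \in s).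
    by rewrite mem_filter.
  have : all (@in_gamma N) s by rewrite filter_all.
  move: us s2 sP; case: (s) => [|[a|p] [|[a'|p'] [|//]]] //= us _ sP _.
  have aa : a != a'.
    by move: us; rewrite inE !andbT; apply: contraNneq => ->.
  have [lt|lt] := ltnP a a'.
    by exists a, a'; split=> // k; rewrite sP !inE.
  exists a', a; split=> [|k]; last by rewrite sP !inE orbC.
  by rewrite ltn_neqAle lt andbT eq_sym (inj_eq (@ord_inj _)).
exists a, a'; split=> //; rewrite ?aP ?eqxx ?orbT // => e.
case: e => [k|[b S]].
  have kN := ltn_ord k; have a'N := ltn_ord a'.
  rewrite aP E_gamma (@joins_set2 a a' k (ordS k)) // ordSE -!(inj_eq (@ord_inj _)).
  by case: (k.+1 =P N) => kE; clear -aa' kN a'N kE; lia.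
have [SE|SE] := boolP ((inr (b, S) : arc N) \in E); last first.
  by apply/negP => /subE; rewrite (negbTE SE).
have [i [j [Sij ij]]] : exists i j : 'I_N, S = [set i; j]%SET /\ (i < j)%N.
  have [i [j [-> ij _]]] := is_diagonalP _ (E_diagonal SE).
  have [lt|lt] := ltnP i j; first by exists i, j.
  exists j, i; rewrite finset.setUC; split=> //.
  by rewrite ltn_neqAle lt andbT eq_sym (inj_eq (@ord_inj _)).
rewrite {S}Sij in SE *; rewrite (@joins_set2 a a' i j) //=.
have par := @cycle_parity _ _ (fun p => below b i j p.1) (fun p => flips b i j p.2) c _ cc.
have {par} : ~~ odd (count (flips b i j) (unzip2 c)).
  rewrite count_map; apply: par => p q; exact: dual_joins_below.
have -> : count (flips b i j) (unzip2 c) =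
    (((inr (b, [set i; j]%SET) : arc N) \in unzip2 c) + ((i <= a < j) + (i <= a' < j)))%N.
  have cnt (e0 : arc N) : count (pred1 e0) (unzip2 c) = (e0 \in unzip2 c).
    by rewrite count_uniq_mem.
  have e1 : count (flips b i j) (unzip2 c) =
     (count (pred1 (inr (b, [set i; j]%SET) : arc N)) (unzip2 c) +
     count (fun e : arc N => if e is inl k then (i <= k < j)%N else false) (unzip2 c))%N.
    rewrite -count_predUI [X in (_ + X)%N](_ : _ = 0%N) ?addn0.
      apply: eq_count => -[k|[b' D]] /=; first by [].
      rewrite orbF; apply/andP/eqP => [[/eqP-> /eqP->] //|[-> ->]].
      by rewrite !eqxx.
    by rewrite -(count_pred0 (unzip2 c)); apply: eq_count => -[k|[b' D]] //=; rewrite andbF.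
  rewrite e1 cnt; congr (_ + _)%N.
  have aa'n : a != a' by rewrite -(inj_eq (@ord_inj _)) ltn_eqF.
  transitivity (count (fun e : arc N => (i <= a < j)%N && pred1 (inl a : arc N) e) (unzip2 c) +
      count (fun e : arc N => (i <= a' < j)%N && pred1 (inl a' : arc N) e) (unzip2 c))%N.
    rewrite -count_predUI [X in (_ + X)%N](_ : _ = 0%N) ?addn0.
      apply: eq_in_count => -[k|[b' D]] /= ec; last by rewrite !andbF.
      move: ec; rewrite aP => /orP[]/eqP->; rewrite !eqxx.
        by rewrite (inj_eq inl_inj) (negbTE aa'n) andbF orbF andbT.
      by rewrite (inj_eq inl_inj) eq_sym (negbTE aa'n) andbF /= andbT.
    rewrite -(count_pred0 (unzip2 c)); apply: eq_count => e /=.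
    case: eqP => [->|_]; last by rewrite andbF.
    by rewrite (inj_eq inl_inj) (negbTE aa'n) !andbF.
  have cb (q : bool) (e0 : arc N) : e0 \in unzip2 c ->
      count (fun e => q && pred1 e0 e) (unzip2 c) = q.
    by case: q => e0c; [rewrite cnt e0c|exact: count_pred0].
  by rewrite !cb // aP eqxx ?orbT.
rewrite !oddD !oddb; clear -ij aa'; case: (_ \in _); lia.
Qed.

Lemma unseparated_face (b : bool) (A : {set 'I_N}) : unseparated E b A ->
  exists2 F, maxset (unseparated E b) F & A \subset F.
Proof. by move=> /maxset_exists[F mF AF]; exists F. Qed.

Definition face_adjacent (b : bool) : rel (gface N) := fun F F' =>
  [exists e in E, [&& ~~ in_gamma e, F.1 == b & dual_joins E e F F']].

(** Walk from face to face towards the side [g]. If [F] has a vertex inside the arc from [p] to [q],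
    shorten the arc. Otherwise either the arc is the side [g], or its ends are joined by a diagonal
    because [F] is maximal, and crossing this diagonal leads to a face with a vertex inside the
    arc. *)
Lemma connect_gap (b : bool) (g : 'I_N) (n : nat) (F : {set 'I_N}) (p q : 'I_N) :
  maxset (unseparated E b) F -> p \in F -> q \in F -> p != q ->
  (g == p) || cyc p g q -> (arc_length N p q <= n)%N ->
  exists F', [/\ maxset (unseparated E b) F', g \in F', ordS g \in F' &
    connect (face_adjacent b) (b, F) (b, F')].
Proof.
elim: n F p q => [|n IH] F p q mF pF qF pq gpq le.
  exfalso; have := ltn_ord p; have := ltn_ord q; move: pq le.
  by rewrite -(inj_eq (@ord_inj _)) /arc_length; clear; case: (leqP p q); lia.
have split_arc (k : 'I_N) : cyc p k q -> ((g == p) || cyc p g k) || ((g == k) || cyc k g q).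
  by move: gpq; rewrite -!(inj_eq (@ord_inj _)) /cyc; clear; lia.
have shorter (k : 'I_N) : cyc p k q -> (arc_length N p k <= n)%N /\ (arc_length N k q <= n)%N.
  move=> pkq; have h1 := arc_length_lt (ltn_ord p) (ltn_ord k) (ltn_ord q) pkq.
  have h2 := arc_length_lt_l (ltn_ord p) (ltn_ord k) (ltn_ord q) pkq.
  by split; rewrite -ltnS; [exact: leq_trans h1 le|exact: leq_trans h2 le].
have descend G k : maxset (unseparated E b) G -> p \in G -> q \in G -> k \in G ->
    cyc p k q -> exists F', [/\ maxset (unseparated E b) F', g \in F', ordS g \in F' &
    connect (face_adjacent b) (b, G) (b, F')].
  move=> mG pG qG kG pkq; have [pk kq _] := cycP pkq; have [l1 l2] := shorter k pkq.
  by case/orP: (split_arc k pkq) => h; [exact: (IH G p k)|exact: (IH G k q)].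
have [|noF] := boolP [exists x in F, cyc p x q].
  by move=> /exists_inP[x xF pxq]; apply: (descend F x).
have out x : x \in F -> cyc p x q -> False.
  by move=> xF pxq; case/negP: noF; apply/exists_inP; exists x.
have [qS|qS] := eqVneq q (ordS p).
  have gp : g = p.
    case/orP: gpq => [/eqP//|]; rewrite qS /cyc ordSE.
    have := ltn_ord g; have := ltn_ord p; clear; case: eqP; lia.
  by exists F; split; rewrite ?gp -?qS ?connect0.
have hS : cyc p (ordS p) q by rewrite cyc_side // eq_sym.
have [/unseparatedP uF maxF] := maxsetP mF.
have pqu := uF _ _ pF qF.
have [k [pkq pk kq]] := uncrossed_third N4 (@E_diagonal b) (@E_noncrossing b) pqu hS.
have kF : k \notin F by apply/negP => kF; exact: out kF pkq.
have u3 : unseparated E b [set p; k; q]%SET.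
  apply/unseparatedP => x y; rewrite !inE -!orbA.
  have [kp qk qp] := And3 (uncrossed_sym pk) (uncrossed_sym kq) (uncrossed_sym pqu).
  by move=> /or3P[]/eqP-> /or3P[]/eqP->; [exact: uncrossed_refl|exact: pk|exact: pqu
    |exact: kp|exact: uncrossed_refl|exact: kq|exact: qp|exact: qk|exact: uncrossed_refl].
have pqE : (inr (b, [set p; q]%SET) : arc N) \in E.
  apply: contraT => npq; case/negP: kF.
  have uk : unseparated E b (k |: F)%SET.
    have cr x S : x \in F -> (inr (b, S) : arc N) \in E -> ~~ crossing S [set x; k]%SET.
      move=> xF SE; apply/negP => c; case/negP: npq.
      by rewrite -(separating_unique N4 (@E_diagonal b) (F := F) (F' := [set p; k; q]%SET) _ u3 pq
        pF qF _ _ xF _ SE c) ?inE ?eqxx ?orbT //; apply/unseparatedP.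
    apply/unseparatedP => x y; rewrite !in_setU1 => /orP[/eqP->|xF] /orP[/eqP->|yF] S SE.
    - by rewrite crossing_refl.
    - by rewrite finset.setUC cr.
    - exact: cr.
    - exact: uF.
  by rewrite -(maxF _ uk (finset.subsetU1 _ _)) in_setU1 eqxx.
have [G mG sG] := unseparated_face u3.
have inG x : x \in [set p; k; q]%SET -> x \in G by move/(fintype.subsetP sG).
have pG : p \in G by rewrite inG // !inE eqxx.
have kG : k \in G by rewrite inG // !inE eqxx orbT.
have qG : q \in G by rewrite inG // !inE eqxx ?orbT.
have [F' [mF' gF' gSF' cF']] := descend G k mG pG qG kG pkq.
exists F'; split=> //; apply: connect_trans cF'; apply: connect1.
apply/exists_inP; exists (inr (b, [set p; q]%SET)) => //; rewrite /= eqxx /=.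
have FG : F != G by apply: contraNneq kF => ->.
rewrite /dual_joins xpair_eqE eqxx FG /incident pqE /= !eqxx /=.
by rewrite /is_gface mF mG !finset.subUset !finset.sub1set pF qF pG qG.
Qed.

Lemma face_path (b : bool) (g g' : 'I_N) : g != g' -> exists (F : gface N) (fs : seq (gface N)),
  [/\ path (face_adjacent b) F fs, uniq (F :: fs), incident E (inl g) F,
    incident E (inl g') (last F fs) & all (fun G => G.1 == b) (F :: fs)].
Proof.
move=> gg'; have ug : unseparated E b [set g; ordS g]%SET.
  apply/unseparatedP => x y; rewrite !inE.
  have h := uncrossed_side N4 (@E_diagonal b) g.
  move=> /orP[]/eqP-> /orP[]/eqP->.
  - exact: uncrossed_refl.
  - exact: h.
  - exact: uncrossed_sym.
  - exact: uncrossed_refl.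
have [F mF sF] := unseparated_face ug.
have gF : g \in F by apply: (fintype.subsetP sF); rewrite !inE eqxx.
have gSF : ordS g \in F by apply: (fintype.subsetP sF); rewrite !inE eqxx orbT.
have hg : (g' == ordS g) || cyc (ordS g) g' g.
  have := ltn_ord g; have := ltn_ord g'; move: gg'.
  by rewrite -!(inj_eq (@ord_inj _)) /cyc !ordSE; clear; case: (g.+1 =P N); lia.
have Sg : ordS g != g by rewrite eq_sym ordS_neq.
have [F' [mF' gF' gSF' /connectP[fs pfs lfs]]] := connect_gap mF gSF gF Sg hg (leqnn _).
have all_side (G : gface N) (s : seq (gface N)) : G.1 = b -> path (face_adjacent b) G s ->
    all (fun G => G.1 == b) (G :: s).
  elim: s G => [|G' s IH] G Gb /=; first by rewrite Gb eqxx.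
  move=> /andP[/exists_inP[e _ /and3P[ng _ /and3P[_ /and4P[_ _ h1 _] /and4P[_ _ h2 _]]]] ps].
  have G'b : G'.1 = b.
    by move: ng h1 h2; rewrite Gb; case: (e) => [//|[c D]] _ /= /eqP-> /eqP->.
  by have := IH _ G'b ps; rewrite /= Gb G'b !eqxx.
have inc (k : 'I_N) (G : {set 'I_N}) : maxset (unseparated E b) G -> k \in G -> ordS k \in G ->
    incident E (inl k) (b, G).
  by move=> mG kG kSG; rewrite /incident E_gamma /is_gface mG /= finset.subUset !finset.sub1set kG.
case/shortenP: pfs lfs => fs' pfs' ufs' _ lfs.
exists (b, F), fs'; split=> //; first exact: inc.
  by rewrite -lfs; exact: inc.
exact: all_side.
Qed.

Definition common_edge (e0 : arc N) (F F' : gface N) : arc N :=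
  odflt e0 [pick e in E | ~~ in_gamma e && dual_joins E e F F'].

(** The last face is not listed, because it is left through a side of [gamma], which
    [exists_circuit] adds. *)
Fixpoint dual_steps (e0 : arc N) (F : gface N) (fs : seq (gface N)) : seq (gface N * arc N) :=
  if fs is F' :: fs' then (F, common_edge e0 F F') :: dual_steps e0 F' fs' else [::].

Lemma common_edgeP (e0 : arc N) (b : bool) (F F' : gface N) : face_adjacent b F F' ->
  ~~ in_gamma (common_edge e0 F F') && dual_joins E (common_edge e0 F F') F F'.
Proof.
move=> /exists_inP[e eE /and3P[ng _ dj]]; rewrite /common_edge; case: pickP => [e' /andP[] //|].
by move/(_ e); rewrite eE ng dj.
Qed.

(** By [dual_joins_below], two distinct faces on a diagonal are on different sides of it, and there
    are only two sides. *)
Lemma three_faces (e : arc N) (F F' F'' : gface N) : ~~ in_gamma e ->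
  incident E e F -> incident E e F' -> incident E e F'' ->
  [|| F == F', F' == F'' | F == F''].
Proof.
case: e => [//|[b S]] _ iF iF' iF''; apply: contraT; rewrite !negb_or => /and3P[n1 n2 n3].
have SE : (inr (b, S) : arc N) \in E by case/and4P: iF.
have [i [j [Sij ij]]] : exists i j : 'I_N, S = [set i; j]%SET /\ (i < j)%N.
  have [i [j [-> ij _]]] := is_diagonalP _ (E_diagonal SE).
  have [lt|lt] := ltnP i j; first by exists i, j.
  exists j, i; rewrite finset.setUC; split=> //.
  by rewrite ltn_neqAle lt andbT eq_sym (inj_eq (@ord_inj _)).
rewrite Sij in SE iF iF' iF''.
have h (G G' : gface N) : G != G' -> incident E (inr (b, [set i; j]%SET)) G ->
    incident E (inr (b, [set i; j]%SET)) G' -> below b i j G (+) below b i j G'.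
  by move=> n g g'; rewrite (dual_joins_below ij SE (e := inr (b, [set i; j]%SET)))
    /= ?eqxx // /dual_joins n g g'.
have := h _ _ n1 iF iF'; have := h _ _ n2 iF' iF''; have := h _ _ n3 iF iF''.
by case: (below _ _ _ F); case: (below _ _ _ F'); case: (below _ _ _ F'').
Qed.

Lemma dual_steps_edge (e0 : arc N) (b : bool) (F : gface N) (fs : seq (gface N)) (e : arc N) :
  path (face_adjacent b) F fs -> e \in unzip2 (dual_steps e0 F fs) ->
  ~~ in_gamma e /\ exists2 G, G \in fs & incident E e G.
Proof.
elim: fs F => [//|F' fs IH] F /= /andP[/(common_edgeP e0)/andP[ng /and3P[_ _ iF']] pfs].
rewrite inE => /orP[/eqP->|/(IH _ pfs)[h1 [G Gfs iG]]].
  by split=> //; exists F'; rewrite // inE eqxx.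
by split=> //; exists G; rewrite // inE Gfs orbT.
Qed.

(** An edge used twice would be incident to three different faces of the path. *)
Lemma dual_steps_uniq (e0 : arc N) (b : bool) (F : gface N) (fs : seq (gface N)) :
  path (face_adjacent b) F fs -> uniq (F :: fs) -> uniq (unzip2 (dual_steps e0 F fs)).
Proof.
elim: fs F => [//|F' fs IH] F.
move=> /= /andP[/(common_edgeP e0)/andP[ng /and3P[FF' iF iF']] pfs] /and3P[nF nF' ufs].
rewrite IH ?andbT //=; last by rewrite nF'.
apply/negP => /(dual_steps_edge pfs)[_ [G Gfs iG]].
have /or3P[h|/eqP h|/eqP h] := three_faces ng iF iF' iG.
- by rewrite h in FF'.
- by rewrite h Gfs in nF'.
- by rewrite h inE Gfs orbT in nF.
Qed.

Lemma unzip1_dual_steps (e0 e : arc N) (F : gface N) (fs : seq (gface N)) r :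
  unzip1 (dual_steps e0 F fs ++ (last F fs, e) :: r) = (F :: fs) ++ unzip1 r.
Proof. by elim: fs F => [//|F' fs IH] F /=; rewrite IH. Qed.

Lemma dual_steps_path (e0 e : arc N) (b : bool) (F : gface N) (fs : seq (gface N)) r :
  let R := fun p q : gface N * arc N => dual_joins E p.2 p.1 q.1 in
  path (face_adjacent b) F fs -> path R (last F fs, e) r ->
  exists x s, [/\ dual_steps e0 F fs ++ (last F fs, e) :: r = x :: s, x.1 = F & path R x s].
Proof.
move=> R; elim: fs F => [|F' fs IH] F /=; first by move=> _ pr; exists (F, e), r.
move=> /andP[/(common_edgeP e0)/andP[_ dj] pfs] /(IH _ pfs)[x [s [-> xF ps]]].
by exists (F, common_edge e0 F F'), (x :: s); split=> //=; rewrite ps andbT /R xF.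
Qed.

(** Go through the top from the side [a] to the side [a'], cross [a'], return through the bottom and
    cross [a]. *)
Lemma exists_circuit (a a' : 'I_N) : a != a' -> exists c,
  [/\ dual_circuit E c, count (@in_gamma N) (unzip2 c) = 2%N,
    (inl a : arc N) \in unzip2 c & (inl a' : arc N) \in unzip2 c].
Proof.
move=> aa'; have [F [fs [pF uF iF lF sF]]] := face_path true aa'.
have a'a : a' != a by rewrite eq_sym.
have [G [gs [pG uG iG lG sG]]] := face_path false a'a.
pose e0 : arc N := inl a; pose R := fun p q : gface N * arc N => dual_joins E p.2 p.1 q.1.
have side_neq (X Y : gface N) : X \in F :: fs -> Y \in G :: gs -> X != Y.
  move=> /(allP sF)/eqP h1 /(allP sG)/eqP h2; apply/eqP => XY; move: h1; rewrite XY.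
  by move: h2 => /= ->.
have lFin : last F fs \in F :: fs by exact: mem_last.
have lGin : last G gs \in G :: gs by exact: mem_last.
have [x [s [cE xF px]]] : exists x s,
    [/\ dual_steps e0 F fs ++ (last F fs, inl a') :: dual_steps e0 G gs ++
      [:: (last G gs, inl a : arc N)] = x :: s, x.1 = F & path R x (rcons s x)].
  pose tail x := dual_steps e0 G gs ++ (last G gs, inl a : arc N) :: [:: x].
  have main y : y.1 = F -> exists x s, [/\ dual_steps e0 F fs ++ (last F fs, inl a' : arc N) :: tail y
      = x :: s, x.1 = F & path R x s].
    move=> yF; apply: (dual_steps_path _ pF).
    have [|x [s [sE xG ps]]] := @dual_steps_path e0 (inl a) false G gs [:: y] pG.
      rewrite /= andbT yF /dual_joins eq_sym side_neq ?mem_head //=.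
      by rewrite lG iF.
    rewrite /tail sE /= ps andbT /R /= xG /dual_joins side_neq ?mem_head //=.
    by rewrite lF iG.
  (* The cycle must end with its own first pair, but [dual_joins] sees only the face of that pair. A
     dummy pair with the right face yields the true first pair [x0], which then closes the path. *)
  have [x0 [s0 [E0 F0 _]]] := main (F, e0) erefl.
  have [x [s [E1 F1 P1]]] := main x0 F0.
  exists x0, (behead (dual_steps e0 F fs ++ (last F fs, inl a') :: dual_steps e0 G gs ++
      [:: (last G gs, inl a : arc N)])).
  have e1 y : dual_steps e0 F fs ++ (last F fs, inl a' : arc N) :: tail y =
      rcons (dual_steps e0 F fs ++ (last F fs, inl a') :: dual_steps e0 G gs ++
      [:: (last G gs, inl a : arc N)]) y.
    by rewrite /tail -cats1 -!catA /= -catA.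
  rewrite e1 in E0; rewrite e1 in E1.
  move: E0 E1; case c0: (dual_steps e0 F fs ++ _) => [|u w] /=.
    by move/(congr1 size): c0; rewrite size_cat /= addnS.
  by move=> [-> _] [xE sE]; move: P1; rewrite -xE -sE; split.
exists (x :: s); have c2 : unzip2 (x :: s) = unzip2 (dual_steps e0 F fs) ++ (inl a' : arc N) ::
    unzip2 (dual_steps e0 G gs) ++ [:: inl a : arc N].
  by rewrite -cE /unzip2 map_cat /= map_cat.
have ngF e : e \in unzip2 (dual_steps e0 F fs) -> ~~ in_gamma e by case/(dual_steps_edge pF).
have ngG e : e \in unzip2 (dual_steps e0 G gs) -> ~~ in_gamma e by case/(dual_steps_edge pG).
split.
- apply/and3P; split; last exact: px.
    rewrite -cE unzip1_dual_steps -[_ ++ [:: _]]/(dual_steps e0 G gs ++ (last G gs, inl a) :: [::]).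
    rewrite unzip1_dual_steps cats0 cat_uniq uF uG andbT andTb.
    apply/hasPn => Y YG; apply/negP => YF.
    by have := side_neq _ _ YF YG; rewrite eqxx.
  rewrite c2 cat_uniq (dual_steps_uniq _ pF) //= cat_uniq (dual_steps_uniq _ pG) //=.
  have n1 (k : 'I_N) : (inl k : arc N) \notin unzip2 (dual_steps e0 F fs) by apply/negP => /ngF.
  have n2 (k : 'I_N) : (inl k : arc N) \notin unzip2 (dual_steps e0 G gs) by apply/negP => /ngG.
  rewrite (negbTE (n1 a')) orFb has_cat /= (negbTE (n1 a)) !orbF mem_cat !inE.
  rewrite (negbTE (n2 a')) (negbTE (n2 a)) orFb /= (inj_eq inl_inj) a'a !andbT.
  apply/hasPn => e eG.
  apply/negP => eF; have [ng [X Xfs iX]] := dual_steps_edge pF eF.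
  have [_ [Y Yfs iY]] := dual_steps_edge pG eG.
  have /eqP X1 := allP sF X (mem_behead (s := F :: fs) Xfs).
  have /eqP Y1 := allP sG Y (mem_behead (s := G :: gs) Yfs).
  move: ng iX iY; case: (e) => [//|[c D]] _ /and4P[_ _ /eqP h1 _] /and4P[_ _ /eqP h2 _].
  by move: X1 Y1; rewrite -h1 -h2 => ->.
- rewrite c2 !count_cat /= count_cat /=.
  have z1 : count (@in_gamma N) (unzip2 (dual_steps e0 F fs)) = 0%N.
    by apply/eqP; rewrite -leqn0 leqNgt -has_count; apply/hasPn.
  have z2 : count (@in_gamma N) (unzip2 (dual_steps e0 G gs)) = 0%N.
    by apply/eqP; rewrite -leqn0 leqNgt -has_count; apply/hasPn.
  by rewrite z1 z2.
- by rewrite c2 mem_cat inE mem_cat inE eqxx !orbT.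
- by rewrite c2 mem_cat inE eqxx orbT.
Qed.

End DualCircuits.

(** * Angle cells in terms of cuts *)

Section PairWeights.
Variables (R : realType) (N : nat).
Hypothesis N4 : (3 < N)%N.
Let N3 : (2 < N)%N := ltnW N4.

(** The top diagonal, the bottom diagonal and the side with the same ends are added, since balance
    and cuts see only the pair of ends. *)
Definition pair_weight (theta : weights R N) (i j : 'I_N) : R :=
  \sum_(e : arc N | ends e == [set i; j]%SET) theta e.

Lemma pair_weight_sym theta i j : pair_weight theta i j = pair_weight theta j i.
Proof. by rewrite /pair_weight finset.setUC. Qed.

Lemma ends_inl_eq (k i j : 'I_N) : i != j ->
  (ends (inl k : arc N) == [set i; j]%SET) = (k == i) && (j == ordS i) || (k == j) && (i == ordS j).
Proof.
move=> ij; apply/eqP/idP => [/set2_inj/orP[]/andP[/eqP-> /eqP<-]|/orP[]/andP[/eqP-> /eqP->] //].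
- by rewrite !eqxx.
- by rewrite !eqxx orbT.
- by rewrite /ends finset.setUC.
Qed.

Lemma pair_weightE theta i j : i != j -> pair_weight theta i j =
  (if j == ordS i then theta (inl i) else if i == ordS j then theta (inl j) else 0) +
  (theta (inr (true, [set i; j]%SET)) + theta (inr (false, [set i; j]%SET))).
Proof.
move=> ij; rewrite /pair_weight big_sumType /=; congr (_ + _).
  under eq_bigl => k do rewrite ends_inl_eq //.
  have nboth : ~~ ((j == ordS i) && (i == ordS j)).
    apply/negP => /andP[/eqP ji /eqP]; rewrite ji => /(congr1 (@nat_of_ord _)).
    by rewrite !ordSE; have := ltn_ord i; clear -N4; case: (i.+1 =P N); case: eqP; lia.
  case: (j =P ordS i) nboth => [jS|jS] /= nb.
    rewrite (big_pred1 i) // => k; rewrite andbT (negbTE nb) andbF orbF.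
    by [].
  case: (i =P ordS j) => [iS|iS]; last by rewrite big1 // => k; rewrite !andbF.
  by rewrite (big_pred1 j) // => k; rewrite andbF andbT.
rewrite (eq_big (fun p : bool * {set 'I_N} => xpredT p.1 && (p.2 == [set i; j]%SET))
  (fun p => theta (inr (p.1, p.2)))); [|by case|by case].
rewrite -(pair_big_dep xpredT (fun _ D => D == [set i; j]%SET) (fun b D => theta (inr (b, D)))) /=.
by rewrite big_bool /= !big_pred1_eq.
Qed.

Section Graph.
Variable E : {set arc N}.
Hypothesis E_gamma : forall i, (inl i : arc N) \in E.
Hypothesis E_diagonal : forall b S, (inr (b, S) : arc N) \in E -> is_diagonal S.
Hypothesis E_noncrossing : forall b S T, (inr (b, S) : arc N) \in E ->
  (inr (b, T) : arc N) \in E -> ~~ crossing S T.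
Variable theta : weights R N.
Hypothesis theta_supp : forall e, e \notin E -> theta e = 0.
Hypothesis theta_sign : forall e, e \in E -> if in_gamma e then theta e < 0 else 0 < theta e.

Lemma ends_two (e : arc N) : e \in E -> exists x y, ends e = [set x; y]%SET /\ x != y.
Proof.
case: e => [k _|[b S] /E_diagonal/is_diagonalP[i [j [-> ij _]]]]; last by exists i, j.
by exists k, (ordS k); rewrite ordS_neq.
Qed.

Definition splits (P : pred 'I_N) (e : arc N) : bool :=
  [exists x in ends e, P x] && [exists y in ends e, ~~ P y].

Lemma cut_pair_weight (P : pred 'I_N) :
  \sum_(e | splits P e) theta e = cut (pair_weight theta) P.
Proof.
rewrite /cut /pair_weight.
transitivity (\sum_e \sum_i \sum_j (if [&& P i, ~~ P j & ends e == [set i; j]%SET] then theta e else 0)).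
  rewrite big_mkcond; apply: eq_bigr => e _.
  have [eE|eE] := boolP (e \in E); last first.
    rewrite theta_supp // if_same big1 // => i _; rewrite big1 // => j _.
    by case: ifP.
  have [x [y [exy xy]]] := ends_two eE.
  have spl : splits P e = P x (+) P y.
    rewrite /splits exy; apply/andP/idP => [[/exists_inP[u uxy u1] /exists_inP[v vxy v1]]|].
      by move: uxy vxy u1 v1; rewrite !inE => /orP[]/eqP-> /orP[]/eqP->; case: (P x); case: (P y).
    have inx : x \in [set x; y]%SET by rewrite !inE eqxx.
    have iny : y \in [set x; y]%SET by rewrite !inE eqxx orbT.
    case: (boolP (P x)) => h1; case: (boolP (P y)) => h2 //= _.
      by split; apply/exists_inP; [exists x|exists y].
    by split; apply/exists_inP; [exists y|exists x].
  have one (u v : 'I_N) : u != v -> ends e = [set u; v]%SET -> P u -> ~~ P v ->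
      \sum_i \sum_j (if [&& P i, ~~ P j & ends e == [set i; j]%SET] then theta e else 0) = theta e.
    move=> uv euv Pu Pv; rewrite (bigD1 u) //= (bigD1 v) //= Pu Pv euv eqxx.
    rewrite [X in _ + X + _]big1 ?addr0 => [|j jv]; last first.
      rewrite /=; case: ifP => // /andP[Pj /eqP/set2_inj/orP[]/andP[/eqP h1 /eqP h2]].
        by rewrite h2 eqxx in jv.
      by rewrite h2 eqxx in uv.
    rewrite big1 ?addr0 // => i iu; rewrite big1 // => j _.
    case: ifP => // /and3P[Pi Pj /eqP/set2_inj/orP[]/andP[/eqP h1 /eqP h2]].
      by rewrite h1 eqxx in iu.
    by rewrite h2 Pi in Pv.
  rewrite spl; case: (boolP (P x)) => h1; case: (boolP (P y)) => h2 /=.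
  - rewrite big1 // => i _; rewrite big1 // => j _; case: ifP => // /and3P[Pi Pj /eqP].
    rewrite exy => /set2_inj/orP[]/andP[/eqP e1 /eqP e2]; first by rewrite -e2 h2 in Pj.
    by rewrite -e1 h1 in Pj.
  - by rewrite (one x y).
  - by rewrite (one y x) // 1?eq_sym // exy finset.setUC.
  - rewrite big1 // => i _; rewrite big1 // => j _; case: ifP => // /and3P[Pi Pj /eqP].
    rewrite exy => /set2_inj/orP[]/andP[/eqP e1 /eqP e2]; first by rewrite -e1 (negbTE h1) in Pi.
    by rewrite -e2 (negbTE h2) in Pi.
rewrite exchange_big /= [RHS]big_mkcond; apply: eq_bigr => i _.
rewrite exchange_big /=; case: (P i) => /=; last by rewrite big1 // => j _; rewrite big1.
rewrite [RHS]big_mkcond; apply: eq_bigr => j _; case: (P j) => /=; first by rewrite big1.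
by rewrite [RHS]big_mkcond.
Qed.

Lemma splits_pred1 (i : 'I_N) (e : arc N) : e \in E -> splits (pred1 i) e = (i \in ends e).
Proof.
move=> /ends_two[x [y [exy xy]]]; rewrite /splits exy.
apply/andP/idP => [[/exists_inP[u uxy /eqP <-] _] //|].
rewrite !inE => /orP[]/eqP e1; rewrite e1.
  by split; apply/exists_inP; [exists x|exists y]; rewrite ?inE ?eqxx ?orbT // eq_sym.
by split; apply/exists_inP; [exists y|exists x]; rewrite ?inE ?eqxx ?orbT.
Qed.

Lemma star_pair_weight (i : 'I_N) :
  \sum_(e in star E i) theta e = \sum_(j | j != i) pair_weight theta i j.
Proof.
transitivity (cut (pair_weight theta) (pred1 i)); last by rewrite /cut big_pred1_eq.
rewrite -cut_pair_weight big_mkcond [RHS]big_mkcond; apply: eq_bigr => e _.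
rewrite inE; have [eE|eE] := boolP (e \in E); first by rewrite splits_pred1.
by rewrite theta_supp // if_same.
Qed.

Lemma pair_weight_ge0 (i j : 'I_N) : i != j -> ~~ adjacent_ord i j -> 0 <= pair_weight theta i j.
Proof.
move=> ij ad; apply: sumr_ge0 => e /eqP ee; have [eE|eE] := boolP (e \in E); last by rewrite theta_supp.
have := theta_sign eE; case: e ee eE => [k|[b S]] ee eE /=; last exact: ltW.
move/eqP: ee; rewrite ends_inl_eq // => h; case/negP: ad; rewrite /adjacent_ord.
by case/orP: h => /andP[_ ->]; rewrite ?orbT.
Qed.

Lemma pair_weight_side (i : 'I_N) : pair_weight theta i (ordS i) = theta (inl i).
Proof.
have iS := ordS_neq N4 i.
have z b : theta (inr (b, [set i; ordS i]%SET)) = 0.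
  apply: theta_supp; apply/negP => /E_diagonal/is_diagonalP[u [v [/set2_inj h uv]]].
  by rewrite /adjacent_ord; case/orP: h => /andP[/eqP<- /eqP<-]; rewrite eqxx ?orbT.
by rewrite pair_weightE // eqxx !z !addr0.
Qed.

Lemma pair_weight_side_lt0 (i : 'I_N) : pair_weight theta i (ordS i) < 0.
Proof. by rewrite pair_weight_side; exact: (theta_sign (E_gamma i)). Qed.

Lemma cut_compl (W : 'I_N -> 'I_N -> R) (P Q : pred 'I_N) :
  (forall i j, W i j = W j i) -> (forall i, Q i = ~~ P i) -> cut W Q = cut W P.
Proof.
move=> Ws QP; rewrite /cut [RHS]exchange_big /=; rewrite (eq_bigl _ _ QP).
by apply: eq_bigr => i _; apply: eq_big => [j|j _]; [rewrite QP negbK|rewrite Ws].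
Qed.

Lemma circuit_sum (c : seq (gface N * arc N)) : dual_circuit E c ->
  count (@in_gamma N) (unzip2 c) = 2%N -> exists a a' : 'I_N,
  [/\ (a < a')%N, forall e, (e \in unzip2 c) = (e \in E) && joins a a' e
    & \sum_(e <- unzip2 c) theta e = cut (pair_weight theta) (fun k => a < k <= a')%N].
Proof.
move=> dc c2; have [a [a' [aa' _ _ ce]]] := circuit_edges N4 E_gamma E_diagonal dc c2.
exists a, a'; split=> //; rewrite -cut_pair_weight big_uniq; last by case/and3P: dc.
rewrite big_mkcond [RHS]big_mkcond; apply: eq_bigr => e _.
rewrite ce; have [eE|eE] := boolP (e \in E); first by [].
by rewrite theta_supp // if_same.
Qed.

Lemma joins_side (a a' k : 'I_N) : (a < a')%N -> joins a a' (inl k) = (k == a) || (k == a').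
Proof.
move=> aa'; rewrite (@joins_set2 N a a' k (ordS k)) // ordSE -!(inj_eq (@ord_inj _)).
have := ltn_ord k; have := ltn_ord a'; clear -aa'.
by case: (k.+1 =P N); lia.
Qed.

Lemma joins_star (a a' i : 'I_N) : (a < a')%N ->
  ((a' = a.+1 :> nat) /\ i = a') \/ (a = 0 :> nat /\ a'.+1 = N /\ i = a) ->
  forall e, e \in E -> joins a a' e = (i \in ends e).
Proof.
move=> aa' h e /ends_two[x [y [exy xy]]]; rewrite (joins_set2 a a' exy) exy !inE.
have := ltn_ord x; have := ltn_ord y; move: xy.
by rewrite -!(inj_eq (@ord_inj _)); case: h => [[h1 ->]|[h1 [h2 ->]]]; move: aa' h1; try move: h2; clear; lia.
Qed.

(** A circuit as in (iii) is the cut along an arc. If the arc or its complement is a single vertex,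
    the circuit bounds the dual face of that vertex; otherwise the cut is positive by assumption. *)
Lemma angle_cell_of_cuts : (forall i, \sum_(j | j != i) pair_weight theta i j = 0) ->
  (forall p q : 'I_N, (p < q)%N -> (q - p < N - 2)%N ->
    0 < cut (pair_weight theta) (fun k => p <= k <= q)%N) ->
  angle_cell R E theta.
Proof.
move=> st cp; split=> //; first by move=> i; rewrite star_pair_weight.
move=> c dc nb c2; have [a [a' [aa' ce ->]]] := circuit_sum dc c2.
have [aN a'N] := (ltn_ord a, ltn_ord a').
have a1N : (a.+1 < N)%N by apply: leq_ltn_trans aa' _.
have nstar i : ~ (((a' = a.+1 :> nat) /\ i = a') \/ (a = 0 :> nat /\ a'.+1 = N /\ i = a)).
  move=> h; case/negP: nb; apply/existsP; exists i; apply/eqP/setP => e.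
  rewrite !inE ce; have [eE|//] := boolP (e \in E).
  by rewrite (joins_star aa' h).
apply: (cp (Ordinal a1N) a'); rewrite /=.
  rewrite ltn_neqAle aa' andbT; apply/eqP => h; apply: (nstar a'); left; split=> //.
rewrite ltn_neqAle; apply/andP; split; last by clear -aa' a'N; lia.
apply/eqP => h; apply: (nstar a); right; clear -h aa' a'N; split; [lia|split=> //; lia].
Qed.

(** Every cut along an arc comes from a circuit, since [exists_circuit] passes through any two
    sides. When the arc and its complement have at least two vertices, no vertex lies on both of
    these sides, so the circuit bounds no dual face. *)
Lemma cuts_of_angle_cell : angle_cell R E theta ->
  (forall i, \sum_(j | j != i) pair_weight theta i j = 0) /\
  (forall p q : 'I_N, (p < q)%N -> (q - p < N - 2)%N ->
    0 < cut (pair_weight theta) (fun k => p <= k <= q)%N).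
Proof.
move=> [_ _ st ci]; split=> [i|]; first by rewrite -star_pair_weight.
have main (a a' : 'I_N) : (a.+1 < a')%N -> (a' - a < N.-1)%N ->
    0 < cut (pair_weight theta) (fun k => a < k <= a')%N.
  move=> aa' aN; have lt : (a < a')%N := ltnW aa'.
  have na : a != a' by rewrite -(inj_eq (@ord_inj _)) ltn_eqF.
  have [c [dc c2 ac a'c]] := exists_circuit N4 E_gamma E_diagonal E_noncrossing na.
  have [b [b' [bb' ce cs]]] := circuit_sum dc c2.
  have [bE b'E] : b = a /\ b' = a'.
    move: ac a'c; rewrite !ce !E_gamma /= !joins_side // -!(inj_eq (@ord_inj _)) => h1 h2.
    by split; apply: ord_inj; clear -h1 h2 bb' lt; lia.
  rewrite {b}bE {b'}b'E in bb' ce cs; rewrite -cs; apply: ci => //.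
  apply/negP => /existsP[i /eqP/setP se].
  have sE (k : 'I_N) : (k == a) || (k == a') = (i == k) || (i == ordS k).
    by have := se (inl k); rewrite !inE ce E_gamma /= joins_side // => ->; rewrite !inE.
  have := sE i; rewrite eqxx /= => /esym ia; have := sE (ord_pred i); rewrite ord_predK eqxx orbT.
  have := ordSE (ord_pred i); rewrite ord_predK.
  move: (ord_pred i) ia => p ia ip pa; have := ltn_ord p; move: ia pa ip.
  rewrite -!(inj_eq (@ord_inj _)) => ia pa; clear -ia pa aa' aN N4.
  have a'N := ltn_ord a'; case: (p.+1 =P N); lia.
move=> p q pq pqN; have [qN pN] := (ltn_ord q, ltn_ord p).
(* The arcs [a < k <= a'] never contain the vertex 0, so an arc that starts at 0 is replaced by its
   complement. *)
have [p0|p0] := posnP p.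
  have nN : (N.-1 < N)%N by lia.
  rewrite -(@cut_compl _ _ (fun k => q < k <= (Ordinal nN : 'I_N))%N (pair_weight_sym theta)).
    by apply: main => /=; clear -p0 pq pqN qN; lia.
  by move=> k /=; have := ltn_ord k; clear -p0; lia.
have p1N : (p.-1 < N)%N by lia.
rewrite (_ : (fun k : 'I_N => _) = (fun k : 'I_N => (Ordinal p1N : 'I_N) < k <= q)%N).
  by apply: main => /=; clear -p0 pq pqN qN; lia.
by apply/funext => k /=; rewrite prednK.
Qed.

Hypothesis theta_star : forall i, \sum_(j | j != i) pair_weight theta i j = 0.
Hypothesis theta_cut : forall p q : 'I_N, (p < q)%N -> (q - p < N - 2)%N ->
  0 < cut (pair_weight theta) (fun k => p <= k <= q)%N.

Lemma connect_arc (X : {set 'I_N}) (x : 'I_N) (t : nat) :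
  (forall s, (s <= t)%N -> iter s (@ordS _) x \notin X) ->
  connect (fun i j => [&& i \notin X, j \notin X & adjacent E i j]) x (iter t (@ordS _) x).
Proof.
elim: t => [|t IH] h; first exact: connect0.
apply: connect_trans (IH _) _; first by move=> s st; apply: h; exact: leqW.
apply: connect1; rewrite (h t) // (h t.+1) //=.
by apply/exists_inP; exists (inl (iter t (@ordS _) x)).
Qed.

Lemma connect_cyc (X : {set 'I_N}) (x y : 'I_N) : x \notin X -> y \notin X ->
  (forall k : 'I_N, cyc x k y -> k \notin X) ->
  connect (fun i j => [&& i \notin X, j \notin X & adjacent E i j]) x y.
Proof.
move=> xX yX h; have [->|xy] := eqVneq x y; first exact: connect0.
have [t tN yE] := iter_ordS_onto xy; rewrite yE; apply: connect_arc => -[|s] st //.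
have [->|ne] := eqVneq s t; first by rewrite -yE.
apply: h; rewrite yE cyc_iter //; first by rewrite ltn_neqAle ne.
by apply: leq_ltn_trans tN.
Qed.

(** Two removed vertices that might separate [x] from [y] cut the cycle into two arcs, and
    [crossing_diagonal] gives an edge joining these arcs. *)
Lemma graph_three_connected : three_connected E.
Proof.
rewrite /three_connected N4 /=; apply/forallP => X; apply/implyP => X3.
apply/forallP => x; apply/forallP => y; apply/implyP => /andP[xX yX].
set r := fun i j => _.
have r_sym : connect_sym r.
  apply: sym_connect_sym => i j; rewrite /r andbCA; congr [&& _, _ & _].
  by apply: eq_existsb => e; rewrite finset.setUC.
have [/existsP[u /andP[uX cu]]|/existsPn h] := boolP [exists u in X, cyc x u y]; last first.
  by apply: connect_cyc => // k ck; apply/negP => kX; have := h k; rewrite kX ck.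
have [/existsP[v /andP[vX cv]]|/existsPn h] := boolP [exists v in X, cyc y v x]; last first.
  rewrite r_sym; apply: connect_cyc => // k ck; apply/negP => kX; have := h k; rewrite kX ck.
  by [].
have uv : u != v by apply/eqP => uv; rewrite uv in cu; move: cu cv; rewrite /cyc; clear; lia.
have XE k : k \in X -> (k == u) || (k == v).
  move=> kX; apply/negPn/negP; rewrite negb_or => /andP[ku kv].
  have : (#|[set k; u; v]%SET| <= #|X|)%N.
    apply: subset_leq_card; apply/fintype.subsetP => w; rewrite !inE => /orP[/orP[]|] /eqP-> //.
  by move/leq_ltn_trans/(_ X3); rewrite -finset.setUA cardsU1 cards2 !inE negb_or ku kv uv.
have ad : ~~ adjacent_ord u v.
  rewrite /adjacent_ord -!(inj_eq (@ord_inj _)) !ordSE.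
  have := (ltn_ord u, ltn_ord v, ltn_ord x, ltn_ord y).
  move: cu cv; rewrite /cyc; clear -N4 => cu cv [[[uN vN] xN] yN].
  apply/negP => /orP[]/eqP; [case: (u.+1 =P N)|case: (v.+1 =P N)]; lia.
have [k [l [ck cl W]]] : exists k l : 'I_N, [/\ cyc u k v, cyc v l u & 0 < pair_weight theta k l].
  have [luv|lvu] := ltnP u v.
    have [k [l [h1 h2 h3]]] := crossing_diagonal (pair_weight_sym theta) theta_star theta_cut luv ad.
    by exists k, l; split=> //; move: h1 h2; rewrite /cyc; clear -luv; lia.
  have lt : (v < u)%N by rewrite ltn_neqAle lvu andbT eq_sym (inj_eq (@ord_inj _)).
  rewrite adjacent_ord_sym in ad.
  have [k [l [h1 h2 h3]]] := crossing_diagonal (pair_weight_sym theta) theta_star theta_cut lt ad.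
  exists l, k; rewrite pair_weight_sym; split=> //; move: h1 h2; rewrite /cyc; clear -lt; lia.
have kX : k \notin X.
  apply/negP => /XE; rewrite -!(inj_eq (@ord_inj _)); move: ck; rewrite /cyc; clear; lia.
have lX : l \notin X.
  apply/negP => /XE; rewrite -!(inj_eq (@ord_inj _)); move: cl; rewrite /cyc; clear; lia.
have rkl : connect r k l.
  apply: connect1; rewrite /r kX lX /=; apply/exists_inP.
  have [e /andP[eE e0]] : exists e, (ends e == [set k; l]%SET) && (theta e != 0).
    apply/existsP; apply: contraT => /existsPn h; move: W; rewrite /pair_weight big1 ?ltxx // => e ee.
    by apply/eqP; have := h e; rewrite ee negbK.
  by exists e => //; apply: contraNT e0 => /theta_supp->.
have arc1 (w w' : 'I_N) : w \notin X -> w' \notin X -> cyc v w u || cyc v w' u ->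
  cyc v w u -> cyc v w' u -> connect r w w'.
  move=> wX w'X _ cw cw'.
  have [->|ne] := eqVneq w w'; first exact: connect0.
  have [c1|c1] := boolP (cyc v w w').
    apply: connect_cyc => // t ct; apply/negP => /XE; rewrite -!(inj_eq (@ord_inj _)).
    move: cw cw' c1 ct; rewrite /cyc; clear; lia.
  rewrite r_sym; apply: connect_cyc => // t ct; apply/negP => /XE; rewrite -!(inj_eq (@ord_inj _)).
  move: ne cw cw' c1 ct; rewrite /cyc -!(inj_eq (@ord_inj _)); clear; lia.
have arc2 (w w' : 'I_N) : w \notin X -> w' \notin X -> cyc u w v -> cyc u w' v -> connect r w w'.
  move=> wX w'X cw cw'.
  have [->|ne] := eqVneq w w'; first exact: connect0.
  have [c1|c1] := boolP (cyc u w w').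
    apply: connect_cyc => // t ct; apply/negP => /XE; rewrite -!(inj_eq (@ord_inj _)).
    move: cw cw' c1 ct; rewrite /cyc; clear; lia.
  rewrite r_sym; apply: connect_cyc => // t ct; apply/negP => /XE; rewrite -!(inj_eq (@ord_inj _)).
  move: ne cw cw' c1 ct; rewrite /cyc -!(inj_eq (@ord_inj _)); clear; lia.
have cx : cyc v x u by move: cu cv; rewrite /cyc; clear; lia.
have cy : cyc u y v by move: cu cv; rewrite /cyc; clear; lia.
apply: (connect_trans (arc1 x l xX lX _ cx cl)); first by rewrite cx.
apply: (connect_trans (y := k)); first by rewrite r_sym.
exact: arc2.
Qed.

End Graph.
End PairWeights.

(** * Reconstructing the heights from the angles *)

Section Balance.
Variables (R : realType) (N : nat).
Hypothesis N4 : (3 < N)%N.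
Let N3 : (2 < N)%N := ltnW N4.
Variable z : 'M[R]_(N, 3).
Hypothesis cz : is_config z.
Implicit Types (W : 'I_N -> 'I_N -> R) (h : 'I_N -> R).

Lemma fv_sum (I : Type) (r : seq I) (P : pred I) (F : I -> 'rV[R]_3) k :
  fv z (\sum_(i <- r | P i) F i) k = \sum_(i <- r | P i) fv z (F i) k.
Proof.
apply: (big_morph (fun f => fv z f k)) => [f g|]; first exact: fvD.
by rewrite /fv !mxE; ring.
Qed.

Lemma balanced_br W i k : balanced z W -> \sum_j W i j / ch z i j * br z i j k = 0.
Proof.
move=> /(_ i)/(congr1 (fun f => fv z f k)); rewrite fv_sum.
under eq_bigr => j _ do rewrite fvZ fv_cross.
by move=> ->; rewrite /fv !mxE; ring.
Qed.

(** Differentiate the balance at [i] along the circle: the functional [g] takes the value [ch z i j]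
    on [cross z i j], which cancels the denominators. *)
Lemma balanced_star W i : balanced z W -> \sum_(j | j != i) W i j = 0.
Proof.
move=> /(_ i) bW; pose g (f : 'rV[R]_3) := f 0 0 * z i 1 - f 0 1 * z i 0.
have g0 : g 0 = 0 by rewrite /g !mxE; ring.
have gs : g (\sum_j (W i j / ch z i j) *: cross z i j) =
    \sum_j W i j / ch z i j * g (cross z i j).
  rewrite (big_morph g (id1 := 0) (op1 := +%R)) //.
    by apply: eq_bigr => j _; rewrite /g !mxE; ring.
  by move=> f f'; rewrite /g !mxE; ring.
move: g0; rewrite -bW gs => e; rewrite big_mkcond -[RHS]e; apply: eq_bigr => j _.
case: eqP => [->|/eqP ji] /=; first by rewrite /g !mxE /=; ring.
rewrite (_ : g (cross z i j) = ch z i j); last first.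
  by rewrite /g !mxE /= /ch; have := cz.1 i; lra.
by rewrite divfK // lt0r_neq0 // ch_gt0 // eq_sym.
Qed.

(** Evaluating the balance at the predecessor of [i] kills the term of the other side at [i], so the
    diagonals at [i] determine the remaining side. *)
Lemma balanced_side_unique (W W' : 'I_N -> 'I_N -> R) (i : 'I_N) : balanced z W -> balanced z W' ->
  (forall j, i != j -> ~~ adjacent_ord i j -> W i j = W' i j) ->
  W i (ordS i) = W' i (ordS i).
Proof.
move=> bW bW' e; have iS := ordS_neq N4 i.
have iP : ord_pred i != i by have := ordS_neq N4 (ord_pred i); rewrite ord_predK.
have iPS : ordS i != ord_pred i.
  apply/eqP => /(congr1 (@nat_of_ord _)); rewrite ordSE.
  have := ordSE (ord_pred i); rewrite ord_predK; have := ltn_ord i; clear -N4.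
  move: (nat_of_ord (ord_pred i)) => p; case: (i.+1 =P N); case: (p.+1 =P N); lia.
have b1 := balanced_br i (ord_pred i) bW; have b2 := balanced_br i (ord_pred i) bW'.
have := congr2 (fun x y => x - y) b1 b2; rewrite subrr -sumrB (bigD1 (ordS i)) 1?eq_sym //= big1.
  move/eqP; rewrite addr0 -mulrBl -mulrBl !mulf_eq0 invr_eq0.
  rewrite [ch _ _ _ == 0]gt_eqF ?ch_gt0 // [br _ _ _ _ == 0](negbTE (br_neq0 cz _ _ _)) //.
    by rewrite !orbF subr_eq0 => /eqP.
  by rewrite eq_sym.
move=> j jS; have [->|ji] := eqVneq j i; first by rewrite br_iij !mulr0 subrr.
have [->|jP] := eqVneq j (ord_pred i); first by rewrite br_ijj !mulr0 subrr.
rewrite e ?subrr // 1?eq_sym // /adjacent_ord negb_or jS /=.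
by apply: contra jP => /eqP->; rewrite ordSK.
Qed.

Lemma top_angle_adj h i j : adjacent_ord i j -> top_angle z h i j = 0.
Proof. by rewrite /top_angle => ->; rewrite orbT. Qed.

Lemma pair_weight_dihedral i j : i != j ->
  pair_weight (dihedral z) i j = angle z (vertex_height z true) i j.
Proof.
move=> ij; rewrite pair_weightE // !dihedral_pair // /angle.
have ad := @top_angle_adj _ i j; rewrite /adjacent_ord in ad.
case: (j =P ordS i) ad => [_|_] ad; first by rewrite !ad // !addr0.
case: (i =P ordS j) ad => [_|_] ad; first by rewrite !ad // !addr0.
by rewrite add0r.
Qed.

Lemma balanced_pair_weight : balanced z (pair_weight (dihedral z)).
Proof.
move=> i; rewrite -[RHS](balanced_angle cz N4 (vertex_height z true) i).
apply: eq_bigr => j _; have [->|ij] := eqVneq i j; last by rewrite pair_weight_dihedral.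
have -> : cross z j j = 0 by apply: row3P; rewrite !mxE /=; ring.
by rewrite !scaler0.
Qed.

Lemma config_angle_cell : ~ coplanar z (vertex_height z true) ->
  is_graph (skeleton z) /\ angle_cell R (skeleton z) (dihedral z).
Proof.
move=> nc; have Ed := skeleton_diagonal N4 cz nc.
have Eg i : (inl i : arc N) \in skeleton z by exact: skeleton_side.
have Enc b S T : (inr (b, S) : arc N) \in skeleton z ->
    (inr (b, T) : arc N) \in skeleton z -> ~~ crossing S T.
  by rewrite !in_skeleton //; exact: dihedral_noncrossing.
have supp := (dihedral_anglesP N4 cz nc).1.
have sgn := dihedral_sign N4 cz nc.
have bal := balanced_pair_weight.
have st i := balanced_star i bal.
have cuts := cut_gt0 N4 cz (pair_weight_sym (dihedral z)) bal
  (pair_weight_ge0 supp sgn) (pair_weight_side_lt0 N4 Eg Ed supp sgn).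
split; last exact: angle_cell_of_cuts.
apply/and4P; split.
- exact/forallP.
- by apply/forallP => b; apply/forallP => D; apply/implyP; exact: Ed.
- apply/forallP => b; apply/forallP => D; apply/forallP => T; apply/implyP => /andP[].
  exact: Enc.
- exact: (graph_three_connected N4 Eg supp st cuts).
Qed.

Lemma top_angle_ext (z' : 'M[R]_(N, 3)) h h' (i j : 'I_N) :
  (forall l r : 'I_N, cyc i l j -> cyc i j r ->
     slope_drop z h i j l r = slope_drop z' h' i j l r) ->
  top_angle z h i j = top_angle z' h' i j.
Proof.
move=> e; rewrite /top_angle; case: (boolP (i == j)) => // ij.
case: (boolP (adjacent_ord i j)) => //= ad.
have /andP[c1 c2] := cyc_diagonal N4 ij ad.
by congr Num.max; rewrite e //; apply: eq_bigr => p /andP[h1 h2]; rewrite e.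
Qed.

Lemma slope_drop_lin h f (i j l r : 'I_N) : cyc i l j -> cyc i j r ->
  slope_drop z (fun k => h k + fv z f k) i j l r = slope_drop z h i j l r.
Proof.
move=> hl hr; rewrite !slope_dropE //; congr (_ * _ / _).
by rewrite /quad /fv /br; ring.
Qed.

Lemma top_angle_lin h f i j :
  top_angle z (fun k => h k + fv z f k) i j = top_angle z h i j.
Proof. by apply: top_angle_ext => l r hl hr; rewrite slope_drop_lin. Qed.

End Balance.

Section Roof.
Variables (R : realType) (N : nat).
Hypothesis N4 : (3 < N)%N.
Let N3 : (2 < N)%N := ltnW N4.
Variable z : 'M[R]_(N, 3).
Hypothesis cz : is_config z.
Implicit Types (h : 'I_N -> R).

(** The unit conormal of the geodesic from [p] to [q], evaluated at the vertex [k]. *)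
Definition bend (p q k : 'I_N) : R := br z p q k / ch z p q.

Definition crease (p q k : 'I_N) : R := Num.max 0 (bend p q k).

(* The roof is flat away from the diagonals and bends down by theta along each of
   them. *)
Definition roof (theta : weights R N) (b : bool) (k : 'I_N) : R :=
  - \sum_(p : 'I_N * 'I_N | (p.1 < p.2)%N)
      theta (inr (b, [set p.1; p.2]%SET)) * crease p.1 p.2 k.

Lemma bend_anti (p q k : 'I_N) : bend q p k = - bend p q k.
Proof. by rewrite /bend -mulNr [ch _ _ _]ch_sym; congr (_ / _); rewrite /br; ring. Qed.

Lemma bend_sgr (p q k : 'I_N) : p != q -> (0 < bend p q k) = cyc p q k.
Proof. by move=> pq; rewrite pmulr_lgt0 ?br_gt0P // invr_gt0 ch_gt0. Qed.

Lemma bend_eq0 (p q k : 'I_N) : p != q -> (bend p q k == 0) = (k == p) || (k == q).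
Proof.
move=> pq; rewrite mulf_eq0 invr_eq0 [ch _ _ _ == 0]gt_eqF ?ch_gt0 // orbF.
have [->|kp] := eqVneq k p; first by rewrite br_iji eqxx.
have [->|kq] := eqVneq k q; first by rewrite br_ijj eqxx.
by apply/negbTE; rewrite br_neq0 // eq_sym.
Qed.

Lemma bend_sum0 (p q : 'I_N) (i l j r : 'I_N) : quad z (bend p q) i l j r = 0.
Proof. by rewrite /quad /bend /br; ring. Qed.

(** The two creases differ by the linear function [bend p q], on which [quad] vanishes. *)
Lemma crease_quad_sym (p q i l j r : 'I_N) :
  quad z (crease p q) i l j r = quad z (crease q p) i l j r.
Proof.
have e k : crease p q k = crease q p k + bend p q k.
  rewrite /crease (bend_anti p q); move: (bend p q k) => x.
  by case: (lerP 0 x); case: (lerP 0 (- x)); lra.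
rewrite -[RHS]addr0 -(bend_sum0 p q i l j r) /quad !e; ring.
Qed.

Lemma bend_uncrossed (p q x y : 'I_N) : p != q -> x != y ->
  ~~ crossing [set p; q]%SET [set x; y]%SET -> 0 <= bend p q x * bend p q y.
Proof.
move=> pq xy; rewrite (crossingP N4) // negb_or => /andP[h1 h2].
rewrite leNgt; apply/negP => lt.
have [x0 y0] : bend p q x != 0 /\ bend p q y != 0.
  by split; apply: contraTneq lt => ->; rewrite ?mul0r ?mulr0 ltxx.
have s (k : 'I_N) : (bend p q k < 0) = cyc p k q.
  by rewrite -oppr_gt0 -bend_anti bend_sgr 1?eq_sym // /cyc; clear; lia.
have [xn|xn] := boolP (bend p q x < 0).
  have y1 : 0 < bend p q y by rewrite -(nmulr_rlt0 _ xn).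
  by move: h1; rewrite -s // xn -bend_sgr // y1.
have x1 : 0 < bend p q x by rewrite lt_def x0 leNgt.
have y1 : bend p q y < 0 by rewrite -(pmulr_rlt0 _ x1).
by move: h2; rewrite -s // y1 -bend_sgr // x1.
Qed.

(** After exchanging [p] and [q] if needed, the crease is 0 at [i] and [j] and nonnegative at [l]
    and [r]. *)
Lemma crease_quad_le0 (p q i l j r : 'I_N) : cyc i l j -> cyc i j r ->
  p != q -> ~~ crossing [set p; q]%SET [set i; j]%SET ->
  quad z (crease p q) i l j r <= 0.
Proof.
move=> hl hr pq nc; have [ij _ _] := cycP hr.
have b1 := br_gt0 cz hl; have b2 := br_gt0 cz hr.
suff main a b : 0 <= bend a b i * bend a b j -> bend a b i <= 0 -> bend a b j <= 0 ->
    quad z (crease a b) i l j r <= 0.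
  have bb := bend_uncrossed pq ij nc.
  have [i0|i0] := lerP (bend p q i) 0; have [j0|j0] := lerP (bend p q j) 0.
  - exact: main.
  - rewrite crease_quad_sym; apply: main; rewrite (bend_anti p q) ?(bend_anti p q j) ?mulrNN //; last lra.
    by have : bend p q i = 0; [nra|lra].
  - rewrite crease_quad_sym; apply: main; rewrite (bend_anti p q) ?(bend_anti p q j) ?mulrNN //; first lra.
    by have : bend p q j = 0; [nra|lra].
  - by rewrite crease_quad_sym; apply: main; rewrite (bend_anti p q) ?(bend_anti p q j) ?mulrNN //; lra.
move=> _ i0 j0; rewrite /quad /crease (max_idPl i0) (max_idPl j0) !mulr0 add0r sub0r.
have h1 : 0 <= br z i j r * Num.max 0 (bend a b l) by apply: mulr_ge0; [exact: ltW|rewrite le_max lexx].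
have h2 : 0 <= br z i l j * Num.max 0 (bend a b r) by apply: mulr_ge0; [exact: ltW|rewrite le_max lexx].
lra.
Qed.

Lemma crease_quad_self (i l j r : 'I_N) : cyc i l j -> cyc i j r ->
  quad z (crease i j) i l j r = - (br z i l j * br z i j r / ch z i j).
Proof.
move=> hl hr; have [ij jr ir] := cycP hr.
have i0 : bend i j i = 0 by rewrite /bend br_iji mul0r.
have j0 : bend i j j = 0 by rewrite /bend br_ijj mul0r.
have l0 : bend i j l <= 0.
  rewrite /bend pmulr_lle0 ?invr_gt0 ?ch_gt0 //; exact: ltW (br_lt0 cz hl).
have r0 : 0 <= bend i j r by rewrite ltW // bend_sgr.
rewrite /quad /crease i0 j0 (max_idPl l0) (max_idPr r0) maxxx /bend; ring.
Qed.

(** The four vertices are weakly on one side of the crease, where it is linear. That [i] or [j] lies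
    off the crease makes the pairwise sign conditions consistent. *)
Lemma crease_quad_eq0 (p q i l j r : 'I_N) : p != q -> [set p; q]%SET <> [set i; j]%SET ->
  i != j ->
  [/\ 0 <= bend p q i * bend p q j, 0 <= bend p q i * bend p q l, 0 <= bend p q l * bend p q j &
   0 <= bend p q i * bend p q r /\ 0 <= bend p q r * bend p q j] ->
  quad z (crease p q) i l j r = 0.
Proof.
move=> pq e ij [hij hil hlj [hir hrj]].
have e' : ~ ((i == p) || (i == q)) \/ ~ ((j == p) || (j == q)).
  have [/orP i1|] := boolP ((i == p) || (i == q)); last by left.
  have [/orP j1|] := boolP ((j == p) || (j == q)); last by right.
  case: i1 j1 => /eqP e1 [] /eqP e2; try by rewrite e1 e2 eqxx in ij.
    by case: e; rewrite e1 e2.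
  by case: e; rewrite e1 e2 finset.setUC.
rewrite -!bend_eq0 // in e'.
suff main a b : bend a b i <= 0 -> bend a b j <= 0 -> bend a b l <= 0 -> bend a b r <= 0 ->
    quad z (crease a b) i l j r = 0.
  have [|] : [/\ bend p q i <= 0, bend p q j <= 0, bend p q l <= 0 & bend p q r <= 0] \/
    [/\ 0 <= bend p q i, 0 <= bend p q j, 0 <= bend p q l & 0 <= bend p q r].
  - move: (bend p q i) (bend p q j) (bend p q l) (bend p q r) hij hil hlj hir hrj e' => x y u v h1 h2 h3 h4 h5.
    move=> e'; have {e'} : x < 0 \/ 0 < x \/ y < 0 \/ 0 < y.
      by case: e' => /negP; rewrite neq_lt => /orP[] ?; tauto.
    case=> [x0|[x0|[x0|x0]]]; [left|right|left|right]; split; nra.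
  - by move=> [h1 h2 h3 h4]; apply: main.
  - by move=> [h1 h2 h3 h4]; rewrite crease_quad_sym; apply: main; rewrite (bend_anti p q) oppr_le0.
move=> i0 j0 l0 r0; rewrite /quad /crease (max_idPl i0) (max_idPl j0) (max_idPl l0) (max_idPl r0); ring.
Qed.


Lemma quad_sum (I : finType) (P : pred I) (F : I -> 'I_N -> R) i l j r :
  quad z (fun k => \sum_(p | P p) F p k) i l j r = \sum_(p | P p) quad z (F p) i l j r.
Proof. by rewrite /quad !mulr_sumr -big_split /= -!sumrB. Qed.

Section Graph.
Variables (E : {set arc N}) (theta : weights R N).
Hypothesis E_diagonal : forall b S, (inr (b, S) : arc N) \in E -> is_diagonal S.
Hypothesis E_noncrossing : forall b S T, (inr (b, S) : arc N) \in E ->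
  (inr (b, T) : arc N) \in E -> ~~ crossing S T.
Hypothesis theta_supp : forall e, e \notin E -> theta e = 0.
Hypothesis theta_sign : forall e, e \in E -> if in_gamma e then theta e < 0 else 0 < theta e.

Let pair_of (i j : 'I_N) := if (i < j)%N then (i, j) else (j, i).

Lemma quad_roof b (i l j r : 'I_N) : cyc i l j -> cyc i j r ->
  quad z (roof theta b) i l j r =
  theta (inr (b, [set i; j]%SET)) * (br z i l j * br z i j r / ch z i j) +
  \sum_(p : 'I_N * 'I_N | (p.1 < p.2)%N && (p != pair_of i j))
    theta (inr (b, [set p.1; p.2]%SET)) * - quad z (crease p.1 p.2) i l j r.
Proof.
move=> hl hr; have [ij _ _] := cycP hr.
have -> : roof theta b = fun k => \sum_(p : 'I_N * 'I_N | (p.1 < p.2)%N)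
    theta (inr (b, [set p.1; p.2]%SET)) * - crease p.1 p.2 k.
  by apply/funext => k; rewrite /roof -sumrN; apply: eq_bigr => p _; rewrite mulrN.
have pl : ((pair_of i j).1 < (pair_of i j).2)%N.
  rewrite /pair_of; case: ifP => //= /negbT; rewrite -leqNgt ltn_neqAle => ->.
  by rewrite andbT eq_sym (inj_eq (@ord_inj _)).
rewrite quad_sum (bigD1 (pair_of i j)) //=; congr (_ + _).
  transitivity (theta (inr (b, [set i; j]%SET)) * - quad z (crease i j) i l j r).
    rewrite /pair_of; case: ifP => _ /=; first by rewrite /quad; ring.
    by rewrite finset.setUC [in RHS]crease_quad_sym /quad; ring.
  by rewrite crease_quad_self // opprK.
by apply: eq_bigr => p _; rewrite /quad; ring.
Qed.

Lemma roof_pair (i j : 'I_N) (p : 'I_N * 'I_N) : (p.1 < p.2)%N -> p != pair_of i j ->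
  [set p.1; p.2]%SET <> [set i; j]%SET.
Proof.
case: p => x y /= xy; apply: contra_neq_not => /set2_inj; rewrite /pair_of.
case/orP=> /andP[/eqP e1 /eqP e2]; rewrite -e1 -e2 ?xy //.
by rewrite ltnNge (ltnW xy).
Qed.

(** By [crease_quad_le0], the creases along the other diagonals can only increase the drop. *)
Lemma roof_drop_ge b (i l j r : 'I_N) : cyc i l j -> cyc i j r -> uncrossed E b i j ->
  theta (inr (b, [set i; j]%SET)) <= slope_drop z (roof theta b) i j l r.
Proof.
move=> hl hr ucr; have [ij _ _] := cycP hr.
have [[b1 b2] c0] := (br_gt0 cz hl, br_gt0 cz hr, ch_gt0 cz N3 ij).
rewrite slope_dropE // quad_roof //; set X := \sum_(p | _) _.
suff X0 : 0 <= X.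
  set t := theta _; rewrite [leRHS](_ : _ = t + ch z i j * X / (br z i l j * br z i j r)).
    by rewrite lerDl; apply: divr_ge0; apply: mulr_ge0 => //; exact: ltW.
  by field; rewrite !lt0r_neq0.
apply: sumr_ge0 => p /andP[pl pn].
have [pE|pE] := boolP ((inr (b, [set p.1; p.2]%SET) : arc N) \in E); last first.
  by rewrite theta_supp // mul0r.
rewrite mulr_ge0 ?(ltW (theta_sign pE)) // oppr_ge0 crease_quad_le0 //; last exact: ucr.
by rewrite -(inj_eq (@ord_inj _)) ltn_eqF.
Qed.

(** When [l] and [r] complete the segment to triangles of uncrossed segments, no other diagonal
    separates the four vertices, so only the crease along the segment itself contributes. *)
Lemma roof_drop_eq b (i l j r : 'I_N) : cyc i l j -> cyc i j r -> uncrossed E b i j ->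
  uncrossed E b i l -> uncrossed E b l j -> uncrossed E b i r -> uncrossed E b r j ->
  slope_drop z (roof theta b) i j l r = theta (inr (b, [set i; j]%SET)).
Proof.
move=> hl hr uij uil ulj uir urj; have [ij jr ir] := cycP hr; have [il lj _] := cycP hl.
have [[b1 b2] c0] := (br_gt0 cz hl, br_gt0 cz hr, ch_gt0 cz N3 ij).
rewrite slope_dropE // quad_roof // big1 ?addr0.
  by field; rewrite !lt0r_neq0.
move=> p /andP[pl pn].
have [pE|pE] := boolP ((inr (b, [set p.1; p.2]%SET) : arc N) \in E); last first.
  by rewrite theta_supp // mul0r.
have pq : p.1 != p.2 by rewrite -(inj_eq (@ord_inj _)) ltn_eqF.
rewrite crease_quad_eq0 ?oppr0 ?mulr0 //; first exact: roof_pair.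
have bu x y : x != y -> uncrossed E b x y -> 0 <= bend p.1 p.2 x * bend p.1 p.2 y.
  by move=> xy uxy; apply: bend_uncrossed => //; exact: uxy.
by split; [| | |split]; apply: bu; rewrite // eq_sym.
Qed.

(** For an uncrossed segment, [roof_drop_ge] and [roof_drop_eq] at the triangles of
    [uncrossed_third] give both bounds. A crossed segment meets a diagonal along which the roof
    bends, and two crossing segments cannot both bend. *)
Lemma top_angle_roof b (i j : 'I_N) : i != j ->
  top_angle z (roof theta b) i j = theta (inr (b, [set i; j]%SET)).
Proof.
have th0 (x y : 'I_N) : 0 <= theta (inr (b, [set x; y]%SET)).
  have [/theta_sign/ltW//|/theta_supp->] := boolP ((inr (b, [set x; y]%SET) : arc N) \in E).
  exact: lexx.
have Ed := E_diagonal (b := b); have Enc := E_noncrossing (b := b).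
have main (x y : 'I_N) : x != y -> ~~ adjacent_ord x y -> uncrossed E b x y ->
    top_angle z (roof theta b) x y = theta (inr (b, [set x; y]%SET)).
  move=> xy ad uxy; have /andP[c1 c2] := cyc_diagonal N4 xy ad.
  have c3 : cyc y (ordS y) x by move: c2; rewrite /cyc; clear; lia.
  have [l [hl uxl uly]] := uncrossed_third N4 Ed Enc uxy c1.
  have [r [hr uyr urx]] := uncrossed_third N4 Ed Enc (uncrossed_sym uxy) c3.
  have hr' : cyc x y r by move: hr; rewrite /cyc; clear; lia.
  have de := roof_drop_eq hl hr' uxy uxl uly (uncrossed_sym urx) (uncrossed_sym uyr).
  have [p0 pl [l' [r' [hl' hr'' e]]]] := top_angleP z N4 (roof theta b) xy ad.
  apply/eqP; rewrite eq_le; apply/andP; split.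
    rewrite -de; have [p|p] := ltP 0 (top_angle z (roof theta b) x y); first exact: pl.
    by apply: (le_trans p); rewrite de th0.
  have g := roof_drop_ge hl' hr'' uxy; case: ifP e => [_ ->//|_ e].
  exact: le_trans g (le_trans e p0).
have adE (x y : 'I_N) : (inr (b, [set x; y]%SET) : arc N) \in E -> ~~ adjacent_ord x y.
  move=> /E_diagonal/is_diagonalP[u [v [/set2_inj/orP[]/andP[/eqP-> /eqP->] _]]] //.
  by rewrite adjacent_ord_sym.
move=> ij; have [ad|ad] := boolP (adjacent_ord i j).
  by rewrite top_angle_adj // theta_supp //; apply: contraL ad; exact: adE.
have [u|] := pselect (uncrossed E b i j); first exact: main.
move=> /existsNP[D /not_implyP[DE /negP]]; rewrite negbK => cr.
have [k [l [DKL kl c1 c2]]] := crossing_cases N4 Ed DE cr.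
have nE : (inr (b, [set i; j]%SET) : arc N) \notin E.
  by apply/negP => /(Enc _ _ DE); rewrite cr.
have adkl : ~~ adjacent_ord k l.
  by apply: adE; rewrite -DKL.
rewrite (theta_supp nE); apply/eqP; rewrite eq_le top_angle_ge0 andbT leNgt; apply/negP => p.
have pkl : 0 < top_angle z (roof theta b) k l.
  rewrite main //; last by move=> T TE; rewrite -DKL; exact: Enc.
  by rewrite -DKL; exact: (theta_sign DE).
apply: (top_angle_cross N4 cz _ _ pkl p); first exact: c1.
exact: c2.
Qed.

End Graph.
End Roof.

Section Reconstruction.
Variables (R : realType) (N : nat).
Hypothesis N4 : (3 < N)%N.
Let N3 : (2 < N)%N := ltnW N4.
Variable z : 'M[R]_(N, 3).
Hypothesis cz : is_config z.

Lemma crease_cut (p q k : 'I_N) : (p < q)%N ->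
  crease z p q k = bend z p q k - (if (p <= k < q)%N then bend z p q k else 0).
Proof.
move=> pq; have npq : p != q by rewrite -(inj_eq (@ord_inj _)) ltn_eqF.
have e0 := bend_eq0 N4 cz k npq; have e1 := bend_sgr N4 cz k npq.
rewrite /crease; case: ifP => pk.
  have : bend z p q k <= 0.
    rewrite leNgt e1; move: pk pq; rewrite /cyc; clear; lia.
  by rewrite subrr => /max_idPl.
rewrite subr0; apply/max_idPr; rewrite le_eqVlt eq_sym e0 e1.
move: pk pq; rewrite /cyc -!(inj_eq (@ord_inj _)); clear; lia.
Qed.

(** The sums differ by the pairs with [p <= k < q]. Balance at [p] replaces its partners after [k]
    by those up to [k], with the opposite sign, and the resulting sum is antisymmetric. So the
    creases add up to a linear function. *)
Lemma roof_balanced (W : 'I_N -> 'I_N -> R) k : (forall i j, W i j = W j i) -> balanced z W ->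
  \sum_(p : 'I_N * 'I_N | (p.1 < p.2)%N) W p.1 p.2 * crease z p.1 p.2 k =
  \sum_(p : 'I_N * 'I_N | (p.1 < p.2)%N) W p.1 p.2 * bend z p.1 p.2 k.
Proof.
move=> Ws bW; apply/eqP; rewrite -subr_eq0 -sumrB; apply/eqP.
transitivity (\sum_(p : 'I_N * 'I_N | (p.1 <= k)%N && (k < p.2)%N) - (W p.1 p.2 * bend z p.1 p.2 k)).
  rewrite big_mkcond [RHS]big_mkcond; apply: eq_bigr => -[p q] _ /=.
  case: ltnP => pq; last first.
    by case: ifP => // /andP[h1 h2]; have := leq_trans h2 (leq_trans pq h1); rewrite ltnn.
  by rewrite crease_cut //; case: ifP => _; ring.
rewrite sumrN -(pair_big (fun i : 'I_N => (i <= k)%N) (fun j : 'I_N => (k < j)%N)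
  (fun i j => W i j * bend z i j k)) /=.
have full i : \sum_j W i j * bend z i j k = 0.
  rewrite -[RHS](balanced_br i k bW); apply: eq_bigr => j _.
  by rewrite /bend mulrA mulrAC.
have part i : \sum_(j : 'I_N | (k < j)%N) W i j * bend z i j k =
    - \sum_(j : 'I_N | (j <= k)%N) W i j * bend z i j k.
  apply/eqP; rewrite -addr_eq0 -[X in _ == X](full i) [X in _ == X](bigID (fun j : 'I_N => (k < j)%N)) /=.
  by apply/eqP; congr (_ + _); apply: eq_bigl => j; rewrite -leqNgt.
under eq_bigr => i _ do rewrite part.
rewrite sumrN opprK; set S := \sum_(i | _) _; have : S = - S; last lra.
rewrite {1}/S exchange_big /= -sumrN; apply: eq_bigr => i _; rewrite -sumrN; apply: eq_bigr => j _.
by rewrite Ws bend_anti mulrN.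
Qed.

Section Graph.
Variables (E : {set arc N}) (theta : weights R N).
Hypothesis E_gamma : forall i, (inl i : arc N) \in E.
Hypothesis E_diagonal : forall b S, (inr (b, S) : arc N) \in E -> is_diagonal S.
Hypothesis E_noncrossing : forall b S T, (inr (b, S) : arc N) \in E ->
  (inr (b, T) : arc N) \in E -> ~~ crossing S T.
Hypothesis theta_cell : angle_cell R E theta.
Hypothesis theta_balanced : balanced z (pair_weight theta).

Let supp : forall e, e \notin E -> theta e = 0. Proof. by case: theta_cell. Qed.
Let sgn : forall e, e \in E -> if in_gamma e then theta e < 0 else 0 < theta e.
Proof. by case: theta_cell. Qed.

(** Together the two roofs crease along each pair with its pair weight, apart from the sides. All
    creases add up to a linear function by [roof_balanced], and the crease of a side is linear on
    the vertices. *)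
Lemma roofs_coplanar : exists f, forall k, - roof z theta true k = roof z theta false k + fv z f k.
Proof.
pose side (p q : 'I_N) := if q == ordS p then theta (inl p) else 0.
exists (\sum_(p : 'I_N * 'I_N | (p.1 < p.2)%N)
  ((pair_weight theta p.1 p.2 - side p.1 p.2) / ch z p.1 p.2) *: cross z p.1 p.2) => k.
apply/eqP; rewrite addrC -subr_eq; apply/eqP; rewrite fv_sum.
have := roof_balanced k (pair_weight_sym theta) theta_balanced => rb.
transitivity (\sum_(p : 'I_N * 'I_N | (p.1 < p.2)%N) pair_weight theta p.1 p.2 * bend z p.1 p.2 k
   - \sum_(p : 'I_N * 'I_N | (p.1 < p.2)%N) side p.1 p.2 * bend z p.1 p.2 k); last first.
  by rewrite -sumrB; apply: eq_bigr => p _; rewrite fvZ fv_cross /bend; ring.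
rewrite -rb /roof !opprK -big_split -sumrB; apply: eq_bigr => -[p q] /= pq.
have npq : p != q by rewrite -(inj_eq (@ord_inj _)) ltn_eqF.
rewrite pair_weightE // /side.
have [qS|qS] := eqVneq q (ordS p).
  have -> : bend z p q k = crease z p q k.
    rewrite crease_cut //; case: ifP => // h; rewrite ?subr0 //.
    have -> : k = p.
      by apply: ord_inj; move: h pq; rewrite qS ordSE; clear; case: (p.+1 =P N); lia.
    by rewrite /bend br_iji mul0r subr0.
  by ring.
have [pS|pS] := eqVneq p (ordS q); last by ring.
have -> : crease z p q k = 0; last by ring.
apply/max_idPl; rewrite leNgt bend_sgr //; have := ltn_ord k.
move: pq pS => pq /(congr1 (@nat_of_ord _)); rewrite ordSE; move: pq; rewrite /cyc; clear.
by case: (q.+1 =P N); lia.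
Qed.

Hypothesis z_height : forall i, z i 2 = roof z theta true i.

Lemma top_angle_reconstruction b (i j : 'I_N) : i != j ->
  top_angle z (vertex_height z b) i j = theta (inr (b, [set i; j]%SET)).
Proof.
move=> ij; rewrite -(top_angle_roof N4 cz E_diagonal E_noncrossing supp sgn) //.
have e : vertex_height z true = roof z theta true by apply/funext => k; exact: z_height.
case: b; first by rewrite e.
have [f hf] := roofs_coplanar.
have -> : vertex_height z false = fun k => roof z theta false k + fv z f k.
  by apply/funext => k; rewrite -hf -e.
exact: top_angle_lin.
Qed.

Lemma dihedral_reconstruction : dihedral z = theta.
Proof.
apply/funext => -[i|[b D]].
  rewrite -(pair_weight_side N4 E_diagonal supp).
  have -> : dihedral z (inl i) = pair_weight (dihedral z) i (ordS i).
    by rewrite pair_weight_dihedral ?ordS_neq // /angle eqxx.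
  apply: (balanced_side_unique N4 cz (balanced_pair_weight N4 cz) theta_balanced) => j ij ad.
  rewrite !(pair_weightE N4 _ ij) !dihedral_pair // !top_angle_reconstruction //.
  by move: ad; rewrite /adjacent_ord negb_or => /andP[/negbTE-> /negbTE->].
have [/cards2P[x [y [xy ->]]]|D2] := boolP (#|D| == 2%N).
  by rewrite dihedral_pair // top_angle_reconstruction.
rewrite supp; last first.
  by apply: contraNN D2 => /E_diagonal/is_diagonalP[x [y [-> xy _]]]; rewrite cards2 xy.
rewrite /dihedral big1 // => -[x y] /= /andP[xy /eqP DE]; case/negP: D2.
by rewrite DE cards2 -(inj_eq (@ord_inj _)) neq_ltn xy.
Qed.

(** For coplanar heights both faces at a side lie in the same plane, so its angle is nonnegative,
    against the sign of the weight. *)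
Lemma reconstruction_noncoplanar : ~ coplanar z (vertex_height z true).
Proof.
move=> [f hf]; pose i : 'I_N := Ordinal (ltnW (ltnW N3)).
have iS := ordS_neq N4 i; have [k [ki kS]] := third_index N3 i (ordS i).
have b0 : br z i (ordS i) k != 0 by rewrite br_neq0 // eq_sym.
have side h g : (forall k, h k = fv z g k) -> side_plane z h i = g.
  move=> hg; apply/esym/(side_face_unique N4 cz) => //; split=> [l|]; first by rewrite hg.
  by exists i, (ordS i), k.
have := side_planes_coplanar N4 cz ki kS (h := vertex_height z true).
rewrite (side _ f) // (side _ (- f)) => [|l]; last by rewrite fvN hf.
move/(_ (esym (hf k))); rewrite fvN hf => /(_ erefl).
rewrite (_ : side_angle _ _ _ = theta (inl i)); last by rewrite -dihedral_reconstruction.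
by have /= := sgn (E_gamma i); rewrite leNgt => ->.
Qed.

End Graph.
End Reconstruction.

(** * The energy of a sequence of gaps *)

Lemma lower_bound_gt0 (R : realType) (I : finType) (P : pred I) (F : I -> R) :
  (forall i, P i -> 0 < F i) -> exists2 c : R, 0 < c & forall i, P i -> c <= F i.
Proof.
move=> F0; exists (\big[Num.min/1]_(i | P i) F i).
  by elim/big_ind: _ => // x y x0 y0; rewrite lt_min x0.
by move=> i Pi; apply: bigmin_le_cond.
Qed.

Section Energy.
Variables (R : realType) (N : nat).
Implicit Types (s : 'I_N -> R) (p q : nat).

Definition span s (i j : nat) : R := \sum_(k < N | (i <= k < j)%N) expR (s k).

Definition tri (F : 'I_N -> 'I_N -> R) p q : R :=
  \sum_(a : 'I_N * 'I_N | [&& p <= a.1, a.1 < a.2 & a.2 < q]%N) F a.1 a.2.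

Lemma tri_split F p k q : (p <= k)%N -> (k <= q)%N -> tri F p q = tri F p k + tri F k q +
  \sum_(a : 'I_N * 'I_N | [&& p <= a.1, a.1 < k, k <= a.2 & a.2 < q]%N) F a.1 a.2.
Proof.
move=> pk kq; rewrite /tri big_mkcond [X in X + _ + _]big_mkcond [X in _ + X + _]big_mkcond /=.
rewrite [X in _ + X]big_mkcond -!big_split; apply: eq_bigr => -[i j] _ /=.
case: (leqP p i) => pi; case: (ltnP i j) => ij; case: (ltnP j q) => jq;
 case: (ltnP j k) => jk; case: (ltnP i k) => ik; rewrite /= ?addr0 ?add0r //; lia.
Qed.

Lemma span_gt0 s (i j : 'I_N) : (i < j)%N -> 0 < span s i j.
Proof.
move=> ij; rewrite /span (bigD1 i) /=; last by rewrite leqnn.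
by apply: ltr_pwDl; [exact: expR_gt0|apply: sumr_ge0 => k _; exact: expR_ge0].
Qed.

Lemma span_ge s (i j k : 'I_N) : (i <= k)%N -> (k < j)%N -> expR (s k) <= span s i j.
Proof.
move=> ik kj; rewrite /span (bigD1 k) /=; last by rewrite ik.
by rewrite lerDl; apply: sumr_ge0 => l _; exact: expR_ge0.
Qed.

Lemma span_side s (i j : 'I_N) : j = i.+1 :> nat -> span s i j = expR (s i).
Proof.
move=> ji; rewrite /span (big_pred1 i) // => k; rewrite ji ltnS -eqn_leq.
by rewrite eq_sym.
Qed.

Lemma ln_span_ge s (i j k : 'I_N) : (i <= k)%N -> (k < j)%N -> s k <= ln (span s i j).
Proof.
move=> ik kj; rewrite -[leLHS]expRK ler_ln ?posrE ?expR_gt0 ?span_ge //.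
exact: span_gt0 (leq_ltn_trans ik kj).
Qed.

Lemma span_add s (t : R) (i j : nat) : span (fun k => s k + t) i j = expR t * span s i j.
Proof. by rewrite /span mulr_sumr; apply: eq_bigr => k _; rewrite expRD mulrC. Qed.

(* Jensen's inequality, with the weights e^{s_k} of the gaps between i and j. *)
Lemma ln_span_convex s s' (i j : 'I_N) : (i < j)%N ->
  ln (span s i j) + (\sum_(k < N | (i <= k < j)%N) expR (s k) * (s' k - s k)) / span s i j
    <= ln (span s' i j) ?= iff
  [forall k : 'I_N, (i <= k < j)%N ==> (s' k - s k ==
     (\sum_(k < N | (i <= k < j)%N) expR (s k) * (s' k - s k)) / span s i j)].
Proof.
move=> ij; set y := _ / _; have s0 := span_gt0 s ij; have s'0 := span_gt0 s' ij.
have yE : y * span s i j = \sum_(k < N | (i <= k < j)%N) expR (s k) * (s' k - s k).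
  by rewrite divfK // lt0r_neq0.
have sE : expR y * span s i j = \sum_(k < N | (i <= k < j)%N)
    expR (y + s k) * (1 + (s' k - s k - y)).
  transitivity (expR y * (span s i j + y * span s i j - y * span s i j)).
    by rewrite addrK.
  rewrite {1}yE /span !mulr_sumr -big_split -sumrB mulr_sumr; apply: eq_bigr => k _ /=.
  by rewrite expRD; ring.
have key : expR y * span s i j <= span s' i j ?= iff
    [forall k : 'I_N, (i <= k < j)%N ==> (s' k - s k == y)].
  rewrite sE.
  have -> : span s' i j = \sum_(k < N | (i <= k < j)%N) expR (y + s k) * expR (s' k - s k - y).
    by rewrite /span; apply: eq_bigr => k _; rewrite -expRD; congr expR; ring.
  apply: leif_sum => k _; rewrite eq_sym -subr_eq0 opprB.
  apply/leifP; case: eqP => [e|/eqP e].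
    have -> : s' k - s k - y = 0 by lra.
    by rewrite expR0 addr0.
  rewrite ltr_pM2l ?expR_gt0 // expR_gt1Dx //.
  by move: e; rewrite -subr_eq0 => e; apply: contra e => /eqP e; apply/eqP; lra.
have -> : ln (span s i j) + y = ln (expR y * span s i j).
  by rewrite lnM ?posrE ?expR_gt0 // expRK addrC.
split; first by rewrite ler_ln ?posrE ?mulr_gt0 ?expR_gt0 // key.1.
rewrite -key.2; apply/eqP/eqP => [|->//] /ln_inj; apply; rewrite posrE //.
by rewrite mulr_gt0 ?expR_gt0.
Qed.

Variable W : 'I_N -> 'I_N -> R.

Definition energy s p q : R := tri (fun i j => W i j * ln (span s i j)) p q.

(* [expR (s k) * flux s k] is the derivative of the energy with respect to s_k. *)
Definition flux s (k : 'I_N) : R :=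
  \sum_(a : 'I_N * 'I_N | [&& a.1 <= k, k < a.2 & a.2 < N.-1]%N) W a.1 a.2 / span s a.1 a.2.

Lemma energy_add s (t : R) p q : energy (fun k => s k + t) p q = energy s p q + t * tri W p q.
Proof.
rewrite /energy /tri mulr_sumr -big_split; apply: eq_bigr => a /and3P[_ h _] /=.
by rewrite span_add lnM ?posrE ?expR_gt0 ?span_gt0 // expRK; ring.
Qed.

Hypothesis W_pos : forall i j : 'I_N, (i.+1 < j)%N -> (j < N.-1)%N -> 0 <= W i j.

(** Pairs on different sides of the gap [k] have span at least [expR (s k)], so their terms stay
    nonnegative after subtracting [s k] from the logarithm. For the neighbours that bound the gap
    the term is exactly 0, whatever the sign of their weight. *)
Lemma energy_split s p q (k : 'I_N) : (p <= k)%N -> (k.+1 < q)%N -> (q <= N.-1)%N ->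
  (energy s p k.+1 - tri W p k.+1 * s k) + (energy s k.+1 q - tri W k.+1 q * s k) <=
  energy s p q - tri W p q * s k.
Proof.
move=> pk kq qN; have pk1 := leqW pk; have kq1 := ltnW kq.
rewrite /energy (tri_split _ pk1 kq1) (tri_split W pk1 kq1).
set S := \sum_(a | _) _; set T := \sum_(a | _) _.
have : 0 <= S - T * s k; last by move: (tri _ _ _) (tri _ _ _) (tri _ _ _) (tri _ _ _) => *; lra.
rewrite /S /T mulr_suml -sumrB; apply: sumr_ge0 => -[i j] /= /and4P[pi ik kj jq].
rewrite ltnS in ik; rewrite -mulrBr.
have [ji|ji] := leqP j i.+1.
  have e : j = i.+1 :> nat by move: ik kj ji; clear; lia.
  have -> : i = k by apply: ord_inj; move: ik kj ji; clear; lia.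
  rewrite (span_side s) ?expRK ?subrr ?mulr0 //.
  by move: ik kj ji; clear; lia.
rewrite mulr_ge0 ?W_pos ?subr_ge0 ?ln_span_ge //; exact: leq_trans jq qN.
Qed.

Variable c : R.
Hypothesis c0 : 0 < c.
Hypothesis tri_le : forall p q, (p.+1 < q)%N -> (q <= N.-1)%N -> (q - p < N.-1)%N -> tri W p q <= - c.

Lemma tri_nil F p q : (q <= p.+1)%N -> tri F p q = 0.
Proof. by move=> qp; rewrite /tri big1 // => -[i j] /and3P[h1 h2 h3]; move: qp h1 h2 h3 => /=; lia. Qed.

(** Split the interval at its largest gap [k] and induct on the length. A shorter piece has total
    weight at most [- c], so raising its reference value from its own largest gap to [s k] gains at
    least [c] times the difference. *)
Lemma energy_coercive_tri s n p q (k l : 'I_N) : (q - p <= n)%N -> (q <= N.-1)%N ->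
  (p <= k)%N -> (k.+1 < q)%N -> (p <= l)%N -> (l.+1 < q)%N ->
  (forall l' : 'I_N, (p <= l')%N -> (l'.+1 < q)%N -> s l' <= s k) ->
  c * (s k - s l) <= energy s p q - tri W p q * s k.
Proof.
elim: n p q k l => [|n IH] p q k l qpn qN pk kq pl lq sk; first by move: qpn pk kq; clear; lia.
have sub p' q' t : (q' - p' <= n)%N -> (q' <= N.-1)%N -> (q' - p' < N.-1)%N ->
    (forall l' : 'I_N, (p' <= l')%N -> (l'.+1 < q')%N -> s l' <= t) ->
    0 <= energy s p' q' - tri W p' q' * t /\
    forall m : 'I_N, (p' <= m)%N -> (m.+1 < q')%N -> c * (t - s m) <= energy s p' q' - tri W p' q' * t.
  move=> qpn' qN' qpN' st.
  have main (m : 'I_N) : (p' <= m)%N -> (m.+1 < q')%N -> 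
      c * (t - s m) <= energy s p' q' - tri W p' q' * t.
    move=> pm mq; pose P (x : 'I_N) := (p' <= x)%N && (x.+1 < q')%N.
    have Pm : P m by rewrite /P pm.
    case: (arg_maxP s Pm) => x /andP[px xq] xmax.
    have h := IH p' q' x m qpn' qN' px xq pm mq (fun l' h1 h2 => xmax l' (introT andP (conj h1 h2))).
    have hE : tri W p' q' <= - c by apply: tri_le => //; move: px xq; clear; lia.
    have tx := st x px xq.
    have : 0 <= (- c - tri W p' q') * (t - s x) by rewrite mulr_ge0 ?subr_ge0.
    by move: h; lra.
  split=> //; have [qp|pq] := leqP q' p'.+1.
    by rewrite /energy !tri_nil // mul0r subrr.
  have mN : (p' < N)%N by move: pq qN'; clear; lia.
  have := main (Ordinal mN) (leqnn _) pq; apply: le_trans.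
  by apply: mulr_ge0; [exact: ltW|rewrite subr_ge0; exact: st].
have [h1 h1'] := sub p k.+1 (s k) ltac:(lia) ltac:(lia) ltac:(lia)
  (fun l' e1 e2 => sk l' e1 ltac:(lia)).
have [h2 h2'] := sub k.+1 q (s k) ltac:(lia) ltac:(lia) ltac:(lia)
  (fun l' e1 e2 => sk l' ltac:(lia) ltac:(lia)).
have es := energy_split s pk kq qN.
have [lk|lk|lk] := ltngtP l k.
- by have := h1' l pl ltac:(lia); move: es h2; lra.
- by have := h2' l ltac:(lia) lq; move: es h1; lra.
- have -> : l = k by exact: ord_inj.
  by rewrite subrr mulr0; move: es h1 h2; lra.
Qed.

Hypothesis tri_full : tri W 0 N.-1 = 0.

Lemma energy_coercive s (k l : 'I_N) : (k.+1 < N.-1)%N -> (l.+1 < N.-1)%N ->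
  c * (s k - s l) <= energy s 0 N.-1.
Proof.
move=> kN lN; pose P (x : 'I_N) := (x.+1 < N.-1)%N.
case: (arg_maxP s (kN : P k)) => x Px xmax.
have := energy_coercive_tri (n := N) (leq_trans (leq_subr _ _) (leq_pred _)) (leqnn _) (leq0n x) Px
  (leq0n l) lN (fun l' _ h => xmax l' h).
rewrite tri_full mul0r subr0; apply: le_trans.
by rewrite ler_pM2l // lerD2r; exact: xmax.
Qed.


Lemma energy_diff s s' : (forall k : 'I_N, (k.+1 < N.-1)%N -> flux s k = 0) ->
  energy s' 0 N.-1 - energy s 0 N.-1 = tri (fun i j => W i j * (ln (span s' i j) -
    (ln (span s i j) + (\sum_(k < N | (i <= k < j)%N) expR (s k) * (s' k - s k)) / span s i j))) 0 N.-1.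
Proof.
move=> fl; pose lin (i j : 'I_N) := W i j / span s i j * \sum_(k < N | (i <= k < j)%N) expR (s k) * (s' k - s k).
have lin0 : tri lin 0 N.-1 = 0.
  transitivity (\sum_(k < N) \sum_(a : 'I_N * 'I_N | [&& a.1 <= k, k < a.2 & a.2 < N.-1]%N)
      W a.1 a.2 / span s a.1 a.2 * (expR (s k) * (s' k - s k))).
    rewrite /tri big_mkcond; under [RHS]eq_bigr do rewrite big_mkcond.
    rewrite exchange_big; apply: eq_bigr => -[i j] _ /=; rewrite /lin mulr_sumr.
    have [jN|jN] := boolP (j < N.-1)%N; last by rewrite andbF big1 // => k _; rewrite !andbF.
    rewrite andbT; have [ij|ji] := ltnP i j.
      by rewrite [LHS]big_mkcond; apply: eq_bigr => k _; rewrite andbT.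
    rewrite big1 // => k _; case: ifP => // /andP[h1 /andP[h2 _]].
    by have := leq_trans (leq_ltn_trans h1 h2) ji; rewrite ltnn.
  rewrite big1 // => k _; rewrite -mulr_suml.
  have [kN|kN] := ltnP k.+1 N.-1; first by rewrite -/(flux s k) fl // mul0r.
  by rewrite big1 ?mul0r // => -[i j] /= /and3P[h1 h2 h3]; move: kN h2 h3; clear; lia.
transitivity (energy s' 0 N.-1 - energy s 0 N.-1 - tri lin 0 N.-1); first by rewrite lin0 subr0.
rewrite /energy /tri -!sumrB.
by apply: eq_bigr => a _; rewrite /lin; ring.
Qed.

(** Only neighbours may have negative weight, and for them the logarithm of the span is the gap
    itself, so the term is 0. *)
Lemma energy_term_ge0 s s' (i j : 'I_N) : (i < j)%N -> (j < N.-1)%N ->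
  0 <= W i j * (ln (span s' i j) -
    (ln (span s i j) + (\sum_(k < N | (i <= k < j)%N) expR (s k) * (s' k - s k)) / span s i j)).
Proof.
move=> ij jN; have [e|ne] := eqVneq (j : nat) i.+1; last first.
  rewrite mulr_ge0 ?W_pos // ?subr_ge0 ?(ln_span_convex s s' ij).1 //.
  by rewrite ltn_neqAle eq_sym ne.
rewrite !(span_side _ e) (big_pred1 i) => [|k]; last first.
  by rewrite e ltnS -eqn_leq eq_sym.
rewrite !expRK [expR _ * _]mulrC mulfK; last by rewrite gt_eqF ?expR_gt0.
by rewrite subrKC subrr mulr0.
Qed.

Hypothesis W_linked : forall k : 'I_N, (0 < k)%N -> (k.+1 < N.-1)%N ->
  exists i j : 'I_N, [/\ (i < k)%N, (k < j)%N, (j < N.-1)%N & 0 < W i j].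

(** Otherwise Jensen's inequality is an equality for every pair of positive weight. By [W_linked]
    the gaps on both sides of each inner point then change by the same amount, which is 0 for the
    first gap. *)
Lemma energy_critical_lt s s' : (forall k : 'I_N, (k.+1 < N.-1)%N -> flux s k = 0) ->
  (forall k : 'I_N, k = 0 :> nat -> s' k = s k) ->
  (exists2 k : 'I_N, (k.+1 < N.-1)%N & s' k != s k) ->
  energy s 0 N.-1 < energy s' 0 N.-1.
Proof.
move=> fl s0 [k kN sk]; rewrite ltNge; apply/negP => le.
have t0 : forall a : 'I_N * 'I_N, [&& 0 <= a.1, a.1 < a.2 & a.2 < N.-1]%N ->
    W a.1 a.2 * (ln (span s' a.1 a.2) - (ln (span s a.1 a.2) +
    (\sum_(k < N | (a.1 <= k < a.2)%N) expR (s k) * (s' k - s k)) / span s a.1 a.2)) = 0.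
  apply: psumr_eq0P; first by move=> -[i j] /and3P[_ ij jN]; exact: energy_term_ge0.
  apply/eqP; rewrite eq_le sumr_ge0; last by move=> -[i j] /and3P[_ ij jN]; exact: energy_term_ge0.
  rewrite andbT; move: le; rewrite -subr_le0 energy_diff //.
have const (l l' : 'I_N) : l' = l.+1 :> nat -> (l'.+1 < N.-1)%N -> s' l - s l = s' l' - s l'.
  move=> e lN; have [|i [j [il lj jN Wij]]] := W_linked (k := l') _ lN; first by rewrite e.
  have ij := ltn_trans il lj; have := t0 (i, j); rewrite /= ij jN => /(_ isT)/eqP.
  rewrite mulf_eq0 gt_eqF //= subr_eq0 eq_sym (ln_span_convex s s' ij).2 => /forallP eqs.
  have := eqs l; have := eqs l'.
  rewrite (_ : (i <= l' < j)%N); last by move: il lj; clear; lia.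
  rewrite (_ : (i <= l < j)%N); last by move: il lj e; clear; lia.
  by move=> /eqP-> /eqP->.
suff all0 n (l : 'I_N) : l = n :> nat -> (l.+1 < N.-1)%N -> s' l = s l.
  by case/eqP: sk; exact: all0 kN.
elim: n l => [|n IH] l ln lN; first exact: s0.
have nN : (n < N)%N by move: ln lN; clear; lia.
have := const (Ordinal nN) l ln lN.
rewrite (IH (Ordinal nN)) //=; last by move: ln lN; clear; lia.
by rewrite subrr => /eqP; rewrite eq_sym subr_eq0 => /eqP.
Qed.

(** Take the tangent inequalities at the intermediate point towards both ends, weighted by [t] and
    [1 - t]; their first-order terms cancel. *)
Lemma energy_convex s s' (t : R) : 0 <= t <= 1 ->
  energy (fun k => s k + t * (s' k - s k)) 0 N.-1 <=
  energy s 0 N.-1 + t * (energy s' 0 N.-1 - energy s 0 N.-1).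
Proof.
move=> /andP[t0 t1]; set m := fun k => _.
rewrite -subr_ge0 (_ : _ - _ = t * (energy s' 0 N.-1 - energy m 0 N.-1) +
   (1 - t) * (energy s 0 N.-1 - energy m 0 N.-1)); last by ring.
rewrite /energy /tri -!sumrB !mulr_sumr -big_split; apply: sumr_ge0 => -[i j] /and3P[_ ij jN] /=.
have h1 := energy_term_ge0 m s' ij jN; have h2 := energy_term_ge0 m s ij jN.
rewrite /= in h1 h2; pose S := \sum_(k < N | (i <= k < j)%N) expR (m k) * (s' k - s k).
have e1 : \sum_(k < N | (i <= k < j)%N) expR (m k) * (s' k - m k) = (1 - t) * S.
  by rewrite mulr_sumr; apply: eq_bigr => k _; rewrite /m; ring.
have e2 : \sum_(k < N | (i <= k < j)%N) expR (m k) * (s k - m k) = - t * S.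
  by rewrite mulr_sumr; apply: eq_bigr => k _; rewrite /m; ring.
rewrite e1 in h1; rewrite e2 in h2; rewrite -subr_ge0 in t1.
have := addr_ge0 (mulr_ge0 t0 h1) (mulr_ge0 t1 h2).
by rewrite (_ : _ + _ = t * (W i j * ln (span s' i j) - W i j * ln (span m i j)) +
  (1 - t) * (W i j * ln (span s i j) - W i j * ln (span m i j))) //; ring.
Qed.

End Energy.

(** * Minimizers of the energy and their stability *)

Section Minimizer.
Variables (R : realType) (N : nat).
Hypothesis N4 : (3 < N)%N.
Implicit Types (s : 'I_N -> R) (W : 'I_N -> 'I_N -> R).

(** At [u = - e A] with small [e] the linear term wins. The constant [e] is chosen so that both
    [e |A|] and [e B] are below 1/2. *)
Lemma small_quadratic (A B : R) : 0 <= B ->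
  (forall u, `|u| <= 2^-1 -> 0 <= A * u + B * u ^+ 2) -> A = 0.
Proof.
move=> B0 h; pose e := (2 * B + 2 * `|A| + 1)^-1.
have d0 : 0 < 2 * B + 2 * `|A| + 1 by have := normr_ge0 A; lra.
have e0 : 0 < e by rewrite invr_gt0.
have e1 : e * (2 * B + 2 * `|A| + 1) = 1 by rewrite mulVf // gt_eqF.
have small : `|- (e * A)| <= 2^-1.
  rewrite normrN normrM (gtr0_norm e0).
  have h1 : 0 <= e * B by rewrite mulr_ge0 // ltW.
  move: e1; rewrite !mulrDr mulr1 !(mulrCA e 2); lra.
have := h _ small.
rewrite (_ : _ + _ = - (A ^+ 2 * e * (1 - B * e))); last by ring.
rewrite oppr_ge0 => le0; apply/eqP; rewrite -sqrf_eq0; apply/eqP/le_anti; rewrite sqr_ge0 andbT.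
have Be : 0 < 1 - B * e.
  have h1 : 0 <= e * `|A| by rewrite mulr_ge0 // ltW.
  have h2 : 0 <= e * B by rewrite mulr_ge0 // ltW.
  move: e1; rewrite !mulrDr mulr1 !(mulrCA e 2) (mulrC B); lra.
by rewrite -(pmulr_lle0 _ Be) -(pmulr_lle0 _ e0) mulrAC.
Qed.

Lemma ln1D_ge (x : R) : - 2^-1 <= x -> x - 2 * x ^+ 2 <= ln (1 + x).
Proof.
move=> x1; have p : 0 < 1 + x by lra.
have e : ln (1 + x) = - ln (1 + - (x / (1 + x))).
  rewrite (_ : 1 + - _ = (1 + x)^-1); last by field; rewrite gt_eqF.
  by rewrite lnV ?opprK // posrE.
have h : ln (1 + - (x / (1 + x))) <= - (x / (1 + x)).
  apply: le_ln1Dx; rewrite ltrN2 ltr_pdivrMr //; lra.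
rewrite e -lerN2 opprK; apply: (le_trans h).
rewrite -subr_ge0 (_ : _ - _ = x ^+ 2 * (1 + 2 * x) / (1 + x)); last by field; rewrite gt_eqF.
by rewrite divr_ge0 ?(ltW p) //; apply: mulr_ge0; [exact: sqr_ge0|lra].
Qed.

(** Multiply [expR (s k)] by [1 + u]. Spans are affine in [u], and bounds of the logarithm from
    above for positive weights and from below for negative ones give the first-order condition
    without derivatives. *)
Lemma min_flux W s (k : 'I_N) : (k.+1 < N.-1)%N ->
  (forall s', energy W s 0 N.-1 <= energy W s' 0 N.-1) -> flux W s k = 0.
Proof.
move=> kN smin; pose B := 2 * \sum_(a : 'I_N * 'I_N) `|W a.1 a.2|.
have fE : expR (s k) * flux W s k = 0; last first.
  by move/eqP: fE; rewrite mulf_eq0 expR_eq0 => /eqP.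
apply: (@small_quadratic _ B); first by rewrite mulr_ge0 // sumr_ge0.
move=> u u2; have u1 : - 2^-1 <= u by move: u2; rewrite ler_norml => /andP[].
have pu : 0 < 1 + u by lra.
pose s' (l : 'I_N) := if l == k then s k + ln (1 + u) else s l.
have span' (i j : nat) : span s' i j = span s i j + (if (i <= k < j)%N then expR (s k) * u else 0).
  rewrite /span; case: ifP => kij; last first.
    rewrite addr0; apply: eq_bigr => l lij; rewrite /s'; case: eqP => // e.
    by rewrite -e lij in kij.
  rewrite (bigD1 k) //= [in RHS](bigD1 k) //= /s' eqxx expRD lnK ?posrE //.
  rewrite (eq_bigr (fun l : 'I_N => expR (s l))) => [|l /andP[_ /negbTE->] //]; ring.
have := smin s'; rewrite -subr_ge0 => /le_trans; apply.
have -> : expR (s k) * flux W s k * u + B * u ^+ 2 = \sum_(a : 'I_N * 'I_N)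
    ((if [&& a.1 <= k, k < a.2 & a.2 < N.-1]%N then W a.1 a.2 / span s a.1 a.2 * (expR (s k) * u) else 0)
     + 2 * `|W a.1 a.2| * u ^+ 2).
  rewrite big_split -big_mkcond /= -!mulr_suml -mulr_sumr -/(flux W s k).
  by congr (_ + _); ring.
rewrite /energy /tri -sumrB [leLHS]big_mkcond; apply: ler_sum => -[i j] _ /=.
have B0 : 0 <= 2 * `|W i j| * u ^+ 2 by rewrite mulr_ge0 ?sqr_ge0 // mulr_ge0.
case: ifP => [/andP[ij jN]|ij]; last first.
  by rewrite ifF ?add0r //; apply: contraFF ij => /and3P[h1 h2 ->]; rewrite (leq_ltn_trans h1 h2).
have sp := span_gt0 s ij; rewrite span' jN andbT.
case: ifP => [/andP[ik kj]|_]; last by rewrite addr0 subrr add0r.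
set r := expR (s k) / span s i j.
have r0 : 0 < r by rewrite divr_gt0 ?expR_gt0.
have r1 : r <= 1 by rewrite ler_pdivrMr // mul1r span_ge.
have -> : span s i j + expR (s k) * u = span s i j * (1 + r * u).
  by rewrite /r; field; rewrite gt_eqF.
have ru : `|r * u| <= `|u| by rewrite normrM (gtr0_norm r0) ler_piMl.
have ru1 : - 2^-1 <= r * u.
  by move: (le_trans ru u2); rewrite ler_norml => /andP[].
rewrite lnM ?posrE //; last by lra.
rewrite (_ : W i j / _ * _ = W i j * (r * u)); last by rewrite /r; ring.
rewrite mulrDr addrAC subrr add0r; have [W0|W0] := leP 0 (W i j).
  apply: ler_wpDr => //; rewrite ler_wpM2l // le_ln1Dx //; lra.
have sq : (r * u) ^+ 2 <= u ^+ 2 by rewrite -(real_normK (num_real (r * u))) -(real_normK (num_real u)) lerXn2r ?nnegrE.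
have := ln1D_ge ru1 => h; rewrite (ltr0_norm W0).
have h1 : 0 <= - W i j * (ln (1 + r * u) - (r * u - 2 * (r * u) ^+ 2)).
  by rewrite mulr_ge0 ?subr_ge0 // oppr_ge0 ltW.
have h2 : 0 <= - W i j * (u ^+ 2 - (r * u) ^+ 2).
  by rewrite mulr_ge0 ?subr_ge0 // oppr_ge0 ltW.
by move: h1 h2; move: (ln (1 + r * u)) (r * u) => y x; lra.
Qed.

Lemma continuous_energy W : continuous (fun v : 'rV[R]_N => energy W (v 0) 0 N.-1).
Proof.
move=> v; apply: (@cvg_big R^o _ _ _ _ _ _ (nbhs v) _ _ _ (nbhs_filter v)) => [|a /and3P[_ h _]].
  exact: add_continuous.
apply: cvgM; first exact: cvg_cst.
have sc : (fun w : 'rV[R]_N => span (w 0) a.1 a.2) @ v --> span (v 0) a.1 a.2.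
  apply: (@cvg_big R^o _ _ _ _ _ _ (nbhs v) _ _ _ (nbhs_filter v)) => [|k _].
    exact: add_continuous.
  by apply: continuous_cvg; [exact: continuous_expR|exact: coord_continuous].
exact: (continuous_cvg (nbhs_filter v) (continuous_ln (span_gt0 (v 0) h)) sc).
Qed.

(** The [N - 1] finite points have gaps with indices 0 to [N - 3]. Scaling fixes the first one, and
    the remaining entries are set to 0. *)
Definition normalized s : Prop := forall k : 'I_N, (k == 0 :> nat) || (N.-1 <= k.+1)%N -> s k = 0.

(** Together these conditions make the energy convex, coercive with constant [c], invariant under
    adding a constant to all gaps, and strictly convex up to such constants. *)
Definition energy_ok W c := [/\ 0 < c, forall i j : 'I_N, (i.+1 < j)%N -> (j < N.-1)%N -> 0 <= W i j,
  forall p q : nat, (p.+1 < q)%N -> (q <= N.-1)%N -> (q - p < N.-1)%N -> tri W p q <= - c,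
  tri W 0 N.-1 = 0 & forall k : 'I_N, (0 < k)%N -> (k.+1 < N.-1)%N ->
  exists i j : 'I_N, [/\ (i < k)%N, (k < j)%N, (j < N.-1)%N & 0 < W i j]].

Lemma energy_gaps W s s' : (forall k : 'I_N, (k.+1 < N.-1)%N -> s k = s' k) ->
  energy W s 0 N.-1 = energy W s' 0 N.-1.
Proof.
move=> e; apply: eq_bigr => -[i j] /and3P[_ _ /= jN]; congr (_ * ln _).
apply: eq_bigr => k /andP[_ kj]; rewrite e //; move: kj jN; clear; lia.
Qed.

(** With [C] the energy of the zero gaps divided by [c], coercivity gives every normalized point
    outside the box of size [C] at least that energy, so the minimum over the box is global. *)
Lemma minimizer_exists W c : energy_ok W c -> exists s, normalized s /\
  forall s', energy W s 0 N.-1 <= energy W s' 0 N.-1.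
Proof.
move=> [c0 Wp tl tf _]; have i0P : (0 < N)%N by lia.
pose i0 : 'I_N := Ordinal i0P; have i0N : (i0.+1 < N.-1)%N by rewrite /=; lia.
pose C := energy W (fun _ => 0) 0 N.-1 / c.
have C0 : 0 <= C.
  apply: divr_ge0; last exact: ltW.
  by have := energy_coercive Wp c0 tl tf (fun _ => 0) i0N i0N; rewrite subrr mulr0.
pose bad (k : 'I_N) := (k == 0 :> nat) || (N.-1 <= k.+1)%N.
pose r k : R := if bad k then 0 else C.
pose K : set 'rV[R]_N := [set v | forall k, v ord0 k \in `[- r k, r k]].
have cK : compact K by by apply: (@rV_compact _ _ (fun k => `[- r k, r k]%classic)) => k; exact: segment_compact.
have K0 : K !=set0.
  by exists 0 => k; rewrite /= mxE in_itv /= oppr_le0 /r; case: ifP => _; rewrite ?lexx ?C0.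
have [v] := EVT_min_rV K0 cK (continuous_subspaceT (@continuous_energy W)).
rewrite inE => Kv vmin; exists (v 0); split=> [k bk|s'].
  by have := Kv k; rewrite in_itv /= /r ifT // oppr0 => h; apply/le_anti; rewrite andbC.
pose s'' (k : 'I_N) := if bad k then 0 else s' k - s' i0.
have e' : energy W s'' 0 N.-1 = energy W s' 0 N.-1.
  transitivity (energy W (fun k => s' k + (- s' i0)) 0 N.-1); last first.
    by rewrite energy_add tf mulr0 addr0.
  apply: energy_gaps => k kN; rewrite /s''; case: ifP => //; rewrite /bad leqNgt kN orbF => /eqP k0.
  by rewrite (_ : k = i0) ?subrr //; exact: ord_inj.
rewrite -e'; have [ins|] := pselect (K (\row_k s'' k)).
  have := vmin (\row_k s'' k); rewrite inE => /(_ ins) /le_trans; apply.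
  by rewrite (_ : (\row_k s'' k) 0 = s'') //; apply/funext => k; rewrite mxE.
move=> /existsNP[k]; rewrite /= mxE in_itv /= /r /s''; case: ifP => bk.
  by rewrite oppr0 lexx.
move: bk => /negbT; rewrite /bad negb_or -ltnNge => /andP[k0 kN].
have Kz : K (0 : 'rV_N).
  by move=> l; rewrite /= mxE in_itv /= oppr_le0 /r; case: ifP => _; rewrite ?lexx ?C0.
have le0 : energy W (v 0) 0 N.-1 <= c * C.
  have := vmin 0; rewrite inE => /(_ Kz) /le_trans; apply.
  rewrite /C mulrC divfK ?gt_eqF //; rewrite (_ : (0 : 'rV_N) 0 = fun _ => 0) //.
  by apply/funext => l; rewrite mxE.
move=> /negP; rewrite negb_and -!ltNge => out; apply: (le_trans le0).
have sk : s'' k = s' k - s' i0 by rewrite /s'' /bad (negbTE k0) leqNgt kN.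
have s0 : s'' i0 = 0 by rewrite /s'' /bad eqxx.
have h1 := energy_coercive Wp c0 tl tf s'' kN i0N.
have h2 := energy_coercive Wp c0 tl tf s'' i0N kN.
rewrite s0 sk in h1 h2; case/orP: out => out.
  by apply: le_trans h2; rewrite ler_pM2l //; lra.
by apply: le_trans h1; rewrite ler_pM2l //; lra.
Qed.

Definition gap_dist s s' : R := \sum_k `|s k - s' k|.

Lemma ln_span_lipschitz s s' (i j : 'I_N) : (i < j)%N ->
  ln (span s i j) <= ln (span s' i j) + gap_dist s s'.
Proof.
move=> ij; have [p p'] := (span_gt0 s ij, span_gt0 s' ij).
rewrite -[gap_dist _ _]expRK -lnM ?posrE ?expR_gt0 // ler_ln ?posrE ?mulr_gt0 ?expR_gt0 //.
rewrite /span mulr_suml; apply: ler_sum => k _; rewrite -expRD ler_expR -lerBlDl.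
apply: (le_trans (ler_norm _)); rewrite /gap_dist (bigD1 k) //= lerDl.
exact: sumr_ge0.
Qed.

(** Compactness gives a positive increase of energy on the sphere of radius [e], and convexity
    propagates it linearly outwards. *)
Lemma energy_growth W c s0 (e : R) : energy_ok W c -> normalized s0 ->
  (forall k : 'I_N, (k.+1 < N.-1)%N -> flux W s0 k = 0) -> 0 < e ->
  exists2 eta : R, 0 < eta & forall s, normalized s -> e <= gap_dist s s0 ->
    eta * gap_dist s s0 <= energy W s 0 N.-1 - energy W s0 0 N.-1.
Proof.
move=> [c0 Wp tl tf Wl] ns0 fl e0.
pose bad (k : 'I_N) := (k == 0 :> nat) || (N.-1 <= k.+1)%N.
pose box (k : 'I_N) := if bad k then `[0, 0] else `[s0 k - e, s0 k + e].
pose B : set 'rV[R]_N := [set v | forall k, v ord0 k \in box k].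
pose K : set 'rV[R]_N := B `&` [set v | gap_dist (v 0) s0 = e].
have cK : compact K.
  apply: compact_closedI.
    apply: (@rV_compact _ _ (fun k => [set` box k])) => k; rewrite /box.
    by case: ifP => _; exact: segment_compact.
  apply: (@closed_comp _ _ (fun v : 'rV[R]_N => gap_dist (v 0) s0) [set e]); last exact: closed_eq.
  move=> v _; apply: (@cvg_big R^o _ _ _ _ _ _ (nbhs v) _ _ _ (nbhs_filter v)) => [|k _].
    exact: add_continuous.
  by apply: cvg_norm; apply: cvgB; [exact: coord_continuous|exact: cvg_cst].
have inK s : normalized s -> e <= gap_dist s s0 ->
    K (\row_k (s0 k + e / gap_dist s s0 * (s k - s0 k))).
  move=> ns es; have D0 := lt_le_trans e0 es.
  have t0 : 0 < e / gap_dist s s0 by rewrite divr_gt0.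
  split=> [k|] /=.
    rewrite mxE /box; case: ifP => bk.
      by rewrite ns // ns0 // subrr mulr0 addr0 in_itv /= lexx.
    suff : `|e / gap_dist s s0 * (s k - s0 k)| <= e.
      by rewrite ler_norml in_itv /= !lerD2l.
    rewrite normrM (gtr0_norm t0) mulrAC -mulrA ler_piMr ?(ltW e0) // ler_pdivrMr // mul1r.
    by rewrite /gap_dist (bigD1 k) //= lerDl; exact: sumr_ge0.
  transitivity (\sum_k e / gap_dist s s0 * `|s k - s0 k|).
    by apply: eq_bigr => k _; rewrite mxE addrC addKr normrM (gtr0_norm t0).
  by rewrite -mulr_sumr divfK // gt_eqF.
have [[w Kw]|K0] := pselect (K !=set0); last first.
  exists 1 => // s ns es; exfalso; apply: K0; eexists; exact: inK es.
have [v] := EVT_min_rV (ex_intro _ w Kw) cK (continuous_subspaceT (@continuous_energy W)).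
rewrite inE => -[Bv De] vmin.
have nv : normalized (v 0).
  move=> k bk; have := Bv k; rewrite /box ifT // in_itv /= => h.
  by apply/le_anti; rewrite andbC.
have gap : energy W s0 0 N.-1 < energy W (v 0) 0 N.-1.
  apply: (energy_critical_lt Wp Wl fl) => [k k0|].
    by rewrite nv ?ns0 //; apply/orP; left; apply/eqP.
  apply: contrapT => h; have : gap_dist (v 0) s0 = 0.
    rewrite /gap_dist big1 // => k _; apply/eqP; rewrite normr_eq0 subr_eq0; apply/eqP.
    have [kN|kN] := ltnP k.+1 N.-1; last by rewrite nv ?ns0 // kN orbT.
    by apply: contrapT => /eqP ne; apply: h; exists k.
  by move/eqP; rewrite De gt_eqF.
exists ((energy W (v 0) 0 N.-1 - energy W s0 0 N.-1) / e).
  by rewrite divr_gt0 // subr_gt0.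
move=> s ns es; have D0 := lt_le_trans e0 es.
have t01 : 0 <= e / gap_dist s s0 <= 1.
  by rewrite divr_ge0 ?(ltW e0) ?(ltW D0) //= ler_pdivrMr // mul1r.
have := energy_convex Wp s0 s t01.
have := vmin (\row_k (s0 k + e / gap_dist s s0 * (s k - s0 k))); rewrite inE => /(_ (inK s ns es)).
rewrite (_ : (\row_k _) 0 = fun k => s0 k + e / gap_dist s s0 * (s k - s0 k)); last first.
  by apply/funext => k; rewrite mxE.
move=> h1 /(le_trans h1); rewrite -lerBlDl.
move=> h; rewrite -(ler_pM2l (divr_gt0 e0 D0)); apply: le_trans h; rewrite le_eqVlt.
by apply/orP; left; apply/eqP; field; rewrite !gt_eqF.
Qed.

(** Changing the weights alters a difference of energies by at most the change of the weights times
    the distance of the gaps, too little to offset the growth at distance [e] or more. *)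
Lemma minimizer_stable W0 c s0 (e : R) : energy_ok W0 c -> normalized s0 ->
  (forall s', energy W0 s0 0 N.-1 <= energy W0 s' 0 N.-1) -> 0 < e ->
  exists2 eta : R, 0 < eta & forall W s, \sum_(a : 'I_N * 'I_N) `|W a.1 a.2 - W0 a.1 a.2| < eta ->
    normalized s -> (forall s', energy W s 0 N.-1 <= energy W s' 0 N.-1) -> gap_dist s s0 < e.
Proof.
move=> ok ns0 min0 e0; have fl k kN := min_flux (k := k) kN min0.
have [eta eta0 grow] := energy_growth ok ns0 fl e0; exists eta => // W s We ns smin.
rewrite ltNge; apply/negP => es; have D0 := lt_le_trans e0 es.
have := grow s ns es; apply/negP; rewrite -ltNge.
apply: le_lt_trans (_ : (\sum_(a : 'I_N * 'I_N) `|W a.1 a.2 - W0 a.1 a.2|) * gap_dist s s0 < _); last first.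
  by rewrite ltr_pM2r.
have := smin s0; rewrite -subr_le0 => h; rewrite -[leRHS]addr0; apply: le_trans (lerD (lexx _) h).
rewrite /energy /tri -!sumrB mulr_suml -lerBlDr -sumrB.
rewrite big_mkcond; apply: ler_sum => -[i j] _ /=; case: ifP => [/andP[ij jN]|_]; last first.
  by rewrite mulr_ge0 ?(ltW D0).
have h1 := ln_span_lipschitz s s0 ij; have h2 := ln_span_lipschitz s0 s ij.
have sD : gap_dist s0 s = gap_dist s s0 by apply: eq_bigr => k _; rewrite distrC.
rewrite (_ : _ - _ = (W0 i j - W i j) * (ln (span s i j) - ln (span s0 i j))); last by ring.
apply: (le_trans (ler_norm _)); rewrite normrM distrC ler_wpM2l //.
by rewrite ler_norml; move: h1 h2; rewrite sD; lra.
Qed.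

End Minimizer.

(** * Balance as a critical point equation *)

Section FiniteVertices.
Variables (R : realType) (N : nat).
Hypothesis N4 : (3 < N)%N.
Implicit Types (W : 'I_N -> 'I_N -> R) (x : 'I_N -> R).

(** All weights at a vertex add up to 0, so what leaves the interval is minus what stays inside,
    where each pair is counted twice. *)
Lemma tri_cut W p q : (forall i j, W i j = W j i) ->
  (forall i, \sum_(j | j != i) W i j = 0) ->
  2 * tri W p q = - cut W (fun k => p <= k < q)%N.
Proof.
move=> Ws st; set P : pred 'I_N := fun k => (p <= k < q)%N.
have ins i : P i -> \sum_(j | ~~ P j) W i j = - \sum_(j | P j && (j != i)) W i j.
  move=> Pi; apply/eqP; rewrite -addr_eq0 -[X in _ == X](st i) [X in _ == X](bigID P) /= addrC.
  apply/eqP; congr (_ + _); apply: eq_bigl => j; last by rewrite andbC.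
  by case: eqP => [->|]; rewrite ?Pi.
rewrite /cut (eq_bigr _ ins) sumrN opprK pair_big_dep /=.
rewrite (bigID (fun a : 'I_N * 'I_N => (a.1 < a.2)%N)) /= mulr_natl mulr2n; congr (_ + _).
  rewrite /tri; apply: eq_bigl => -[i j] /=; rewrite /P -(inj_eq (@ord_inj _)); clear; lia.
rewrite /tri (reindex_inj (h := fun a : 'I_N * 'I_N => (a.2, a.1))) /=; last by move=> [i j] [k l] [-> ->].
apply: eq_big => [-[i j]|-[i j] _] /=; last exact: Ws.
rewrite /P -(inj_eq (@ord_inj _)); clear; lia.
Qed.

(** The whole interval of finite points has total weight 0 because its complement is the single last
    vertex. The linking pairs come from [crossing_diagonal] for the segment from [k] to that
    vertex. *)
Lemma energy_ok_of_cuts W : (forall i j, W i j = W j i) ->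
  (forall i, \sum_(j | j != i) W i j = 0) ->
  (forall p q : 'I_N, (p < q)%N -> (q - p < N - 2)%N -> 0 < cut W (fun k => p <= k <= q)%N) ->
  (forall i j, i != j -> ~~ adjacent_ord i j -> 0 <= W i j) ->
  exists c, energy_ok W c.
Proof.
move=> Ws st cuts Wp.
have neg p q : (p.+1 < q)%N -> (q <= N.-1)%N -> (q - p < N.-1)%N -> tri W p q < 0.
  move=> pq qN pqN; have pN : (p < N)%N by lia.
  have qN' : (q.-1 < N)%N by lia.
  have := cuts (Ordinal pN) (Ordinal qN') ltac:(rewrite /=; lia) ltac:(rewrite /=; lia).
  have := tri_cut p q Ws st.
  rewrite (_ : (fun k : 'I_N => _) = (fun k : 'I_N => (p <= k < q)%N)); last first.
    apply/funext => k /=; clear -pq; lia.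
  lra.
have [c c0 hc] := @lower_bound_gt0 R ('I_N * 'I_N)%type
  (fun a => [&& a.1.+1 < a.2, a.2 <= N.-1 & a.2 - a.1 < N.-1]%N) (fun a => - tri W a.1 a.2)
  ltac:(by move=> [i j] /= /and3P[h1 h2 h3]; rewrite oppr_gt0 neg).
exists c; split=> //.
- move=> i j ij jN; apply: Wp; first by rewrite -(inj_eq (@ord_inj _)); move: ij; clear; lia.
  by rewrite adjacent_ordE; move: ij jN; clear; lia.
- move=> p q pq qN pqN; have pN : (p < N)%N by lia.
  have qN' : (q < N)%N by lia.
  have := hc (Ordinal pN, Ordinal qN') ltac:(rewrite /=; lia); rewrite /=; lra.
- have := tri_cut 0 N.-1 Ws st; rewrite (_ : cut _ _ = 0) ?oppr0; first lra.
  have cP : (N.-1 < N)%N by lia.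
  rewrite /cut exchange_big /= (big_pred1 (Ordinal cP)) => [|k]; last first.
    rewrite /= -(inj_eq (@ord_inj _)) /=; have := ltn_ord k; clear; lia.
  rewrite -[RHS](st (Ordinal cP)); apply: eq_big => [k|k _]; last exact: Ws.
  rewrite -(inj_eq (@ord_inj _)) /=; have := ltn_ord k; clear; lia.
- move=> k k0 kN; have cP : (N.-1 < N)%N by lia.
  have [] := @crossing_diagonal R N W Ws st cuts k (Ordinal cP).
  + by rewrite /=; lia.
  + by rewrite adjacent_ordE /=; move: k0 kN; clear; lia.
  move=> i [j [/= ki jk Wij]]; have := ltn_ord j => jN.
  by exists j, i; split; [lia|lia|lia|rewrite Ws].
Qed.

(* The derivative of the energy under moving the vertex i. *)
Definition force W x (i : 'I_N) : R :=
  \sum_(j : 'I_N | (j < N.-1)%N && (j != i)) W i j / (x j - x i).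

(** A pair on both sides of the gap [k] acts on exactly one vertex up to [k], and forces between two
    vertices up to [k] cancel. *)
Lemma flux_force W s x (r : R) (k : 'I_N) : (forall i j, W i j = W j i) -> r != 0 ->
  (forall i j : 'I_N, (i < j)%N -> (j < N.-1)%N -> span s i j = r * (x j - x i)) ->
  (k < N.-1)%N -> r * flux W s k = \sum_(i : 'I_N | (i <= k)%N) force W x i.
Proof.
move=> Ws r0 sx kN.
transitivity (\sum_(i : 'I_N | (i <= k)%N) \sum_(j : 'I_N | (k < j)%N && (j < N.-1)%N) W i j / (x j - x i)).
  rewrite /flux mulr_sumr (pair_big (fun i : 'I_N => (i <= k)%N) (fun j : 'I_N => (k < j)%N && (j < N.-1)%N)) /=.
  apply: eq_bigr => -[i j] /= /and3P[ik kj jN]; rewrite sx ?(leq_ltn_trans ik kj) //.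
  by rewrite invfM mulrCA mulVKf.
have anti : \sum_(i : 'I_N | (i <= k)%N) \sum_(j : 'I_N | (j <= k)%N && (j != i)) W i j / (x j - x i) = 0.
  rewrite -[RHS](@sum_antisym R 'I_N (fun i j =>
    if (i <= k)%N && (j <= k)%N then W i j / (x j - x i) else 0)); last first.
    move=> i j; rewrite andbC; case: ifP => _; last by rewrite oppr0.
    by rewrite Ws -mulrN -invrN opprB.
  rewrite [LHS]big_mkcond; apply: eq_bigr => i _; case: (i <= k)%N => /=; last by rewrite big1.
  rewrite big_mkcond; apply: eq_bigr => j _; have [->|_] := eqVneq j i; last by rewrite andbT.
  by rewrite subrr invr0 mulr0 !if_same.
rewrite -[LHS]addr0 -[X in _ + X = _]anti -big_split; apply: eq_bigr => i ik /=.
rewrite /force [RHS](bigID (fun j : 'I_N => (k < j)%N)) /=; congr (_ + _); apply: eq_bigl => j.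
  rewrite -(inj_eq (@ord_inj _)); move: ik; clear; lia.
rewrite -leqNgt; move: kN; clear; lia.
Qed.

Lemma flux0_force0 W s x (r : R) : (forall i j, W i j = W j i) -> r != 0 ->
  (forall i j : 'I_N, (i < j)%N -> (j < N.-1)%N -> span s i j = r * (x j - x i)) ->
  (forall k : 'I_N, (k.+1 < N.-1)%N -> flux W s k = 0) <->
  (forall i : 'I_N, (i < N.-1)%N -> force W x i = 0).
Proof.
move=> Ws r0 sx; have ff k := @flux_force W s x r k Ws r0 sx; split=> [fl|fo k kN]; last first.
  apply: (mulfI r0); rewrite mulr0 ff; last by lia.
  rewrite big1 // => i ik; apply: fo; lia.
have {}fl (k : 'I_N) : (k < N.-1)%N -> \sum_(i : 'I_N | (i <= k)%N) force W x i = 0.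
  move=> kN; rewrite -ff //; have [/fl->|Nk] := ltnP k.+1 N.-1; first by rewrite mulr0.
  rewrite /flux big1 ?mulr0 // => -[i j] /= /and3P[h1 h2 h3]; move: Nk h2 h3; clear; lia.
move=> i iN; have := fl i iN; rewrite (bigD1 i) //= => /eqP; have [i0|i0] := posnP i.
  rewrite big1 ?addr0 => [/eqP//|j /andP[ji ne]]; move: ji ne.
  rewrite -(inj_eq (@ord_inj _)); move: i0; clear; lia.
have pN : (i.-1 < N)%N by lia.
have := fl (Ordinal pN) ltac:(rewrite /=; lia) => /= e.
rewrite (eq_bigl (fun j : 'I_N => (j <= i.-1)%N)) ?e ?addr0 => [/eqP//|j].
by rewrite -(inj_eq (@ord_inj _)); move: i0; clear; lia.
Qed.

Section Config.
Variable z : 'M[R]_(N, 3).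
Hypothesis cz : is_config z.
Let N3 : (2 < N)%N := ltnW N4.
Variable c : 'I_N.
Hypothesis c_last : c = N.-1 :> nat.
Let x k := pencil_x z c k.

Lemma last_neq (i : 'I_N) : (i < N.-1)%N = (c != i).
Proof. by rewrite -(inj_eq (@ord_inj _)) c_last; have := ltn_ord i; clear; lia. Qed.

Lemma pencil_x_inj (i j : 'I_N) : c != i -> c != j -> i != j -> x i != x j.
Proof.
move=> ci cj ij; case/orP: (cyc_total ci ij cj) => /(pencil_x_lt N4 cz); rewrite neq_lt /x => ->//.
by rewrite orbT.
Qed.

(** Evaluated at any vertex, the balance at a finite vertex [i] is a multiple of the force at [i],
    with factor 2 at [c]. The balance at [c] then follows, because the balance sums of all vertices
    add up to 0 by antisymmetry. *)
Lemma balanced_force W : (forall i j, W i j = W j i) ->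
  (forall i, \sum_(j | j != i) W i j = 0) ->
  balanced z W <-> forall i : 'I_N, (i < N.-1)%N -> force W x i = 0.
Proof.
move=> Ws st.
have forceE i : force W x i = \sum_(j | (j != c) && (j != i)) W i j / (x j - x i).
  by apply: eq_bigl => j; rewrite last_neq eq_sym.
have ev_fin (i k : 'I_N) : c != i -> c != k -> \sum_j W i j / ch z i j * br z i j k =
    ch z c k * (x k - x i) ^+ 2 * force W x i.
  move=> ci ck; have := st i; have [ki|ki] := eqVneq k i.
    move=> _; rewrite ki subrr expr0n /= mulr0 mul0r big1 // => j _; by rewrite br_iji mulr0.
  rewrite (bigD1 c) //= (eq_bigl (fun j => (j != c) && (j != i))) => [stc|j]; last by rewrite andbC.
  transitivity (- (ch z c k * (x k - x i) * W i c) + (ch z c k * (x k - x i) ^+ 2 * force W x i -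
      ch z c k * (x k - x i) * \sum_(j | (j != c) && (j != i)) W i j)); last first.
    by move/eqP: stc; rewrite addr_eq0 => /eqP->; ring.
  rewrite (bigD1 c) //= (bigD1 i) 1?eq_sym //= br_iij mulr0 add0r; congr (_ + _).
    rewrite [ch z i c]ch_sym (_ : br z i c k = - br z c i k); last by rewrite /br; ring.
    rewrite br_chart_pole // -/(x k) -/(x i); have := ch_gt0 cz N3 ci => h.
    by field; rewrite gt_eqF.
  rewrite forceE !mulr_sumr -sumrB; apply: eq_bigr => j /andP[jc ji].
  rewrite eq_sym in jc; rewrite (br_chart N4 cz ci jc ck) (ch_chart N4 cz ci jc) -/(x i) -/(x j) -/(x k).
  have ne : x j - x i != 0 by rewrite subr_eq0 pencil_x_inj.
  have h1 := ch_gt0 cz N3 ci; have h2 := ch_gt0 cz N3 jc.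
  by field; rewrite ne !gt_eqF.
have ev_last (i : 'I_N) : c != i -> \sum_j W i j / ch z i j * br z i j c = 2 * force W x i.
  move=> ci; rewrite (bigD1 c) //= (bigD1 i) 1?eq_sym //= br_iij br_ijj !mulr0 !add0r.
  rewrite forceE !mulr_sumr; apply: eq_bigr => j /andP[jc ji].
  rewrite eq_sym in jc; rewrite -br_rot -br_rot (br_chart_pole N4 cz ci jc) (ch_chart N4 cz ci jc) -/(x i) -/(x j).
  have ne : x j - x i != 0 by rewrite subr_eq0 pencil_x_inj.
  have h1 := ch_gt0 cz N3 ci; have h2 := ch_gt0 cz N3 jc.
  by field; rewrite ne !gt_eqF.
split=> [bW i iN|fo].
  have ci : c != i by rewrite -last_neq.
  have := ev_last i ci; rewrite (balanced_br i c bW) => /esym/eqP.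
  by rewrite mulf_eq0 pnatr_eq0 /= => /eqP.
have fin (i : 'I_N) : c != i -> \sum_j (W i j / ch z i j) *: cross z i j = 0.
  move=> ci; have [j [ji jc]] := third_index N3 i c.
  apply: (fv_inj0 (z := z) (i := c) (j := i) (k := j)).
  - by rewrite br_neq0 // eq_sym.
  - rewrite fv_sum; under eq_bigr do rewrite fvZ fv_cross.
    by rewrite ev_last // fo ?mulr0 // last_neq.
  - rewrite fv_sum; under eq_bigr do rewrite fvZ fv_cross.
    by rewrite ev_fin // fo ?mulr0 // last_neq.
  - rewrite fv_sum; under eq_bigr do rewrite fvZ fv_cross.
    by rewrite ev_fin // ?(eq_sym c) // fo ?mulr0 // last_neq.
move=> i; have [->|ic] := eqVneq i c; last by apply: fin; rewrite eq_sym.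
have tot : \sum_i \sum_j (W i j / ch z i j) *: cross z i j = 0.
  have e : forall y : 'rV[R]_3, y = - y -> y = 0.
    move=> y /matrixP e; apply/matrixP => a b; have := e a b; rewrite !mxE; lra.
  apply: e; rewrite {1}exchange_big /= -sumrN; apply: eq_bigr => a _.
  rewrite -sumrN; apply: eq_bigr => b _; rewrite Ws ch_sym -scalerN; congr (_ *: _).
  by apply: row3P; rewrite !mxE /=; ring.
rewrite -[LHS]addr0 -[RHS]tot [RHS](bigD1 c) //=; congr (_ + _).
by rewrite big1 // => j jc; apply: fin; rewrite eq_sym.
Qed.

End Config.
End FiniteVertices.

(** * The action of the group and canonical representatives *)

Section Action.
Variables (R : realType) (N : nat).
Hypothesis N4 : (3 < N)%N.
Let N3 : (2 < N)%N := ltnW N4.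
Variables (A : 'M[R]_3) (z Z : 'M[R]_(N, 3)) (w : 'I_N -> R).
Hypotheses (cz : is_config z) (cZ : is_config Z) (A_SO : SO21 A).
Hypothesis w_neq0 : forall k, w k != 0.
Hypothesis A_row : forall k, A *m upart (row k z) = w k *: upart (row k Z).

Lemma br_act (i j k : 'I_N) : br z i j k = w i * w j * w k * br Z i j k.
Proof.
have e : uvec3 z i j k *m A^T = \matrix_(a < 3, b < 3)
    (w (nth i [:: i; j; k] a) * uvec3 Z i j k a b).
  apply/matrixP => a b; transitivity ((A *m upart (row (nth i [:: i; j; k] a) z)) b 0).
    by rewrite !mxE; apply: eq_bigr => d _; rewrite !mxE mulrC.
  by rewrite A_row [RHS]mxE mxE; congr (_ * _); rewrite [RHS]mxE.
rewrite -(det_uvec3 z) -[LHS]mulr1 -A_SO.2 -(det_tr A) -det_mulmx e det_mx33 -det_uvec3 det_mx33 !mxE /=.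
by ring.
Qed.

Lemma ch_act (i j : 'I_N) : ch z i j = w i * w j * ch Z i j.
Proof.
have chl (y : 'M[R]_(N, 3)) : ch y i j = - lform (upart (row i y)) (upart (row j y)).
  by rewrite /lform !upart_rowE /= /ch; ring.
rewrite !chl -A_SO.1 !A_row /lform !mxE /=; ring.
Qed.

Lemma slope_drop_act (H : 'I_N -> R) (i j l r : 'I_N) : cyc i l j -> cyc i j r ->
  slope_drop z (fun k => w k * H k) i j l r = slope_drop Z H i j l r.
Proof.
move=> hl hr; rewrite !slope_dropE // /quad !br_act ch_act.
have [b1 b2] := (br_gt0 cZ hl, br_gt0 cZ hr).
by field; rewrite !w_neq0 !gt_eqF.
Qed.

Lemma top_angle_act (H : 'I_N -> R) (i j : 'I_N) :
  top_angle z (fun k => w k * H k) i j = top_angle Z H i j.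
Proof. by apply: top_angle_ext => // l r hl hr; exact: slope_drop_act. Qed.

Lemma balanced_act (W : 'I_N -> 'I_N -> R) : balanced z W -> balanced Z W.
Proof.
move=> bW i; have zero k : fv Z (\sum_j (W i j / ch Z i j) *: cross Z i j) k = 0.
  rewrite fv_sum; under eq_bigr do rewrite fvZ fv_cross.
  apply: (mulfI (w_neq0 k)); rewrite mulr0 mulr_sumr -[RHS](balanced_br i k bW).
  apply: eq_bigr => j _; have [->|ij] := eqVneq i j; first by rewrite !br_iij !mulr0.
  by rewrite br_act ch_act; field; rewrite !w_neq0 gt_eqF // ch_gt0.
have iS := ordS_neq N4 i; have [k [ki kS]] := third_index N3 i (ordS i).
have b0 : br Z i (ordS i) k != 0 by rewrite br_neq0 // eq_sym.
exact: (fv_inj0 b0).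
Qed.

(** The heights scale like the lifts and linear functions do not bend, so the diagonals keep their
    angles; the sides follow by balance. *)
Lemma dihedral_act f : (forall k, w k * Z k 2 = z k 2 + fv z f k) -> dihedral Z = dihedral z.
Proof.
move=> hf; have top b i j : top_angle Z (vertex_height Z b) i j = top_angle z (vertex_height z b) i j.
  rewrite -top_angle_act; case: b.
    by rewrite -[RHS](top_angle_lin N4 cz _ f); congr (top_angle _ _ _ _); apply/funext => k; exact: hf.
  rewrite -[RHS](top_angle_lin N4 cz _ (- f)); congr (top_angle _ _ _ _); apply/funext => k.
  by rewrite /vertex_height mulrN hf fvN opprD.
apply/funext => -[i|[b D]]; last by apply: eq_bigr => p _; exact: top.
have side (y : 'M[R]_(N, 3)) : is_config y -> dihedral y (inl i) = pair_weight (dihedral y) i (ordS i).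
  by move=> cy; rewrite pair_weight_dihedral ?ordS_neq // /angle eqxx.
rewrite !side //; apply: (balanced_side_unique N4 cZ (balanced_pair_weight N4 cZ)).
  exact/balanced_act/balanced_pair_weight.
move=> j ij ad; rewrite !(pair_weightE N4 _ ij) !dihedral_pair // !top.
by move: ad; rewrite /adjacent_ord negb_or => /andP[/negbTE-> /negbTE->].
Qed.

End Action.

(** * Isometries in the identity component *)

Section SO0.
Variable R : realType.

Lemma mx_cvg (T : Type) (F : set_system T) (m n : nat) (g : T -> 'M[R]_(m, n)) (l : 'M[R]_(m, n)) :
  Filter F -> (forall i j, g x i j @[x --> F] --> l i j) -> g x @[x --> F] --> l.
Proof.
move=> FF cg U [P Px sPU] /=.
have nP : \forall y \near F, forall i j, P i j (g y i j).
  apply: (@filter_forall _ _ _ _ FF) => i; apply: (@filter_forall _ _ _ _ FF) => j.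
  exact: cg (Px i j).
by apply: (@filterS _ _ FF _ _ _ nP) => y Py; exact: sPU.
Qed.

Lemma mx_continuous (T : topologicalType) (m n : nat) (g : T -> 'M[R]_(m, n)) :
  (forall i j, continuous (fun x => g x i j)) -> continuous g.
Proof. by move=> cg x; apply: mx_cvg => i j; exact: cg. Qed.

Lemma SO0_path (g : R -> 'M[R]_3) (t : R) : continuous g -> (forall t, SO21 (g t)) ->
  g 0 = 1%:M -> SO0_21 (g t).
Proof.
move=> cg gS g0; exists (range g); last by exists t.
split; first by exists 0.
  by move=> _ [s _ <-].
apply: connected_continuous_connected; last exact: continuous_subspaceT.
by apply/connected_intervalP => x y _ _ u _.
Qed.

Definition mx3 (a b c d e f g h i : R) : 'M[R]_3 :=
  \matrix_(k < 3, l < 3) nth 0 (nth [::] [:: [:: a; b; c]; [:: d; e; f]; [:: g; h; i]] k) l.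

Lemma mx3_continuous (a b c d e f g h i : R -> R) :
  continuous a -> continuous b -> continuous c -> continuous d -> continuous e ->
  continuous f -> continuous g -> continuous h -> continuous i ->
  continuous (fun t => mx3 (a t) (b t) (c t) (d t) (e t) (f t) (g t) (h t) (i t)).
Proof.
move=> ca cb cc cd ce cf cg ch ci; apply: mx_continuous => k l.
by have [->|[->|->]] := ord3_cases k; have [->|[->|->]] := ord3_cases l;
  under eq_fun do rewrite mxE /=.
Qed.

Lemma mx3_1 : mx3 1 0 0 0 1 0 0 0 1 = 1%:M.
Proof.
apply/matrixP => k l; rewrite !mxE.
by have [->|[->|->]] := ord3_cases k; have [->|[->|->]] := ord3_cases l.
Qed.

Definition rotation (p q : R) : 'M[R]_3 := mx3 p (- q) 0 q p 0 0 0 1.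

Lemma rotation_SO21 p q : p ^+ 2 + q ^+ 2 = 1 -> SO21 (rotation p q).
Proof.
move=> pq; split=> [u v|].
  transitivity ((p ^+ 2 + q ^+ 2) * (u 0 0 * v 0 0 + u 1 0 * v 1 0) - u 2 0 * v 2 0).
    by rewrite /lform !mxE !sum3 !mxE /=; ring.
  by rewrite pq mul1r.
by rewrite det_mx33 !mxE /= -[RHS]pq; ring.
Qed.

(** The rational parametrization of the circle, starting at the identity, reaches every rotation but
    the half turn, here at [t = q / (1 + p)]. *)
Lemma half_turn_SO0 p q : p ^+ 2 + q ^+ 2 = 1 -> p != -1 -> SO0_21 (rotation p q).
Proof.
move=> pq p1; pose g t := rotation ((1 - t ^+ 2) / (1 + t ^+ 2)) (2 * t / (1 + t ^+ 2)).
have d0 t : 1 + t ^+ 2 != 0 :> R by rewrite gt_eqF // ltr_pwDl ?sqr_ge0.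
have p0 : 1 + p != 0 by rewrite addrC addr_eq0.
have -> : rotation p q = g (q / (1 + p)).
  have e : 1 + (q / (1 + p)) ^+ 2 = 2 / (1 + p).
    rewrite exprMn (_ : q ^+ 2 = (1 - p) * (1 + p)); last by apply: (addrI (p ^+ 2)); rewrite pq; ring.
    by field.
  rewrite /g e; congr rotation; last by field.
  rewrite (_ : 1 - _ = 2 - (1 + (q / (1 + p)) ^+ 2)); last by ring.
  by rewrite e; field.
have sq : continuous (fun t : R => t ^+ 2) by move=> t; exact: exprn_continuous.
have ci : continuous (fun t : R => (1 + t ^+ 2)^-1).
  by move=> t; apply: cvgV => //; apply: cvgD; [exact: cvg_cst|exact: sq].
have c1 : continuous (fun t : R => (1 - t ^+ 2) / (1 + t ^+ 2)).
  by move=> t; apply: cvgM; [apply: cvgB; [exact: cvg_cst|exact: sq]|exact: ci].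
have c2 : continuous (fun t : R => 2 * t / (1 + t ^+ 2)).
  by move=> t; apply: cvgM; [apply: cvgM; [exact: cvg_cst|exact: cvg_id]|exact: ci].
apply: SO0_path => [|t|].
- apply: mx3_continuous => // t; try exact: cvg_cst; try exact: c1; try exact: c2.
  by apply: cvgN; exact: c2.
- by apply: rotation_SO21; field; rewrite d0.
- by rewrite /g /rotation expr0n /= mulr0 mul0r subr0 addr0 divr1 oppr0 mx3_1.
Qed.

(** The half turn, missed by the parametrization, is the square of a quarter turn. *)
Lemma rotation_SO0 p q : p ^+ 2 + q ^+ 2 = 1 -> SO0_21 (rotation p q).
Proof.
move=> pq; have [p1|] := eqVneq p (-1); last exact: half_turn_SO0.
have q0 : q = 0 by apply/eqP; rewrite -sqrf_eq0; apply/eqP; move: pq; rewrite p1; lra.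
have -> : rotation p q = rotation 0 1 *m rotation 0 1.
  apply/matrixP => k l; rewrite p1 q0 !mxE sum3 !mxE.
  by have [->|[->|->]] := ord3_cases k; have [->|[->|->]] := ord3_cases l; rewrite /=; ring.
have r : SO0_21 (rotation 0 1).
  by apply: half_turn_SO0; [ring|rewrite eq_sym oppr_eq0 oner_eq0].
exact: SO0_21_mul.
Qed.

(* The isometry acting on the boundary of the hyperbolic plane by
   x |-> r x + s, where x stands for the null line of (1 - x^2, 2 x, 1 + x^2). *)
Definition affinity (r s : R) : 'M[R]_3 := mx3
  (((1 - s ^+ 2) / r + r) / 2) (- s) (((1 - s ^+ 2) / r - r) / 2)
  (s / r) 1 (s / r)
  (((1 + s ^+ 2) / r - r) / 2) s (((1 + s ^+ 2) / r + r) / 2).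

Definition null_vec (x : R) : 'cV[R]_3 :=
  \col_k (if k == 0 then 1 - x ^+ 2 else if k == 1 then 2 * x else 1 + x ^+ 2).

Lemma affinity_null r s x : r != 0 ->
  affinity r s *m null_vec x = r^-1 *: null_vec (r * x + s).
Proof.
move=> r0; apply/matrixP => k l; rewrite ord1 !mxE sum3 !mxE.
by have [->|[->|->]] := ord3_cases k; rewrite /=; field.
Qed.

Lemma affinity_SO21 r s : r != 0 -> SO21 (affinity r s).
Proof.
move=> r0; split=> [u v|]; first by rewrite /lform !mxE !sum3 !mxE /=; field.
by rewrite det_mx33 !mxE /=; field.
Qed.

Lemma affinity_SO0 r s : 0 < r -> SO0_21 (affinity r s).
Proof.
move=> r0; pose g t := affinity (expR (t * ln r)) (t * s).
have -> : affinity r s = g 1 by rewrite /g !mul1r lnK.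
have e0 t : expR t != 0 :> R by rewrite gt_eqF ?expR_gt0.
have ce : continuous (fun t : R => expR (t * ln r)).
  move=> t; apply: (continuous_cvg (nbhs_filter t) (@continuous_expR R _)).
  by apply: cvgM; [exact: cvg_id|exact: cvg_cst].
have cs : continuous (fun t : R => t * s).
  by move=> t; apply: cvgM; [exact: cvg_id|exact: cvg_cst].
have cq (a : R) : continuous (fun t : R => (1 + a * (t * s) ^+ 2) / expR (t * ln r)).
  move=> t; apply: cvgM; last by apply: cvgV => //; exact: ce.
  apply: cvgD; first exact: cvg_cst.
  by apply: cvgM; [exact: cvg_cst|apply: cvgM; exact: cs].
have cq' (a b : R) : continuous (fun t : R => ((1 + a * (t * s) ^+ 2) / expR (t * ln r) + b * expR (t * ln r)) / 2).
  move=> t; apply: cvgM; last exact: cvg_cst.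
  apply: cvgD; first exact: cq.
  by apply: cvgM; [exact: cvg_cst|exact: ce].
have cr : continuous (fun t : R => t * s / expR (t * ln r)).
  by move=> t; apply: cvgM; [exact: cs|apply: cvgV => //; exact: ce].
apply: SO0_path => [|t|].
- have -> : g = fun t => mx3
    (((1 + (- 1) * (t * s) ^+ 2) / expR (t * ln r) + 1 * expR (t * ln r)) / 2) (- (t * s))
    (((1 + (- 1) * (t * s) ^+ 2) / expR (t * ln r) + (- 1) * expR (t * ln r)) / 2)
    (t * s / expR (t * ln r)) 1 (t * s / expR (t * ln r))
    (((1 + 1 * (t * s) ^+ 2) / expR (t * ln r) + (- 1) * expR (t * ln r)) / 2) (t * s)
    (((1 + 1 * (t * s) ^+ 2) / expR (t * ln r) + 1 * expR (t * ln r)) / 2).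
    by apply/funext => t; rewrite /g /affinity !mul1r !mulN1r.
  apply: mx3_continuous => // t; try exact: cq'; try exact: cr; try exact: cs.
    by apply: cvgN; exact: cs.
  exact: cvg_cst.
- exact: affinity_SO21.
- by rewrite /g !mul0r expR0 /affinity expr0n /= -mx3_1; congr mx3; field.
Qed.

End SO0.

(** * The polyhedron built from a weight *)

Section Canonical.
Variables (R : realType) (N : nat).
Hypothesis N4 : (3 < N)%N.
Let N3 : (2 < N)%N := ltnW N4.
Implicit Types (x h : 'I_N -> R) (theta : weights R N).

(** The last vertex is [(-1, 0)], the point at infinity of the parametrization of the circle that
    places the other ones. *)
Definition chart_mx x h : 'M[R]_(N, 3) := \matrix_(k < N, a < 3)
  (if a == 2 then h k else if k.+1 == N then (if a == 0 then -1 else 0) else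
   if a == 0 then (1 - x k ^+ 2) / (1 + x k ^+ 2) else 2 * x k / (1 + x k ^+ 2)).

Let d0 (t : R) : 1 + t ^+ 2 != 0. Proof. by rewrite gt_eqF // ltr_pwDl ?sqr_ge0. Qed.

Lemma chart_mx_config x h : (forall i j : 'I_N, (i < j)%N -> (j < N.-1)%N -> x i < x j) ->
  is_config (chart_mx x h).
Proof.
move=> xlt; have pos t : 0 < 1 + t ^+ 2 :> R by rewrite ltr_pwDl ?sqr_ge0.
split=> [i|i j k ij jk].
  by rewrite !mxE /=; case: eqP => _; [ring|field; rewrite d0].
have kN := ltn_ord k; rewrite /br !mxE /=.
have -> : (i.+1 == N) = false by move: ij jk kN; clear; lia.
have -> : (j.+1 == N) = false by move: ij jk kN; clear; lia.
have xij : x i < x j by apply: xlt => //; move: jk kN; clear; lia.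
case: eqP => [_|/eqP kN'].
  rewrite (_ : _ - _ = 4 * (x j - x i) / ((1 + x i ^+ 2) * (1 + x j ^+ 2))).
    by rewrite divr_gt0 ?mulr_gt0 ?subr_gt0.
  by field; rewrite !d0.
have xjk : x j < x k by apply: xlt => //; move: kN kN'; clear; lia.
rewrite (_ : _ - _ = 4 * ((x j - x i) * (x k - x j) * (x k - x i)) /
    ((1 + x i ^+ 2) * (1 + x j ^+ 2) * (1 + x k ^+ 2))).
  by rewrite divr_gt0 ?mulr_gt0 ?subr_gt0 // (lt_trans xij).
by field; rewrite !d0.
Qed.

Lemma chart_mx_x x h (c k : 'I_N) : c = N.-1 :> nat -> (k < N.-1)%N ->
  pencil_x (chart_mx x h) c k = x k.
Proof.
move=> cN kN; rewrite /pencil_x /ch !mxE /=.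
have -> : (c.+1 == N) by rewrite cN; clear -N4; lia.
have -> : (k.+1 == N) = false by move: kN; clear; lia.
rewrite (_ : 1 - _ - _ = 2 / (1 + x k ^+ 2)); last by field; rewrite d0.
by field; rewrite d0.
Qed.

Lemma chart_mx_null x h (k : 'I_N) : (k < N.-1)%N ->
  upart (row k (chart_mx x h)) = (1 + x k ^+ 2)^-1 *: null_vec (x k).
Proof.
move=> kN; apply/matrixP => a b; rewrite ord1 !mxE.
have -> : (k.+1 == N) = false by move: kN; clear; lia.
by have [->|[->|->]] := ord3_cases a; rewrite /= mulrC // mulfV.
Qed.

Lemma roof_chart x h h' theta b k : roof (chart_mx x h) theta b k = roof (chart_mx x h') theta b k.
Proof.
congr (- _); apply: eq_bigr => p _; congr (_ * Num.max _ _).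
by rewrite /bend /br /ch !mxE.
Qed.

Lemma span_recr (s : 'I_N -> R) (i : nat) (j j' : 'I_N) : (i <= j)%N -> j' = j.+1 :> nat ->
  span s i j' = span s i j + expR (s j).
Proof.
move=> ij e; rewrite /span (bigD1 j) /=; last by rewrite ij e leqnn.
rewrite addrC; congr (_ + _); apply: eq_bigl => k.
by rewrite -(inj_eq (@ord_inj _)) e; clear; lia.
Qed.

Lemma span_chain (s : 'I_N -> R) (i j : nat) : (i <= j)%N -> span s 0 j = span s 0 i + span s i j.
Proof.
move=> ij; rewrite /span (bigID (fun k : 'I_N => (k < i)%N)) /=.
by congr (_ + _); apply: eq_bigl => k; move: ij; clear; lia.
Qed.

Definition realizable theta : Prop := exists G : graph_gamma N, angle_cell R (val G) theta.

Lemma graph_gammaP (G : graph_gamma N) :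
  [/\ forall i, (inl i : arc N) \in val G,
      forall b D, (inr (b, D) : arc N) \in val G -> is_diagonal D
    & forall b D T, (inr (b, D) : arc N) \in val G -> (inr (b, T) : arc N) \in val G -> ~~ crossing D T].
Proof.
have /and4P[/forallP h1 /forallP h2 /forallP h3 _] := valP G; split=> // b D.
  by move/implyP: (forallP (h2 b) D).
by move=> T h4 h5; move/implyP: (forallP (forallP (h3 b) D) T); rewrite h4 h5 => /(_ isT).
Qed.

(** For a weight in a cell this is the unique normalized minimizer; the default value is taken only
    if there is none. *)
Definition gaps theta : 'I_N -> R := xget (fun _ => 0)
  [set s | normalized s /\ forall s', energy (pair_weight theta) s 0 N.-1 <= energy (pair_weight theta) s' 0 N.-1].

Definition positions theta (k : 'I_N) : R := span (gaps theta) 0 k.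

(** The roof depends only on the positions of the vertices, so it is computed over them at height 0
    before the heights exist. *)
Definition canonical theta : 'M[R]_(N, 3) :=
  chart_mx (positions theta) (roof (chart_mx (positions theta) (fun _ => 0)) theta true).

Lemma positionsB theta (i j : 'I_N) : (i < j)%N ->
  span (gaps theta) i j = 1 * (positions theta j - positions theta i).
Proof. by move=> ij; rewrite mul1r /positions (span_chain _ (ltnW ij)) addrC addKr. Qed.

Lemma canonical_config theta : is_config (canonical theta).
Proof.
apply: chart_mx_config => i j ij _; rewrite -subr_gt0 -[_ - _]mul1r -positionsB //.
exact: span_gt0.
Qed.

Section Realizable.
Variable theta : weights R N.
Hypothesis theta_real : realizable theta.

Lemma realizable_star i : \sum_(j | j != i) pair_weight theta i j = 0.
Proof.
have [G cell] := theta_real; have [h1 h2 h3] := graph_gammaP G; case: (cell) => h4 h5 _ _.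
by have [st _] := cuts_of_angle_cell N4 h1 h2 h3 h4 cell.
Qed.

Lemma realizable_energy : exists c, energy_ok (pair_weight theta) c.
Proof.
have [G cell] := theta_real; have [h1 h2 h3] := graph_gammaP G; case: (cell) => h4 h5 _ _.
have [st cu] := cuts_of_angle_cell N4 h1 h2 h3 h4 cell.
exact: (energy_ok_of_cuts N4 (pair_weight_sym theta) st cu (pair_weight_ge0 h4 h5)).
Qed.

Lemma gapsP : normalized (gaps theta) /\
  forall s', energy (pair_weight theta) (gaps theta) 0 N.-1 <= energy (pair_weight theta) s' 0 N.-1.
Proof.
have [c ok] := realizable_energy; have [s hs] := minimizer_exists N4 ok.
by rewrite /gaps; set P := [set s | _]; apply: (xgetPex _ (P := P)); exists s.
Qed.

(** Two different normalized critical points would each have strictly smaller energy than the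
    other. *)
Lemma gaps_unique s : normalized s ->
  (forall k : 'I_N, (k.+1 < N.-1)%N -> flux (pair_weight theta) s k = 0) -> s = gaps theta.
Proof.
have [c [c0 Wp tl tf Wl]] := realizable_energy; have [nS mS] := gapsP; move=> ns fl.
have fS k kN := min_flux (k := k) kN mS.
have z0 (k : 'I_N) : k = 0 :> nat -> s k = gaps theta k.
  by move=> k0; rewrite ns ?nS // k0 eqxx.
apply/funext => k; have [kN|kN] := ltnP k.+1 N.-1; last by rewrite ns ?nS // kN orbT.
apply: contrapT => /eqP ne.
have h1 := energy_critical_lt Wp Wl fS z0 (ex_intro2 _ _ k kN ne).
have := energy_critical_lt Wp Wl fl (fun k k0 => esym (z0 k k0)).
rewrite eq_sym in ne => /(_ (ex_intro2 _ _ k kN ne)) h2.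
by have := lt_trans h1 h2; rewrite ltxx.
Qed.

Let last_ord : 'I_N := Ordinal (ltac:(rewrite prednK //; lia) : (N.-1 < N)%N).

Lemma canonical_balanced : balanced (canonical theta) (pair_weight theta).
Proof.
apply/(balanced_force N4 (canonical_config theta) (erefl : last_ord = N.-1 :> nat)
  (pair_weight_sym theta) realizable_star) => i iN.
have := @flux0_force0 R N N4 (pair_weight theta) (gaps theta) (positions theta) 1 (pair_weight_sym theta).
rewrite oner_neq0 => /(_ isT (fun i j ij _ => positionsB theta ij))[+ _].
move=> /(_ (fun k kN => min_flux kN gapsP.2) i iN) => <-.
apply: eq_bigr => j /andP[jN _]; by rewrite !chart_mx_x.
Qed.

Lemma canonical_height k : canonical theta k 2 = roof (canonical theta) theta true k.
Proof. by rewrite {1}/canonical mxE /=; exact: roof_chart. Qed.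

Lemma dihedral_canonical : dihedral (canonical theta) = theta.
Proof.
have [G cell] := theta_real; have [h1 h2 h3] := graph_gammaP G.
exact: (dihedral_reconstruction N4 (canonical_config theta) h2 h3 cell canonical_balanced canonical_height).
Qed.

Lemma canonical_marked : marked_poly R N (canonical theta).
Proof.
have [G cell] := theta_real; have [h1 h2 h3] := graph_gammaP G.
apply: (config_marked_poly N4 (canonical_config theta)).
exact: (reconstruction_noncoplanar N4 (canonical_config theta) h1 h2 h3 cell canonical_balanced canonical_height).
Qed.

End Realizable.

Lemma dihedral_realizable z : marked_poly R N z -> realizable (dihedral z).
Proof.
move=> /marked_poly_config[cz nc]; have [g cell] := config_angle_cell N4 cz nc.
by exists (exist (fun E : {set arc N} => is_graph E) (skeleton z) g).
Qed.

Lemma dihedral_G0 (z z' : marked_poly R N) : G0_rel z z' -> dihedral (val z') = dihedral (val z).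
Proof.
move=> /asboolP[A [l [/SO0_21_sub hA h]]].
have [cz _] := marked_poly_config (set_mem (valP z)).
have [cz' _] := marked_poly_config (set_mem (valP z')).
pose w (k : 'I_N) : R := (A *m upart (row k (val z))) 2 0.
have w0 k : w k != 0 by apply: SO21_bd_neq0 => //; exact: marked_poly_bd.
apply: (@dihedral_act _ _ N4 A _ _ w cz cz' hA w0 _ l) => k.
  by rewrite h upart_hp_act ?w0 // scalerA mulfV ?scale1r ?w0.
by rewrite -(height_vertex (val z')) h height_hp_act ev_vertex height_vertex mulrC divfK // w0.
Qed.

(** Put the last vertex at infinity and scale the line so that the first gap is 1. Balance makes the
    logarithms of the gaps critical, hence equal to [gaps theta], and an affine map of the line
    takes the points to the canonical ones. The top angles then determine the heights up to a linear
    function, which is the [f] of the group element. *)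
Lemma canonical_G0 (z Z : marked_poly R N) : val Z = canonical (dihedral (val z)) -> G0_rel z Z.
Proof.
have [y yE] : exists y, y = val z by exists (val z).
rewrite -yE; set theta := dihedral y => ZE.
have mz : marked_poly R N y by rewrite yE; exact: set_mem (valP z).
have re := dihedral_realizable mz; have [cz nc] := marked_poly_config mz.
have W_bal := balanced_pair_weight N4 cz; rewrite -/theta in W_bal.
have cN : (N.-1 < N)%N by lia.
have i0N : (0 < N)%N by lia.
have i1N : (1 < N)%N by lia.
pose c : 'I_N := Ordinal cN; pose i0 : 'I_N := Ordinal i0N; pose i1 : 'I_N := Ordinal i1N.
pose x k := pencil_x y c k.
have xlt (i j : 'I_N) : (i < j)%N -> (j < N.-1)%N -> x i < x j.
  by move=> ij jN; apply: (pencil_x_lt N4 cz); rewrite /cyc /=; move: ij jN; clear; lia.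
pose r := (x i1 - x i0)^-1.
have r0 : 0 < r by rewrite invr_gt0 subr_gt0 xlt //=; lia.
pose s (k : 'I_N) := if (k.+1 < N.-1)%N then ln (r * (x (ordS k) - x k)) else 0.
have Sk (k : 'I_N) : (k.+1 < N.-1)%N -> ordS k = k.+1 :> nat.
  by move=> kN; rewrite ordSE; case: eqP => //; move: kN; clear; lia.
have spanE (i j : 'I_N) : (i <= j)%N -> (j < N.-1)%N -> span s i j = r * (x j - x i).
  elim: {j}(j : nat) {-2}j (erefl (j : nat)) => [|n IH] j jn ij jN.
    rewrite (_ : j = i); last by apply: ord_inj; move: ij jn; clear; lia.
    by rewrite subrr mulr0 /span big1 // => k; clear; lia.
  have [ji|ji] := eqVneq j i.
    by rewrite ji subrr mulr0 /span big1 // => k; clear; lia.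
  have pN : (n < N)%N by move: jn jN; clear; lia.
  have ip : (i <= Ordinal pN)%N by move: ji ij; rewrite -(inj_eq (@ord_inj _)) /= jn; clear; lia.
  have pj : ((Ordinal pN).+1 < N.-1)%N by rewrite /= -jn.
  have Sp : ordS (Ordinal pN) = j by apply: ord_inj; rewrite Sk.
  rewrite (@span_recr s i (Ordinal pN) j ip jn) IH //=; last by move: jn jN; clear; lia.
  rewrite /s pj lnK ?Sp; first by ring.
  by rewrite posrE mulr_gt0 // subr_gt0 xlt // jn.
have ns : normalized s.
  move=> k; rewrite /s; case: ltnP => //= kN; rewrite orbF => /eqP k0.
  have -> : k = i0 by apply: ord_inj.
  have -> : ordS i0 = i1 by apply: ord_inj; rewrite Sk //=; lia.
  by rewrite /r mulVf ?ln1 // gt_eqF // subr_gt0 xlt //=; lia.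
have sE : s = gaps theta.
  apply: (gaps_unique re) => //.
  have := @flux0_force0 R N N4 (pair_weight theta) s x r (pair_weight_sym theta).
  rewrite gt_eqF // => /(_ isT (fun i j ij jN => spanE i j (ltnW ij) jN))[_]; apply.
  exact: (balanced_force N4 cz (erefl : c = N.-1 :> nat) (pair_weight_sym theta) (realizable_star re)).1.
have posE (k : 'I_N) : (k < N.-1)%N -> positions theta k = r * x k + - (r * x i0).
  by move=> kN; rewrite /positions -sE (spanE i0) // mulrBr.
(* The rotation takes [u_c] to [(-1, 0)]; the affinity then takes the coordinates [x] to the
   positions. *)
pose A := affinity r (- (r * x i0)) *m rotation (- y c 0) (y c 1).
have cc : (- y c 0) ^+ 2 + (y c 1) ^+ 2 = 1 by rewrite sqrrN cz.1.
have A0 : SO0_21 A by apply: SO0_21_mul; [exact: affinity_SO0|exact: rotation_SO0].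
pose w (k : 'I_N) := if k == c then r else ch y c k / 2 / r * (1 + positions theta k ^+ 2).
have w0 k : w k != 0.
  rewrite /w; case: ifP => [_|/negbT kc]; first by rewrite gt_eqF.
  have ck0 : ch y c k != 0 by rewrite gt_eqF // ch_gt0 // eq_sym.
  apply: mulf_neq0; last exact: d0.
  apply: mulf_neq0; last by rewrite invr_eq0 gt_eqF.
  by apply: mulf_neq0 => //; rewrite invr_eq0 pnatr_eq0.
have Arow k : A *m upart (row k y) = w k *: upart (row k (val Z)).
  rewrite ZE /w; case: ifP => [/eqP->|/negbT kc].
    have -> : A *m upart (row c y) = affinity r (- (r * x i0)) *m \col_a (if a == 0 then -1 else if a == 1 then 0 else 1).
      rewrite -mulmxA; congr (_ *m _); apply/matrixP => a b; rewrite ord1 mxE sum3 !mxE.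
      have := cz.1 c => e.
      by have [->|[->|->]] := ord3_cases a; rewrite /=; [rewrite -e|idtac|idtac]; ring.
    apply/matrixP => a b; rewrite ord1 !mxE sum3 !mxE /= prednK ?eqxx; last by lia.
    by have [->|[->|->]] := ord3_cases a; rewrite /=; field; rewrite gt_eqF.
  have kN : (k < N.-1)%N by rewrite (@last_neq N c (erefl _)) eq_sym.
  have ck : c != k by rewrite eq_sym.
  rewrite chart_mx_null // scalerA mulfK ?d0 // posE // -scalerA -affinity_null ?gt_eqF //.
  rewrite -mulmxA scalemxAr; congr (_ *m _).
  have [lE y0 y1] := chart_coord N4 cz ck.
  apply/matrixP => a b; rewrite ord1 mxE sum3 !mxE /=; rewrite y0 y1 lE -/(x k).
  have e := cz.1 c; move: (y c 0) (y c 1) (x k) e => p q t e; have dt := d0 t.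
  have [->|[->|->]] := ord3_cases a; rewrite /=.
  - transitivity ((p ^+ 2 + q ^+ 2) * (2 / (1 + t ^+ 2) - 1)); first by ring.
    by rewrite e; field.
  - transitivity ((p ^+ 2 + q ^+ 2) * (2 / (1 + t ^+ 2) * t)); first by ring.
    by rewrite e; field.
  - by field.
have top b (i j : 'I_N) : top_angle y (fun k => w k * vertex_height (val Z) b k) i j =
    top_angle y (vertex_height y b) i j.
  have cZ : is_config (val Z) by rewrite ZE; exact: canonical_config.
  rewrite (top_angle_act N4 cz cZ (SO0_21_sub A0) w0 Arow).
  have [->|ij] := eqVneq i j; first by rewrite /top_angle !eqxx.
  by rewrite -!(dihedral_pair N4) // ZE (dihedral_canonical re).
have [f hf] := top_angles_inj cz N4 (top true).
apply/asboolP; exists A, f; split=> // k; rewrite -yE.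
have wE : (A *m upart (row k y)) 2 0 = w k by rewrite Arow mxE upart_rowE mulr1.
apply: chart_eq; first by rewrite upart_hp_act ?wE ?w0 // Arow scalerA mulVf ?scale1r ?w0.
rewrite height_hp_act wE ev_vertex !height_vertex -hf /vertex_height addrC subrK mulrC mulKf //.
Qed.

End Canonical.

(** * Continuity *)

Section BigContinuity.
Variable R : realType.

Lemma cvgR_cst (T : Type) (F : set_system T) (a : R) : Filter F ->
  (fun _ : T => a) x @[x --> F] --> a.
Proof. by move=> FF; exact: (@cvg_cst R^o _ _ _ FF). Qed.

(** The initial value may vary too: the extrema in [top_angle] and [side_slope] start from one of
    their own terms. *)
Lemma cvg_big_idx (T I : Type) (F : set_system T) (r : seq I) (P : pred I) (op : R -> R -> R)
    (x : T -> R) (x0 : R) (f : I -> T -> R) (f0 : I -> R) : Filter F ->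
  continuous (fun p : R * R => op p.1 p.2) ->
  x t @[t --> F] --> x0 -> (forall i, P i -> f i t @[t --> F] --> f0 i) ->
  \big[op/x t]_(i <- r | P i) f i t @[t --> F] --> \big[op/x0]_(i <- r | P i) f0 i.
Proof.
move=> FF cop cx cf; elim: r => [|i r IH].
  by under eq_cvg do rewrite big_nil; rewrite big_nil.
under eq_cvg do rewrite big_cons; rewrite big_cons; case: ifPn => // Pi.
apply: (@cvg_comp _ _ _ (fun t => (f i t, \big[op/x t]_(j <- r | P j) f j t)) _ _
  (nbhs (f0 i, \big[op/x0]_(j <- r | P j) f0 j)) _ _ (continuous_curry_cvg cop)).
exact: (cvg_pair (cf i Pi) IH).
Qed.

Lemma max_cont : continuous (fun p : R * R => Num.max p.1 p.2).
Proof.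
by move=> p; apply: (@continuous_max R _ (fun p : R * R => p.1) (fun p : R * R => p.2));
  [exact: cvg_fst|exact: cvg_snd].
Qed.

Lemma min_cont : continuous (fun p : R * R => Num.min p.1 p.2).
Proof.
by move=> p; apply: (@continuous_min R _ (fun p : R * R => p.1) (fun p : R * R => p.2));
  [exact: cvg_fst|exact: cvg_snd].
Qed.

Lemma cvg_max (T : Type) (F : set_system T) (f g : T -> R) (a b : R) : Filter F ->
  f t @[t --> F] --> a -> g t @[t --> F] --> b -> Num.max (f t) (g t) @[t --> F] --> Num.max a b.
Proof.
move=> FF cf cg; apply: (@cvg_comp _ _ _ (fun t => (f t, g t)) _ _ (nbhs (a, b)) _ _
  (continuous_curry_cvg max_cont)).
exact: (cvg_pair cf cg).
Qed.

Lemma cvg_sumR (T I : Type) (F : set_system T) (r : seq I) (P : pred I)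
    (f : I -> T -> R) (f0 : I -> R) : Filter F ->
  (forall i, P i -> f i t @[t --> F] --> f0 i) ->
  \sum_(i <- r | P i) f i t @[t --> F] --> \sum_(i <- r | P i) f0 i.
Proof.
by move=> FF cf; apply: cvg_big_idx => //; [exact: add_continuous|exact: cvgR_cst].
Qed.

End BigContinuity.

Section AngleContinuity.
Variables (R : realType) (N : nat).
Hypothesis N4 : (3 < N)%N.
Let N3 : (2 < N)%N := ltnW N4.
Variable z0 : 'M[R]_(N, 3).
Hypothesis cz : is_config z0.
Implicit Types z : 'M[R]_(N, 3).

Lemma entry_cvg (i : 'I_N) (a : 'I_3) : z i a @[z --> z0] --> z0 i a.
Proof. exact: coord_continuous. Qed.

Lemma br_cvg (i j k : 'I_N) : br z i j k @[z --> z0] --> br z0 i j k.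
Proof.
exact: (cvgB (cvgM (cvgB (@entry_cvg j 0) (@entry_cvg i 0)) (cvgB (@entry_cvg k 1) (@entry_cvg i 1)))
             (cvgM (cvgB (@entry_cvg k 0) (@entry_cvg i 0)) (cvgB (@entry_cvg j 1) (@entry_cvg i 1)))).
Qed.

Lemma ch_cvg (i j : 'I_N) : ch z i j @[z --> z0] --> ch z0 i j.
Proof.
have c1 : (fun _ : 'M[R]_(N, 3) => 1 : R^o) @ z0 --> (1 : R^o).
  exact: (@cvgR_cst _ _ _ _ (nbhs_filter z0)).
exact: (cvgB (cvgB c1 (cvgM (@entry_cvg i 0) (@entry_cvg j 0)))
  (cvgM (@entry_cvg i 1) (@entry_cvg j 1))).
Qed.

Lemma vertex_height_cvg b (i : 'I_N) : vertex_height z b i @[z --> z0] --> vertex_height z0 b i.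
Proof. by case: b; [exact: entry_cvg|exact: (cvgN (@entry_cvg i 2))]. Qed.

Lemma plane_slope_cvg b (i j k : 'I_N) : i != j -> j != k -> i != k ->
  plane_slope z (vertex_height z b) i j k @[z --> z0] --> plane_slope z0 (vertex_height z0 b) i j k.
Proof.
move=> ij jk ik; have hc x y : (vertex_height z b x - vertex_height z b y) @[z --> z0] -->
    vertex_height z0 b x - vertex_height z0 b y.
  exact: (cvgB (@vertex_height_cvg b x) (@vertex_height_cvg b y)).
exact: (cvgM (cvgB (cvgM (hc k i) (@ch_cvg i j)) (cvgM (hc j i) (@ch_cvg i k)))
  (cvgV (br_neq0 cz ij jk ik) (@br_cvg i j k))).
Qed.

Lemma slope_drop_cvg b (i j l r : 'I_N) : cyc i l j -> cyc i j r ->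
  slope_drop z (vertex_height z b) i j l r @[z --> z0] --> slope_drop z0 (vertex_height z0 b) i j l r.
Proof.
move=> hl hr; have [il lj ij] := cycP hl; have [_ jr ir] := cycP hr.
exact: (cvgB (@plane_slope_cvg b _ _ _ il lj ij) (@plane_slope_cvg b _ _ _ ij jr ir)).
Qed.

Lemma top_angle_cvg b (i j : 'I_N) :
  top_angle z (vertex_height z b) i j @[z --> z0] --> top_angle z0 (vertex_height z0 b) i j.
Proof.
rewrite /top_angle; case: ifPn => [_|] /=; first exact: (@cvgR_cst _ _ _ _ (nbhs_filter z0)).
rewrite negb_or => /andP[ij ad]; have /andP[c1 c2] := cyc_diagonal N4 ij ad.
apply: (cvg_max (nbhs_filter z0)); first exact: (@cvgR_cst _ _ _ _ (nbhs_filter z0)).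
apply: (cvg_big_idx (nbhs_filter z0)); first exact: min_cont.
  exact: slope_drop_cvg.
by move=> p /andP[h1 h2]; exact: slope_drop_cvg.
Qed.

Lemma side_slope_cvg b (i : 'I_N) :
  side_slope z (vertex_height z b) i @[z --> z0] --> side_slope z0 (vertex_height z0 b) i.
Proof.
have iS := ordS_neq N4 i.
apply: (cvg_big_idx (nbhs_filter z0)); first exact: max_cont.
  apply: plane_slope_cvg => //; first exact: ordS_neq.
  apply/eqP => /(congr1 (@nat_of_ord _)); rewrite !ordSE; have := ltn_ord i; clear -N4.
  by case: (i.+1 =P N) => h; case: eqP; lia.
by move=> k /cycP[h1 h2 h3]; exact: plane_slope_cvg.
Qed.

Lemma dihedral_cvg (e : arc N) : dihedral z e @[z --> z0] --> dihedral z0 e.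
Proof.
case: e => [i|[b D]]; last by apply: (cvg_sumR (nbhs_filter z0)) => p _; exact: top_angle_cvg.
exact: (cvgN (cvgD (@side_slope_cvg true i) (@side_slope_cvg false i))).
Qed.

Lemma crease_cvg (p q k : 'I_N) : p != q -> crease z p q k @[z --> z0] --> crease z0 p q k.
Proof.
move=> pq; apply: (cvg_max (nbhs_filter z0)); first exact: (@cvgR_cst _ _ _ _ (nbhs_filter z0)).
have c0 : ch z0 p q != 0 by rewrite gt_eqF // ch_gt0.
exact: (cvgM (@br_cvg p q k) (cvgV c0 (@ch_cvg p q))).
Qed.

End AngleContinuity.

Section CanonicalContinuity.
Variables (R : realType) (N : nat).
Hypothesis N4 : (3 < N)%N.
Implicit Types theta : weights R N.

Lemma weights_cvg (T : Type) (F : set_system T) (g : T -> weights R N) (l : weights R N) :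
  Filter F -> (forall e, g t e @[t --> F] --> l e) -> g t @[t --> F] --> l.
Proof.
move=> FF cg; apply/cvg_sup => e U.
have /= -> := @nbhsE (initial_topology (fun f : weights R N => f e)) l.
move=> [B [[C oC <-] Cl] sBU]; apply: (filterS sBU); apply: (cg e).
exact: open_nbhs_nbhs.
Qed.

Lemma weight_cvg theta0 (e : arc N) : theta e @[theta --> theta0] --> theta0 e.
Proof. exact: (@proj_continuous _ (fun _ : arc N => R : topologicalType) e). Qed.

(** The limit is taken within the weights that lie in some cell, since minimizers are provided only
    for these. *)
Lemma gaps_cvg theta0 (k : 'I_N) : realizable theta0 ->
  gaps theta k @[theta --> within [set theta | realizable theta] (nbhs theta0)] --> gaps theta0 k.
Proof.
move=> re0; have [c ok] := realizable_energy N4 re0; have [n0 m0] := gapsP N4 re0.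
apply/cvgrPdist_lt => e e0; have [eta eta0 st] := minimizer_stable ok n0 m0 e0.
pose D theta := \sum_(a : 'I_N * 'I_N) `|pair_weight theta a.1 a.2 - pair_weight theta0 a.1 a.2|.
have cD : D theta @[theta --> theta0] --> (0 : R).
  have -> : 0 = D theta0 by rewrite /D big1 // => a _; rewrite subrr normr0.
  apply: (cvg_sumR (nbhs_filter theta0)) => a _; apply: cvg_norm; apply: cvgB; last exact: (@cvgR_cst _ _ _ _ (nbhs_filter theta0)).
  by apply: (cvg_sumR (nbhs_filter theta0)) => e' _; exact: weight_cvg.
have near0 : \forall theta \near nbhs theta0, D theta < eta.
  by move/cvgrPdist_lt: cD => /(_ _ eta0); apply: filterS => theta; rewrite sub0r normrN; apply: le_lt_trans; exact: ler_norm.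
apply: filterS near0 => theta Dt re.
have [n m] := gapsP N4 re; have := st _ _ Dt n m; apply: le_lt_trans.
by rewrite distrC /gap_dist (bigD1 k) //= lerDl; exact: sumr_ge0.
Qed.

Section Limit.
Variables (F : set_system (weights R N)) (theta0 : weights R N).
Context {FF : Filter F}.
Hypothesis positions_lim : forall k, positions theta k @[theta --> F] --> positions theta0 k.

Lemma chart_mx_cvg (h : weights R N -> 'I_N -> R) :
  (forall k, h theta k @[theta --> F] --> h theta0 k) ->
  chart_mx (positions theta) (h theta) @[theta --> F] --> chart_mx (positions theta0) (h theta0).
Proof.
move=> lim_h; have sq k : positions theta k * positions theta k @[theta --> F] -->
    positions theta0 k * positions theta0 k by exact: (cvgM (@positions_lim k) (@positions_lim k)).
have iv k : (1 + positions theta k * positions theta k)^-1 @[theta --> F] -->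
    (1 + positions theta0 k * positions theta0 k)^-1.
  apply: cvgV; first by rewrite gt_eqF // ltr_pwDl // -expr2 sqr_ge0.
  exact: (cvgD (@cvgR_cst R _ F 1 FF) (sq k)).
have c2 k := cvgM (cvgM (@cvgR_cst R _ F 2 FF) (@positions_lim k)) (iv k).
have c1 k := cvgM (cvgB (@cvgR_cst R _ F 1 FF) (sq k)) (iv k).
apply: mx_cvg => k a.
pose g (y : R) (x : R) := if a == 2 then y else if k.+1 == N then (if a == 0 then -1 else 0) else
   if a == 0 then (1 - x * x) / (1 + x * x) else 2 * x / (1 + x * x).
suff lim : g (h theta k) (positions theta k) @[theta --> F] --> g (h theta0 k) (positions theta0 k).
  by rewrite mxE; apply: cvg_trans lim; apply: near_eq_cvg; apply: nearW => theta; rewrite mxE.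
rewrite /g; case: (a == 2) => /=; first exact: lim_h.
case: (k.+1 == N) => /=; first exact: cvgR_cst.
by case: (a == 0) => /=; [exact: c1|exact: c2].
Qed.

Hypothesis weights_lim : forall e, theta e @[theta --> F] --> theta0 e.

Lemma canonical_lim : canonical theta @[theta --> F] --> canonical theta0.
Proof.
apply: chart_mx_cvg => k; apply: cvgN; apply: cvg_sumR => p pq.
have c0 : is_config (chart_mx (positions theta0) (fun=> 0)).
  apply: chart_mx_config => i j ij _; rewrite -subr_gt0 -[_ - _]mul1r -positionsB //.
  exact: span_gt0.
have pq' : p.1 != p.2 by rewrite -(inj_eq (@ord_inj _)) neq_ltn pq.
apply: cvgM; first exact: weights_lim.
exact: (cvg_comp (fun theta => chart_mx (positions theta) (fun=> 0)) (fun z => crease z p.1 p.2 k)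
  (chart_mx_cvg (h := fun _ _ => 0) (fun _ => @cvgR_cst R _ F 0 FF)) (@crease_cvg R N N4 _ c0 _ _ k pq')).
Qed.

End Limit.

Lemma canonical_cvg theta0 : realizable theta0 ->
  canonical theta @[theta --> within [set theta | realizable theta] (nbhs theta0)] --> canonical theta0.
Proof.
move=> re0; have FF := within_filter [set theta : weights R N | realizable theta] (nbhs_filter theta0).
apply: canonical_lim => [k|e].
  apply: cvg_sumR => l _; apply: (continuous_cvg FF (@continuous_expR R _)).
  exact: gaps_cvg.
apply: cvg_trans (@weight_cvg theta0 e); apply: cvg_app; exact: cvg_within.
Qed.

End CanonicalContinuity.

(** * The homeomorphism *)

Section Main.
Variables (R : realType) (N : nat).
Hypothesis N4 : (3 < N)%N.
Local Open Scope quotient_scope.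

Lemma pi_cellsP (a b : cells R N) :
  \pi_(quotient_topology {eq_quot (glue_equiv_rel R N)}) a =
  \pi_(quotient_topology {eq_quot (glue_equiv_rel R N)}) b <->
  val (projT2 a) = val (projT2 b).
Proof.
split=> [e|e].
  by have /eqmodP/asboolP : a = b %[mod {eq_quot (glue_equiv_rel R N)}] := e.
have : a = b %[mod {eq_quot (glue_equiv_rel R N)}] by apply/eqmodP/asboolP.
by [].
Qed.

Lemma poly_classP (z z' : marked_poly R N) : poly_class z = poly_class z' <-> G0_rel z z'.
Proof.
split=> [e|e].
  by have /eqmodP : z = z' %[mod {eq_quot (G0_equiv_rel R N)}] := e.
have : z = z' %[mod {eq_quot (G0_equiv_rel R N)}] by apply/eqmodP.
by [].
Qed.

Lemma poly_cell (z : marked_poly R N) : exists (G : graph_gamma N) (t : cell_space R G),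
  [/\ val G = skeleton (val z), val t = dihedral (val z) & angle_cell R (val G) (val t)].
Proof.
have [cz nc] := marked_poly_config (set_mem (valP z)).
have [g cell] := config_angle_cell N4 cz nc.
pose G : graph_gamma N := exist (fun E : {set arc N} => is_graph E) (skeleton (val z)) g.
have clo : angle_cell_closure R G (dihedral (val z)) by exists G.
by exists G, (exist (fun t => t \in angle_cell_closure R G) _ (mem_set clo)).
Qed.

Lemma cell_support (G : graph_gamma N) (t : weights R N) (e : arc N) :
  angle_cell R (val G) t -> (e \in val G) = (t e != 0).
Proof.
move=> [h1 h2 _ _]; have [eG|eG] := boolP (e \in val G); last by rewrite h1 // eqxx.
by have := h2 e eG; case: (in_gamma e) => h; [rewrite lt_eqF|rewrite gt_eqF].
Qed.

Lemma cell_space_realizable (G : graph_gamma N) (t : cell_space R G) : realizable (val t).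
Proof. by have [G' _ cell] := set_mem (valP t); exists G'. Qed.

Lemma continuous_dihedral : continuous (fun z : marked_poly R N => dihedral (val z)).
Proof.
move=> z0; apply: (weights_cvg (nbhs_filter z0)) => e.
have [cz _] := marked_poly_config (set_mem (valP z0)).
exact: (cvg_comp (fun z : marked_poly R N => val z) (fun y => dihedral y e)
  (@initial_continuous _ _ (fun z : marked_poly R N => val z) z0) (@dihedral_cvg R N N4 _ cz e)).
Qed.

(** For each of the finitely many graphs [G]: if [theta0] lies in the closed cell of [G], openness
    of [V] is used there. If not, [theta0] is nonzero on some edge outside [G], so are the nearby
    weights, and none of them lies in this closed cell. *)
Lemma near_cell (theta0 : weights R N) (V : set (angle_complex R N)) (G0 : graph_gamma N)
    (t0 : cell_space R G0) : open V -> V (angle_class t0) -> val t0 = theta0 ->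
  angle_cell R (val G0) theta0 ->
  \forall theta \near theta0, forall (G : graph_gamma N) (t : cell_space R G),
    val t = theta -> V (angle_class t).
Proof.
move=> oV Vt0 t0E cell0; apply: (@filter_forall _ _ _ _ (nbhs_filter theta0)) => G.
have [clo|nclo] := pselect (angle_cell_closure R G theta0); last first.
  have [e eG te] : exists2 e : arc N, e \notin val G & theta0 e != 0.
    apply: contrapT => h; apply: nclo; exists G0 => //; apply/fintype.subsetP => e.
    rewrite (cell_support _ cell0) => te; apply: contrapT => /negP eG; apply: h.
    by exists e.
  have : \forall theta \near theta0, theta e != 0.
    by apply: (cvgr_neq0 (F := nbhs theta0) (theta0 e) (@weight_cvg R N theta0 e) te).
  apply: filterS => theta nz t tE; case/negP: nz; rewrite -tE.
  have [G' sub [h1 _ _ _]] := set_mem (valP t); rewrite h1 //.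
  by apply: contra eG; exact: (fintype.subsetP sub).
pose t1 : cell_space R G := exist (fun t => t \in angle_cell_closure R G) theta0 (mem_set clo).
have Vt1 : V (angle_class t1).
  rewrite (_ : angle_class t1 = angle_class t0) //.
  by apply/pi_cellsP; rewrite /= t0E.
have oc : open (\pi_(quotient_topology {eq_quot (glue_equiv_rel R N)}) @^-1` V : set (cells R N)).
  exact: oV.
have og : open (@angle_class R N G @^-1` V) by have /sigT_openP/(_ G) := oc.
have : nbhs t1 (@angle_class R N G @^-1` V) by exact: open_nbhs_nbhs.
rewrite nbhsE => -[B [[C oC <-] Ct1] sBV].
have : nbhs theta0 C by apply: open_nbhs_nbhs.
by apply: filterS => theta Ct t tE; apply: sBV; move: Ct; rewrite -tE.
Qed.

Lemma continuous_poly_angles (psi : marked_poly R N -> angle_complex R N) :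
  (forall z, exists (G : graph_gamma N) (t : cell_space R G),
    [/\ val G = skeleton (val z), val t = dihedral (val z), angle_cell R (val G) (val t)
      & psi z = angle_class t]) -> continuous psi.
Proof.
move=> psiP z0 U; rewrite nbhsE => -[V [oV Vz0] sVU].
have [G0 [t0 [_ t0E cell0 e0]]] := psiP z0; rewrite e0 in Vz0; rewrite t0E in cell0.
have nV := near_cell oV Vz0 t0E cell0.
have : nbhs z0 ((fun z : marked_poly R N => dihedral (val z)) @^-1`
    [set theta | forall (G : graph_gamma N) (t : cell_space R G), val t = theta -> V (angle_class t)]).
  exact: continuous_dihedral nV.
apply: filterS => z Vz; apply: sVU; have [G [t [_ tE _ ->]]] := psiP z.
exact: Vz.
Qed.

(** On a disjoint union continuity is checked on each closed cell, all of whose weights are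
    realizable. *)
Lemma continuous_canonical (can : cells R N -> marked_poly R N) :
  (forall c, val (can c) = canonical (val (projT2 c))) -> continuous can.
Proof.
move=> canE; suff cG (G : graph_gamma N) : continuous (fun t : cell_space R G => can (existT _ G t)).
  by move=> -[G t] U nU; exact: (cG G t U nU).
apply: (@continuous_comp_initial _ _ _ (fun z : marked_poly R N => val z)).
rewrite (_ : _ \o _ = @canonical R N \o (fun t : cell_space R G => val t)); last first.
  by apply/funext => t; rewrite /= canE.
move=> t0.
apply: (cvg_comp (fun t : cell_space R G => val t) (@canonical R N) _
  (canonical_cvg N4 (cell_space_realizable t0))).
move=> A; rewrite /within /= => nA.
have h : nbhs t0 [set t : cell_space R G | realizable (val t) -> A (val t)].
  exact: (@initial_continuous _ _ (fun t : cell_space R G => val t) t0 _ nA).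
by apply: (@filterS _ _ (nbhs_filter t0) _ _ _ h) => t; apply; exact: cell_space_realizable.
Qed.

End Main.

Theorem theorem1p7 (R : realType) (N : nat) (hN : (4 <= N)%N) :
  exists Psi : HPPolyh R N -> angle_complex R N,
    (forall P : marked_poly R N,
       exists (G : graph_gamma N) (theta : cell_space R G),
         [/\ val G = skeleton (val P),
             dihedral_angles (val P) (val theta),
             angle_cell R (val G) (val theta)
           & Psi (poly_class P) = angle_class theta]) /\
    homeomorphism Psi.
Proof.
have ex_angles (z : marked_poly R N) : exists a : angle_complex R N,
    exists (G : graph_gamma N) (t : cell_space R G),
    [/\ val G = skeleton (val z), val t = dihedral (val z), angle_cell R (val G) (val t)
      & a = angle_class t].
  by have [G [t [h1 h2 h3]]] := poly_cell hN z; exists (angle_class t), G, t.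
have [psi psiP] := choice ex_angles.
have ex_poly (c : cells R N) : exists z : marked_poly R N, val z = canonical (val (projT2 c)).
  case: c => G t; have m := canonical_marked hN (cell_space_realizable t).
  by exists (exist (fun z => z \in marked_poly R N) _ (mem_set m)).
have [can canE] := choice ex_poly.
have psi_eq (z z' : marked_poly R N) : dihedral (val z) = dihedral (val z') -> psi z = psi z'.
  move=> e; have [G [t [_ h1 _ ->]]] := psiP z; have [G' [t' [_ h2 _ ->]]] := psiP z'.
  by apply/pi_cellsP; rewrite /= h1 h2.
have psi_G0 (z z' : marked_poly R N) : poly_class z = poly_class z' -> psi z = psi z'.
  by move=> /poly_classP h; apply: psi_eq; rewrite (dihedral_G0 hN h).
have psiK (z : marked_poly R N) : psi (repr (poly_class z)) = psi z by apply: psi_G0; rewrite /poly_class reprK.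
(* Both maps are defined on representatives. They descend because [dihedral] is constant on orbits
   and [canonical] depends only on the weight. *)
exists (psi \o repr); split=> [P|].
  have [G [t [h1 h2 h3 h4]]] := psiP P; exists G, t; split=> //; last by rewrite /= psiK.
  have [cz nc] := marked_poly_config (set_mem (valP P)).
  by rewrite h2; exact: dihedral_anglesP.
split.
  apply: repr_comp_continuous; first exact: continuous_poly_angles psiP.
  by move=> a b /eqP e; apply/eqP; exact: psi_G0.
exists ((fun c => poly_class (can c)) \o repr); split.
- move=> P; rewrite -[RHS]reprK /=; set z := repr P.
  have [G [t [_ h _ ->]]] := psiP z; set c := repr _.
  have cE : val (projT2 c) = dihedral (val z).
    by rewrite -h; apply/(pi_cellsP c (existT _ G t)); rewrite /c reprK.
  apply/esym/poly_classP/(canonical_G0 hN); by rewrite canE cE.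
- move=> a /=; rewrite psiK; set c := repr a.
  have [G [t [_ h _ ->]]] := psiP (can c).
  rewrite -[RHS]reprK; apply/pi_cellsP; rewrite /= h canE (dihedral_canonical hN) //.
  by case: (c) => G' t'; exact: cell_space_realizable.
- apply: repr_comp_continuous => [c|a b /eqP/pi_cellsP e]; last first.
    by apply/eqP; congr poly_class; apply: val_inj; rewrite !canE e.
  apply: (@continuous_comp _ _ _ can (@poly_class R N)); first by apply: (continuous_canonical hN canE).
  exact: pi_continuous.
Qed.
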